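(* Let $\tau$ be a locally convex topology on $E$ and let $\varsigma$ be a $\tau$-continuous semi-norm on $E$ with $|\sigma(f,g)|\le c\,\varsigma(f)\varsigma(g)$ for all $f,g\in E$ and some constant $c>0$. (1) Let $n\in\mathbb{N}\cup\{\infty\}$ and $\mu\in\mathcal{M}^n_\varsigma(E)$. Then $\widehat\mu:E'_\tau\to\mathbb{C}$ is $n$-times continuously differentiable in all directions of $E'_\varsigma$, and for each $F\in E'_\tau$ its total differential $d_F\widehat\mu\in E_\varsigma+iE_\varsigma$ is given by the Bochner integral $$d_F\widehat\mu=i\int_E d\mu(f)\,e^{iF(f)}\,[f]=\int_E d\mu(f)\,d_FW_c(f),$$ which converges with respect to the norm $\|\cdot\|_\varsigma$ on the Banach space $E_\varsigma+iE_\varsigma$. (2) The Fourier transformation $\mathbb{F}:\mu\mapsto\widehat\mu$ transforms the measure Poisson bracket $\{\cdot,\cdot\}_0$ into the function Poisson bracket $\{\cdot,\cdot\}$, that is, $$\{\widehat\mu,\widehat\nu\}=\mathbb{F}\{\mu,\nu\}_0,\qquad\forall\,\mu,\nu\in\mathcal{M}^1_\varsigma(E).$$ (3) Let $\mathcal{P}$ be any of the spaces of measures listed under (I)–(IV) in the context and $\widehat{\mathcal{P}}:=\mathbb{F}\mathcal{P}$. Then $(\widehat{\mathcal{P}},\cdot_0,\{\cdot,\cdot\})$ is a Poisson algebra contained in $\widehat{\mathcal{M}}^\infty_\varsigma(E'_\tau):=\mathbb{F}\mathcal{M}^\infty_\varsigma(E)$, which in addition is invariant under all deformed products $\cdot_\hbar$,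 $\hbar\in\mathbb{R}$. In particular $(\widehat{\mathcal{M}}^\infty_\varsigma(E'_\tau),\cdot_0,\{\cdot,\cdot\})$ is a Poisson algebra of this type.
   Context: Setting. $E$ is an infinite dimensional real vector space and $\sigma$ is a pre-symplectic form on $E$ (an $\mathbb{R}$-bilinear antisymmetric form, possibly degenerate, $\sigma\neq0$). All topologies are Hausdorff. $\{E_\alpha\mid\alpha\in I\}$ is the family of all finite dimensional subspaces of $E$ with their vector space topologies; $\mathcal{M}(E_\alpha)$ denotes the finite complex (regular) Borel measures on $E_\alpha$. $\tau_{\mathrm{il}}$ is the finest locally convex topology on $E$, $\mathsf{B}^{\mathrm{il}}(E)$ its Borel $\sigma$-algebra. $\mathcal{M}(E)$ is the closure of $\bigcup_\alpha\mathcal{M}(E_\alpha)$ (measures concentrated on finite dimensional subspaces) in the total variation norm $\|\mu\|_1=|\mu|(E)$, within the finite complex measures on $\mathsf{B}^{\mathrm{il}}(E)$. $(\mathcal{M}(E),\star_\hbar)$, $\hbar\in\mathbb{R}$, is the Banach-$*$-algebra with $\mu^*(\Lambda)=\overline{\mu(-\Lambda)}$ and $\mu\star_\hbar\nu(\Lambda)=\int_E d\mu(f)\int_E d\nu(g)\,e^{-\frac i2\hbar\sigma(f,g)}\mathbf 1_\Lambda(f+g)$. For a semi-norm $\kappa$ on $E$ and $n\in\mathbb{N}\cup\{\infty\}$, $\mathcal{M}^n_\kappa(E)$ is the set of $\mu\in\mathcal{M}(E)$ with $\int_E\kappa^m\,d|\mu|<\infty$ for all finite $0\le m\le n$. For $\mu,\nu\in\mathcal{M}^1_\varsigma(E)$,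 $\{\mu,\nu\}_0\in\mathcal{M}(E)$ is the measure $\{\mu,\nu\}_0(\Lambda)=\int_E d\mu(f)\int_E d\nu(g)\,\sigma(f,g)\mathbf 1_\Lambda(f+g)$. Phase space. $E'_\tau$ is the $\tau$-topological dual of $E$ with the $\sigma(E'_\tau,E)$-topology. Weyl functions: $W_c(f)[F]=e^{iF(f)}$, $f\in E$, $F\in E'_\tau$. Fourier transformation: $\mathbb{F}\mu[F]=\widehat\mu[F]=\int_E d\mu(f)\,e^{iF(f)}$, an injective map on $\mathcal{M}(E)$. Deformed products: $\widehat\mu\cdot_\hbar\widehat\nu:=\widehat{\mu\star_\hbar\nu}$; $\cdot_0$ is the pointwise product, and the $*$-operation on functions is pointwise complex conjugation. Differential calculus. $f\mapsto[f]$ is the quotient map onto $E/\ker(\varsigma)$, $\ker(\varsigma)=\{f\mid\varsigma(f)=0\}$, with norm $\|[f]\|_\varsigma=\varsigma(f)$; $E_\varsigma$ is the completion, and $\sigma_\varsigma$ is the continuous extension to $E_\varsigma$ of $\sigma_\varsigma([f],[g])=\sigma(f,g)$. $E'_\varsigma\subseteq E'_\tau$ consists of the $\mathbb{R}$-linear $G:E\to\mathbb{R}$ with $|G(f)|\le k\,\varsigma(f)$ for all $f\in E$ and some $k\ge0$; it is identified with the topological dual of $E_\varsigma$ via $G([f])=G(f)$. For $A:E'_\tau\to\mathbb{C}$, $F\in E'_\tau$ and a direction $G\in E'_\varsigma$, $d_FA(G)=\frac{d}{dt}A[F+tG]|_{t=0}$; the total differential $d_FA$ is identified with the element of the complexified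 cotangent space $E_\varsigma+iE_\varsigma$ representing $G\mapsto d_FA(G)$ ($E'_\varsigma$ carrying the $\sigma(E'_\varsigma,E_\varsigma)$-topology). E.g. $d_FW_c(f)=ie^{iF(f)}[f]$. ''$n$-times continuously differentiable in all directions of $E'_\varsigma$'' means that all iterated directional derivatives of order at most $n$ (all finite orders if $n=\infty$) along directions in $E'_\varsigma$ exist and are continuous functions on $E'_\tau$. The function Poisson bracket is $\{A,B\}[F]:=-\sigma_\varsigma(d_FA,d_FB)$, with $\sigma_\varsigma$ extended complex bilinearly to $E_\varsigma+iE_\varsigma$. A Poisson algebra is a commutative complex $*$-algebra with a bilinear, anticommutative, real ($\{A,B\}^*=\{A^*,B^*\}$) bracket satisfying the Jacobi identity and the Leibniz rule. Admissible $\mathcal{P}$: (I) $\mathcal{P}=\mathcal{M}^\infty_\kappa(E)$ for a semi-norm $\kappa$ on $E$ stronger than ($\varsigma\le k\kappa$ for some $k\ge 0$), or equivalent to, $\varsigma$; (II) $\mathcal{P}=\bigcap_{\beta\in B}\mathcal{M}^\infty_{\kappa_\beta}(E)$ for semi-norms $\kappa_\beta$ with $\varsigma\le\sum_{\beta\in\Gamma}c_\beta\kappa_\beta$ for some finite $\Gamma\subseteq B$ and constants $c_\beta>0$; (III) the intersection of a space from (I) or (II) with $\mathcal{M}(E)_d$ (closure of $\bigcup_\alpha$ of the discrete measures on $E_\alpha$), or with $\mathcal{M}(E)_c$ (closure of $\bigcup_\alpha$ of the continuous, i.e. atomless, measures on $E_\alpha$), or with $\mathcal{M}(E_\alpha)_a$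 (measures on a finite dimensional subspace $E_\alpha$ absolutely continuous with respect to Haar measure); (IV) $\mathcal{P}=\mathcal{M}(E)_{df}$, the finite complex linear combinations of point measures $\delta(f)$, $f\in E$. *)

(* Defs.v *)
From HB Require Import structures.
From mathcomp Require Import all_boot all_order all_algebra.
From mathcomp Require Import all_classical all_reals all_analysis.
From mathcomp Require Import complex.

Set Implicit Arguments.
Unset Strict Implicit.
Unset Printing Implicit Defensive.

Import Order.TTheory GRing.Theory Num.Theory.
Import numFieldNormedType.Exports.

Local Open Scope classical_set_scope.
Local Open Scope ring_scope.

(* An alias of [R[i]] carrying both its field structure and the topology of its
   norm, which the library declares on [R[i]^o] only. *)
Definition C (R : realType) : Type := R[i].
HB.instance Definition _ (R : realType) := Num.ClosedField.copy (C R) R[i].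
HB.instance Definition _ (R : realType) := NormedModule.copy (C R) (C R)^o.

Definition cRe (R : realType) (z : C R) : R := complex.Re z.
Definition cIm (R : realType) (z : C R) : R := complex.Im z.
Definition ofRI (R : realType) (a b : R) : C R := complex.Complex a b.
Definition ofR (R : realType) (a : R) : C R := ofRI a 0.
Definition cmod (R : realType) (z : C R) : R := cRe `|z|.
Definition expi (R : realType) (a : R) : C R := ofRI (cos a) (sin a).

Section complex_measure.
Context d (T : measurableType d) (R : realType).
Implicit Types (mu : set T -> C R) (m : set T -> R).

Definition is_cmeasure mu := forall A : (set T)^nat,
  (forall n, measurable (A n)) -> trivIset setT A ->
  (fun n => \sum_(0 <= i < n) mu (A i)) @ \oo --> mu (\bigcup_n A n).

(* Finite measurable partitions give the same supremum as countable ones. For a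
   non-measurable [A] the value is irrelevant. *)
Definition total_var mu (A : set T) : \bar R :=
  ereal_sup [set x | exists (n : nat) (D : 'I_n -> set T),
    [/\ forall i, measurable (D i), trivIset setT D, \bigcup_i D i = A
      & x = (\sum_(i < n) cmod (mu (D i)))%:E]].

(* The Jordan decomposition of a finite signed measure [m] is
   [upper_var m - lower_var m]. *)
Definition upper_var m (A : set T) : \bar R :=
  ereal_sup [set (m B)%:E | B in [set B | measurable B /\ B `<=` A]].
Definition lower_var m : set T -> \bar R := upper_var (fun A => - m A).

Definition sint m (h : T -> R) : R :=
  fine (\int[upper_var m]_x (h x)%:E) - fine (\int[lower_var m]_x (h x)%:E).

Definition cint mu (h : T -> C R) : C R :=
  let mr := fun A => cRe (mu A) in let mi := fun A => cIm (mu A) in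
  let hr := fun x => cRe (h x) in let hi := fun x => cIm (h x) in
  ofRI (sint mr hr - sint mi hi) (sint mr hi + sint mi hr).

Variable X : completeNormedModType R.

(* [(u, v) : X * X] stands for [u + i v] in the complexification [X + i X].
   The library's (maximum) norm on [X * X] is equivalent to every
   complexification norm, so that it defines the same convergence. *)
Definition cplx_scale (c : C R) (z : X * X) : X * X :=
  (cRe c *: z.1 - cIm c *: z.2, cRe c *: z.2 + cIm c *: z.1).

Definition is_simple (s : T -> X * X) :=
  finite_set (range s) /\ forall z, measurable (s @^-1` [set z]).

Definition simple_int mu (s : T -> X * X) : X * X :=
  \sum_(z \in range s) cplx_scale (mu (s @^-1` [set z])) z.

Definition is_bochner_int mu (h : T -> X * X) (z : X * X) :=
  exists s : nat -> T -> X * X,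
    [/\ forall n, is_simple (s n),
        exists N, [/\ measurable N, total_var mu N = 0%E
          & forall x, ~ N x -> (fun n => s n x) @ \oo --> h x],
        (fun n => \int[total_var mu]_x (`|s n x - h x|)%:E)%E @ \oo --> 0%E
      & (fun n => simple_int mu (s n)) @ \oo --> z].

Definition tv_closure (S : set (set T -> C R)) : set (set T -> C R) :=
  [set mu | is_cmeasure mu /\ forall e : R, 0 < e ->
     exists2 nu, S nu & (total_var (fun A => mu A - nu A)%R setT < e%:E)%E].

End complex_measure.

Record is_seminorm (R : realType) (E : lmodType R) (p : E -> R) : Prop := {
  seminormD : forall x y, p (x + y) <= p x + p y ;
  seminormZ : forall a x, p (a *: x) = `|a| * p x }.

(* [il E] is [E] with the topology generated by all semi-norms, which is the
   finest locally convex topology. *)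
Definition il (R : realType) (E : lmodType R) : Type := E.

Section il_topology.
Context (R : realType) (E : lmodType R).

HB.instance Definition _ := Choice.on (il E).
HB.instance Definition _ := isPointed.Build (il E) (0 : E).

Definition il_open (U : set (il E)) := forall x : E, U x ->
  exists2 p : E -> R, is_seminorm p & [set y : E | p (y - x) < 1] `<=` U.

Lemma il_openT : il_open setT.
Proof.
move=> x _; exists (fun=> 0) => //.
by split=> *; rewrite ?addr0 ?mulr0.
Qed.

Lemma il_openI : setI_closed il_open.
Proof.
move=> U V oU oV x [/oU[p sp pU] /oV[q sq qV]].
exists (fun y => Num.max (p y) (q y)); last first.
  by move=> y /=; rewrite gt_max => /andP[/pU ? /qV].
split=> [y z|a y].
  rewrite ge_max; apply/andP; split.
    by rewrite (le_trans (seminormD sp y z))// lerD// le_max lexx.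
  by rewrite (le_trans (seminormD sq y z))// lerD// le_max lexx orbT.
by rewrite (seminormZ sp) (seminormZ sq) maxr_pMr.
Qed.

Lemma il_open_bigU (I : Type) (f : I -> set (il E)) :
  (forall i, il_open (f i)) -> il_open (\bigcup_i f i).
Proof.
move=> of_ x [i _ fix_]; have [p sp pf] := of_ i x fix_.
by exists p => // y /pf; exists i.
Qed.

HB.instance Definition _ :=
  isOpenTopological.Build (il E) il_openT il_openI il_open_bigU.

End il_topology.

(* [E] with the Borel sigma-algebra of the finest locally convex topology. *)
Definition ilB (R : realType) (E : lmodType R) :=
  g_sigma_algebraType (@open (il E)).

(* [None] stands for infinity. *)
Definition le_ext (m : nat) (n : option nat) : bool :=
  if n is Some k then (m <= k)%N else true.

Section measures.
Context (R : realType) (E : lmodType R).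
Local Notation setfun := (set (ilB E) -> C R).
Implicit Types (mu nu : setfun) (V : set E) (kappa : E -> R).

Definition is_findim V := exists (n : nat) (e : 'I_n -> E),
  V = [set x | exists a : 'I_n -> R, x = \sum_i a i *: e i].

(* The Borel sigma-algebra of a finite dimensional [V] is the trace on [V] of
   that of [il E], hence the measures on [V] are the measures on [E] carried by
   [V]; they are automatically regular. *)
Definition meas_on V : set setfun :=
  [set mu : setfun | is_cmeasure mu /\ total_var mu (~` (V : set (ilB E))) = 0%E].

Definition meas_on_d V : set setfun :=
  [set mu : setfun | meas_on V mu /\
     exists2 D : set (ilB E), countable D & total_var mu (~` D) = 0%E].

(* Continuous measures: no point has positive mass. *)
Definition meas_on_c V : set setfun :=
  [set mu : setfun | meas_on V mu /\ forall f : E, mu [set f] = 0].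

Definition is_haar V (lam : {measure set (ilB E) -> \bar R}) :=
  [/\ lam (~` V) = 0%E, (0 < lam V)%E,
      forall (v : E) (A : set (ilB E)), V v -> measurable A ->
        lam [set ((x : E) + v : E) | x in A] = lam A
    & forall K : set (il E), compact K -> K `<=` V -> (lam K < +oo)%E].

(* The quantification over [lam] is harmless: a Haar measure on [V] exists
   and is unique up to a positive factor. *)
Definition meas_on_a V : set setfun :=
  [set mu : setfun | meas_on V mu /\
     forall lam : {measure set (ilB E) -> \bar R}, is_haar V lam ->
     forall A, measurable A -> lam A = 0%E -> mu A = 0].

Definition ME := tv_closure (\bigcup_(V in is_findim) meas_on V).
Definition ME_d := tv_closure (\bigcup_(V in is_findim) meas_on_d V).
Definition ME_c := tv_closure (\bigcup_(V in is_findim) meas_on_c V).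

Definition ME_df : set setfun :=
  [set mu : setfun | is_cmeasure mu /\
     exists (n : nat) (c : 'I_n -> C R) (f : 'I_n -> E),
     forall A, measurable A -> mu A = \sum_i c i * ofR (\1_A (f i))].

Definition ME_moment (n : option nat) kappa : set setfun :=
  [set mu : setfun | ME mu /\ forall m, le_ext m n ->
     (\int[total_var mu]_f ((kappa f) ^+ m)%:E < +oo)%E].

Variable sigma : {biscalar E}.

(* The inner integral is a function of [f] that is measurable on each finite
   dimensional subspace, hence up to a null set of any [mu] in [ME]; on such
   functions the library's integral has its usual value. *)
Definition weyl_conv (hbar : R) mu nu : setfun := fun A =>
  cint mu (fun f => cint nu (fun g : E =>
    expi (- (hbar / 2) * sigma f g) * ofR (\1_A ((f : E) + g)))).

Definition mbracket mu nu : setfun := fun A =>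
  cint mu (fun f => cint nu (fun g : E =>
    ofR (sigma f g * \1_A ((f : E) + g)))).

Variable s : E -> R.

Definition admissible_I (P : set setfun) :=
  exists kappa, [/\ is_seminorm kappa,
    exists2 k : R, 0 <= k & forall f, s f <= k * kappa f
  & P = ME_moment None kappa].

Definition admissible_II (P : set setfun) :=
  exists (B : Type) (kappa : B -> E -> R),
    [/\ forall b, is_seminorm (kappa b),
        exists (G : seq B) (c : B -> R), (forall b, 0 < c b) /\
          forall f, s f <= \sum_(b <- G) c b * kappa b f
      & P = \bigcap_b ME_moment None (kappa b)].

Definition admissible_III (P : set setfun) :=
  exists2 Q, admissible_I Q \/ admissible_II Q &
    [\/ P = Q `&` ME_d, P = Q `&` ME_c
      | exists2 V, is_findim V & P = Q `&` meas_on_a V].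

Definition admissible (P : set setfun) :=
  [\/ admissible_I P, admissible_II P, admissible_III P | P = ME_df].

End measures.

Section dual.
Context (R : realType) (E : tvsType R).

Definition dual_pred : {pred (E -> R^o)} :=
  fun F => `[< linear F /\ continuous F >].

Lemma dual_submod : submod_closed dual_pred.
Proof.
split=> [|a F G].
  apply/asboolP; split => [b x y|]; last exact: cst_continuous.
  by rewrite /= scaler0 addr0.
move=> /asboolP[lF cF] /asboolP[lG cG].
have FG z : (a *: F + G) z = a *: F z + G z by [].
apply/asboolP; split=> [b x y|x].
  by rewrite !FG lF lG !scalerDr addrACA !scalerA mulrC.
by apply: cvgD; [apply: cvgZr; exact: cF|exact: cG].
Qed.

HB.instance Definition _ :=
  GRing.isSubmodClosed.Build R (E -> R^o) dual_pred dual_submod.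

Record dual := Dual { dual_fun :> E -> R^o ; _ : dual_fun \in dual_pred }.

HB.instance Definition _ := [isSub for dual_fun].
HB.instance Definition _ := [Choice of dual by <:].
HB.instance Definition _ := [SubChoice_isSubLmodule of dual by <:].

(* The weak topology [sigma(E', E)]. *)
HB.instance Definition _ := Topological.copy dual
  (initial_topology (fun F : dual => (dual_fun F : {ptws E -> R^o}))).

Definition weyl (f : E) : dual -> C R := fun F => expi (F f).

Definition fourier (mu : set (ilB E) -> C R) : dual -> C R :=
  fun F => cint mu (fun f : E => expi (F f)).

(* The inverse of the (injective) Fourier transformation on [ME E]. *)
Definition ifourier (A : dual -> C R) : set (ilB E) -> C R :=
  xget (fun=> 0) [set mu | ME mu /\ fourier mu = A].

Definition deformed (sigma : {biscalar E}) (hbar : R) (A B : dual -> C R) :=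
  fourier (weyl_conv sigma hbar (ifourier A) (ifourier B)).

Definition dual_sn (s : E -> R) : set dual :=
  [set G | exists2 k : R, 0 <= k & forall f, `|G f| <= k * s f].

(* The derivative of [t |-> A (F + t G)] at [t = 0] is [z]. *)
Definition is_dirder (A : dual -> C R) (F G : dual) (z : C R) :=
  (fun t : R => ofR t^-1 * (A (F + t *: G) - A F)) @ (0 : R)^' --> z.

Fixpoint Cn_dir (D : set dual) (n : nat) (A : dual -> C R) : Prop :=
  continuous A /\
  if n is m.+1 then forall G, D G -> exists B : dual -> C R,
    (forall F, is_dirder A F G (B F)) /\ Cn_dir D m B
  else True.

End dual.

(* [cls : E -> X] exhibits [X] as the completion of [E / ker s], [cls f] being
   the class of [f]: it factors through an isometry of [E / ker s] onto a dense
   subspace of the Banach space [X]. *)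
Definition is_completion (R : realType) (E : lmodType R) (s : E -> R)
    (X : completeNormedModType R) (cls : {linear E -> X}) :=
  (forall f, `|cls f| = s f) /\ dense (range cls).

Section differential.
Context (R : realType) (E : tvsType R) (s : E -> R).
Context (X : completeNormedModType R) (cls : {linear E -> X}).
Implicit Types (A B : dual E -> C R) (F G : dual E).

(* The continuous linear functional on [X] identified with [G]; it exists and is
   unique when [G] is bounded by a multiple of [s]. *)
Definition dual_ext G : X -> R^o :=
  xget (fun=> 0) [set L : X -> R^o |
    [/\ linear L, continuous L & forall f, L (cls f) = G f]].

Definition is_totdiff A F (z : X * X) :=
  forall G, dual_sn s G ->
    is_dirder A F G (ofRI (dual_ext G z.1) (dual_ext G z.2)).

(* Such a [z] is unique, the functionals [dual_ext G] separating the points of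
   [X]. *)
Definition totdiff A F : X * X := xget 0 (is_totdiff A F).

Variable sigma : {biscalar E}.

(* The continuous extension of [sigma] to the completion, unique by density. *)
Definition sigma_ext : X -> X -> R :=
  xget (fun _ _ => 0) [set S : X -> X -> R |
    continuous (fun p : X * X => S p.1 p.2 : R^o) /\
    forall f g, S (cls f) (cls g) = sigma f g].

Definition sigma_extC (z w : X * X) : C R :=
  ofRI (sigma_ext z.1 w.1 - sigma_ext z.2 w.2)
       (sigma_ext z.1 w.2 + sigma_ext z.2 w.1).

Definition fbracket A B : dual E -> C R :=
  fun F => - sigma_extC (totdiff A F) (totdiff B F).

End differential.

(* A subset [S] of a complex vector space is a Poisson algebra under the given
   operations of the ambient space; algebras need not have a unit. *)
Record is_poisson_algebra (R : realType) (V : lmodType (C R)) (S : set V)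
    (mul br : V -> V -> V) (star : V -> V) : Prop := {
  pa0 : S 0 ;
  paD : forall a b, S a -> S b -> S (a + b) ;
  paZ : forall (c : C R) a, S a -> S (c *: a) ;
  pa_mul : forall a b, S a -> S b -> S (mul a b) ;
  pa_star : forall a, S a -> S (star a) ;
  pa_br : forall a b, S a -> S b -> S (br a b) ;
  pa_mulA : forall a b c, S a -> S b -> S c ->
    mul a (mul b c) = mul (mul a b) c ;
  pa_mulC : forall a b, S a -> S b -> mul a b = mul b a ;
  pa_mulDl : forall a b c, S a -> S b -> S c ->
    mul (a + b) c = mul a c + mul b c ;
  pa_mulZl : forall (k : C R) a b, S a -> S b ->
    mul (k *: a) b = k *: mul a b ;
  pa_starK : forall a, S a -> star (star a) = a ;
  pa_starD : forall a b, S a -> S b -> star (a + b) = star a + star b ;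
  pa_starZ : forall (k : C R) a, S a -> star (k *: a) = k^* *: star a ;
  pa_starM : forall a b, S a -> S b -> star (mul a b) = mul (star b) (star a) ;
  pa_brDl : forall a b c, S a -> S b -> S c -> br (a + b) c = br a c + br b c ;
  pa_brZl : forall (k : C R) a b, S a -> S b -> br (k *: a) b = k *: br a b ;
  pa_brC : forall a b, S a -> S b -> br a b = - br b a ;
  pa_br_real : forall a b, S a -> S b -> star (br a b) = br (star a) (star b) ;
  pa_jacobi : forall a b c, S a -> S b -> S c ->
    br a (br b c) + br b (br c a) + br c (br a b) = 0 ;
  pa_leibniz : forall a b c, S a -> S b -> S c ->
    br a (mul b c) = mul (br a b) c + mul b (br a c) }.

Definition fstar (R : realType) (T : Type) (A : T -> C R) : T -> C R :=
  fun F => (A F)^*.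

(* Main.v *)
Require Import Defs.
From HB Require Import structures.
From mathcomp Require Import all_boot all_order all_algebra.
From mathcomp Require Import all_classical all_reals all_analysis.
From mathcomp Require Import measurable_realfun complex.
From mathcomp Require Import ring lra.

Set Implicit Arguments.
Unset Strict Implicit.
Unset Printing Implicit Defensive.

Import Order.TTheory GRing.Theory Num.Theory.
Import numFieldNormedType.Exports.

Local Open Scope classical_set_scope.
Local Open Scope ring_scope.

(* A total variation limit of measures on finite dimensional subspaces is carried
   by a subspace W of countable dimension. On W the semi-norms, the addition and
   sigma are measurable (the sum and sigma being pointwise limits of compositions
   with finite dimensional projections), so that Radon-Nikodym densities, Fubini's
   theorem and dominated convergence apply to all integrals in question.

   Derivatives of the Fourier transform in directions bounded by a multiple of s
   are obtained under the integral sign. The Bochner integrand takes its values in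
   a separable space and is approximated by the nearest of finitely many rational
   combinations. The total differential is determined by the directional
   derivatives because, by Hahn-Banach, functionals bounded by a multiple of s
   separate the points of the completion; pairing it with sigma turns the function
   bracket into an iterated integral, which is the transform of the measure
   bracket.

   The admissible spaces are closed under every twisted convolution whose kernel
   phi(sigma(f, g)) has at most linear growth, which includes the deformed products
   and the measure bracket. The Fourier transformation is injective, so that these
   operations pass to functions, where the Leibniz rule is a rule for differentials
   and the Jacobi identity reduces to the antisymmetry of sigma after splitting the
   iterated integrals. *)

(** * Complex numbers *)

(** Two obstacles shape the proof. Joint measurability of the addition and of [sigma] is available
    on W x W only, so iterated integrals are rewritten with integrands that agree with the given
    ones on W x W and are measurable everywhere. As the integral is defined for every integrand,
    this replacement is a statement about null sets. Moreover the total variation is not treated as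
    a measure: integrals against it are compared with those against a finite measure l between it
    and four times it, whence the factors 4 and 16 in the majorants. The coordinates of the finite
    dimensional projections are taken in the topological dual of E, because the injectivity proof
    has to reach the same coordinates from the characters exp(iF). The deformed products use a
    chosen inverse transform, which is determined on measurable sets only; hence the admissible
    classes must depend on these values only. A kernel of linear growth adds a factor 1 + s in each
    variable; Cauchy-Schwarz absorbs it at the price of doubling the order of the moments, so that
    moments of all orders are preserved together. *)

Section complex_numbers.
Context {R : realType}.
Implicit Types (z w : C R) (a b : R).

Lemma C_eq z w : cRe z = cRe w -> cIm z = cIm w -> z = w.
Proof. by case: z w => [a b] [c d] /= -> ->. Qed.

Lemma cRe_ofRI a b : cRe (ofRI a b) = a. Proof. by []. Qed.

Lemma cIm_ofRI a b : cIm (ofRI a b) = b. Proof. by []. Qed.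

Lemma cRe_ofR a : cRe (ofR a) = a. Proof. by []. Qed.

Lemma cIm_ofR a : cIm (ofR a) = 0. Proof. by []. Qed.

Lemma cRe_expi a : cRe (expi a) = cos a. Proof. by []. Qed.

Lemma cIm_expi a : cIm (expi a) = sin a. Proof. by []. Qed.

Lemma cRe0 : cRe (0 : C R) = 0. Proof. by []. Qed.

Lemma cIm0 : cIm (0 : C R) = 0. Proof. by []. Qed.

Lemma cRe1 : cRe (1 : C R) = 1. Proof. by []. Qed.

Lemma cIm1 : cIm (1 : C R) = 0. Proof. by []. Qed.

Lemma cReD z w : cRe (z + w) = cRe z + cRe w. Proof. by case: z w => [? ?] [? ?]. Qed.

Lemma cImD z w : cIm (z + w) = cIm z + cIm w. Proof. by case: z w => [? ?] [? ?]. Qed.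

Lemma cReN z : cRe (- z) = - cRe z. Proof. by case: z. Qed.

Lemma cImN z : cIm (- z) = - cIm z. Proof. by case: z. Qed.

Lemma cReM z w : cRe (z * w) = cRe z * cRe w - cIm z * cIm w.
Proof. by case: z w => [? ?] [? ?]. Qed.

Lemma cImM z w : cIm (z * w) = cRe z * cIm w + cIm z * cRe w.
Proof. by case: z w => [? ?] [? ?]. Qed.

Lemma cRe_conj z : cRe z^* = cRe z. Proof. by case: z. Qed.

Lemma cIm_conj z : cIm z^* = - cIm z. Proof. by case: z. Qed.

Lemma imaginaryCE : ('i : C R) = ofRI 0 1.
Proof. exact: complexiE. Qed.

Definition cE := (cRe_ofRI, cIm_ofRI, cRe_ofR, cIm_ofR, cRe_expi, cIm_expi,
  cRe0, cIm0, cRe1, cIm1, cReD, cImD, cReN, cImN, cReM, cImM, cRe_conj, cIm_conj).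

Lemma cRe_i : cRe ('i : C R) = 0. Proof. by rewrite imaginaryCE cE. Qed.

Lemma cIm_i : cIm ('i : C R) = 1. Proof. by rewrite imaginaryCE cE. Qed.

Lemma cRe_sum I (r : seq I) (P : pred I) (F : I -> C R) :
  cRe (\sum_(i <- r | P i) F i) = \sum_(i <- r | P i) cRe (F i).
Proof. exact: (big_morph (@cRe R) cReD cRe0). Qed.

Lemma cIm_sum I (r : seq I) (P : pred I) (F : I -> C R) :
  cIm (\sum_(i <- r | P i) F i) = \sum_(i <- r | P i) cIm (F i).
Proof. exact: (big_morph (@cIm R) cImD cIm0). Qed.

Lemma cmodE z : cmod z = Num.sqrt (cRe z ^+ 2 + cIm z ^+ 2).
Proof. by case: z. Qed.

Lemma normCE z : `|z| = ofR (cmod z).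
Proof. by case: z. Qed.

Lemma cmod0 : cmod (0 : C R) = 0.
Proof. by rewrite cmodE !cE expr0n/= addr0 sqrtr0. Qed.

Lemma ofR_lt a (w : C R) : (ofR a < w) = (a < cRe w) && (cIm w == 0).
Proof. by case: w => c d; rewrite ltcE/= andbC. Qed.

(* Used instead of the equivalent [cmod] because measurability and integrability
   are then componentwise statements. *)
Definition n1 z : R := `|cRe z| + `|cIm z|.

Lemma n1_ge0 z : 0 <= n1 z. Proof. by rewrite addr_ge0. Qed.

Lemma n10 : n1 0 = 0. Proof. by rewrite /n1 !cE normr0 addr0. Qed.

Lemma n1D z w : n1 (z + w) <= n1 z + n1 w.
Proof.
rewrite /n1 !cE; have := ler_normD (cRe z) (cRe w).
by have := ler_normD (cIm z) (cIm w); lra.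
Qed.

Lemma n1N z : n1 (- z) = n1 z. Proof. by rewrite /n1 !cE !normrN. Qed.

Lemma n1B z w : n1 (z - w) <= n1 z + n1 w.
Proof. by rewrite -(n1N w); exact: n1D. Qed.

Lemma n1M z w : n1 (z * w) <= n1 z * n1 w.
Proof.
rewrite /n1 !cE mulrDl !mulrDr.
have := ler_normB (cRe z * cRe w) (cIm z * cIm w).
have := ler_normD (cRe z * cIm w) (cIm z * cRe w).
rewrite !normrM; lra.
Qed.

Lemma cRe_le_n1 z : `|cRe z| <= n1 z. Proof. by rewrite /n1 lerDl. Qed.

Lemma cIm_le_n1 z : `|cIm z| <= n1 z. Proof. by rewrite /n1 lerDr. Qed.

Lemma n1_ofR a : n1 (ofR a) = `|a|. Proof. by rewrite /n1 !cE normr0 addr0. Qed.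

Lemma n1_expi a : n1 (expi a) <= 2.
Proof.
rewrite /n1 !cE (_ : 2 = 1 + 1)//.
by rewrite lerD// ler_norml ?cos_geN1 ?cos_le1 ?sin_geN1 ?sin_le1.
Qed.

Lemma n1_conj z : n1 z^* = n1 z. Proof. by rewrite /n1 !cE normrN. Qed.

Lemma n1_i z : n1 ('i * z) = n1 z.
Proof. by rewrite /n1 !(cE, cRe_i, cIm_i) !mul0r !mul1r sub0r add0r normrN addrC. Qed.

Lemma cmod_le_n1 z : cmod z <= n1 z.
Proof.
rewrite cmodE -(ger0_norm (n1_ge0 z)) -sqrtr_sqr ler_wsqrtr//.
rewrite /n1 sqrrD !real_normK ?num_real//.
by rewrite lerD2r lerDl mulrn_wge0// mulr_ge0.
Qed.

Lemma cRe_le_cmod z : `|cRe z| <= cmod z.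
Proof. by rewrite cmodE -sqrtr_sqr ler_wsqrtr// lerDl sqr_ge0. Qed.

Lemma cIm_le_cmod z : `|cIm z| <= cmod z.
Proof. by rewrite cmodE -sqrtr_sqr ler_wsqrtr// lerDr sqr_ge0. Qed.

Lemma n1_le_cmod z : n1 z <= 2 * cmod z.
Proof. by have := cRe_le_cmod z; have := cIm_le_cmod z; rewrite /n1; lra. Qed.

Lemma cmod_ge0 z : 0 <= cmod z. Proof. by rewrite cmodE sqrtr_ge0. Qed.

Lemma expiD a b : expi (a + b) = expi a * expi b.
Proof. by apply: C_eq; rewrite !cE ?cosD ?sinD// addrC mulrC [X in X + _]mulrC. Qed.

Lemma expi0 : expi 0 = 1 :> C R.
Proof. by apply: C_eq; rewrite !cE ?cos0 ?sin0. Qed.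

Lemma expiN a : expi (- a) = (expi a)^*.
Proof. by apply: C_eq; rewrite !cE ?cosN ?sinN. Qed.

Lemma ofRD a b : ofR (a + b) = ofR a + ofR b.
Proof. by apply: C_eq; rewrite !cE ?addr0. Qed.

Lemma ofRM a b : ofR (a * b) = ofR a * ofR b.
Proof. by apply: C_eq; rewrite !cE; ring. Qed.

Lemma ofRN a : ofR (- a) = - ofR a.
Proof. by apply: C_eq; rewrite !cE ?oppr0. Qed.

Lemma ofR0 : ofR 0 = 0 :> C R. Proof. by []. Qed.

Lemma ofR1 : ofR 1 = 1 :> C R. Proof. by []. Qed.

(** In the order of the complex numbers a positive radius is real, so that the limit can be tested
    with real radii. *)
Lemma cvgC_n1 (T : Type) (F : set_system T) (FF : Filter F) (f : T -> C R) z :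
  f @ F --> z <-> forall e : R, 0 < e -> \forall t \near F, n1 (z - f t) < e.
Proof.
split=> [/cvgrPdist_lt h e e0|h].
  have e20 : 0 < ofR (e / 2) :> C R by rewrite ofR_lt !cE eqxx andbT divr_gt0.
  apply: filterS (h _ e20) => t; rewrite normCE ofR_lt !cE => /andP[+ _].
  by have := n1_le_cmod (z - f t); lra.
apply/cvgrPdist_lt => e; rewrite -[0]/(ofR 0) ofR_lt => /andP[e0 ei].
apply: filterS (h _ e0) => t; rewrite normCE ofR_lt ei andbT.
exact: le_lt_trans (cmod_le_n1 _).
Qed.

Lemma cvgC (T : Type) (F : set_system T) (FF : Filter F) (f : T -> C R) z :
  f @ F --> z <->
  ((fun t => cRe (f t)) @ F --> cRe z /\ (fun t => cIm (f t)) @ F --> cIm z).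
Proof.
rewrite cvgC_n1; split=> [h|[/cvgrPdist_lt h1 /cvgrPdist_lt h2] e e0].
  split; apply/cvgrPdist_lt => e e0; apply: filterS (h _ e0) => t.
    by apply: le_lt_trans; rewrite -cReN -cReD cRe_le_n1.
  by apply: le_lt_trans; rewrite -cImN -cImD cIm_le_n1.
have e20 : 0 < e / 2 by rewrite divr_gt0.
near=> t; rewrite /n1 !cE.
have : `|cRe z - cRe (f t)| < e / 2 by near: t; exact: h1.
have : `|cIm z - cIm (f t)| < e / 2 by near: t; exact: h2.
lra.
Unshelve. all: by end_near. Qed.

End complex_numbers.

(** * Hahn-Banach extension and separation *)

Section linear_functionals.
Context {R : realType} {V : lmodType R} {F : V -> R}.
Hypothesis lF : linear (F : V -> R^o).

Lemma linfD x y : F (x + y) = F x + F y.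
Proof. by have := lF 1 x y; rewrite !scale1r. Qed.

Lemma linf0 : F 0 = 0.
Proof. by have := linfD 0 0; rewrite addr0; lra. Qed.

Lemma linfZ a x : F (a *: x) = a * F x.
Proof. by have := lF a x 0; rewrite !addr0 linf0 addr0. Qed.

Lemma linfN x : F (- x) = - F x.
Proof. by rewrite -scaleN1r linfZ mulN1r. Qed.

Lemma linfB x y : F (x - y) = F x - F y.
Proof. by rewrite linfD linfN. Qed.

Lemma linf_sum I (r : seq I) (P : pred I) (u : I -> V) :
  F (\sum_(i <- r | P i) u i) = \sum_(i <- r | P i) F (u i).
Proof. exact: (big_morph F linfD linf0). Qed.
End linear_functionals.

Section Hahn_Banach.
Context {R : realType} {V : lmodType R}.
Implicit Types p q : V -> R.

Definition sublinear p :=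
  (forall x y, p (x + y) <= p x + p y) /\
  (forall t x, 0 < t -> p (t *: x) = t * p x).

Lemma sublinear0 p : sublinear p -> p 0 = 0.
Proof.
by move=> [_ /(_ 2 0 (ltr0Sn _ _))]; rewrite scaler0; lra.
Qed.

Lemma sublinear_opp p x : sublinear p -> - p (- x) <= p x.
Proof.
move=> sp; have := sp.1 x (- x); rewrite subrr (sublinear0 sp); lra.
Qed.

(** Lower bounds of chains for Zorn's lemma. The infimum is finite because [- p (- x)] bounds every
    member from below at [x]. It is subadditive because, of two members of a chain, the smaller one
    can be used at both arguments. The empty chain is bounded by [p] itself. *)
Lemma sublinear_inf p (A : set (V -> R)) : sublinear p ->
  (forall q, A q -> sublinear q /\ forall x, q x <= p x) ->
  (forall q r, A q -> A r -> (forall x, q x <= r x) \/ (forall x, r x <= q x)) ->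
  exists2 q, sublinear q /\ (forall x, q x <= p x) &
    forall r, A r -> forall x, q x <= r x.
Proof.
move=> sp Ap tot; have [[r0 Ar0]|A0] := pselect (A !=set0); last first.
  by exists p => // r Ar; case: A0; exists r.
pose q x := inf [set r x | r in A].
have lb r x : A r -> - p (- x) <= r x.
  move=> Ar; apply: le_trans (sublinear_opp x (Ap _ Ar).1).
  by rewrite lerN2 (Ap _ Ar).2.
have hasinf x : has_lbound [set r x | r in A].
  by exists (- p (- x)) => _ [r Ar <-]; exact: lb.
have qle r x : A r -> q x <= r x by move=> Ar; apply: ge_inf => //; exists r.
have leq x c : (forall r, A r -> c <= r x) -> c <= q x.
  move=> h; apply: lb_le_inf; first by exists (r0 x), r0.
  by move=> _ [r Ar <-]; exact: h.
have key x y r1 r2 : A r1 -> A r2 -> q (x + y) <= r1 x + r2 y.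
  move=> A1 A2; case: (tot _ _ A1 A2) => h.
    apply: le_trans (qle _ _ A1) _; apply: le_trans ((Ap _ A1).1.1 _ _) _.
    by rewrite lerD2l.
  apply: le_trans (qle _ _ A2) _; apply: le_trans ((Ap _ A2).1.1 _ _) _.
  by rewrite lerD2r.
exists q; last by move=> r Ar x; exact: qle.
split; last by move=> x; apply: le_trans (qle _ _ Ar0) ((Ap _ Ar0).2 x).
split=> [x y|t x t0].
  rewrite -lerBlDr; apply: (leq) => r1 A1; rewrite lerBlDr -lerBlDl.
  by apply: (leq) => r2 A2; rewrite lerBlDl; exact: key.
apply/eqP; rewrite eq_le; apply/andP; split.
  rewrite -ler_pdivrMl//; apply: (leq) => r Ar.
  rewrite ler_pdivrMl// -((Ap _ Ar).1.2 _ _ t0); exact: qle.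
apply: (leq) => r Ar; rewrite ((Ap _ Ar).1.2 _ _ t0) ler_pM2l//; exact: qle.
Qed.

(** Zorn's lemma for the reversed pointwise order on the sublinear functionals below [p]. *)
Lemma sublinear_minimal p : sublinear p -> exists m,
  [/\ sublinear m, forall x, m x <= p x &
   forall q, sublinear q -> (forall x, q x <= m x) -> forall x, q x = m x].
Proof.
move=> sp; pose T := {q | sublinear q /\ forall x, q x <= p x}.
pose le (s t : T) := `[< forall x, sval t x <= sval s x >].
have [||s t|A tot|t tmin] := @Zorn T le.
- by move=> t; apply/asboolP.
- move=> r s t /asboolP rs /asboolP st; apply/asboolP => x.
  exact: le_trans (st x) (rs x).
- case: s t => [s sP] [t tP] /asboolP/= st /asboolP/= ts.
  have e : s = t by apply/funext => x; apply/eqP; rewrite eq_le st ts.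
  by move: tP {st ts}; rewrite -e => tP; congr exist; exact: Prop_irrelevance.
- have [||q Qq qA] := @sublinear_inf p [set sval t | t in A] sp.
  + by move=> _ [[q qP] _ <-].
  + move=> _ _ [s As <-] [t At <-].
    by case: (tot _ _ As At) => /asboolP h; [right|left].
  by exists (exist _ q Qq) => s As; apply/asboolP => x /=; apply: qA; exists s.
exists (sval t); case: t tmin => m mp' /= tmin; have [sm mp] := mp'; split=> // q sq qm x.
have Qq : sublinear q /\ forall x, q x <= p x.
  by split=> // y; exact: le_trans (qm y) (mp y).
have /(congr1 sval)/= <- // : exist _ m mp' = exist _ q Qq :> T.
by apply/esym/tmin; apply/asboolP.
Qed.

(** The functional is the infimum of p(x + ta) - t p(a) over t >= 0; t = 0 and t = 1 give the two
    bounds. When [p] is minimal it must equal [p], and the second bound becomes superadditivity. *)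
Lemma sublinear_dir p a : sublinear p -> exists2 q, sublinear q &
  (forall x, q x <= p x) /\ (forall x, q x <= p (x + a) - p a).
Proof.
move=> sp; pose S x := [set p (x + t *: a) - t * p a | t in [set t : R | 0 <= t]].
have p0 := sublinear0 sp.
have pt t y : 0 <= t -> p (t *: y) = t * p y.
  by rewrite le_eqVlt => /orP[/eqP<-|/sp.2//]; rewrite scale0r p0 mul0r.
have lb x t : 0 <= t -> - p (- x) <= p (x + t *: a) - t * p a.
  move=> t0; rewrite -pt//; have := sp.1 (x + t *: a) (- x).
  by rewrite addrAC subrr add0r; lra.
have hl x : has_lbound (S x) by exists (- p (- x)) => _ [t t0 <-]; exact: lb.
have qle x t : 0 <= t -> inf (S x) <= p (x + t *: a) - t * p a.
  by move=> t0; apply: ge_inf => //; exists t.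
have leq x c : (forall t, 0 <= t -> c <= p (x + t *: a) - t * p a) -> c <= inf (S x).
  move=> h; apply: lb_le_inf; first by exists (p (x + 0 *: a) - 0 * p a), 0 => /=.
  by move=> _ [t t0 <-]; exact: h.
exists (fun x => inf (S x)); last first.
  split=> x; first by have := qle x 0 (lexx _); rewrite scale0r addr0 mul0r subr0.
  by have := qle x 1 ler01; rewrite scale1r mul1r.
split=> [x y|t x t0].
  rewrite -lerBlDr; apply: (leq) => t t0; rewrite lerBlDr -lerBlDl.
  apply: (leq) => u u0; rewrite lerBlDl.
  apply: le_trans (qle _ _ (addr_ge0 t0 u0)) _.
  have := sp.1 (x + t *: a) (y + u *: a); rewrite addrACA -scalerDl; lra.
apply/eqP; rewrite eq_le; apply/andP; split.
  rewrite -ler_pdivrMl//; apply: (leq) => u u0; rewrite ler_pdivrMl//.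
  apply: le_trans (qle _ (t * u) _) _; first by rewrite mulr_ge0// ltW.
  by rewrite -scalerA -scalerDr sp.2// mulrBr mulrA.
apply: (leq) => u u0.
have -> : t *: x + u *: a = t *: (x + (u / t) *: a).
  by rewrite scalerDr scalerA mulrCA divff ?mulr1// gt_eqF.
have tu : 0 <= u / t by rewrite divr_ge0// ltW.
rewrite sp.2//; have := qle x _ tu; rewrite -(ler_pM2l t0) => /le_trans; apply.
by rewrite mulrBr mulrA mulrCA divff ?gt_eqF// mulr1.
Qed.

(** Minimal sublinear functionals are linear, by [sublinear_dir]. Extension problems are coded into
    the choice of [p], as in [ext_functional]. *)
Lemma Hahn_Banach p : sublinear p ->
  exists2 F : V -> R, linear (F : V -> R^o) & forall x, F x <= p x.
Proof.
move=> /sublinear_minimal[m [sm mp mmin]]; exists m => //.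
have mD x y : m (x + y) = m x + m y.
  apply/eqP; rewrite eq_le sm.1/=.
  have [q sq [qm qa]] := sublinear_dir y sm.
  by have := qa x; rewrite (mmin _ sq qm); lra.
have mN x : m (- x) = - m x.
  by have := mD x (- x); rewrite subrr (sublinear0 sm); lra.
move=> t x y; rewrite mD; congr (_ + _).
case: (ltgtP t 0) => t0; last by rewrite t0 !scale0r (sublinear0 sm).
  by rewrite -[t]opprK scaleNr mN sm.2 ?oppr_gt0// scaleNr.
by rewrite sm.2.
Qed.

(** The linear functional is taken below the one that [sublinear_dir] provides for the direction
    [v]. The latter is at most [p 0 - p v] at [- v], which forces [F v >= p v]. *)
Lemma Hahn_Banach_at p v : sublinear p ->
  exists2 F : V -> R, linear (F : V -> R^o) & (forall x, F x <= p x) /\ F v = p v.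
Proof.
move=> sp; have [q sq [qp qv]] := sublinear_dir v sp.
have [F lF Fq] := Hahn_Banach sq; exists F => //; split.
  by move=> x; exact: le_trans (Fq x) (qp x).
have := Fq (- v); have := qv (- v); rewrite addNr (sublinear0 sp) (linfN lF).
have := le_trans (Fq v) (qp v); lra.
Qed.

End Hahn_Banach.

Section dual_separation.
Context {R : realType} {E : tvsType R}.

Lemma dual_linear (F : dual E) : linear (F : E -> R^o).
Proof. by case: F => F FP; have /asboolP[] := FP. Qed.

Lemma mk_dual (F : E -> R) : linear (F : E -> R^o) ->
  continuous (F : E -> R^o) -> exists G : dual E, forall x, G x = F x.
Proof.
move=> lF cF; have FP : (F : E -> R^o) \in @dual_pred R E by apply/asboolP.
by exists (Dual FP).
Qed.

Lemma linear_nbhs_continuous (F : E -> R) (U : set E) : linear (F : E -> R^o) ->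
  nbhs (0 : E) U -> (forall x, U x -> `|F x| <= 1) -> continuous (F : E -> R^o).
Proof.
move=> lF nU FU x; apply/cvgrPdist_lt => e e0.
(* The factor 2 makes the final bound strict: near [x] one gets [|F (y - x)| <= e / 2]. *)
have e2 : 0 < 2 / e by rewrite divr_gt0.
have c : (2 / e) *: (y - x) @[y --> x] --> ((2 / e) *: (x - x) : E).
  apply: (@continuous2_cvg E R^o E E _ _ (fun=> 2 / e) (fun y => y - x)
    (fun (a : R^o) (z : E) => a *: z)); first exact: (@scale_continuous R E (_, _)).
    exact: cvg_cst.
  apply: (@continuous2_cvg E E E E _ _ id (fun=> - x) (fun y z : E => y + z)).
  - exact: (@add_continuous E (_, _)).
  - exact: cvg_id.
  - exact: cvg_cst.
rewrite subrr scaler0 in c.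
have := c _ nU; rewrite !near_simpl /=; apply: filterS => y /= /FU.
rewrite (linfZ lF) (linfB lF) normrM gtr0_norm// -ler_pdivlMl// invf_div mulr1 distrC.
by move=> /le_lt_trans; apply; lra.
Qed.

(** The Minkowski gauge of an open convex neighbourhood of 0 that misses [v] is sublinear and at
    least 1 at [v]; a linear functional below it with the same value at [v] separates [v] from 0. *)
Lemma dual_separates (v : E) : hausdorff_space E -> v != 0 ->
  exists F : dual E, F v != 0.
Proof.
move=> /hausdorff_accessible hE v0.
have [V [oV V0 Vv]] : exists V : set E, [/\ open V, V 0 & ~ V v].
  have [|V [oV V0 Vv]] := hE 0 v; first by rewrite eq_sym.
  exists V; split => //; first exact: set_mem.
  exact: set_mem Vv.
have [B Bconv [Bo Bb]] := @locally_convex R E.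
have [b [Bb' b0] bV] := Bb 0 V (open_nbhs_nbhs (conj oV V0)).
have nb : nbhs (0 : E) b by apply: open_nbhs_nbhs; split => //; exact: Bo.
have conv x y (t : R) : b x -> b y -> 0 <= t <= 1 -> b (t *: x + (1 - t) *: y).
  move=> bx by' t01; have [t0 t1] := andP t01.
  have := Bconv b (mem_set Bb') x y (Itv01 t0 t1) (mem_set bx) (mem_set by').
  by rewrite inE.
(* The gauge of [x] is the infimum of [S x], which is nonempty since r x tends to 0 with r. *)
pose S x := [set t : R | 0 < t /\ b (t^-1 *: x)].
have S0 x : S x !=set0.
  have c : (r *: x : E) @[r --> (0 : R^o)] --> (0 *: x : E).
    apply: (@continuous2_cvg R^o R^o E E _ _ id (fun=> x)
      (fun (a : R^o) (z : E) => a *: z)); first exact: (@scale_continuous R E (_, _)).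
      exact: cvg_id.
    exact: cvg_cst.
  rewrite scale0r in c; have := c _ nb; rewrite near_simpl => -[e /= e0 he].
  exists (2 / e); split; first by rewrite divr_gt0.
  rewrite invf_div; apply: he => /=; rewrite sub0r normrN gtr0_norm ?divr_gt0//; lra.
have lbS x : has_lbound (S x) by exists 0 => t [/ltW].
pose p x := inf (S x).
have ple x t : 0 < t -> b (t^-1 *: x) -> p x <= t by move=> t0 bt; apply: ge_inf.
have lep x c : (forall t, 0 < t -> b (t^-1 *: x) -> c <= t) -> c <= p x.
  by move=> h; apply: lb_le_inf => // t [t0 bt]; exact: h.
have sp : sublinear p.
  split=> [x y|t x t0].
    rewrite -lerBlDr; apply: (lep) => t t0 bt; rewrite lerBlDr -lerBlDl.
    apply: (lep) => u u0 bu; rewrite lerBlDl.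
    have tu : 0 < t + u by rewrite addr_gt0.
    apply: ple => //.
    have -> : (t + u)^-1 *: (x + y) =
        (t / (t + u)) *: (t^-1 *: x) + (1 - t / (t + u)) *: (u^-1 *: y).
      rewrite scalerDr !scalerA; congr (_ *: _ + _ *: _); field.
        by rewrite !gt_eqF.
      by rewrite !gt_eqF.
    apply: conv => //; rewrite ler_pdivrMr// mul1r lerDl (ltW u0) andbT.
    by rewrite divr_ge0// ltW.
  apply/eqP; rewrite eq_le; apply/andP; split.
    rewrite -ler_pdivrMl//; apply: (lep) => u u0 bu; rewrite ler_pdivrMl//.
    by apply: ple; rewrite ?mulr_gt0// scalerA invfM mulrAC mulVf ?gt_eqF// mul1r.
  apply: (lep) => u u0 bu; rewrite mulrC -ler_pdivlMr//.
  by apply: ple; rewrite ?divr_gt0// invf_div mulrC -scalerA.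
have pb x : b x -> p x <= 1 by move=> bx; apply: ple => //; rewrite invr1 scale1r.
have pv : 1 <= p v.
  apply: lep => t t0 bt; rewrite leNgt; apply/negP => t1; apply: Vv; apply: bV.
  have := conv _ _ t bt b0; rewrite scaler0 addr0 scalerA divff ?gt_eqF// scale1r.
  by apply; rewrite (ltW t0) (ltW t1).
have [F lF [Fp Fv]] := Hahn_Banach_at v sp.
have cF : continuous (F : E -> R^o).
  (* The neighbourhood [b] need not be symmetric, so [F] is bounded from both sides only on its
     intersection with the reflected one. *)
  apply: (@linear_nbhs_continuous F (b `&` [set x | b (- x)])) => //.
    apply: filterI => //; apply: (@opp_continuous E 0); rewrite oppr0; exact: nb.
  move=> x [bx bNx]; rewrite ler_norml (le_trans (Fp x) (pb _ bx)) andbT.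
  by rewrite lerNl -(linfN lF) (le_trans (Fp _) (pb _ bNx)).
have [G GF] := mk_dual lF cF.
by exists G; rewrite GF Fv gt_eqF// (lt_le_trans _ pv).
Qed.

End dual_separation.

Section normed_duality.
Context {R : realType} {X : normedModType R}.

Lemma norming_functional (x : X) : exists2 L : X -> R, linear (L : X -> R^o) &
  (forall y, `|L y| <= `|y|) /\ L x = `|x|.
Proof.
have sn : sublinear (fun y : X => `|y|).
  by split=> [y z|t y t0]; [exact: ler_normD|rewrite normrZ gtr0_norm].
have [L lL [Ln Lx]] := Hahn_Banach_at x sn; exists L => //; split => // y.
by rewrite ler_norml Ln andbT lerNl -(linfN lL) (le_trans (Ln _))// normrN.
Qed.

Lemma linf_bounded_continuous (L : X -> R) (k : R) : linear (L : X -> R^o) ->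
  (forall y, `|L y| <= k * `|y|) -> continuous (L : X -> R^o).
Proof.
move=> lL Lk x; apply/cvgrPdist_lt => e e0.
have k1 : 0 < `|k| + 1 by rewrite ltr_wpDl.
near=> y; rewrite -(linfB lL); apply: (le_lt_trans (Lk _)).
apply: (@le_lt_trans _ _ ((`|k| + 1) * `|x - y|)).
  by rewrite ler_wpM2r// (le_trans (ler_norm k))// lerDl.
rewrite -ltr_pdivlMl//; near: y.
by apply: cvgr_dist_lt => //; rewrite mulr_gt0// invr_gt0.
Unshelve. all: by end_near. Qed.

Lemma linf_dense_eq (L L' : X -> R) (A : set X) : dense A ->
  continuous (L : X -> R^o) -> continuous (L' : X -> R^o) ->
  (forall x, A x -> L x = L' x) -> L = L'.
Proof.
move=> dA cL cL' e; apply/funext => x; apply/eqP/negPn/negP => Lx.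
pose U := [set y : X | (L y - L' y : R^o) != 0].
have oU : open U.
  apply: (@open_comp X R^o (fun y => L y - L' y) [set z : R^o | z != 0]).
    by move=> y _; apply: (@cvgB R R^o); [exact: cL|exact: cL'].
  exact: open_neq.
have [|y [Uy /e Ly]] := dA U _ oU; first by exists x; rewrite /U /= subr_eq0.
by move: Uy; rewrite /U /= Ly subrr eqxx.
Qed.

End normed_duality.

(** * Integration against complex measures *)

Section raw_integral.
Context d (T : measurableType d) (R : realType).
Implicit Types (m : set T -> \bar R).
Local Open Scope ereal_scope.
Import HBNNSimple.

Lemma sintegral_raw m (h : {nnsfun T >-> R}) : m set0 = 0 ->
  sintegral m h = \sum_(x \in range h) x%:E * m (h @^-1` [set x]).
Proof.
move=> m0; rewrite /sintegral (fsbig_widen (range h) setT)//= => x [_ Nhx] /=.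
by rewrite preimage10// m0 mule0.
Qed.

Lemma integral_raw0 m (f : T -> \bar R) : m set0 = 0 -> (forall x, 0 <= f x) ->
  \int[m]_x f x = ereal_sup [set sintegral m h |
    h in [set h : {nnsfun T >-> R} | forall x, (h x)%:E <= f x]].
Proof.
move=> m0 f0; rewrite /integral patch_setT.
have -> : f ^\+ = f by apply/funext => x; rewrite (@ge0_funeposE _ _ setT) ?inE.
rewrite (_ : f ^\- = cst 0); last first.
  by apply/funext => x; rewrite (@ge0_funenegE _ _ setT) ?inE.
rewrite -[RHS]sube0; congr (_ - _).
transitivity (ereal_sup [set (0 : \bar R)]); last by rewrite ereal_sup1.
congr ereal_sup; apply/seteqP; split=> [_ [h /= h0 <-]|_ ->]; last first.
  exists nnsfun0 => //; rewrite sintegral_raw// fsbig1// => x _.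
  have [->|x0] := eqVneq x 0%R; first by rewrite mul0e.
  by rewrite preimage10 ?m0 ?mule0// => -[t _ /= /esym]; exact/eqP.
rewrite sintegral_raw// fsbig1// => x [t _ <-].
have -> : h t = 0%R by apply/eqP; rewrite eq_le fun_ge0 andbT -lee_fin h0.
by rewrite mul0e.
Qed.

(** Upper and total variations enter the integrals as bare suprema. Monotonicity survives because
    the integral of a nonnegative function is a supremum of finite sums over level sets, each
    increasing in the masses. *)
Lemma le_integral_raw m1 m2 (f : T -> \bar R) : m2 set0 = 0 ->
  (forall A, measurable A -> 0 <= m1 A <= m2 A) -> (forall x, 0 <= f x) ->
  \int[m1]_x f x <= \int[m2]_x f x.
Proof.
move=> m20 m12 f0.
have m10 : m1 set0 = 0.
  by apply/eqP; rewrite eq_le; have := m12 set0 measurable0; rewrite m20 andbC.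
rewrite !integral_raw0// ge_ereal_sup// => _ [h /= hf <-].
apply: le_ereal_sup_tmp; exists (sintegral m2 h); first by exists h.
rewrite !sintegral_raw// lee_fsum// => r [t _ <-].
by have /andP[? ?] := m12 _ (measurable_funPTI h (measurable_set1 (h t))); rewrite lee_pmul// lee_fin.
Qed.

Lemma eq_integral_raw m1 m2 (f : T -> \bar R) :
  (forall A, measurable A -> m1 A = m2 A) -> \int[m1]_x f x = \int[m2]_x f x.
Proof.
move=> m12.
have e (h : {nnsfun T >-> R}) : sintegral m1 h = sintegral m2 h.
  by rewrite /sintegral; apply: eq_fsbigr => x _; rewrite m12.
by rewrite /integral; congr (ereal_sup _ - ereal_sup _); apply: eq_imagel => h _.
Qed.

(** The integrands are arbitrary functions, so the integral is unfolded: a simple function below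
    [f], cut off outside [W], lies below [g] and has the same integral. *)
Lemma le_integral_null (p : {measure set T -> \bar R}) (W : set T)
    (f g : T -> \bar R) : measurable W -> p (~` W) = 0 ->
  (forall x, 0 <= f x) -> (forall x, 0 <= g x) ->
  (forall x, W x -> f x = g x) -> \int[p]_x f x <= \int[p]_x g x.
Proof.
move=> mW pW f0 g0 fg; rewrite !ge0_integralTE//.
apply: ge_ereal_sup => _ [h /= hf <-]; apply: le_ereal_sup_tmp.
exists (sintegral p (proj_nnsfun h mW)).
  exists (proj_nnsfun h mW) => //= x; rewrite mindicE.
  have [Wx|Wx] := boolP (x \in W); last by rewrite mulr0.
  by rewrite mulr1 -fg//; exact: set_mem.
have -> : sintegral p (proj_nnsfun h mW) = sintegral p (h \_ W).
  apply: eq_sintegral => x /=; rewrite mindicE patchE.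
  by case: ifP => _; rewrite ?mulr1 ?mulr0.
rewrite -integral_nnsfun// -integralT_nnsfun.
rewrite (@ge0_negligible_integral _ _ _ p setT (~` W))//=.
- by rewrite setDE setTI setCK.
- exact: measurableC.
- exact/measurable_EFinP.
- by move=> x _; rewrite lee_fin.
Qed.

Lemma eq_integral_null (p : {measure set T -> \bar R}) (W : set T)
    (f g : T -> \bar R) : measurable W -> p (~` W) = 0 ->
  (forall x, W x -> f x = g x) -> \int[p]_x f x = \int[p]_x g x.
Proof.
move=> mW pW fg; rewrite integralE [RHS]integralE.
by congr (_ - _); apply/eqP; rewrite eq_le; apply/andP; split;
  apply: (le_integral_null mW pW) => [x|x|x Wx]; rewrite ?funepos_ge0 ?funeneg_ge0 //; rewrite ?(funepos.unlock, funeneg.unlock) ?fg.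
Qed.

End raw_integral.

(** * Finite signed measures and their Jordan decomposition *)

Section real_measure.
Context d (T : measurableType d) (R : realType).

Definition is_rmeasure (m : set T -> R) := forall A : (set T)^nat,
  (forall n, measurable (A n)) -> trivIset setT A ->
  (fun n => \sum_(0 <= i < n) m (A i)) @ \oo --> m (\bigcup_n A n).

Lemma cmeasure_Re (mu : set T -> C R) : is_cmeasure mu ->
  is_rmeasure (fun A => cRe (mu A)).
Proof.
move=> h A mA tA; have /cvgC[+ _] := h A mA tA.
by under eq_fun do rewrite cRe_sum.
Qed.

Lemma cmeasure_Im (mu : set T -> C R) : is_cmeasure mu ->
  is_rmeasure (fun A => cIm (mu A)).
Proof.
move=> h A mA tA; have /cvgC[_ +] := h A mA tA.
by under eq_fun do rewrite cIm_sum.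
Qed.

Lemma rcmeasure (mu : set T -> C R) : is_rmeasure (fun A => cRe (mu A)) ->
  is_rmeasure (fun A => cIm (mu A)) -> is_cmeasure mu.
Proof.
move=> hr hi A mA tA; apply/cvgC; split.
  by under eq_fun do rewrite cRe_sum; exact: hr.
by under eq_fun do rewrite cIm_sum; exact: hi.
Qed.

(** For the constant sequence of empty sets the partial sums are the multiples n m(set0). They
    converge, so their constant increment m(set0) is 0. *)
Lemma rmeasure0 (m : set T -> R) : is_rmeasure m -> m set0 = 0.
Proof.
move=> h; have := h (fun=> set0) (fun=> measurable0) (@trivIset_set0 _ _ _).
rewrite bigcup0// => hc.
have {}hc : (fun n : nat => n%:R * m set0) @ \oo --> m set0.
  by under eq_fun do rewrite mulr_natl -[n in _ *+ n]subn0 -sumr_const_nat.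
have hc2 : (fun n : nat => n.+1%:R * m set0) @ \oo --> m set0.
  by rewrite -(cvg_shiftS (fun n : nat => n%:R * m set0)) in hc.
have : (fun=> m set0) @ \oo --> m set0 - m set0.
  rewrite (_ : (fun=> m set0) = (fun n : nat => n.+1%:R * m set0 - n%:R * m set0)).
    exact: cvgB hc2 hc.
  by apply/funext => n; rewrite -natr1 mulrDl mul1r addrC addKr.
by rewrite subrr => /(cvg_lim (@Rhausdorff R)) <-; rewrite lim_cst.
Qed.

(** The proof of countable additivity is carried by the term so that the structure of a charge, and
    with it the Hahn decomposition, can be attached to it. *)
Definition rcharge (m : set T -> R) (_ : is_rmeasure m) (A : set T) : \bar R :=
  (m A)%:E.

Section rcharge.
Variables (m : set T -> R) (hm : is_rmeasure m).

Let rcharge0 : rcharge hm set0 = 0%E.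
Proof. by rewrite /rcharge rmeasure0. Qed.

Let rcharge_fin A : measurable A -> rcharge hm A \is a fin_num.
Proof. by []. Qed.

Let rcharge_sigma_additive : semi_sigma_additive (rcharge hm).
Proof.
move=> F mF tF _; rewrite /rcharge; under eq_fun do rewrite sumEFin.
by apply: cvg_EFin; [exact: nearW|exact: hm].
Qed.

HB.instance Definition _ := isCharge.Build _ _ _ (rcharge hm)
  rcharge0 rcharge_fin rcharge_sigma_additive.

End rcharge.

(** For a Hahn decomposition into P and N, the suprema defining the two variations of A are attained
    at the intersections of A with P and with N. *)
Lemma rmeasure_jordan (m : set T -> R) : is_rmeasure m ->
  exists p q : {finite_measure set T -> \bar R}, [/\
    forall A, measurable A -> (m A)%:E = (p A - q A)%E,
    forall A, measurable A -> upper_var m A = p A &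
    forall A, measurable A -> lower_var m A = q A].
Proof.
move=> hm; pose nu : {charge set T -> \bar R} := rcharge hm.
have [P [N PN]] := Hahn_decomposition nu.
have [[mP posP] [mN negN] PUN PIN] := PN.
have split_ A : measurable A -> nu A = (nu (A `&` P) + nu (A `&` N))%E.
  by move=> mA; exact: charge_partition PUN PIN.
have pE A : measurable A -> (jordan_pos PN : {finite_measure set T -> \bar R}) A = nu (A `&` P).
  by move=> mA; rewrite [LHS]jordan_posE cjordan_posE /crestr0 mem_set.
have qE A : measurable A -> (jordan_neg PN : {finite_measure set T -> \bar R}) A = (- nu (A `&` N))%E.
  by move=> mA; rewrite [LHS]jordan_negE cjordan_negE /crestr0 mem_set.
have mono A B Q : measurable A -> measurable B -> measurable Q -> B `<=` A ->
    nu (A `&` Q) = (nu (B `&` Q) + nu ((A `\` B) `&` Q))%E.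
  move=> mA mB mQ BA; rewrite -chargeU//.
  - by rewrite -setIUl setDUK.
  - exact: measurableI.
  - by apply: measurableI => //; exact: measurableD.
  - by rewrite setIACA setDIK set0I.
exists (jordan_pos PN), (jordan_neg PN); split=> A mA.
- by rewrite -[LHS]/(nu A) pE// qE// oppeK; exact: split_.
- rewrite pE// /upper_var; apply/eqP; rewrite eq_le; apply/andP; split.
    apply: ge_ereal_sup => _ [B [mB BA] <-]; rewrite -[leLHS]/(nu B) split_//.
    rewrite (mono A B P)// leeD//.
    have h1 : (nu (B `&` N) <= 0)%E by apply: negN => //; exact: measurableI.
    apply: le_trans h1 _; apply: posP => //.
    by apply: measurableI => //; exact: measurableD.
  by apply: ereal_sup_ubound; exists (A `&` P) => //; split => //; exact: measurableI.
- rewrite qE// /lower_var /upper_var; apply/eqP; rewrite eq_le; apply/andP; split.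
    apply: ge_ereal_sup => _ [B [mB BA] <-]; rewrite EFinN -[(m B)%:E]/(nu B) split_//.
    rewrite leeN2 (mono A B N)// addeC leeD//.
    have h1 : (nu ((A `\` B) `&` N) <= 0)%E.
      by apply: negN => //; apply: measurableI => //; exact: measurableD.
    by apply: le_trans h1 _; apply: posP => //; exact: measurableI.
  by apply: ereal_sup_ubound; exists (A `&` N) => //; split => //; exact: measurableI.
Qed.

End real_measure.

(** The image under [S] of the measure with density [u] against [L]. It serves both for densities
    proper, with [S] the identity, and for convolutions, with [S] an addition on a product. *)
Definition dmeas d (T : measurableType d) d' (T' : measurableType d')
    (R : realType) (L : {measure set T -> \bar R}) (S : T -> T') (u : T -> R)
    (_ : measurable_fun setT S) (_ : L.-integrable setT (EFin \o u))
    (_ : forall x, 0 <= u x) (A : set T') : \bar R :=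
  (\int[L]_(x in S @^-1` A) (u x)%:E)%E.

Section density.
Context d (T : measurableType d) d' (T' : measurableType d') (R : realType).
Context (L : {measure set T -> \bar R}) (S : T -> T').
Hypothesis mS : measurable_fun setT S.
Variables (u : T -> R) (iu : L.-integrable setT (EFin \o u)).
Hypothesis u0 : forall x, 0 <= u x.
Local Notation a := (dmeas mS iu u0).
Local Open Scope ereal_scope.

Let mpre A : measurable A -> measurable (S @^-1` A).
Proof. by move=> mA; rewrite -[X in measurable X]setTI; exact: mS. Qed.

Let a0 : a set0 = 0.
Proof. by rewrite /dmeas preimage_set0 integral_set0. Qed.

Let a_ge0 A : 0 <= a A.
Proof. by apply: integral_ge0 => x _; rewrite lee_fin. Qed.

Let a_semi : semi_sigma_additive a.
Proof.
move=> F mF tF mUF; rewrite /dmeas preimage_bigcup.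
apply: (@semi_sigma_additive_nng_induced _ _ _ L (EFin \o u)).
- exact: measurable_int iu.
- by move=> x; rewrite /= lee_fin.
- by move=> n; exact: mpre.
- apply/trivIsetP => /= i j _ _ ij; rewrite -preimage_setI.
  by move/trivIsetP : tF => /(_ _ _ _ _ ij) ->//; rewrite preimage_set0.
- by rewrite -preimage_bigcup; exact: mpre.
Qed.

HB.instance Definition _ := isMeasure.Build _ _ _ a a0 a_ge0 a_semi.

Let a_fin : fin_num_fun a.
Proof.
move=> A mA; have mSA := mpre mA; apply: integrable_fin_num => //.
by apply: integrableS iu.
Qed.

HB.instance Definition _ := Measure_isFinite.Build _ _ _ a a_fin.

Import HBNNSimple.

Lemma dmeasE A : a A = \int[L]_(x in S @^-1` A) (u x)%:E. Proof. by []. Qed.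

Lemma integral_dmeas (h : T' -> R) : measurable_fun setT h -> (forall x, 0 <= h x)%R ->
  \int[a]_x (h x)%:E = \int[L]_x (h (S x) * u x)%:E.
Proof.
move=> mh h0.
have mh' : measurable_fun setT (EFin \o h) by exact/measurable_EFinP.
have mu' : measurable_fun setT u by apply/measurable_EFinP; exact: measurable_int iu.
pose g := nnsfun_approx measurableT mh'.
have gh x : (EFin \o g n) x @[n --> \oo] --> (h x)%:E.
  by apply: cvg_nnsfun_approx => // y _; rewrite lee_fin.
have -> : \int[a]_x (h x)%:E = lim (\int[a]_x (g n x)%:E @[n --> \oo]).
  under eq_integral do rewrite -(cvg_lim (@ereal_hausdorff R) (gh _)).
  apply: monotone_convergence => //.
  - by move=> n; apply/measurable_EFinP.
  - by move=> n x _; rewrite lee_fin.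
  - by move=> x _ m n mn; rewrite lee_fin; exact/lefP/nd_nnsfun_approx.
have -> : \int[L]_x (h (S x) * u x)%:E = lim (\int[L]_x (g n (S x) * u x)%:E @[n --> \oo]).
  have gu x : (g n (S x) * u x)%:E @[n --> \oo] --> (h (S x) * u x)%:E.
    rewrite EFinM; under eq_fun do rewrite EFinM.
    by apply: cvgeZr => //; exact: gh.
  under eq_integral do rewrite -(cvg_lim (@ereal_hausdorff R) (gu _)).
  apply: monotone_convergence => //.
  - move=> n; apply/measurable_EFinP; apply: measurable_funM => //.
    exact: measurableT_comp.
  - by move=> n x _; rewrite lee_fin mulr_ge0.
  - move=> x _ m n mn; rewrite lee_fin ler_wpM2r//; exact/lefP/nd_nnsfun_approx.
suff e n : \int[a]_x (g n x)%:E = \int[L]_x (g n (S x) * u x)%:E.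
  by under eq_fun do rewrite e.
rewrite integralT_nnsfun sintegralE.
transitivity (\int[L]_x (\sum_(y \in range (g n))
    (y * \1_(g n @^-1` [set y]) (S x) * u x)%:E)); last first.
  apply: eq_integral => x _; rewrite fsumEFin// -mulr_fsuml; congr (_ * _)%:E.
  by rewrite [RHS]fimfunE.
rewrite ge0_integral_fsum//=; first last.
- by move=> y x _; rewrite EFinM mule_ge0 ?lee_fin//; exact: nnfun_muleindic_ge0.
- move=> y; apply/measurable_EFinP; apply: measurable_funM => //.
  apply: measurable_funM => //.
  exact: (@measurableT_comp _ _ _ _ _ _ (\1_(g n @^-1` [set y]) : T' -> R)).
apply: eq_fsbigr => y /set_mem[t _ gy].
rewrite /dmeas integral_mkcond -ge0_integralZl//; first last.
- by rewrite lee_fin -gy.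
- by move=> x _; rewrite patchE; case: ifP => // _; rewrite lee_fin.
- have mD : measurable (S @^-1` (g n @^-1` [set y])).
    by apply: mpre; exact: measurable_funPTI.
  apply/(measurable_restrictT _ mD).
  by apply: measurable_funTS; exact/measurable_EFinP.
apply: eq_integral => x _; rewrite patchE indicE.
rewrite -[S x \in _]/(x \in S @^-1` (g n @^-1` [set y])); case: ifP => _.
  by rewrite mulr1 EFinM.
by rewrite mulr0 mul0r mule0.
Qed.

End density.

(** * Complex-valued functions and positive measures *)

Section complex_integral.
Context d (T : measurableType d) (R : realType).
Implicit Types (h g : T -> C R) (L : {measure set T -> \bar R}).

Definition cmfun h := measurable_fun setT (fun x => cRe (h x)) /\
  measurable_fun setT (fun x => cIm (h x)).

Definition cintg L h := L.-integrable setT (fun x => (cRe (h x))%:E) /\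
  L.-integrable setT (fun x => (cIm (h x))%:E).

Definition cI L h : C R :=
  ofRI (Rintegral L setT (fun x => cRe (h x)))
       (Rintegral L setT (fun x => cIm (h x))).

Lemma cmfun_ofR (a : T -> R) : measurable_fun setT a -> cmfun (fun x => ofR (a x)).
Proof. by move=> ma; split=> //=; exact: measurable_cst. Qed.

Lemma cmfun_cst (z : C R) : cmfun (fun=> z).
Proof. by split; exact: measurable_cst. Qed.

Lemma cmfunD h g : cmfun h -> cmfun g -> cmfun (fun x => h x + g x).
Proof.
move=> [hr hi] [gr gi]; split.
  by under eq_fun do rewrite cReD; exact: measurable_funD.
by under eq_fun do rewrite cImD; exact: measurable_funD.
Qed.

Lemma cmfunM h g : cmfun h -> cmfun g -> cmfun (fun x => h x * g x).
Proof.
move=> [hr hi] [gr gi]; split.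
  by under eq_fun do rewrite cReM; apply: measurable_funB; exact: measurable_funM.
by under eq_fun do rewrite cImM; apply: measurable_funD; exact: measurable_funM.
Qed.

Lemma cmfun_conj h : cmfun h -> cmfun (fun x => (h x)^*).
Proof.
move=> [hr hi]; split; first by under eq_fun do rewrite cRe_conj.
by under eq_fun do rewrite cIm_conj; exact: measurable_funN.
Qed.

Lemma cmfun_expi (a : T -> R) : measurable_fun setT a ->
  cmfun (fun x => expi (a x)).
Proof.
move=> ma; split=> /=.
  apply: (measurableT_comp (f := @cos R)) => //.
  by apply: continuous_measurable_fun; exact: continuous_cos.
apply: (measurableT_comp (f := @sin R)) => //.
by apply: continuous_measurable_fun; exact: continuous_sin.
Qed.

Lemma measurable_n1 h : cmfun h -> measurable_fun setT (fun x => n1 (h x)).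
Proof.
by move=> [hr hi]; apply: measurable_funD; exact: measurableT_comp.
Qed.

Lemma cintg_mfun L h : cintg L h -> cmfun h.
Proof.
by move=> [/measurable_int/measurable_EFinP ? /measurable_int/measurable_EFinP].
Qed.

Lemma cintg_le L h (g : T -> R) : cmfun h -> L.-integrable setT (EFin \o g) ->
  (forall x, n1 (h x) <= g x) -> cintg L h.
Proof.
move=> [hr hi] ig hg; split; apply: (le_integrable measurableT _ _ ig).
- exact/measurable_EFinP.
- move=> x _; rewrite /= !lee_fin; apply: (le_trans (cRe_le_n1 _)).
  exact: le_trans (hg x) (ler_norm _).
- exact/measurable_EFinP.
- move=> x _; rewrite /= !lee_fin; apply: (le_trans (cIm_le_n1 _)).
  exact: le_trans (hg x) (ler_norm _).
Qed.

Lemma cintg_n1 L h : cintg L h -> L.-integrable setT (fun x => (n1 (h x))%:E).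
Proof.
move=> [hr hi]; under eq_fun do rewrite /n1 EFinD.
by apply: integrableD => //; [exact: (integrable_norm hr)|exact: (integrable_norm hi)].
Qed.

Lemma cintgD L h g : cintg L h -> cintg L g -> cintg L (fun x => h x + g x).
Proof.
move=> ih ig; apply: (@cintg_le L _ (fun x => n1 (h x) + n1 (g x))).
- by apply: cmfunD; [exact: cintg_mfun ih|exact: cintg_mfun ig].
- rewrite (_ : EFin \o _ = (fun x => (n1 (h x))%:E + (n1 (g x))%:E)%E)//.
  by apply: integrableD => //; exact: cintg_n1.
- by move=> x; exact: n1D.
Qed.

Lemma cintgZ L (c : C R) h : cintg L h -> cintg L (fun x => c * h x).
Proof.
move=> ih; apply: (@cintg_le L _ (fun x => n1 c * n1 (h x))).
- by apply: cmfunM; [exact: cmfun_cst|exact: cintg_mfun ih].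
- rewrite (_ : EFin \o _ = (fun x => (n1 c)%:E * (n1 (h x))%:E)%E)//.
  by apply: integrableZl => //; exact: cintg_n1.
- by move=> x; exact: n1M.
Qed.

Lemma eq_cI L h g : (forall x, h x = g x) -> cI L h = cI L g.
Proof. by move=> hg; congr cI; apply/funext. Qed.

Lemma cID L h g : cintg L h -> cintg L g ->
  cI L (fun x => h x + g x) = cI L h + cI L g.
Proof.
move=> [hr hi] [gr gi]; apply: C_eq; rewrite !cE.
  by under [LHS]eq_Rintegral do rewrite cReD; exact: RintegralD.
by under [LHS]eq_Rintegral do rewrite cImD; exact: RintegralD.
Qed.

Lemma cIZ L (c : C R) h : cintg L h -> cI L (fun x => c * h x) = c * cI L h.
Proof.
move=> [hr hi]; have Z k (f : T -> R) : L.-integrable setT (EFin \o f) ->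
    L.-integrable setT (EFin \o (fun x => k * f x)).
  move=> fi; rewrite (_ : EFin \o _ = (fun x => k%:E * (f x)%:E)%E)//.
  exact: integrableZl.
apply: C_eq; rewrite !cE.
  under [LHS]eq_Rintegral do rewrite cReM.
  by rewrite RintegralB//; [rewrite !RintegralZl|exact: Z|exact: Z].
under [LHS]eq_Rintegral do rewrite cImM.
by rewrite RintegralD//; [rewrite !RintegralZl|exact: Z|exact: Z].
Qed.

Lemma cI_conj L h : cintg L h -> cI L (fun x => (h x)^*) = (cI L h)^*.
Proof.
move=> [hr hi]; apply: C_eq; rewrite !cE.
  by apply: eq_Rintegral => x _; rewrite cRe_conj.
rewrite -mulN1r -RintegralZl//.
by apply: eq_Rintegral => x _; rewrite cIm_conj mulN1r.
Qed.

Lemma n1_cI L h : cintg L h -> n1 (cI L h) <= Rintegral L setT (fun x => n1 (h x)).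
Proof.
move=> [hr hi]; rewrite /n1 !cE RintegralD//; last 2 first.
- exact: (integrable_norm hr).
- exact: (integrable_norm hi).
by apply: lerD; exact: le_normr_Rintegral.
Qed.

Lemma cI_cvg L (hn : nat -> T -> C R) h (g : T -> R) :
  (forall n, cmfun (hn n)) -> L.-integrable setT (EFin \o g) ->
  (forall n x, n1 (hn n x) <= g x) ->
  (forall x, hn n x @[n --> \oo] --> h x) ->
  cintg L h /\ cI L (hn n) @[n --> \oo] --> cI L h.
Proof.
move=> mhn ig hg hc.
have key (f : nat -> T -> R) (f0 : T -> R) :
    (forall n, measurable_fun setT (f n)) -> (forall n x, `|f n x| <= g x) ->
    (forall x, f n x @[n --> \oo] --> f0 x) ->
    L.-integrable setT (EFin \o f0) /\
    Rintegral L setT (f n) @[n --> \oo] --> Rintegral L setT f0.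
  move=> mf fg fc.
  have fcE x : (f n x)%:E @[n --> \oo] --> (f0 x)%:E.
    by apply: cvg_EFin; [exact: nearW|exact: fc].
  have [] := @dominated_convergence _ _ _ L setT measurableT
    (fun n x => (f n x)%:E) (EFin \o f0) (EFin \o g).
  - by move=> n; exact/measurable_EFinP.
  - apply/measurable_EFinP; apply: (measurable_fun_cvg (h := f)).
      by move=> n; exact: mf.
    by move=> x _; exact: fc.
  - by apply: aeW => x _; exact: fcE.
  - exact: ig.
  - by apply: aeW => x n _; rewrite /= lee_fin.
  move=> if0 _ c; split => //; apply: fine_cvg.
  by rewrite fineK//; exact: integrable_fin_num.
have [ir cr] := key (fun n x => cRe (hn n x)) (fun x => cRe (h x))
  (fun n => (mhn n).1) (fun n x => le_trans (cRe_le_n1 _) (hg n x))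
  (fun x => ((cvgC _ _ _).1 (hc x)).1).
have [ii ci] := key (fun n x => cIm (hn n x)) (fun x => cIm (h x))
  (fun n => (mhn n).2) (fun n x => le_trans (cIm_le_n1 _) (hg n x))
  (fun x => ((cvgC _ _ _).1 (hc x)).2).
by split=> //; apply/cvgC; split.
Qed.

End complex_integral.

Lemma cmfun_comp d1 d2 (T1 : measurableType d1) (T2 : measurableType d2)
    (R : realType) (h : T2 -> C R) (S : T1 -> T2) :
  measurable_fun setT S -> cmfun h -> cmfun (fun x => h (S x)).
Proof.
by move=> mS [hr hi]; split;
  [exact: (measurableT_comp hr)|exact: (measurableT_comp hi)].
Qed.

Lemma integrable_max0 d (T : measurableType d) (R : realType)
    (L : {measure set T -> \bar R}) (u : T -> R) :
  L.-integrable setT (EFin \o u) ->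
  L.-integrable setT (EFin \o (fun x => Num.max (u x) 0)).
Proof.
move=> iu; have mu' : measurable_fun setT u.
  by apply/measurable_EFinP; exact: measurable_int iu.
apply: (le_integrable measurableT _ _ iu).
  by apply/measurable_EFinP; apply: measurable_maxr => //; exact: measurable_cst.
by move=> x _; rewrite /= lee_fin; case: (leP (u x) 0) => ux; rewrite ?normr0.
Qed.

Lemma max0_decomp (R : realType) (a : R) : a = Num.max a 0 - Num.max (- a) 0.
Proof. by case: (leP a 0); case: (leP (- a) 0); lra. Qed.

Lemma max0_ge0 (R : realType) (a : R) : 0 <= Num.max a 0.
Proof. by rewrite le_max lexx orbT. Qed.

Section Rintegral_density.
Context d (T : measurableType d) d' (T' : measurableType d') (R : realType).
Context (L : {measure set T -> \bar R}) (S : T -> T').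
Hypothesis mS : measurable_fun setT S.
Variables (u : T -> R) (iu : L.-integrable setT (EFin \o u)).
Hypothesis u0 : forall x, 0 <= u x.
Local Notation a := (dmeas mS iu u0).

Lemma Rintegral_dmeas (h : T' -> R) : measurable_fun setT h ->
  L.-integrable setT (EFin \o (fun x => h (S x) * u x)) ->
  a.-integrable setT (EFin \o h) /\
  Rintegral a setT h = Rintegral L setT (fun x => h (S x) * u x).
Proof.
move=> mh /[dup] ihu /integrableP[mhu hu].
have ih : a.-integrable setT (EFin \o h).
  apply/integrableP; split; first exact/measurable_EFinP.
  rewrite (_ : (\int[a]_x _)%E = (\int[a]_x (`|h x|)%:E)%E)// integral_dmeas//.
    apply: le_lt_trans hu; rewrite le_eqVlt; apply/orP; left; apply/eqP.
    by apply: eq_integral => x _; rewrite /= normrM (ger0_norm (u0 x)).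
  exact: measurableT_comp.
have ihN : a.-integrable setT (EFin \o (fun x => - h x)) by exact: (integrableN ih).
have huE e x : Num.max (e * h (S x)) 0 * u x = Num.max (e * (h (S x) * u x)) 0.
  by rewrite maxr_pMl// mul0r mulrA.
have ihuN : L.-integrable setT (EFin \o (fun x => - (h (S x) * u x))) by exact: (integrableN ihu).
split=> //.
have part (g : T' -> R) : measurable_fun setT g -> (forall x, 0 <= g x) ->
    Rintegral a setT g = Rintegral L setT (fun x => g (S x) * u x).
  by move=> mg g0; rewrite /Rintegral integral_dmeas.
transitivity (Rintegral a setT (fun x => Num.max (h x) 0 - Num.max (- h x) 0)).
  by apply: eq_Rintegral => x _; rewrite -max0_decomp.
rewrite RintegralB//; [|exact: integrable_max0|exact: integrable_max0].
rewrite !part//; last 4 first.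
- by apply: measurable_maxr; [exact: measurable_funN|exact: measurable_cst].
- by move=> x; exact: max0_ge0.
- by apply: measurable_maxr; [|exact: measurable_cst].
- by move=> x; exact: max0_ge0.
transitivity (Rintegral L setT (fun x => Num.max (h (S x) * u x) 0) -
  Rintegral L setT (fun x => Num.max (- (h (S x) * u x)) 0)).
  congr (_ - _); apply: eq_Rintegral => x _.
    by have := huE 1 x; rewrite !mul1r.
  by have := huE (-1) x; rewrite !mulN1r.
rewrite -RintegralB//; [|exact: integrable_max0 ihu|exact: integrable_max0 ihuN].
by apply: eq_Rintegral => x _; rewrite -max0_decomp.
Qed.

End Rintegral_density.

Section sint.
Context d (T : measurableType d) (R : realType).
Implicit Types (m : set T -> R).

(** Any decomposition into a difference computes the integral, not only that of Jordan: the latter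
    is minimal, so that [p <= a] and [q <= b] preserve integrability, and p + b = a + q as
    measures. *)
Lemma sint_diff m (a b : {finite_measure set T -> \bar R}) (h : T -> R) :
  is_rmeasure m -> (forall A, measurable A -> (m A)%:E = (a A - b A)%E) ->
  a.-integrable setT (EFin \o h) -> b.-integrable setT (EFin \o h) ->
  sint m h = Rintegral a setT h - Rintegral b setT h.
Proof.
move=> hm mab ia ib; have [p [q [mpq pE qE]]] := rmeasure_jordan hm.
rewrite /sint (eq_integral_raw _ pE) (eq_integral_raw _ qE).
have pa A : measurable A -> (p A <= a A)%E.
  move=> mA; rewrite -pE//; apply: ge_ereal_sup => _ [B [mB BA] <-].
  rewrite mab//; apply: (@le_trans _ _ (a B)); first by rewrite geeDl// oppe_le0.
  by rewrite le_measure// inE.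
have qb A : measurable A -> (q A <= b A)%E.
  move=> mA; rewrite -qE//; apply: ge_ereal_sup => _ [B [mB BA] <-].
  rewrite EFinN mab// fin_num_oppeB ?fin_num_measure// addeC.
  apply: (@le_trans _ _ (b B)); first by rewrite geeDl// oppe_le0.
  by rewrite le_measure// inE.
have sub (u v : {finite_measure set T -> \bar R}) :
    (forall A, measurable A -> (u A <= v A)%E) ->
    v.-integrable setT (EFin \o h) -> u.-integrable setT (EFin \o h).
  move=> uv /integrableP[mh hv]; apply/integrableP; split => //.
  apply: le_lt_trans hv; apply: ge0_le_measure_integral => //.
  exact: measurableT_comp.
have ip := sub _ _ pa ia; have iq := sub _ _ qb ib.
have e A : measurable A -> (measure_add p b A = measure_add a q A)%E.
  move=> mA; rewrite !measure_addE; have := mab A mA; rewrite mpq//.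
  rewrite -(fineK (fin_num_measure p A mA)) -(fineK (fin_num_measure q A mA)).
  rewrite -(fineK (fin_num_measure a A mA)) -(fineK (fin_num_measure b A mA)).
  rewrite -!EFinB => -[e].
  transitivity (fine (p A) + fine (b A))%:E.
    by rewrite EFinD; congr (_ + _)%E; apply/esym/fineK; exact: fin_num_measure.
  transitivity (fine (a A) + fine (q A))%:E; first by congr _%:E; lra.
  by rewrite EFinD; congr (_ + _)%E; apply/fineK; exact: fin_num_measure.
have := eq_integral_raw (EFin \o h) e.
rewrite !integral_measure_add// => {}e.
have f_ (u : {finite_measure set T -> \bar R}) : u.-integrable setT (EFin \o h) ->
    (\int[u]_x (EFin \o h) x)%E \is a fin_num by exact: integrable_fin_num.
have := congr1 fine e.
rewrite (fineD (f_ _ ip) (f_ _ ib)) (fineD (f_ _ ia) (f_ _ iq)).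
rewrite /Rintegral /comp; lra.
Qed.

Lemma sint_null m (W : set T) (h g : T -> R) : is_rmeasure m -> measurable W ->
  (forall B, measurable B -> B `<=` ~` W -> m B = 0) ->
  (forall x, W x -> h x = g x) -> sint m h = sint m g.
Proof.
move=> hm mW m0 hg; have [p [q [mpq pE qE]]] := rmeasure_jordan hm.
have mWC : measurable (~` W) by exact: measurableC.
have sup0 (f : set T -> R) : (forall B, measurable B -> B `<=` ~` W -> f B = 0) ->
    upper_var f (~` W) = 0%E.
  move=> f0; transitivity (ereal_sup [set (0 : \bar R)]%E); last by rewrite ereal_sup1.
  rewrite /upper_var; congr ereal_sup; apply/seteqP; split.
    by move=> _ [B [mB BW] <-] /=; rewrite f0.
  have s0 : (set0 : set T) `<=` ~` W by exact: sub0set.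
  by move=> _ ->; exists set0; [split|rewrite f0].
have p0 : p (~` W) = 0%E by rewrite -pE// sup0.
have q0 : q (~` W) = 0%E.
  by rewrite -qE// /lower_var sup0// => B mB BW; rewrite m0// oppr0.
rewrite /sint !(eq_integral_raw _ pE) !(eq_integral_raw _ qE).
by congr (fine _ - fine _); apply: (eq_integral_null mW) => // x Wx; rewrite hg.
Qed.

End sint.

(** * Images of complex densities *)

Section push.
Context d (T : measurableType d) d' (T' : measurableType d') (R : realType).
Context (L : {measure set T -> \bar R}) (S : T -> T') (D : T -> C R).
Hypothesis mS : measurable_fun setT S.
Hypothesis iD : cintg L D.

Let mpre A : measurable A -> measurable (S @^-1` A).
Proof. by move=> mA; rewrite -[X in measurable X]setTI; exact: mS. Qed.

(** The images of the positive and negative parts of [u] decompose [m]. They may overlap after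
    applying [S], so this need not be the Jordan decomposition, and [sint_diff] is required. *)
Let real_push (u : T -> R) (m : set T' -> R) (h : T' -> R) :
  L.-integrable setT (EFin \o u) -> measurable_fun setT h ->
  L.-integrable setT (EFin \o (fun x => h (S x) * u x)) ->
  (forall A, measurable A -> m A = Rintegral L setT (fun x => u x * \1_A (S x))) ->
  is_rmeasure m /\ sint m h = Rintegral L setT (fun x => h (S x) * u x).
Proof.
move=> iu mh ihu mE.
have mu' : measurable_fun setT u by apply/measurable_EFinP; exact: measurable_int iu.
pose up x := Num.max (u x) 0; pose un x := Num.max (- u x) 0.
have iup : L.-integrable setT (EFin \o up) by exact: integrable_max0.
have iun : L.-integrable setT (EFin \o un).
  by apply: integrable_max0; exact: (integrableN iu).
have up0 x : 0 <= up x by exact: max0_ge0.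
have un0 x : 0 <= un x by exact: max0_ge0.
have uE x : u x = up x - un x by exact: max0_decomp.
have mhS : measurable_fun setT (fun x => h (S x)) by exact: measurableT_comp.
have ih (v : T -> R) : measurable_fun setT v -> (forall x, `|v x| <= `|u x|) ->
    L.-integrable setT (EFin \o (fun x => h (S x) * v x)).
  move=> mv vu; apply: (le_integrable measurableT _ _ ihu).
    by apply/measurable_EFinP; exact: measurable_funM.
  by move=> x _; rewrite /= lee_fin !normrM ler_wpM2l.
have ihp : L.-integrable setT (EFin \o (fun x => h (S x) * up x)).
  apply: ih => [|x]; first by apply: measurable_maxr => //; exact: measurable_cst.
  by rewrite /up; case: (leP (u x) 0) => ux; rewrite ?normr0.
have ihn : L.-integrable setT (EFin \o (fun x => h (S x) * un x)).
  apply: ih => [|x].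
    by apply: measurable_maxr; [exact: measurable_funN|exact: measurable_cst].
  by rewrite /un; case: (leP (- u x) 0) => ux; rewrite ?normr0// normrN.
pose a : {finite_measure set T' -> \bar R} := dmeas mS iup up0.
pose b : {finite_measure set T' -> \bar R} := dmeas mS iun un0.
have mab A : measurable A -> (m A)%:E = (a A - b A)%E.
  move=> mA; rewrite mE// /a /b /= !dmeasE.
  have iS f : L.-integrable setT (EFin \o f) -> L.-integrable (S @^-1` A) (EFin \o f).
    by apply: integrableS => //; exact: mpre.
  rewrite -integralB//; [|exact: mpre|exact: iS|exact: iS].
  rewrite -[RHS]fineK; last first.
    rewrite integrable_fin_num//; first exact: mpre.
    by apply: integrableB => //; [exact: mpre|exact: iS|exact: iS].
  congr (fine _)%:E; rewrite [RHS]integral_mkcond; apply: eq_integral => x _.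
  rewrite patchE indicE -[S x \in A]/(x \in S @^-1` A).
  by case: ifP => _; rewrite ?mulr1 ?mulr0//= uE EFinB.
have hm : is_rmeasure m.
  move=> A mA tA.
  have -> : m (\bigcup_n A n) = fine (a (\bigcup_n A n)) - fine (b (\bigcup_n A n)).
    have mU : measurable (\bigcup_n A n) by exact: bigcupT_measurable.
    by rewrite -fineB ?fin_num_measure// -mab.
  have -> : (fun n => \sum_(0 <= i < n) m (A i)) =
     (fun n => \sum_(0 <= i < n) fine (a (A i)) - \sum_(0 <= i < n) fine (b (A i))).
    apply/funext => n; rewrite -sumrB; apply: eq_bigr => i _.
    by rewrite -fineB ?fin_num_measure// -mab.
  have sa (c : {finite_measure set T' -> \bar R}) :
     \sum_(0 <= i < n) fine (c (A i)) @[n --> \oo] --> fine (c (\bigcup_n A n)).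
    have mU : measurable (\bigcup_n A n) by exact: bigcupT_measurable.
    have := @measure_semi_sigma_additive _ _ _ c A mA tA mU.
    rewrite -{1}[X in _ --> X -> _](fineK (fin_num_measure c _ mU)) => /fine_cvg.
    apply: cvg_trans; apply: near_eq_cvg; apply: nearW => n /=.
    rewrite -[RHS]/(fine (\sum_(0 <= i < n) fine (c (A i)))%:E) -sumEFin.
    by congr fine; apply: eq_bigr => i _; rewrite fineK// fin_num_measure.
  by apply: cvgB; exact: sa.
split => //.
have [iah ea] := Rintegral_dmeas mS iup up0 mh ihp.
have [ibh eb] := Rintegral_dmeas mS iun un0 mh ihn.
rewrite (sint_diff hm mab iah ibh) [X in X - _]ea [X in _ - X]eb -RintegralB//.
by apply: eq_Rintegral => x _; rewrite -mulrBr -uE.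
Qed.

Variable mu : set T' -> C R.
Hypothesis muE : forall A, measurable A ->
  mu A = cI L (fun x => D x * ofR (\1_A (S x))).

Lemma push_cmeasure : is_cmeasure mu.
Proof.
(* Countable additivity is the first half of [real_push], obtained with the zero integrand. *)
have h0 : measurable_fun [set: T'] (fun=> 0 : R) by exact: measurable_cst.
have i0 (u : T -> R) : L.-integrable setT (EFin \o (fun x => 0 * u x)).
  by rewrite (_ : EFin \o _ = cst 0%E); [exact: integrable0|apply/funext => x /=; rewrite mul0r].
apply: rcmeasure.
  apply: (real_push iD.1 h0 (i0 _) _).1 => A mA; rewrite muE// /cI !cE.
  by apply: eq_Rintegral => x _; rewrite !cE mulr0 subr0.
apply: (real_push iD.2 h0 (i0 _) _).1 => A mA; rewrite muE// /cI !cE.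
by apply: eq_Rintegral => x _; rewrite !cE mulr0 add0r.
Qed.

Lemma push_cint (h : T' -> C R) : cmfun h ->
  L.-integrable setT (EFin \o (fun x => n1 (h (S x)) * n1 (D x))) ->
  cint mu h = cI L (fun x => D x * h (S x)).
Proof.
move=> [mhr mhi] ih; have [mDr mDi] := cintg_mfun iD.
have mu_re A : measurable A ->
    cRe (mu A) = Rintegral L setT (fun x => cRe (D x) * \1_A (S x)).
  move=> mA; rewrite muE// /cI !cE.
  by apply: eq_Rintegral => x _; rewrite !cE mulr0 subr0.
have mu_im A : measurable A ->
    cIm (mu A) = Rintegral L setT (fun x => cIm (D x) * \1_A (S x)).
  move=> mA; rewrite muE// /cI !cE.
  by apply: eq_Rintegral => x _; rewrite !cE mulr0 add0r.
have int (u : T -> R) (g : T' -> R) : measurable_fun setT u -> measurable_fun setT g ->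
    (forall x, `|u x| <= n1 (D x)) -> (forall x, `|g (S x)| <= n1 (h (S x))) ->
    L.-integrable setT (EFin \o (fun x => g (S x) * u x)).
  move=> mu' mg uD gh; apply: (le_integrable measurableT _ _ ih).
    apply/measurable_EFinP; apply: measurable_funM => //.
    exact: (measurableT_comp mg).
  move=> x _; rewrite /= lee_fin !normrM.
  by apply: ler_pM => //; rewrite [leRHS]ger0_norm ?n1_ge0.
have irr := int _ _ mDr mhr (fun x => cRe_le_n1 _) (fun x => cRe_le_n1 _).
have iri := int _ _ mDr mhi (fun x => cRe_le_n1 _) (fun x => cIm_le_n1 _).
have iir := int _ _ mDi mhr (fun x => cIm_le_n1 _) (fun x => cRe_le_n1 _).
have iii := int _ _ mDi mhi (fun x => cIm_le_n1 _) (fun x => cIm_le_n1 _).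
rewrite /cint (real_push iD.1 mhr irr mu_re).2 (real_push iD.1 mhi iri mu_re).2.
rewrite (real_push iD.2 mhr iir mu_im).2 (real_push iD.2 mhi iii mu_im).2.
apply: C_eq; rewrite !cE.
  rewrite -RintegralB//; apply: eq_Rintegral => x _; rewrite !cE; ring.
rewrite -RintegralD//; apply: eq_Rintegral => x _; rewrite !cE; ring.
Qed.

(** Combined with [total_var_le], this bounds the total variation of an image by the image of the
    modulus of the density. *)
Lemma push_n1_le A : measurable A ->
  ((n1 (mu A))%:E <= \int[L]_(x in S @^-1` A) (n1 (D x))%:E)%E.
Proof.
move=> mA; rewrite muE//.
have mSA := mpre mA.
have iDA : cintg L (fun x => D x * ofR (\1_A (S x))).
  apply: (@cintg_le _ _ _ _ _ (fun x => n1 (D x))); last 2 first.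
  - exact: cintg_n1.
  - move=> x; apply: le_trans (n1M _ _) _; rewrite n1_ofR indicE.
    by case: (_ \in _); rewrite ?normr1 ?normr0 ?mulr1 ?mulr0 ?n1_ge0.
  apply: cmfunM; first exact: cintg_mfun iD.
  by apply: cmfun_ofR; apply: (measurableT_comp (f := \1_A : T' -> R)).
have := n1_cI iDA; rewrite -lee_fin => /le_trans; apply.
rewrite /Rintegral fineK; last by apply: integrable_fin_num => //; exact: cintg_n1.
rewrite [leRHS]integral_mkcond; apply: ge0_le_integral => //.
- by move=> x _; rewrite lee_fin n1_ge0.
- by apply/measurable_EFinP; apply: measurable_n1; exact: cintg_mfun iDA.
- apply/(measurable_restrictT _ mSA); apply: measurable_funTS.
  by apply/measurable_EFinP; apply: measurable_n1; exact: cintg_mfun iD.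
- move=> x _; rewrite patchE -[x \in _]/(S x \in A) indicE; case: ifP => _.
    by rewrite ofR1 mulr1.
  by rewrite ofR0 mulr0 n10.
Qed.

End push.

Lemma measurable_lt_set d (T : measurableType d) (R : realType) (f g : T -> R) :
  measurable_fun setT f -> measurable_fun setT g -> measurable [set x | f x < g x].
Proof.
move=> mf mg; have := measurable_fun_ltr mf mg measurableT (Y := [set true]).
by rewrite setTI; apply.
Qed.

Section fmeasure_add.
Context d (T : measurableType d) (R : realType).
Variables p q : {finite_measure set T -> \bar R}.

Definition fmeasure_add : set T -> \bar R := measure_add p q.

HB.instance Definition _ := Measure.on fmeasure_add.

Let fmeasure_add_fin : fin_num_fun fmeasure_add.
Proof.
by move=> A mA; rewrite /fmeasure_add measure_addE fin_numD !fin_num_measure.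
Qed.

HB.instance Definition _ :=
  Measure_isFinite.Build _ _ _ fmeasure_add fmeasure_add_fin.

End fmeasure_add.

(** * Total variation and Radon-Nikodym densities *)

Section total_variation.
Context d (T : measurableType d) (R : realType).
Implicit Types (mu nu : set T -> C R).

Lemma cmod_le_total_var mu A B : measurable A -> measurable B -> B `<=` A ->
  ((cmod (mu B))%:E <= total_var mu A)%E.
Proof.
move=> mA mB BA; pose D (i : 'I_2) := if val i == 0%N then B else A `\` B.
apply: le_ereal_sup_tmp; exists (\sum_(i < 2) cmod (mu (D i)))%:E; last first.
  by rewrite lee_fin big_ord_recl/= lerDl sumr_ge0// => i _; exact: cmod_ge0.
exists 2%N, D; split => //.
- by move=> i; rewrite /D; case: ifP => _ //; exact: measurableD.
- apply/trivIsetP => -[[|[|i]] hi] // -[[|[|j]] hj] // _ _ ij; rewrite /D/=.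
  + by rewrite setDIK.
  + by rewrite setIC setDIK.
- apply/seteqP; split=> [x [i _]|x Ax]; rewrite /D; first by case: ifP => _ => [/BA|[]].
  have [Bx|nBx] := pselect (B x); first by exists ord0.
  by exists (lift ord0 ord0).
Qed.

Lemma total_var_ge0 mu A : measurable A -> (0 <= total_var mu A)%E.
Proof.
move=> mA; apply: le_trans (cmod_le_total_var mu mA mA (@subset_refl _ _)).
by rewrite lee_fin cmod_ge0.
Qed.

Lemma total_var_le mu (G : {measure set T -> \bar R}) :
  (forall A, measurable A -> ((n1 (mu A))%:E <= G A)%E) ->
  forall A, measurable A -> (total_var mu A <= G A)%E.
Proof.
move=> h A mA; apply: ge_ereal_sup => _ [n [D [mD tD DA ->]]].
have -> : A = \big[setU/set0]_(i < n) D i.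
  rewrite -DA -bigcup_seq (_ : [set` index_enum _] = setT)//.
  by apply/seteqP; split=> i //= _; rewrite mem_index_enum.
rewrite measure_bigsetU_ord_cond//; last first.
  by apply: sub_trivIset tD.
rewrite -(sumEFin _ _ (fun i => cmod (mu (D i)))) lee_sum// => i _.
by apply: le_trans (h _ (mD i)); rewrite lee_fin cmod_le_n1.
Qed.

Lemma total_var_null mu A B : measurable A -> total_var mu A = 0%E ->
  measurable B -> B `<=` A -> mu B = 0.
Proof.
move=> mA A0 mB BA; have := cmod_le_total_var mu mA mB BA; rewrite A0 lee_fin => h.
have {}h : n1 (mu B) <= 0 by have := n1_le_cmod (mu B); lra.
have hr := le_trans (cRe_le_n1 (mu B)) h; have hi := le_trans (cIm_le_n1 (mu B)) h.
by apply: C_eq; apply/eqP; rewrite cE -normr_le0.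
Qed.

Lemma null_total_var mu A : measurable A ->
  (forall B, measurable B -> B `<=` A -> mu B = 0) -> total_var mu A = 0%E.
Proof.
move=> mA h; apply/eqP; rewrite eq_le total_var_ge0// andbT.
apply: ge_ereal_sup => _ [n [D [mD tD DA ->]]].
by rewrite big1// => i _; rewrite h ?cmod0// -DA => x Dx; exists i.
Qed.

(** A Radon-Nikodym density of [p] is at most 1 almost everywhere because [p <= l]; truncating it at
    1 makes the bound hold everywhere. *)
Lemma density_le1 (p l : {finite_measure set T -> \bar R}) :
  (forall A, measurable A -> (p A <= l A)%E) ->
  exists r : T -> R, [/\ measurable_fun setT r, forall x, 0 <= r x <= 1 &
    forall A, measurable A -> p A = (\int[l]_(x in A) (r x)%:E)%E].
Proof.
move=> pl.
have dom : p `<< l.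
  apply/null_content_dominatesP => A mA lA; apply/eqP; rewrite eq_le measure_ge0 andbT.
  by rewrite -lA; exact: pl.
have [f [f0 ffin fi fE]] := radon_nikodym_sigma_finite dom.
have mf : measurable_fun setT (fine \o f).
  by apply: measurableT_comp => //; exact: measurable_int fi.
pose B := [set x | 1 < fine (f x)].
have mB : measurable B by exact: measurable_lt_set.
(* On [B] the function f - 1 is positive, while its integral is [p B - l B <= 0]. *)
have lB : l B = 0%E.
  apply/eqP/negPn/negP => lB0.
  have ig : l.-integrable B (fun x => f x - 1%:E)%E.
    apply: integrableB => //; first exact: integrableS fi.
    exact: finite_measure_integrable_cst.
  have : (\int[l]_(x in B) `|f x - 1| = 0)%E.
    apply/eqP; rewrite eq_le integral_ge0 ?andbT; last by move=> x _; exact: abse_ge0.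
    rewrite (eq_integral (fun x => f x - 1%:E)%E); last first.
      move=> x /[!inE] Bx; rewrite gee0_abs// -(fineK (ffin x)) -EFinB lee_fin.
      by move: Bx; rewrite /B/=; lra.
    rewrite integralB//; [|exact: integrableS fi|exact: finite_measure_integrable_cst].
    rewrite -fE// integral_cst// mul1e sube_le0; exact: pl.
  move/(ae_eq_integral_abs l mB (measurable_int _ ig)) => [N [mN N0 BN]].
  apply/negP: lB0; rewrite negbK -measure_le0 -N0; apply: le_measure; rewrite ?inE//.
  move=> x Bx; apply: BN => /= /(_ Bx) /eqP.
  rewrite -(fineK (ffin x)) -EFinB eqe; move: Bx; rewrite /B/= => h /eqP; lra.
exists (fun x => Num.min (fine (f x)) 1); split.
- by apply: measurable_minr => //; exact: measurable_cst.
- by move=> x; rewrite ge_min lexx orbT le_min ler01 andbT/= andbT fine_ge0.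
move=> A mA; rewrite fE//.
apply: ae_eq_integral => //.
- by apply: measurable_funTS; exact: measurable_int fi.
- by apply: measurable_funTS; apply/measurable_EFinP; apply: measurable_minr => //; exact: measurable_cst.
exists B; split=> // x /=; apply: contra_notP => /negP; rewrite -leNgt => fx _.
by rewrite min_l// fineK.
Qed.

Lemma finite_measure_sum (p q : {finite_measure set T -> \bar R}) :
  exists r : {finite_measure set T -> \bar R},
    forall A, measurable A -> r A = (p A + q A)%E.
Proof.
by exists (fmeasure_add p q) => A mA; rewrite -measure_addE.
Qed.

(* The reference measure [l] is the sum of the four Jordan parts of [mu], which is
   between the total variation and four times it. *)
Record is_density mu (l : {finite_measure set T -> \bar R}) (dn : T -> C R) : Prop := {
  density_mfun : cmfun dn ;
  density_le4 : forall x, n1 (dn x) <= 4 ;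
  densityE : forall A, measurable A -> mu A = cI l (fun x => dn x * ofR (\1_A x)) ;
  density_tv_le : forall A, measurable A -> (total_var mu A <= l A)%E ;
  density_null : forall A, measurable A -> total_var mu A = 0%E -> l A = 0%E ;
  density_integrable : forall f : T -> R, measurable_fun setT f ->
    (forall x, 0 <= f x) -> (\int[total_var mu]_x (f x)%:E < +oo)%E ->
    l.-integrable setT (EFin \o f) }.

(** Each of the four Jordan parts is at most [l], hence has a density with values in [0, 1]; these
    are combined into [dn]. Each part is also at most the total variation, since the modulus
    dominates the signed real and imaginary parts; this transfers null sets and integrability from
    the total variation to [l]. *)
Lemma cmeasure_density mu : is_cmeasure mu -> exists l dn, is_density mu l dn.
Proof.
move=> hmu.
have [p1 [p2 [h12 p1E p2E]]] := rmeasure_jordan (cmeasure_Re hmu).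
have [p3 [p4 [h34 p3E p4E]]] := rmeasure_jordan (cmeasure_Im hmu).
have [l12 l12E] := finite_measure_sum p1 p2.
have [l34 l34E] := finite_measure_sum p3 p4.
have [l lE'] := finite_measure_sum l12 l34.
have lE A : measurable A -> l A = (p1 A + p2 A + (p3 A + p4 A))%E.
  by move=> mA; rewrite lE'// l12E// l34E.
have ple i A : measurable A -> (nth p1 [:: p1; p2; p3; p4] i A <= l A)%E.
  move=> mA; have p0 j : (0 <= nth p1 [:: p1; p2; p3; p4] j A)%E by exact: measure_ge0.
  have := (p0 0, p0 1, p0 2, p0 3)%N; rewrite /= lE// => -[[[h1 h2] h3] h4].
  case: i => [|[|[|[|i]]]] /=.
  - by rewrite -addeA leeDl// !adde_ge0.
  - by rewrite [(p1 A + _)%E]addeC -addeA leeDl// !adde_ge0.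
  - by rewrite addeC -addeA leeDl// !adde_ge0.
  - by rewrite addeC [(p3 A + _)%E]addeC -addeA leeDl// !adde_ge0.
  - by rewrite nth_nil -addeA leeDl// !adde_ge0.
have rex (p : {finite_measure set T -> \bar R}) :
    (forall A, measurable A -> (p A <= l A)%E) ->
    exists r : T -> R, [/\ measurable_fun setT r, forall x, 0 <= r x <= 1,
      l.-integrable setT (EFin \o r) &
      forall A, measurable A -> fine (p A) = Rintegral l setT (fun x => r x * \1_A x)].
  move=> pl; have [r [mr r01 rE]] := density_le1 pl.
  exists r; split=> //.
    apply: (@le_integrable _ _ _ l setT measurableT _ (EFin \o cst 1)).
    - exact/measurable_EFinP.
    - move=> x _; have /andP[r0 r1] := r01 x.
      by rewrite /= lee_fin !ger0_norm.
    - exact: finite_measure_integrable_cst.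
  move=> A mA; rewrite rE// /Rintegral [in LHS]integral_mkcond; congr fine.
  apply: eq_integral => x _; rewrite patchE indicE.
  by case: ifP => _; rewrite ?mulr1 ?mulr0.
have [r1 [m1 b1 i1 e1]] := rex p1 (ple 0%N).
have [r2 [m2 b2 i2 e2]] := rex p2 (ple 1%N).
have [r3 [m3 b3 i3 e3]] := rex p3 (ple 2%N).
have [r4 [m4 b4 i4 e4]] := rex p4 (ple 3%N).
have iA (r : T -> R) A : measurable A -> measurable_fun setT r -> (forall x, 0 <= r x <= 1) ->
    l.-integrable setT (EFin \o (fun x => r x * \1_A x)).
  move=> mA mr br; apply: (@le_integrable _ _ _ l setT measurableT _ (EFin \o cst 1)).
  - by apply/measurable_EFinP; apply: measurable_funM.
  - move=> x _; have /andP[r0 r1'] := br x.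
    rewrite /= lee_fin !ger0_norm// ?mulr_ge0//.
    by rewrite indicE mulr_ile1// ?ler0n// lern1; case: (_ \in _).
  - exact: finite_measure_integrable_cst.
have p1tv A : measurable A -> (p1 A <= total_var mu A)%E.
  move=> mA; rewrite -p1E//; apply: ge_ereal_sup => _ [B [mB BA] <-].
  apply: le_trans (cmod_le_total_var mu mA mB BA).
  by rewrite lee_fin (le_trans (ler_norm _) (cRe_le_cmod _)).
have p2tv A : measurable A -> (p2 A <= total_var mu A)%E.
  move=> mA; rewrite -p2E//; apply: ge_ereal_sup => _ [B [mB BA] <-].
  apply: le_trans (cmod_le_total_var mu mA mB BA).
  by rewrite lee_fin (le_trans (ler_norm _))// normrN cRe_le_cmod.
have p3tv A : measurable A -> (p3 A <= total_var mu A)%E.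
  move=> mA; rewrite -p3E//; apply: ge_ereal_sup => _ [B [mB BA] <-].
  apply: le_trans (cmod_le_total_var mu mA mB BA).
  by rewrite lee_fin (le_trans (ler_norm _) (cIm_le_cmod _)).
have p4tv A : measurable A -> (p4 A <= total_var mu A)%E.
  move=> mA; rewrite -p4E//; apply: ge_ereal_sup => _ [B [mB BA] <-].
  apply: le_trans (cmod_le_total_var mu mA mB BA).
  by rewrite lee_fin (le_trans (ler_norm _))// normrN cIm_le_cmod.
exists l, (fun x => ofRI (r1 x - r2 x) (r3 x - r4 x)); split.
- by split; exact: measurable_funB.
- move=> x; rewrite /n1 !cE; have := b1 x; have := b2 x; have := b3 x; have := b4 x.
  move=> /andP[? ?] /andP[? ?] /andP[? ?] /andP[? ?].
  rewrite (_ : 4 = 2 + 2 :> R); last by lra.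
  by apply: lerD; rewrite ler_norml; apply/andP; split; lra.
- move=> A mA; apply: C_eq; rewrite /cI !cE.
    transitivity (fine (p1 A) - fine (p2 A)).
      by rewrite -fineB ?fin_num_measure// -h12.
    rewrite e1// e2// -RintegralB//; [|exact: iA|exact: iA].
    by apply: eq_Rintegral => x _; rewrite !cE mulr0 subr0 mulrBl.
  transitivity (fine (p3 A) - fine (p4 A)).
    by rewrite -fineB ?fin_num_measure// -h34.
  rewrite e3// e4// -RintegralB//; [|exact: iA|exact: iA].
  by apply: eq_Rintegral => x _; rewrite !cE mulr0 add0r mulrBl.
- apply: total_var_le => A mA; rewrite /n1 EFinD [leRHS]lE//.
  have bnd (a : R) (p q : {finite_measure set T -> \bar R}) :
      a%:E = (p A - q A)%E -> (`|a|%:E <= p A + q A)%E.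
    rewrite -(fineK (fin_num_measure p A mA)) -(fineK (fin_num_measure q A mA)).
    rewrite -EFinB -EFinD lee_fin => -[->].
    have : 0 <= fine (p A) by rewrite fine_ge0.
    have : 0 <= fine (q A) by rewrite fine_ge0.
    by rewrite ler_norml; move=> ? ?; apply/andP; split; lra.
  by apply: leeD; apply: bnd; [exact: h12|exact: h34].
- move=> A mA A0; rewrite [LHS]lE//.
  have z (p : {finite_measure set T -> \bar R}) :
      (forall A, measurable A -> (p A <= total_var mu A)%E) -> p A = 0%E.
    by move=> ptv; apply/eqP; rewrite eq_le measure_ge0 andbT -A0 ptv.
  by rewrite (z _ p1tv) (z _ p2tv) (z _ p3tv) (z _ p4tv) !adde0.
- move=> f mf f0 ftv.
  have mf' : measurable_fun setT (EFin \o f) by exact/measurable_EFinP.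
  apply/integrableP; split=> //.
  rewrite (_ : (\int[l]_x _)%E = (\int[l]_x (f x)%:E)%E); last first.
    by apply: eq_integral => x _; rewrite /= ger0_norm.
  have pf (p : {finite_measure set T -> \bar R}) :
      (forall A, measurable A -> (p A <= total_var mu A)%E) ->
      (\int[p]_x (f x)%:E < +oo)%E.
    move=> ptv; apply: le_lt_trans ftv; apply: le_integral_raw => //.
    + apply: null_total_var => // B mB; rewrite subset0 => ->.
      by apply: C_eq; rewrite !cE; [exact: rmeasure0 (cmeasure_Re hmu)|exact: rmeasure0 (cmeasure_Im hmu)].
    + by move=> A mA; rewrite measure_ge0 ptv.
  have q1 := pf _ p1tv; have q2 := pf _ p2tv.
  have q3 := pf _ p3tv; have q4 := pf _ p4tv.
  rewrite (eq_integral_raw (m2 := measure_add l12 l34)); last first.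
    by move=> A mA; rewrite lE'// measure_addE.
  have f0' x : [set: T] x -> (0 <= (f x)%:E)%E by rewrite lee_fin.
  rewrite ge0_integral_measure_add//.
  rewrite (eq_integral_raw (m1 := l12) (m2 := measure_add p1 p2)); last first.
    by move=> A mA; rewrite l12E// measure_addE.
  rewrite (eq_integral_raw (m1 := l34) (m2 := measure_add p3 p4)); last first.
    by move=> A mA; rewrite l34E// measure_addE.
  rewrite !ge0_integral_measure_add//.
  by apply: lte_add_pinfty; apply: lte_add_pinfty.
Qed.

End total_variation.

Lemma integrable_EFinZ d (T : measurableType d) (R : realType)
    (L : {measure set T -> \bar R}) (k : R) (f : T -> R) :
  L.-integrable setT (EFin \o f) -> L.-integrable setT (EFin \o (fun x => k * f x)).
Proof.
move=> fi; rewrite (_ : EFin \o _ = (fun x => k%:E * (f x)%:E)%E)//.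
exact: integrableZl.
Qed.

Lemma integrable_EFinD d (T : measurableType d) (R : realType)
    (L : {measure set T -> \bar R}) (f g : T -> R) :
  L.-integrable setT (EFin \o f) -> L.-integrable setT (EFin \o g) ->
  L.-integrable setT (EFin \o (fun x => f x + g x)).
Proof.
move=> fi gi; rewrite (_ : EFin \o _ = (fun x => (f x)%:E + (g x)%:E)%E)//.
exact: integrableD.
Qed.

Lemma integrable_EFin_le d (T : measurableType d) (R : realType)
    (L : {measure set T -> \bar R}) (f g : T -> R) :
  measurable_fun setT f -> L.-integrable setT (EFin \o g) ->
  (forall x, `|f x| <= g x) -> L.-integrable setT (EFin \o f).
Proof.
move=> mf gi fg; apply: (le_integrable measurableT _ _ gi).
  exact/measurable_EFinP.
by move=> x _; rewrite /= lee_fin (le_trans (fg x))// ler_norm.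
Qed.

Section cint_theory.
Context d (T : measurableType d) (R : realType).
Implicit Types (mu nu : set T -> C R) (h g : T -> C R).

Lemma cint_null mu (W : set T) h g : is_cmeasure mu -> measurable W ->
  total_var mu (~` W) = 0%E -> (forall x, W x -> h x = g x) ->
  cint mu h = cint mu g.
Proof.
move=> hmu mW W0 hg.
have mWC : measurable (~` W) by exact: measurableC.
have z := total_var_null mWC W0.
have hr := sint_null (cmeasure_Re hmu) mW (fun B mB BW => congr1 (@cRe R) (z B mB BW)).
have hi := sint_null (cmeasure_Im hmu) mW (fun B mB BW => congr1 (@cIm R) (z B mB BW)).
have er x : W x -> cRe (h x) = cRe (g x) by move=> /hg ->.
have ei x : W x -> cIm (h x) = cIm (g x) by move=> /hg ->.
by rewrite /cint (hr _ _ er) (hr _ _ ei) (hi _ _ er) (hi _ _ ei).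
Qed.

Section density.
Variables (mu : set T -> C R) (l : {finite_measure set T -> \bar R}) (dn : T -> C R).
Hypothesis D : is_density mu l dn.

Lemma cintg_density : cintg l dn.
Proof.
apply: (@cintg_le _ _ _ _ _ (fun=> 4)); first exact: density_mfun D.
  exact: finite_measure_integrable_cst.
exact: density_le4 D.
Qed.

Lemma cintgM_density (h : T -> C R) (w : T -> R) : cmfun h ->
  l.-integrable setT (EFin \o w) -> (forall x, n1 (h x) <= w x) ->
  cintg l (fun x => dn x * h x).
Proof.
move=> mh iw hw; apply: (@cintg_le _ _ _ _ _ (fun x => 4 * w x)).
- by apply: cmfunM => //; exact: density_mfun D.
- exact: integrable_EFinZ.
- move=> x; apply: le_trans (n1M _ _) _.
  by apply: ler_pM; rewrite ?n1_ge0// (density_le4 D).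
Qed.

Lemma cint_density (h : T -> C R) : cmfun h ->
  l.-integrable setT (fun x => (n1 (h x))%:E) ->
  cint mu h = cI l (fun x => dn x * h x).
Proof.
move=> mh ih; apply: (@push_cint _ _ _ _ _ l id dn) => //.
- exact: cintg_density.
- by move=> A mA; rewrite (densityE D).
apply: (@integrable_EFin_le _ _ _ _ _ (fun x => 4 * n1 (h x))).
- apply: measurable_funM; apply: measurable_n1 => //.
  exact: density_mfun D.
- exact: integrable_EFinZ.
- move=> x; rewrite ger0_norm ?mulr_ge0 ?n1_ge0//.
  by rewrite mulrC ler_wpM2r ?n1_ge0// (density_le4 D).
Qed.

End density.

Lemma cI0 (l : {measure set T -> \bar R}) : cI l (fun=> 0) = 0.
Proof.
by apply: C_eq; rewrite /cI !cE; rewrite /Rintegral integral0.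
Qed.

Lemma cint0 mu : is_cmeasure mu -> cint mu (fun=> 0) = 0.
Proof.
move=> hmu; have [l [dn D]] := cmeasure_density hmu.
rewrite (cint_density D).
- by under eq_cI do rewrite mulr0; exact: cI0.
- exact: cmfun_cst.
- by rewrite n10; exact: integrable0.
Qed.

End cint_theory.

(** * Closures in the total variation norm *)

Section tv_closure_theory.
Context d (T : measurableType d) (R : realType).
Implicit Types (mu nu : set T -> C R).

Lemma cmeasure_restr mu A : measurable A -> is_cmeasure mu ->
  is_cmeasure (fun B => mu (B `&` A)).
Proof.
move=> mA hmu F mF tF; rewrite setI_bigcupl; apply: hmu => [n|].
  exact: measurableI.
exact: trivIset_setIr.
Qed.

Lemma cmeasureD mu nu : is_cmeasure mu -> is_cmeasure nu ->
  is_cmeasure (fun B => mu B + nu B).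
Proof.
move=> hmu hnu F mF tF; under eq_fun do rewrite big_split/=.
by apply: cvgD; [exact: hmu|exact: hnu].
Qed.

Lemma cmeasureZ (c : C R) mu : is_cmeasure mu -> is_cmeasure (fun B => c * mu B).
Proof.
move=> hmu F mF tF; under eq_fun do rewrite -mulr_sumr.
by apply: cvgMl_tmp; exact: hmu.
Qed.

Lemma cmeasure_cst0 : is_cmeasure (fun _ : set T => 0 : C R).
Proof.
move=> F mF tF; under eq_fun do rewrite big1//.
exact: cvg_cst.
Qed.

Lemma cmeasureU mu A B : is_cmeasure mu -> measurable A -> measurable B ->
  A `&` B = set0 -> mu (A `|` B) = mu A + mu B.
Proof.
move=> hmu mA mB AB; have [l [dn D]] := cmeasure_density hmu.
have cint_ X : measurable X -> cintg l (fun x => dn x * ofR (\1_X x)).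
  move=> mX; apply: (cintgM_density D (w := fun=> 1)).
  - by apply: cmfun_ofR; exact: measurable_indic.
  - exact: finite_measure_integrable_cst.
  - by move=> x; rewrite n1_ofR indicE; case: (_ \in _); rewrite ?normr1 ?normr0.
rewrite !(densityE D)//; last exact: measurableU.
rewrite -cID; [|exact: cint_|exact: cint_].
apply: eq_cI => x; rewrite -mulrDr -ofRD; congr (_ * ofR _).
rewrite !indicE in_setU.
have [xA|xA] := boolP (x \in A); have [xB|xB] := boolP (x \in B); rewrite ?addr0 ?add0r//.
by exfalso; rewrite -[False]/(set0 x) -AB; split; exact: set_mem.
Qed.

(** Only this consequence of approximation is used: a set that is null for countably many
    approximants, at distance less than 1/(k + 1), is null for the limit. *)
Lemma tv_closure_seq (S : set (set T -> C R)) mu : tv_closure S mu ->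
  exists nu : nat -> set T -> C R, (forall k, S (nu k)) /\
    forall B, measurable B -> (forall k, nu k B = 0) -> mu B = 0.
Proof.
move=> [hmu h].
have [nu hnu] := choice (fun k : nat => let: ex_intro2 nu Snu tnu :=
  h k.+1%:R^-1 (ltac:(by rewrite invr_gt0)) in ex_intro (fun nu => S nu /\ 
    (total_var (fun A => mu A - nu A)%R setT < (k.+1%:R^-1)%:E)%E) nu (conj Snu tnu)).
exists nu; split=> [k|B mB nuB]; first by have [] := hnu k.
have small k : cmod (mu B) <= k.+1%:R^-1.
  have [_ /ltW] := hnu k; rewrite -lee_fin; apply: le_trans.
  have := @cmod_le_total_var _ _ _ (fun A => mu A - nu k A) setT B measurableT mB (@subsetT _ _).
  by rewrite nuB subr0.
have c0 : cmod (mu B) = 0.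
  apply/eqP; rewrite eq_le cmod_ge0 andbT leNgt; apply/negP => c0.
  have := small (Num.truncn (cmod (mu B))^-1).
  rewrite leNgt => /negP; apply; rewrite -[ltRHS]invrK ltf_pV2 ?posrE ?invr_gt0//.
  exact: truncnS_gt.
have h0 : n1 (mu B) <= 0 by have := n1_le_cmod (mu B); rewrite c0; lra.
have hr := le_trans (cRe_le_n1 (mu B)) h0; have hi := le_trans (cIm_le_n1 (mu B)) h0.
by apply: C_eq; apply/eqP; rewrite cE -normr_le0.
Qed.

(** The restrictions of [mu] to the increasing sets [A n] converge in total variation, because [l]
    is finite and the masses of the complements tend to that of a null set. *)
Lemma tv_closure_exhaust (S : set (set T -> C R)) mu (A : nat -> set T) :
  is_cmeasure mu -> (forall n, measurable (A n)) ->
  (forall n m, (n <= m)%N -> A n `<=` A m) ->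
  total_var mu (~` \bigcup_n A n) = 0%E ->
  (forall n, S (fun B => mu (B `&` A n))) -> tv_closure S mu.
Proof.
move=> hmu mA ndA null hS; split=> // e e0.
have [l [dn D]] := cmeasure_density hmu.
have mU : measurable (\bigcup_n A n) by exact: bigcupT_measurable.
have lim0 : l (~` A n) @[n --> \oo] --> 0%E.
  have <- : l (\bigcap_n ~` A n) = 0%E.
    rewrite -setC_bigcup; apply: (density_null D) => //; exact: measurableC.
  apply: nonincreasing_cvg_mu => //.
  - by rewrite ltey_eq fin_num_measure//; exact: measurableC.
  - by move=> n; exact: measurableC.
  - by apply: bigcapT_measurable => n; exact: measurableC.
  - by move=> n m nm; apply/subsetPset; apply: subsetC; exact: ndA.
have [n ln] : exists n, (l (~` A n) < (e / 3)%:E)%E.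
  have e3 : 0 < e / 3 by rewrite divr_gt0.
  have /fine_cvg/cvgrPdist_lt/(_ _ e3)[N _ hN] := lim0.
  exists N; have := hN N (leqnn N); rewrite /= sub0r normrN => /(le_lt_trans (ler_norm _)).
  by rewrite -lte_fin fineK// fin_num_measure//; exact: measurableC.
exists (fun B => mu (B `&` A n)) => //.
have mC : measurable (~` A n) by exact: measurableC.
pose G : {measure set T -> \bar R} := mscale (NngNum (ler0n R 2)) (mrestr l mC).
apply: (@le_lt_trans _ _ (G setT)).
  apply: total_var_le => // B mB.
  rewrite (_ : mu B - mu (B `&` A n) = mu (B `&` ~` A n)); last first.
    rewrite -[in mu B](setIT B) -(setUv (A n)) setIUr cmeasureU//.
    - by rewrite addrC addKr.
    - exact: measurableI.
    - exact: measurableI.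
    - by rewrite setIACA setICr setI0.
  have mBC : measurable (B `&` ~` A n) by exact: measurableI.
  have h1 := cmod_le_total_var mu mBC mBC (@subset_refl _ _).
  have {}h1 := le_trans h1 (density_tv_le D mBC).
  rewrite /G /mscale /= /mrestr.
  apply: (@le_trans _ _ (2 * cmod (mu (B `&` ~` A n)))%:E); first by rewrite lee_fin n1_le_cmod.
  by rewrite EFinM lee_wpmul2l.
rewrite (_ : G setT = (2%:E * l (~` A n))%E); last first.
  by rewrite /G /mscale /= /mrestr; congr (_ * l _)%E; exact: setTI.
have := ln; rewrite -(fineK (fin_num_measure l _ mC)) -EFinM !lte_fin; lra.
Qed.

Lemma tv_closure_mono (S S' : set (set T -> C R)) : S `<=` S' ->
  tv_closure S `<=` tv_closure S'.
Proof.
move=> SS mu [hmu h]; split=> // e /h[nu Snu tnu].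
by exists nu => //; exact: SS.
Qed.

End tv_closure_theory.

(** * Measures carried by subspaces of countable dimension *)

Section seminorms.
Context {R : realType} {E : lmodType R} {p : E -> R}.
Hypothesis sp : is_seminorm p.

Lemma seminorm0 : p 0 = 0.
Proof. by have := seminormZ sp 0 0; rewrite scale0r normr0 mul0r. Qed.

Lemma seminormN x : p (- x) = p x.
Proof. by rewrite -scaleN1r (seminormZ sp) normrN1 mul1r. Qed.

Lemma seminorm_ge0 x : 0 <= p x.
Proof. by have := seminormD sp x (- x); rewrite subrr seminorm0 seminormN; lra. Qed.

Lemma seminorm_sub x y : `|p x - p y| <= p (x - y).
Proof.
have := seminormD sp (x - y) y; have := seminormD sp (y - x) x.
rewrite !subrK -[y - x]opprB seminormN ler_norml => ? ?.
by apply/andP; split; lra.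
Qed.

Lemma seminorm_sum I (r : seq I) (P : pred I) (F : I -> E) :
  p (\sum_(i <- r | P i) F i) <= \sum_(i <- r | P i) p (F i).
Proof.
elim/big_ind2 : _ => //; first by rewrite seminorm0.
by move=> x1 x2 y1 y2 h1 h2; apply: le_trans (seminormD sp _ _) (lerD h1 h2).
Qed.

Lemma seminorm_scale k : 0 <= k -> is_seminorm (fun x => k * p x).
Proof.
move=> k0; split=> [x y|a x]; first by rewrite -mulrDr ler_wpM2l// (seminormD sp).
by rewrite (seminormZ sp) mulrCA.
Qed.

End seminorms.

Lemma seminorm_linf (R : realType) (E : lmodType R) (F : E -> R) :
  linear (F : E -> R^o) -> is_seminorm (fun x => `|F x|).
Proof.
move=> lF; split=> [x y|a x]; first by rewrite (linfD lF) ler_normD.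
by rewrite (linfZ lF) normrM.
Qed.

Lemma seminorm_addn (R : realType) (E : lmodType R) (p q : E -> R) :
  is_seminorm p -> is_seminorm q -> is_seminorm (fun x => p x + q x).
Proof.
move=> sp sq; split=> [x y|a x].
  by have := seminormD sp x y; have := seminormD sq x y; lra.
by rewrite (seminormZ sp) (seminormZ sq) mulrDr.
Qed.

Section il_measurability.
Context {R : realType} {E : lmodType R}.

Lemma il_open_measurable (U : set (ilB E)) : il_open (U : set (il E)) -> measurable U.
Proof. by move=> oU; exact: sub_sigma_algebra. Qed.

Lemma measurable_to_il d (T : measurableType d) (S : T -> ilB E) :
  (forall U : set (il E), il_open U -> measurable (S @^-1` U)) -> measurable_fun setT S.
Proof.
move=> h; apply: (@measurability _ _ T (ilB E) setT S (@open (il E))) => // _ [U oU <-].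
by rewrite setTI; exact: h.
Qed.

(** Continuity for the finest locally convex topology, in terms of unit balls of arbitrary
    semi-norms. *)
Definition il_cont (f : E -> R) := forall x e, 0 < e ->
  exists2 p : E -> R, is_seminorm p & forall y, p (y - x) < 1 -> `|f y - f x| < e.

Lemma il_cont_measurable (f : E -> R) : il_cont f ->
  measurable_fun setT (f : ilB E -> R).
Proof.
move=> cf; apply: (measurability (@RGenOInfty.G R)).
  exact: RGenOInfty.measurableE.
move=> _ [_ [a ->] <-]; rewrite setTI; apply: il_open_measurable => x /=.
rewrite in_itv/= andbT => ax; have ax0 : 0 < f x - a by rewrite subr_gt0.
have [p sp pf] := cf x _ ax0; exists p => // y /= /pf.
by rewrite in_itv/= andbT ltr_norml => /andP[+ _]; lra.
Qed.

Lemma il_cont_lip (f p : E -> R) : is_seminorm p ->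
  (forall x y, `|f y - f x| <= p (y - x)) -> il_cont f.
Proof.
move=> sp fp x e e0; exists (fun y => (e^-1) * p y).
  by apply: seminorm_scale => //; rewrite invr_ge0 ltW.
by move=> y; rewrite ltr_pdivrMl// mulr1; exact: le_lt_trans.
Qed.

Lemma measurable_seminorm (p : E -> R) : is_seminorm p ->
  measurable_fun setT (p : ilB E -> R).
Proof.
move=> sp; apply: (il_cont_measurable (f := p)).
apply: (il_cont_lip sp) => x y.
exact: seminorm_sub.
Qed.

Lemma measurable_linf (F : E -> R) : linear (F : E -> R^o) ->
  measurable_fun setT (F : ilB E -> R).
Proof.
move=> lF; apply: (il_cont_measurable (f := F)).
apply: (il_cont_lip (seminorm_linf lF)) => x y.
by rewrite (linfB lF).
Qed.

(** A single translation is continuous, hence Borel. Joint measurability of the addition is a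
    different matter, treated in [measurable_addW]. *)
Lemma measurable_addl (v : E) :
  measurable_fun setT (fun x : ilB E => ((v : E) + x) : ilB E).
Proof.
apply: measurable_to_il => U oU; apply: il_open_measurable => x /= /oU[p sp pU].
by exists p => // y py; apply: pU => /=; rewrite opprD addrACA subrr add0r.
Qed.

Lemma measurable_oppE : measurable_fun setT (fun x : ilB E => (- (x : E)) : ilB E).
Proof.
apply: measurable_to_il => U oU; apply: il_open_measurable => x /= /oU[p sp pU].
exists p => // y py; apply: pU => /=.
by rewrite -opprD (seminormN sp).
Qed.

Lemma measurable_preimage d d' (T : measurableType d) (T' : measurableType d')
    (S : T -> T') A : measurable_fun setT S -> measurable A -> measurable (S @^-1` A).
Proof. by move=> mS mA; rewrite -[X in measurable X]setTI; exact: mS. Qed.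

Lemma measurable_translate (v : E) (A : set (ilB E)) : measurable A ->
  measurable [set ((x : E) + v : ilB E) | x in A].
Proof.
move=> mA; rewrite (_ : [set _ | _ in _] = (fun x : ilB E => - v + (x : E) : ilB E) @^-1` A).
  exact: measurable_preimage (measurable_addl _) mA.
apply/seteqP; split=> [_ [x Ax <-]|x Ax] /=; first by rewrite addrC addrK.
by exists (- v + (x : E)) => //; rewrite addrC addrA subrr add0r.
Qed.

End il_measurability.

Lemma rat_near (R : realType) (x e : R) : 0 < e -> exists r : rat, `|x - ratr r| < e.
Proof.
move=> e0; have xe : x - e < x + e by lra.
have [r] := rat_in_itvoo xe; rewrite in_itv/= => /andP[h1 h2]; exists r.
by rewrite ltr_norml; apply/andP; split; lra.
Qed.

(* On a finite dimensional subspace, an open set is a countable union of boxes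
   with rational coordinates. *)
Section finite_combination.
Context {R : realType} {E : lmodType R} d (T : measurableType d).

Lemma measurable_combination (n : nat) (e : 'I_n -> E) (c : 'I_n -> T -> R) :
  (forall i, measurable_fun setT (c i)) ->
  measurable_fun setT (fun w => (\sum_i c i w *: e i : E) : ilB E).
Proof.
move=> mc; apply: measurable_to_il => U oU.
pose I := ({ffun 'I_n -> rat} * nat)%type.
pose box (q : I) := [set w | forall i, `|c i w - ratr (q.1 i)| < q.2.+1%:R^-1].
pose good (q : I) := forall a : 'I_n -> R,
  (forall i, `|a i - ratr (q.1 i)| < q.2.+1%:R^-1) -> U (\sum_i a i *: e i).
have mbox q : measurable (box q).
  rewrite (_ : box q = \bigcap_i [set w | `|c i w - ratr (q.1 i)| < q.2.+1%:R^-1]).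
    apply: fin_bigcap_measurable => // i _; apply: measurable_lt_set => //.
    apply: measurableT_comp => //; apply: measurable_funB => //.
  by apply/seteqP; split=> [w h i _|w h i]; [exact: h|exact: h].
rewrite (_ : _ @^-1` U = \bigcup_(q in good) box q).
  rewrite bigcup_mkcond; apply: countable_bigcupT_measurable; first exact: countableP.
  by move=> q; case: ifP.
apply/seteqP; split=> [w Uw|w [q gq bq]]; last exact: gq.
have [p sp pU] := oU _ Uw.
(* Coefficients in a common box differ by less than 2/(k + 1), so the combinations differ by at most
   2(M - 1)/(k + 1) in the semi-norm, which is below 1 once 2M < k + 1. The summand 1 keeps [M]
   positive. *)
pose M := 1 + \sum_i p (e i); have M0 : 0 < M.
  by rewrite ltr_wpDr// sumr_ge0// => i _; exact: seminorm_ge0.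
pose k := Num.truncn (2 * M).
have kM : 2 * M < k.+1%:R by rewrite truncnS_gt.
have k0 : 0 < k.+1%:R^-1 :> R by rewrite invr_gt0.
have [q qE] := choice (fun i => rat_near (c i w) k0).
exists ([ffun i => q i], k); last by move=> i /=; rewrite ffunE.
move=> a ha; apply: pU => /=; rewrite -sumrB.
apply: le_lt_trans (seminorm_sum sp _ _ _) _.
apply: (@le_lt_trans _ _ (\sum_i (2 / k.+1%:R) * p (e i))).
  apply: ler_sum => i _; rewrite -scalerBl (seminormZ sp) ler_wpM2r ?seminorm_ge0//.
  have := ha i; rewrite /= ffunE => h1; have h2 := qE i.
  have := ler_distD (ratr (q i)) (a i) (c i w); rewrite [`|ratr _ - _|]distrC.
  by move: h1 h2; move: (k.+1%:R^-1) => z; lra.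
rewrite -mulr_sumr mulrAC ltr_pdivrMr// mul1r; apply: lt_trans kM.
by rewrite ltr_pM2l// /M ltrDr.
Qed.

End finite_combination.

(** * Spans of finite and infinite sequences *)

Section spans.
Context {R : realType} {E : lmodType R}.
Implicit Types (e : nat -> E).

(** The vectors may be linearly dependent; indexing them by one infinite sequence makes the spans
    increase with [n]. *)
Definition fspan e (n : nat) : set E :=
  [set x | exists a : nat -> R, x = \sum_(i < n) a i *: e i].

Definition cspan e : set E := \bigcup_n fspan e n.

Lemma fspan_le e n m : (n <= m)%N -> fspan e n `<=` fspan e m.
Proof.
move=> nm x [a ->]; exists (fun i => if (i < n)%N then a i else 0).
rewrite (big_ord_widen _ (fun i => a i *: e i) nm) big_mkcond/=.
by apply: eq_bigr => i _; case: ifP; rewrite ?scale0r.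
Qed.

Lemma fspanD e n x y : fspan e n x -> fspan e n y -> fspan e n (x + y).
Proof.
move=> [a ->] [b ->]; exists (fun i => a i + b i).
by rewrite -big_split; apply: eq_bigr => i _; rewrite scalerDl.
Qed.

Lemma fspanZ e n k x : fspan e n x -> fspan e n (k *: x).
Proof.
move=> [a ->]; exists (fun i => k * a i).
by rewrite scaler_sumr; apply: eq_bigr => i _; rewrite scalerA.
Qed.

Lemma fspan0 e n : fspan e n 0.
Proof. by exists (fun=> 0); rewrite big1// => i _; rewrite scale0r. Qed.

Lemma fspan_gen e n i : (i < n)%N -> fspan e n (e i).
Proof.
move=> hi; exists (fun j => (j == i)%:R).
rewrite (bigD1 (Ordinal hi))//= eqxx scale1r big1 ?addr0// => j ji.
by rewrite (_ : (j == i :> nat) = false) ?scale0r//; exact/negbTE.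
Qed.

Lemma fspan_findim e n : is_findim (fspan e n).
Proof.
exists n, (fun i : 'I_n => e i); apply/seteqP; split=> [x [a ->]|x [a ->]].
  by exists (fun i : 'I_n => a i).
exists (fun i => if insub i is Some j then a j else 0).
by apply: eq_bigr => i _; rewrite valK.
Qed.

Lemma findim_fspan (V : set E) : is_findim V -> exists e n, V = fspan e n.
Proof.
move=> [n [e ->]]; exists (fun i => if insub i is Some j then e j else 0), n.
apply/seteqP; split=> [x [a ->]|x [a ->]].
  exists (fun i => if insub i is Some j then a j else 0).
  by apply: eq_bigr => i _; rewrite valK.
by exists (fun i : 'I_n => a i); apply: eq_bigr => i _; rewrite valK.
Qed.

Lemma fspan_cspan e n : fspan e n `<=` cspan e.
Proof. by move=> x ex; exists n. Qed.

Lemma cspanD e x y : cspan e x -> cspan e y -> cspan e (x + y).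
Proof.
move=> [n _ xn] [m _ ym]; exists (maxn n m) => //.
by apply: fspanD; [apply: fspan_le xn|apply: fspan_le ym]; rewrite ?leq_maxl ?leq_maxr.
Qed.

Lemma cspanZ e k x : cspan e x -> cspan e (k *: x).
Proof. by move=> [n _ xn]; exists n => //; exact: fspanZ. Qed.

Lemma cspanN e x : cspan e x -> cspan e (- x).
Proof. by rewrite -scaleN1r; exact: cspanZ. Qed.

Lemma cspan_sub e e' : (forall i, cspan e' (e i)) -> cspan e `<=` cspan e'.
Proof.
move=> h x [n _ [a ->]]; elim/big_ind : _ => //.
- by exists 0%N => //; exact: fspan0.
- by move=> y z; exact: cspanD.
- by move=> i _; apply: cspanZ.
Qed.

Lemma cspan_gen e i : cspan e (e i).
Proof. by exists i.+1 => //; exact: fspan_gen. Qed.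

(** An enumeration of the pairs of natural numbers merges countably many sequences into one. *)
Lemma cspan_cover (e : nat -> nat -> E) :
  exists e', forall k, cspan (e k) `<=` cspan e'.
Proof.
pose f n := if unpickle n is Some ki then e ki.1 ki.2 else 0.
exists f => k; apply: cspan_sub => i.
have <- : f (pickle (k, i)) = e k i by rewrite /f pickleK.
exact: cspan_gen.
Qed.

Lemma cspan_cover2 e1 e2 :
  exists e', cspan e1 `<=` cspan e' /\ cspan e2 `<=` cspan e'.
Proof.
have [e' h] := cspan_cover (fun k => if k is 0%N then e1 else e2).
by exists e'; split; [exact: (h 0%N)|exact: (h 1%N)].
Qed.

End spans.

Section projections.
Context {R : realType} {E : tvsType R}.
Hypothesis hE : hausdorff_space E.
Implicit Types (e : nat -> E).

Lemma dualD (F G : dual E) x : (F + G) x = F x + G x.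
Proof. by []. Qed.

Lemma dualN (F : dual E) x : (- F) x = - F x.
Proof. by []. Qed.

Lemma dualB (F G : dual E) x : (F - G) x = F x - G x.
Proof. by []. Qed.

Lemma dualZ k (F : dual E) x : (k *: F) x = k * F x.
Proof. by []. Qed.

Lemma dual_sum I (r : seq I) (P : pred I) (F : I -> dual E) x :
  (\sum_(i <- r | P i) F i) x = \sum_(i <- r | P i) F i x.
Proof. by apply: (big_morph (fun G : dual E => G x)) => [F1 F2|]; rewrite ?dualD. Qed.

(** Induction on the number of vectors. If the projection P found so far fixes the next vector, its
    coordinates suffice; otherwise the residue v of that vector is separated from 0 by a continuous
    functional F, which yields the new coordinate. *)
Lemma fin_proj e n : exists G : nat -> dual E, forall x, fspan e n x ->
  \sum_(i < n) G i x *: e i = x.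
Proof.
elim: n => [|n [G hG]].
  by exists (fun=> 0) => x [a ->]; rewrite !big_ord0.
pose P x := \sum_(i < n) G i x *: e i.
have PD x y : P (x + y) = P x + P y.
  rewrite /P -big_split; apply: eq_bigr => i _.
  by rewrite (linfD (@dual_linear _ _ (G i))) scalerDl.
have PZ k x : P (k *: x) = k *: P x.
  rewrite /P scaler_sumr; apply: eq_bigr => i _.
  by rewrite (linfZ (@dual_linear _ _ (G i))) scalerA.
have split_ x : fspan e n.+1 x -> exists k y, fspan e n y /\ x = y + k *: e n.
  by move=> [a ->]; exists (a n), (\sum_(i < n) a i *: e i); rewrite big_ord_recr/=; split=> //; exists a.
have [Pe|Pe] := eqVneq (P (e n)) (e n).
  exists (fun i => if (i < n)%N then G i else 0) => x /split_[k [y [yn ->]]].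
  rewrite big_ord_recr/= ltnn scale0r addr0.
  under eq_bigr do rewrite ltn_ord.
  by rewrite -/(P _) PD PZ Pe [P y]hG.
have [|F Fv] := @dual_separates _ _ (e n - P (e n)) hE.
  by rewrite subr_eq0 eq_sym.
have FPE x : F (P x) = \sum_(i < n) F (e i) * G i x.
  rewrite /P (linf_sum (@dual_linear _ _ F)); apply: eq_bigr => i _.
  by rewrite (linfZ (@dual_linear _ _ F)) mulrC.
set c := F (e n - P (e n)) in Fv.
(* [F'] is x |-> F(x - P x)/F(v): it vanishes on the old span and is 1 at the new vector, hence it
   is the new coordinate. The old coordinates are corrected by their values at the new vector. *)
pose F' : dual E := c^-1 *: (F - \sum_(i < n) F (e i) *: G i).
have F'E x : F' x = c^-1 * F (x - P x).
  rewrite (linfB (@dual_linear _ _ F)) FPE /F' dualZ dualB dual_sum.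
  by congr (_ * (_ - _)); apply: eq_bigr => i _; rewrite dualZ.
exists (fun i => if (i < n)%N then G i - G i (e n) *: F' else F') => x /split_[k [y [yn ->]]].
rewrite big_ord_recr/= ltnn.
have -> : F' (y + k *: e n) = k.
  rewrite F'E PD PZ [P y]hG// opprD addrACA subrr add0r -scalerBr.
  by rewrite (linfZ (@dual_linear _ _ F)) -/c mulrCA mulVf// mulr1.
transitivity (P (y + k *: e n) - F' (y + k *: e n) *: P (e n) + k *: e n).
  congr (_ + _); rewrite /P scaler_sumr -sumrB; apply: eq_bigr => i _.
  by rewrite ltn_ord dualB dualZ scalerBl scalerA mulrC.
have -> : F' (y + k *: e n) = k.
  rewrite F'E PD PZ [P y]hG// opprD addrACA subrr add0r -scalerBr.
  by rewrite (linfZ (@dual_linear _ _ F)) -/c mulrCA mulVf// mulr1.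
by rewrite PD PZ addrK [P y]hG.
Qed.

Lemma fspan_proj e : exists G : nat -> nat -> dual E, forall n x,
  fspan e n x -> \sum_(i < n) G n i x *: e i = x.
Proof. by have [G hG] := choice (fin_proj e); exists G. Qed.

(** For [x] outside the span some F does not vanish at the residue x - P x. The functional L(z) =
    F(z - P z) vanishes on the span, so the ball of radius 1 of |L|/|L(x)| around [x] misses it. *)
Lemma fspan_closed e n : measurable (fspan e n : set (ilB E)).
Proof.
have [G hG] := fin_proj e n.
rewrite -[fspan e n]setCK; apply: measurableC; apply: il_open_measurable => x /= nx.
pose y := x - \sum_(i < n) G i x *: e i.
have y0 : y != 0.
  apply/eqP => y0; apply: nx; exists (fun i => G i x).
  by apply/eqP; rewrite -subr_eq0; apply/eqP.
have [F Fy] := dual_separates hE y0.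
pose L z := F (z - \sum_(i < n) G i z *: e i).
have lL : linear (L : E -> R^o).
  move=> k u v; rewrite /L -(dual_linear F); congr (F _).
  rewrite scalerBr addrACA -opprD; congr (_ - _).
  rewrite scaler_sumr -big_split; apply: eq_bigr => i _.
  by rewrite (dual_linear (G i)) scalerDl scalerA.
exists (fun z => `|L x|^-1 * `|L z|).
  by apply: (seminorm_scale (seminorm_linf lL)); rewrite invr_ge0.
move=> z /= hz fz; move: hz; rewrite (linfB lL).
have -> : L z = 0 by rewrite /L hG// subrr (linf0 (@dual_linear _ _ F)).
by rewrite sub0r normrN mulVf ?ltxx// normr_eq0.
Qed.

Lemma cspan_measurable e : measurable (cspan e : set (ilB E)).
Proof. by apply: bigcupT_measurable => n; exact: fspan_closed. Qed.

Lemma findim_measurable (V : set E) : is_findim V -> measurable (V : set (ilB E)).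
Proof. by move=> /findim_fspan[e [n ->]]; exact: fspan_closed. Qed.

Lemma measurable_pt (x : E) : measurable ([set x] : set (ilB E)).
Proof.
(* A point is a translate of the zero subspace, the span of no vectors. *)
rewrite (_ : [set x] = [set ((y : E) + x : ilB E) | y in (fspan (fun=> 0) 0 : set (ilB E))]).
  by apply: measurable_translate; exact: fspan_closed.
apply/seteqP; split=> [y ->|_ [y [a ->] <-]].
  by exists (0 : E); [exact: fspan0|rewrite add0r].
by rewrite big_ord0 add0r.
Qed.

(* A measurable version of the addition of [E x E]: it is the eventually
   constant limit of the sums of the projections onto [fspan e n]. *)
Section addition.
Variable e : nat -> E.
Local Notation W := (cspan e).

Definition addW (p : ilB E * ilB E) : ilB E :=
  if `[< W p.1 /\ W p.2 >] then (p.1 : E) + p.2 else (0 : E).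

Lemma WW_measurable : measurable [set p : ilB E * ilB E | W p.1 /\ W p.2].
Proof.
rewrite (_ : [set p | _] = W `*` W); last by apply/seteqP; split.
by apply: measurableX; exact: cspan_measurable.
Qed.

Lemma addW_in x y : W x -> W y -> addW (x, y) = (x : E) + y.
Proof. by move=> Wx Wy; rewrite /addW asboolT. Qed.

Let measurable_WW : measurable_fun setT
  (fun p : ilB E * ilB E => `[< W p.1 /\ W p.2 >]).
Proof.
apply: (measurable_fun_bool true) => //; rewrite setTI.
rewrite (_ : _ @^-1` _ = [set p : ilB E * ilB E | W p.1 /\ W p.2]); first exact: WW_measurable.
by apply/seteqP; split=> p /= /asboolP.
Qed.

(** The target is an arbitrary measurable space without a topology. For sequences that are
    eventually equal to [f] at each point, the preimages under [f] are the inferior limits of the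
    preimages. *)
Lemma measurable_eventually d d' (T : measurableType d) (T' : measurableType d')
    (t : nat -> T -> T') (f : T -> T') : (forall n, measurable_fun setT (t n)) ->
  (forall w, exists N, forall n, (N <= n)%N -> t n w = f w) -> measurable_fun setT f.
Proof.
move=> mt tf _ A mA; rewrite setTI.
rewrite (_ : f @^-1` A = \bigcup_N \bigcap_(n in [set n | (N <= n)%N]) t n @^-1` A).
  apply: bigcupT_measurable => N; apply: bigcap_measurable => [|n _].
    by exists N => /=.
  exact: measurable_preimage (mt n) mA.
apply/seteqP; split=> [w Aw|w [N _ h]].
  by have [N hN] := tf w; exists N => // n /= Nn; rewrite hN.
have [M hM] := tf w; have := h (maxn N M); rewrite /= hM ?leq_maxr//.
by apply; exact: leq_maxl.
Qed.

Lemma measurable_addW : measurable_fun setT addW.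
Proof.
have [G hG] := fspan_proj e.
pose t n (p : ilB E * ilB E) : ilB E := if `[< W p.1 /\ W p.2 >]
  then \sum_(i < n) (G n i p.1 + G n i p.2) *: e i else (0 : E).
apply: (@measurable_eventually _ _ _ _ t) => [n|[x y]].
  apply: (@measurable_fun_ifT _ _ _ (ilB E) _ _ _ measurable_WW); last exact: measurable_cst.
  apply: measurable_combination => i; apply: measurable_funD.
    by apply: (measurableT_comp (f := G n i : ilB E -> R)) => //; exact: measurable_linf (dual_linear _).
  by apply: (measurableT_comp (f := G n i : ilB E -> R)) => //; exact: measurable_linf (dual_linear _).
have [[[n _ xn] [m _ ym]]|nW] := pselect (W x /\ W y); last first.
  by exists 0%N => k _; rewrite /t /addW asboolF.
exists (maxn n m) => k; rewrite geq_max => /andP[nk mk].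
have Wx : W x by exists n. have Wy : W y by exists m.
rewrite addW_in// /t asboolT//=; under eq_bigr do rewrite scalerDl.
by rewrite big_split/= !hG//; [exact: fspan_le ym|exact: fspan_le xn].
Qed.

Variable sigma : {biscalar E}.

Definition sigmaW (p : ilB E * ilB E) : R :=
  if `[< W p.1 /\ W p.2 >] then sigma (p.1 : E) (p.2 : E) else 0.

Lemma sigmaW_in x y : W x -> W y -> sigmaW (x, y) = sigma x y.
Proof. by move=> Wx Wy; rewrite /sigmaW asboolT. Qed.

Lemma measurable_sigmaW : measurable_fun setT sigmaW.
Proof.
have [G hG] := fspan_proj e.
pose t n (p : ilB E * ilB E) : R := if `[< W p.1 /\ W p.2 >]
  then \sum_(i < n) \sum_(j < n) (G n i p.1 * G n j p.2) * sigma (e i) (e j) else 0.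
apply: (@measurable_eventually _ _ _ _ t) => [n|[x y]].
  apply: (@measurable_fun_ifT _ _ _ R _ _ _ measurable_WW); last exact: measurable_cst.
  apply: measurable_sum => i; apply: measurable_sum => j.
  apply: measurable_funM; last exact: measurable_cst.
  apply: measurable_funM.
    by apply: (measurableT_comp (f := G n i : ilB E -> R)) => //; exact: measurable_linf (dual_linear _).
  by apply: (measurableT_comp (f := G n j : ilB E -> R)) => //; exact: measurable_linf (dual_linear _).
have [[[n _ xn] [m _ ym]]|nW] := pselect (W x /\ W y); last first.
  by exists 0%N => k _; rewrite /t /sigmaW asboolF.
exists (maxn n m) => k; rewrite geq_max => /andP[nk mk].
have Wx : W x by exists n. have Wy : W y by exists m.
rewrite sigmaW_in// /t asboolT//=.
rewrite -[in RHS](hG k x); last exact: fspan_le xn.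
rewrite -[in RHS](hG k y); last exact: fspan_le ym.
rewrite linear_sumlz; apply: eq_bigr => i _.
rewrite linear_sumr; apply: eq_bigr => j _.
transitivity (G k i x * (G k j y * sigma (e i) (e j))); first by rewrite mulrA.
by rewrite -(linearZr_LR sigma (e i) (G k j y) (e j)) -(linearZl_LR sigma _ (G k i x) (e i)).
Qed.

End addition.

End projections.

Lemma cmeasure0 d (T : measurableType d) (R : realType) (mu : set T -> C R) :
  is_cmeasure mu -> mu set0 = 0.
Proof.
move=> hmu; have := cmeasureU hmu measurable0 measurable0 (set0I _); rewrite setU0 => /eqP.
by rewrite -subr_eq0 opprD addrA subrr add0r oppr_eq0 => /eqP.
Qed.

(** The family [K] ranges over spans, countable sets, finite sets or one fixed subspace, so that
    these classes of measures share one stability proof, [carried_stable]. *)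
Definition carried {R : realType} {E : lmodType R} (K : set (set E)) :
    set (set (ilB E) -> C R) :=
  [set mu | is_cmeasure mu /\
    exists2 D : set E, K D & total_var mu (~` (D : set (ilB E))) = 0%E].

Section carriers.
Context {R : realType} {E : tvsType R}.
Hypothesis hE : hausdorff_space E.
Implicit Types mu nu : set (ilB E) -> C R.

Lemma total_var_carrier_sub mu (A B : set (ilB E)) : measurable A -> measurable B ->
  A `<=` B -> total_var mu (~` A) = 0%E -> total_var mu (~` B) = 0%E.
Proof.
move=> mA mB AB A0; apply: null_total_var => [|D mD DB]; first exact: measurableC.
apply: total_var_null A0 mD _; first exact: measurableC.
by apply: subset_trans DB _; exact: subsetC.
Qed.

Lemma total_var_restr mu (A : set (ilB E)) : measurable A -> is_cmeasure mu ->
  total_var (fun B => mu (B `&` A)) (~` A) = 0%E.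
Proof.
move=> mA hmu; apply: null_total_var => [|B mB BV]; first exact: measurableC.
by rewrite (_ : B `&` _ = set0) ?cmeasure0//; apply/disjoints_subset.
Qed.

Lemma countable_sub_range (D : set E) : countable D -> exists e : nat -> E, D `<=` range e.
Proof.
move=> /countable_injP[g gi].
exists (fun n => xget 0 [set y | D y /\ g y = n]) => y Dy; exists (g y) => //.
by case: xgetP => [z _ [Dz gz]|/(_ y)]; [apply: gi; rewrite ?inE|case].
Qed.

Lemma countableE_measurable (D : set E) : countable D -> measurable (D : set (ilB E)).
Proof.
move=> /countable_sub_range[e De].
rewrite (_ : D = \bigcup_n (if e n \in D then [set e n] else set0)).
  by apply: bigcupT_measurable => n; case: ifP => // _; exact: measurable_pt.
apply/seteqP; split=> [x Dx|x [n _]]; last by case: ifP => // /set_mem + ->.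
by have [n _ nx] := De x Dx; exists n => //; rewrite nx mem_set.
Qed.

Lemma finiteE_measurable (D : set E) : finite_set D -> measurable (D : set (ilB E)).
Proof. by move=> fD; apply: countableE_measurable; exact: finite_set_countable. Qed.

(** The carriers of a sequence of approximants are merged by [cspan_cover]. Conversely, a measure on
    a countable span is exhausted by its restrictions to the finite dimensional [fspan e n]. *)
Lemma MEP : @ME R E = carried [set cspan e | e in [set: nat -> E]].
Proof.
apply/seteqP; split=> mu.
  move=> /[dup] [[hmu _]] /tv_closure_seq[nu [Snu nu0]]; split=> //.
  have /choice[e he] k : exists e : nat -> E,
      total_var (nu k) (~` (cspan e : set (ilB E))) = 0%E.
    have [V fV [hnu nu0k]] := Snu k; have [u [n Vu]] := findim_fspan fV.
    exists u; apply: total_var_carrier_sub nu0k.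
    - exact: findim_measurable.
    - exact: cspan_measurable.
    - by rewrite Vu; exact: fspan_cspan.
  have [e' ee'] := cspan_cover e; exists (cspan e'); first by exists e'.
  apply: null_total_var => [|B mB BV]; first by apply: measurableC; exact: cspan_measurable.
  apply: nu0 => // k; apply: total_var_null (he k) mB _.
    by apply: measurableC; exact: cspan_measurable.
  by apply: subset_trans BV _; apply: subsetC.
move=> [hmu [_ [e _ <-] null]].
apply: (@tv_closure_exhaust _ _ _ _ _ (fun n => fspan e n : set (ilB E))) => //.
- by move=> n; exact: fspan_closed.
- by move=> n m; exact: fspan_le.
move=> n; exists (fspan e n); first exact: fspan_findim.
split; first by apply: cmeasure_restr => //; exact: fspan_closed.
by apply: total_var_restr => //; exact: fspan_closed.
Qed.

(** The countable carrier need not lie in a finite dimensional subspace. It is exhausted by finite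
    sets, each contained in a finite span. *)
Lemma ME_dP : @ME_d R E = carried [set D : set E | countable D].
Proof.
apply/seteqP; split=> mu.
  move=> /[dup] [[hmu _]] /tv_closure_seq[nu [Snu nu0]]; split=> //.
  have /choice[D he] k : exists D : set (ilB E),
      countable D /\ total_var (nu k) (~` D) = 0%E.
    by have [V fV [hnu [D cD D0]]] := Snu k; exists D.
  have cD : countable (\bigcup_k D k) by apply: bigcup_countable => // k _; exact: (he k).1.
  exists (\bigcup_k D k) => //.
  apply: null_total_var => [|B mB BV]; first by apply: measurableC; exact: countableE_measurable.
  apply: nu0 => // k; apply: total_var_null (he k).2 mB _.
    by apply: measurableC; apply: countableE_measurable; exact: (he k).1.
  by apply: subset_trans BV _; apply: subsetC; exact: bigcup_sup.
move=> [hmu [D cD D0]].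
have [e De] := countable_sub_range cD.
pose A n : set (ilB E) := [set e i | i in [set i | (i < n)%N]].
have fA n : finite_set (A n) by apply: finite_image; exact: finite_II.
have mA n : measurable (A n) by exact: finiteE_measurable.
apply: (@tv_closure_exhaust _ _ _ _ _ A) => //.
- by move=> n m nm _ [i /= i1 <-]; exists i => //=; exact: leq_trans nm.
- apply: total_var_carrier_sub D0; first exact: countableE_measurable.
    exact: bigcupT_measurable.
  by move=> x /De[i _ <-]; exists i.+1 => //; exists i => /=.
move=> n; exists (fspan e n); first exact: fspan_findim.
have hr : is_cmeasure (fun B => mu (B `&` A n)) by exact: cmeasure_restr.
have r0 := total_var_restr (mA n) hmu.
split; last by exists (A n) => //; exact: finite_set_countable.
split => //; apply: total_var_carrier_sub (mA n) _ _ r0; first exact: fspan_closed.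
by move=> _ [i /= i1 <-]; exact: fspan_gen.
Qed.

(** The mass of a point passes to limits in total variation, and restrictions to finite spans create
    no atoms. *)
Lemma ME_cP mu : ME_c mu <-> ME mu /\ forall f : E, mu [set f] = 0.
Proof.
split=> [|[hmu at0]].
  move=> h; split.
    by apply: tv_closure_mono h => nu [V fV [hnu _]]; exists V.
  move=> f; have [nu [Snu nu0]] := tv_closure_seq h.
  by apply: nu0 => [|k]; [exact: measurable_pt|have [V fV [_]] := Snu k; exact].
have : carried [set cspan e | e in [set: nat -> E]] mu by rewrite -MEP.
move=> [cmu [_ [e _ <-] null]].
apply: (@tv_closure_exhaust _ _ _ _ _ (fun n => fspan e n : set (ilB E))) => //.
- by move=> n; exact: fspan_closed.
- by move=> n m; exact: fspan_le.
move=> n; exists (fspan e n); first exact: fspan_findim.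
split; first split.
- by apply: cmeasure_restr => //; exact: fspan_closed.
- by apply: total_var_restr => //; exact: fspan_closed.
- move=> f; have [fe|fe] := pselect (fspan e n f).
    by rewrite (_ : _ `&` _ = [set f])//; apply/setIidPl => _ ->.
  rewrite (_ : _ `&` _ = set0) ?cmeasure0//.
  by apply/disjoints_subset => _ ->.
Qed.

Lemma ME_dfP : @ME_df R E = carried [set D : set E | finite_set D].
Proof.
apply/seteqP; split=> mu [hmu].
  move=> [n [c [f muE]]]; split => //.
  have fr : finite_set (range f) by apply: finite_image; exact: finite_finset.
  exists (range f) => //; apply: null_total_var => [|B mB Bf].
    by apply: measurableC; exact: finiteE_measurable.
  rewrite muE// big1// => i _; rewrite indicE memNset ?ofR0 ?mulr0//.
  by move=> /Bf; apply; exists i.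
move=> [D fD D0]; split=> //; have [r Dr] := (finite_seqP (D : set E)).1 fD.
pose r' := undup r.
exists (size r'), (fun i => mu [set nth 0 r' i]), (fun i => nth 0 r' i) => A mA.
have mD := finiteE_measurable fD.
have -> : mu A = mu (A `&` D).
  rewrite -[in LHS](setIT A) -(setUv D) setIUr cmeasureU//.
  - rewrite (_ : mu (A `&` ~` D) = 0) ?addr0//.
    apply: total_var_null D0 _ _ => //; first exact: measurableC.
    by apply: measurableI => //; exact: measurableC.
  - exact: measurableI.
  - by apply: measurableI => //; exact: measurableC.
  - by rewrite setIACA setICr setI0.
have -> : D = [set` r'] by rewrite Dr; apply/seteqP; split=> x /=; rewrite mem_undup.

have : uniq r' by exact: undup_uniq.
rewrite -(big_mkord xpredT (fun i => mu [set nth 0 r' i] * ofR (\1_A (nth 0 r' i)))).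
rewrite -(big_nth 0 xpredT (fun x => mu [set x] * ofR (\1_A x))).
elim: r' => [_|x t IH /= /andP[xt ut]].
  by rewrite big_nil set_nil setI0 cmeasure0.
rewrite big_cons (_ : [set` x :: t] = [set x] `|` [set` t]); last first.
  apply/seteqP; split=> y /=; rewrite in_cons; first by case/orP => [/eqP|]; by [left|right].
  by case=> [->|->]; rewrite ?eqxx ?orbT.
rewrite setIUr cmeasureU//.
- rewrite IH//; congr (_ + _).
  rewrite indicE; have [xA|xA] := boolP (x \in A); rewrite ?ofR1 ?mulr1 ?ofR0 ?mulr0.
    by congr mu; apply/setIidPr => _ ->; exact: set_mem.
  rewrite (_ : _ `&` _ = set0) ?cmeasure0//.
  by rewrite setIC; apply/disjoints_subset => _ -> /= Ax; move/negP: xA; apply; exact: mem_set.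
- by apply: measurableI => //; exact: measurable_pt.
- by apply: measurableI => //; apply: finiteE_measurable; exact: finite_seq.
- rewrite setIACA (_ : [set x] `&` _ = set0) ?setI0//.
  by apply/disjoints_subset => _ -> /=; exact/negP.
Qed.

End carriers.

(** * Fubini's theorem and twisted convolutions *)

Section complex_fubini.
Context d1 d2 (T1 : measurableType d1) (T2 : measurableType d2) (R : realType).
Variables (l1 : {finite_measure set T1 -> \bar R}) (l2 : {finite_measure set T2 -> \bar R}).
Local Notation L := (l1 \x l2)%E.

Lemma integrable_prod (v1 : T1 -> R) (v2 : T2 -> R) :
  l1.-integrable setT (EFin \o v1) -> l2.-integrable setT (EFin \o v2) ->
  L.-integrable setT (EFin \o (fun p => v1 p.1 * v2 p.2)).
Proof.
move=> i1 i2.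
have m1 : measurable_fun setT v1 by apply/measurable_EFinP; exact: measurable_int i1.
have m2 : measurable_fun setT v2 by apply/measurable_EFinP; exact: measurable_int i2.
apply/integrable12ltyP.
  apply/measurable_EFinP; apply: measurable_funM.
    by apply: (measurableT_comp m1); exact: measurable_fst.
  by apply: (measurableT_comp m2); exact: measurable_snd.
have /integrableP[_ fi1] := i1; have /integrableP[_ fi2] := i2.
under eq_integral => x _.
  under eq_integral => y _ do rewrite /= normrM EFinM.
  rewrite ge0_integralZl//; first over.
  - by apply/measurable_EFinP; exact: measurableT_comp.
have fin2 : (\int[l2]_y `|v2 y|%:E)%E \is a fin_num by rewrite ge0_fin_numE// integral_ge0.
rewrite -(fineK fin2); under eq_integral do rewrite muleC.
rewrite ge0_integralZl//; last 2 first.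
- by apply/measurable_EFinP; exact: measurableT_comp.
- by rewrite lee_fin fine_ge0// integral_ge0.
by rewrite lte_mul_pinfty// lee_fin fine_ge0// integral_ge0.
Qed.

Variables (g : T1 * T2 -> C R) (v1 : T1 -> R) (v2 : T2 -> R).
Hypothesis mg : cmfun g.
Hypothesis i1 : l1.-integrable setT (EFin \o v1).
Hypothesis i2 : l2.-integrable setT (EFin \o v2).
Hypothesis gv : forall x y, n1 (g (x, y)) <= v1 x * v2 y.

Lemma cintg_prod : cintg L g.
Proof.
by apply: (cintg_le mg (integrable_prod i1 i2)) => -[x y]; exact: gv.
Qed.

(** The majorant in product form makes every section integrable, rather than almost every one, so
    that partial integrals obey a bound at every point. *)
Lemma cintg_section1 x : cintg l2 (fun y => g (x, y)).
Proof.
apply: (@cintg_le _ _ _ _ _ (fun y => v1 x * v2 y)) => //.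
- by apply: cmfun_comp => //; exact: pair1_measurable.
- exact: integrable_EFinZ.
Qed.

Lemma cintg_section2 y : cintg l1 (fun x => g (x, y)).
Proof.
apply: (@cintg_le _ _ _ _ _ (fun x => v2 y * v1 x)) => //.
- by apply: cmfun_comp => //; exact: pair2_measurable.
- exact: integrable_EFinZ.
- by move=> x; rewrite mulrC.
Qed.

Lemma cmfun_section1 : cmfun (fun x => cI l2 (fun y => g (x, y))).
Proof.
have [ir ii] := cintg_prod; split; apply/measurable_EFinP.
  rewrite (_ : EFin \o _ = fubini_F l2 (fun p => (cRe (g p))%:E)).
    exact: (measurable_fubini_F ir).
  apply/funext => x /=; rewrite /Rintegral fineK//.
  by have [s1 s2] := cintg_section1 x; exact: integrable_fin_num s1.
rewrite (_ : EFin \o _ = fubini_F l2 (fun p => (cIm (g p))%:E)).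
  exact: (measurable_fubini_F ii).
apply/funext => x /=; rewrite /Rintegral fineK//.
by have [s1 s2] := cintg_section1 x; exact: integrable_fin_num s2.
Qed.

Lemma n1_section1 x : n1 (cI l2 (fun y => g (x, y))) <= Rintegral l2 setT v2 * v1 x.
Proof.
apply: le_trans (n1_cI (cintg_section1 x)) _.
rewrite mulrC -RintegralZl//; apply: le_Rintegral => //.
- exact: cintg_n1 (cintg_section1 x).
- exact: integrable_EFinZ.
Qed.

Lemma cI_prod12 : cI L g = cI l1 (fun x => cI l2 (fun y => g (x, y))).
Proof.
have [ir ii] := cintg_prod; apply: C_eq; rewrite !cE /Rintegral; congr fine.
  rewrite -(integral12_prod_meas1 ir); apply: eq_integral => x _ /=.
  rewrite fineK//; have [s1 s2] := cintg_section1 x.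
  exact: integrable_fin_num s1.
rewrite -(integral12_prod_meas1 ii); apply: eq_integral => x _ /=.
rewrite fineK//; have [s1 s2] := cintg_section1 x.
exact: integrable_fin_num s2.
Qed.

Lemma cI_prod21 : cI L g = cI l2 (fun y => cI l1 (fun x => g (x, y))).
Proof.
have [ir ii] := cintg_prod; apply: C_eq; rewrite !cE /Rintegral; congr fine.
  rewrite -(integral21_prod_meas1 ir); apply: eq_integral => y _ /=.
  rewrite fineK//; have [s1 s2] := cintg_section2 y.
  exact: integrable_fin_num s1.
rewrite -(integral21_prod_meas1 ii); apply: eq_integral => y _ /=.
rewrite fineK//; have [s1 s2] := cintg_section2 y.
exact: integrable_fin_num s2.
Qed.

End complex_fubini.

Lemma density_tvint d (T : measurableType d) (R : realType) (mu : set T -> C R)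
    (l : {finite_measure set T -> \bar R}) (dn : T -> C R) (w : T -> R) :
  is_density mu l dn -> l.-integrable setT (EFin \o w) -> (forall x, 0 <= w x) ->
  (\int[total_var mu]_x (w x)%:E < +oo)%E.
Proof.
move=> D /integrableP[mw iw] w0; apply: le_lt_trans iw.
under [leRHS]eq_integral do rewrite /= ger0_norm//.
apply: le_integral_raw => //= A mA.
by rewrite total_var_ge0// (density_tv_le D).
Qed.

(** * Iterated integrals against complex measures *)

Section iterated_integral.
Context d1 d2 (T1 : measurableType d1) (T2 : measurableType d2) (R : realType).
Variables (mu : set T1 -> C R) (nu : set T2 -> C R).
Hypotheses (hmu : is_cmeasure mu) (hnu : is_cmeasure nu).
Variables (l1 : {finite_measure set T1 -> \bar R}) (dn1 : T1 -> C R).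
Variables (l2 : {finite_measure set T2 -> \bar R}) (dn2 : T2 -> C R).
Hypotheses (D1 : is_density mu l1 dn1) (D2 : is_density nu l2 dn2).
Variables (W1 : set T1) (W2 : set T2).
Hypotheses (mW1 : measurable W1) (mW2 : measurable W2).
Hypotheses (null1 : total_var mu (~` W1) = 0%E) (null2 : total_var nu (~` W2) = 0%E).
Variables (k : T1 -> T2 -> C R) (kt : T1 * T2 -> C R) (v1 : T1 -> R) (v2 : T2 -> R).
Hypothesis mkt : cmfun kt.
Hypothesis ktE : forall x y, W1 x -> W2 y -> kt (x, y) = k x y.
Hypothesis i1 : l1.-integrable setT (EFin \o v1).
Hypothesis i2 : l2.-integrable setT (EFin \o v2).
Hypothesis kv : forall x y, n1 (kt (x, y)) <= v1 x * v2 y.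

Let g (p : T1 * T2) := dn1 p.1 * dn2 p.2 * kt p.

Let mg : cmfun g.
Proof.
apply: cmfunM => //; apply: cmfunM.
  by apply: (cmfun_comp (S := fst)) => //; exact: density_mfun D1.
by apply: (cmfun_comp (S := snd)) => //; exact: density_mfun D2.
Qed.

Let gv x y : n1 (g (x, y)) <= (16 * v1 x) * v2 y.
Proof.
rewrite /g (_ : 16 * v1 x * v2 y = (4 * 4) * (v1 x * v2 y)); last by ring.
apply: le_trans (n1M _ _) _; apply: ler_pM; rewrite ?n1_ge0//.
apply: le_trans (n1M _ _) _.
by apply: ler_pM; rewrite ?n1_ge0 ?(density_le4 D1) ?(density_le4 D2).
Qed.

Let i1' : l1.-integrable setT (EFin \o (fun x => 16 * v1 x)).
Proof. exact: integrable_EFinZ. Qed.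

Let kt1 x : cintg l2 (fun y => kt (x, y)).
Proof. exact: (cintg_section1 mkt i2 kv). Qed.

Let kt2 y : cintg l1 (fun x => kt (x, y)).
Proof. exact: (cintg_section2 mkt i1 kv). Qed.

Let kd1 x : cintg l2 (fun y => dn2 y * kt (x, y)).
Proof.
apply: (cintgM_density D2 (w := fun y => n1 (kt (x, y)))) => //.
- exact: cintg_mfun (kt1 x).
- exact: cintg_n1 (kt1 x).
Qed.

Let kd2 y : cintg l1 (fun x => dn1 x * kt (x, y)).
Proof.
apply: (cintgM_density D1 (w := fun x => n1 (kt (x, y)))) => //.
- exact: cintg_mfun (kt2 y).
- exact: cintg_n1 (kt2 y).
Qed.

(** The kernel [k] itself is not assumed to be measurable. It is replaced by [kt] in the inner
    integral on [W2], then in the outer one on [W1]; after that both measures have densities and the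
    theorem of Fubini applies. *)
Lemma cint2_prod : cint mu (fun x => cint nu (k x)) = cI (l1 \x l2)%E g.
Proof.
pose h x := cI l2 (fun y => dn2 y * kt (x, y)).
have mh0 : cmfun (fun p : T1 * T2 => dn2 p.2 * kt p).
  by apply: cmfunM => //; apply: (cmfun_comp (S := snd)) => //; exact: density_mfun D2.
have i14 : l1.-integrable setT (EFin \o (fun x => 4 * v1 x)) by exact: integrable_EFinZ.
have hv0 x y : n1 (dn2 y * kt (x, y)) <= (4 * v1 x) * v2 y.
  rewrite -mulrA; apply: le_trans (n1M _ _) _.
  by apply: ler_pM; rewrite ?n1_ge0 ?(density_le4 D2).
have mh : cmfun h by exact: (cmfun_section1 mh0 i14 i2 hv0).
have hv x : n1 (h x) <= Rintegral l2 setT v2 * (4 * v1 x).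
  exact: (n1_section1 mh0 i2 hv0).
rewrite (cI_prod12 mg i1' i2 gv).
rewrite (@cint_null _ _ _ mu W1 _ h)//; last first.
  move=> x W1x; rewrite (@cint_null _ _ _ nu W2 _ (fun y => kt (x, y)))//; last first.
    by move=> y W2y; rewrite ktE.
  apply: (cint_density D2); first exact: cintg_mfun (kt1 x).
  exact: cintg_n1 (kt1 x).
rewrite (cint_density D1 mh); last first.
  apply: (@integrable_EFin_le _ _ _ _ _ (fun x => Rintegral l2 setT v2 * (4 * v1 x))).
  - exact: measurable_n1.
  - exact: integrable_EFinZ.
  - by move=> x; rewrite ger0_norm ?n1_ge0.
apply: eq_cI => x; rewrite -cIZ//; apply: eq_cI => y.
by rewrite /g /= mulrA.
Qed.

Lemma cint2_prodC : cint nu (fun y => cint mu (k^~ y)) = cI (l1 \x l2)%E g.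
Proof.
pose h y := cI l1 (fun x => dn1 x * kt (x, y)).
(* Exchanging the factors reduces measurability of the partial integral over the first variable to
   [cmfun_section1]. *)
pose sw (p : T2 * T1) := (p.2, p.1).
have msw : measurable_fun setT sw by apply: measurable_fun_pair.
have mh0 : cmfun (fun p : T2 * T1 => dn1 p.2 * kt (sw p)).
  apply: cmfunM; last exact: cmfun_comp.
  by apply: (cmfun_comp (S := snd)) => //; exact: density_mfun D1.
have i24 : l2.-integrable setT (EFin \o (fun x => 4 * v2 x)) by exact: integrable_EFinZ.
have hv0 y x : n1 (dn1 x * kt (sw (y, x))) <= (4 * v2 y) * v1 x.
  rewrite -mulrA [v2 _ * _]mulrC; apply: le_trans (n1M _ _) _.
  by apply: ler_pM; rewrite ?n1_ge0 ?(density_le4 D1)//; exact: kv.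
have mh : cmfun h by exact: (cmfun_section1 mh0 i24 i1 hv0).
have hv y : n1 (h y) <= Rintegral l1 setT v1 * (4 * v2 y).
  exact: (n1_section1 mh0 i1 hv0).
rewrite (cI_prod21 mg i1' i2 gv).
rewrite (@cint_null _ _ _ nu W2 _ h)//; last first.
  move=> y W2y; rewrite (@cint_null _ _ _ mu W1 _ (fun x => kt (x, y)))//; last first.
    by move=> x W1x; rewrite ktE.
  apply: (cint_density D1); first exact: cintg_mfun (kt2 y).
  exact: cintg_n1 (kt2 y).
rewrite (cint_density D2 mh); last first.
  apply: (@integrable_EFin_le _ _ _ _ _ (fun x => Rintegral l1 setT v1 * (4 * v2 x))).
  - exact: measurable_n1.
  - exact: integrable_EFinZ.
  - by move=> x; rewrite ger0_norm ?n1_ge0.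
apply: eq_cI => y; rewrite -cIZ//; apply: eq_cI => x.
by rewrite /g /= mulrA (mulrC (dn1 x)).
Qed.

Lemma cint_swap : cint mu (fun x => cint nu (k x)) = cint nu (fun y => cint mu (k^~ y)).
Proof. by rewrite cint2_prod cint2_prodC. Qed.

End iterated_integral.

(* Both [weyl_conv] and [mbracket] are of this form. *)
Definition twisted_conv (R : realType) (E : lmodType R) (sigma : {biscalar E})
    (phi : R -> C R) (mu nu : set (ilB E) -> C R) : set (ilB E) -> C R :=
  fun A => cint mu (fun f => cint nu (fun g : E =>
    phi (sigma f g) * ofR (\1_A ((f : E) + g)))).

Section twisted_convolution.
Context {R : realType} {E : tvsType R}.
Hypothesis hE : hausdorff_space E.
Variables (sigma : {biscalar E}) (phi : R -> C R) (mphi : cmfun phi).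
Variables (mu nu : set (ilB E) -> C R).
Hypotheses (hmu : is_cmeasure mu) (hnu : is_cmeasure nu).
Local Notation K := (twisted_conv sigma phi mu nu).

Lemma twisted_conv_carrier (A B D : set (ilB E)) : measurable A -> measurable B ->
  measurable D -> total_var mu (~` A) = 0%E -> total_var nu (~` B) = 0%E ->
  (forall x y : E, A x -> B y -> D ((x : E) + y)) -> total_var K (~` D) = 0%E.
Proof.
move=> mA mB mD A0 B0 ABD; apply: null_total_var => [|M mM MD]; first exact: measurableC.
rewrite /twisted_conv (@cint_null _ _ _ mu A _ (fun=> 0)) ?cint0// => x Ax.
rewrite (@cint_null _ _ _ nu B _ (fun=> 0)) ?cint0// => y By.
by rewrite indicE memNset ?ofR0 ?mulr0// => /MD; apply; exact: ABD.
Qed.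

Variable e : nat -> E.
Local Notation W := (cspan e : set (ilB E)).
Hypotheses (null1 : total_var mu (~` W) = 0%E) (null2 : total_var nu (~` W) = 0%E).
Variables w1 w2 : E -> R.
Hypotheses (mw1 : measurable_fun setT (w1 : ilB E -> R)) (mw2 : measurable_fun setT (w2 : ilB E -> R)).
Hypotheses (w10 : forall x, 0 <= w1 x) (w20 : forall x, 0 <= w2 x).
Hypothesis phiw : forall x y, n1 (phi (sigmaW e sigma (x, y))) <= w1 x * w2 y.
Hypothesis iw1 : (\int[total_var mu]_x (w1 x)%:E < +oo)%E.
Hypothesis iw2 : (\int[total_var nu]_x (w2 x)%:E < +oo)%E.

Let mW : measurable W. Proof. exact: cspan_measurable. Qed.

Let mphiW : cmfun (fun p => phi (sigmaW e sigma p)).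
Proof. by apply: cmfun_comp => //; exact: measurable_sigmaW. Qed.

(** The convolution is the image under [addW] of the density [D] on the product, so the lemmas on
    images apply. The functions [w1], [w2] dominate the kernel and [u1], [u2] the kernel times the
    integrand. In the third part the majorant is a sum of products, as needed for powers of a
    semi-norm of f + g. *)
Lemma twisted_conv_spec : is_cmeasure K /\
  (forall (h : E -> C R) (u1 u2 : E -> R), cmfun (h : ilB E -> C R) ->
     measurable_fun setT (u1 : ilB E -> R) -> measurable_fun setT (u2 : ilB E -> R) ->
     (forall x, 0 <= u1 x) -> (forall x, 0 <= u2 x) ->
     (\int[total_var mu]_x (u1 x)%:E < +oo)%E ->
     (\int[total_var nu]_x (u2 x)%:E < +oo)%E ->
     (forall x y, n1 (h (addW e (x, y))) * (w1 x * w2 y) <= u1 x * u2 y) ->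
     cint K h = cint mu (fun f => cint nu (fun g : E =>
       phi (sigma f g) * h ((f : E) + g)))) /\
  (forall (q : E -> R) n (u1 u2 : 'I_n -> E -> R), measurable_fun setT (q : ilB E -> R) ->
     (forall x, 0 <= q x) ->
     (forall i, measurable_fun setT (u1 i : ilB E -> R)) ->
     (forall i, measurable_fun setT (u2 i : ilB E -> R)) ->
     (forall i x, 0 <= u1 i x) -> (forall i x, 0 <= u2 i x) ->
     (forall i, (\int[total_var mu]_x (u1 i x)%:E < +oo)%E) ->
     (forall i, (\int[total_var nu]_x (u2 i x)%:E < +oo)%E) ->
     (forall x y, q (addW e (x, y)) * (w1 x * w2 y) <= \sum_i u1 i x * u2 i y) ->
     (\int[total_var K]_x (q x)%:E < +oo)%E).
Proof.
have [l1 [d1 D1]] := cmeasure_density hmu.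
have [l2 [d2 D2]] := cmeasure_density hnu.
have il1 := density_integrable D1 mw1 w10 iw1.
have il2 := density_integrable D2 mw2 w20 iw2.
pose L := (l1 \x l2)%E.
pose D (p : ilB E * ilB E) := d1 p.1 * d2 p.2 * phi (sigmaW e sigma p).
have mD : cmfun D.
  apply: cmfunM => //; apply: cmfunM.
    by apply: (cmfun_comp (S := fst)) => //; exact: density_mfun D1.
  by apply: (cmfun_comp (S := snd)) => //; exact: density_mfun D2.
have Dw p : n1 (D p) <= 16 * (w1 p.1 * w2 p.2).
  case: p => x y; rewrite /D (_ : 16 = 4 * 4); last by rewrite -natrM.
  apply: le_trans (n1M _ _) _; apply: ler_pM; rewrite ?n1_ge0//.
  apply: le_trans (n1M _ _) _.
  by apply: ler_pM; rewrite ?n1_ge0 ?(density_le4 D1) ?(density_le4 D2).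
have iww : L.-integrable setT (EFin \o (fun p => 16 * (w1 p.1 * w2 p.2))).
  by apply: integrable_EFinZ; exact: integrable_prod.
have iD : cintg L D by exact: cintg_le Dw.
have mS := measurable_addW hE e.
have main (h : E -> C R) (u1 u2 : E -> R) : cmfun (h : ilB E -> C R) ->
    l1.-integrable setT (EFin \o u1) -> l2.-integrable setT (EFin \o u2) ->
    (forall x y, n1 (h (addW e (x, y))) * (w1 x * w2 y) <= u1 x * u2 y) ->
    cint mu (fun f => cint nu (fun g : E => phi (sigma f g) * h ((f : E) + g))) =
    cI L (fun p => D p * h (addW e p)).
  move=> mh iu1 iu2 hu.
  rewrite (cint2_prod hmu hnu D1 D2 mW mW null1 null2
    (kt := fun p => phi (sigmaW e sigma p) * h (addW e p)) _ _ iu1 iu2).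
  - by apply: eq_cI => p; rewrite /D mulrA.
  - by apply: cmfunM => //; exact: cmfun_comp.
  - by move=> x y Wx Wy; rewrite sigmaW_in// addW_in.
  - move=> x y; apply: le_trans (n1M _ _) _; apply: le_trans (hu x y).
    by rewrite mulrC ler_wpM2l ?n1_ge0.
have KE A : measurable A -> K A = cI L (fun p => D p * ofR (\1_A (addW e p))).
  move=> mA; apply: (main (fun x => ofR (\1_A x)) w1 w2) => //.
    by apply: cmfun_ofR; exact: measurable_indic.
  move=> x y; rewrite n1_ofR indicE; case: (_ \in _); rewrite ?normr1 ?mul1r// normr0 mul0r.
  exact: mulr_ge0.
split; first exact: (push_cmeasure mS iD KE).
split.
  move=> h u1 u2 mh mu1 mu2 u10 u20 iu1 iu2 hu.
  have ju1 := density_integrable D1 mu1 u10 iu1.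
  have ju2 := density_integrable D2 mu2 u20 iu2.
  rewrite (push_cint mS iD KE mh); first by rewrite (main h u1 u2).
  apply: (@integrable_EFin_le _ _ _ _ _ (fun p : ilB E * ilB E => 16 * (u1 p.1 * u2 p.2))).
  - apply: measurable_funM; apply: measurable_n1 => //.
    exact: cmfun_comp.
  - by apply: integrable_EFinZ; exact: integrable_prod.
  - move=> [x y]; rewrite ger0_norm ?mulr_ge0 ?n1_ge0//.
    apply: le_trans (ler_wpM2l (n1_ge0 _) (Dw _)) _.
    by rewrite mulrCA ler_wpM2l//; exact: hu.
move=> q n u1 u2 mq q0 mu1 mu2 u10 u20 iu1 iu2 qu.
have n0 p : 0 <= n1 (D p) by exact: n1_ge0.
have in1 : L.-integrable setT (EFin \o (fun p => n1 (D p))) by exact: cintg_n1.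
(* [G] is the image of the modulus of the density; it dominates the total variation of the
   convolution. *)
pose G : {finite_measure set (ilB E) -> \bar R} := dmeas mS in1 n0.
have KG A : measurable A -> (total_var K A <= G A)%E.
  by apply: total_var_le => B mB; exact: (push_n1_le mS iD KE mB).
apply: (@le_lt_trans _ _ (\int[G]_x (q x)%:E)%E).
  by apply: le_integral_raw => //= A mA; rewrite total_var_ge0// KG.
rewrite integral_dmeas//.
have iq : L.-integrable setT (EFin \o (fun p => q (addW e p) * n1 (D p))).
  apply: (@integrable_EFin_le _ _ _ _ _ (fun p : ilB E * ilB E => 16 * \sum_i u1 i p.1 * u2 i p.2)).
  - apply: measurable_funM; first exact: (measurableT_comp (f := q : ilB E -> R)).
    exact: measurable_n1.
  - apply: integrable_EFinZ.
    rewrite (_ : EFin \o _ = (fun p => \sum_i (u1 i p.1 * u2 i p.2)%:E)%E); last first.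
      by apply/funext => p; rewrite /= sumEFin.
    apply: integrable_sum => // i _; apply: integrable_prod.
      exact: (density_integrable D1).
    exact: (density_integrable D2).
  - move=> [x y]; rewrite ger0_norm ?mulr_ge0//.
    apply: le_trans (ler_wpM2l (q0 _) (Dw _)) _.
    by rewrite mulrCA ler_wpM2l//; exact: qu.
have /integrableP[_] := iq; apply: le_lt_trans.
rewrite le_eqVlt; apply/orP; left; apply/eqP; apply: eq_integral => p _.
by rewrite /= ger0_norm// mulr_ge0.
Qed.

End twisted_convolution.

(** * Sums, multiples and images of complex measures *)

Section measure_sums.
Context d (T : measurableType d) (R : realType).
Implicit Types (mu nu : set T -> C R).

Lemma integrable_fmeasure_add (p q : {finite_measure set T -> \bar R}) (h : T -> \bar R) :
  p.-integrable setT h -> q.-integrable setT h -> (fmeasure_add p q).-integrable setT h.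
Proof.
move=> /integrableP[mh hp] /integrableP[_ hq]; apply/integrableP; split => //.
rewrite ge0_integral_measure_add//; first exact: lte_add_pinfty.
exact: measurableT_comp.
Qed.

Lemma real_jordan_integrable (m : set T -> R) (N : set T -> \bar R) (h : T -> R) :
  is_rmeasure m -> N set0 = 0%E ->
  (forall A B, measurable A -> measurable B -> B `<=` A -> (`|m B|%:E <= N A)%E) ->
  measurable_fun setT h -> (\int[N]_x `|h x|%:E < +oo)%E ->
  exists p q : {finite_measure set T -> \bar R}, [/\
    forall A, measurable A -> (m A)%:E = (p A - q A)%E,
    p.-integrable setT (EFin \o h) & q.-integrable setT (EFin \o h)].
Proof.
move=> hm N0 mN mh hN; have [p [q [mpq pE qE]]] := rmeasure_jordan hm.
have i (r : {finite_measure set T -> \bar R}) :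
    (forall A, measurable A -> (r A <= N A)%E) -> r.-integrable setT (EFin \o h).
  move=> rN; apply/integrableP; split; first exact/measurable_EFinP.
  apply: le_lt_trans hN; apply: le_integral_raw => // A mA.
  by rewrite measure_ge0 rN.
exists p, q; split => //; apply: i => A mA.
  rewrite -pE//; apply: ge_ereal_sup => _ [B [mB BA] <-].
  by apply: le_trans (mN A B mA mB BA); rewrite lee_fin ler_norm.
rewrite -qE//; apply: ge_ereal_sup => _ [B [mB BA] <-].
by apply: le_trans (mN A B mA mB BA); rewrite lee_fin -normrN ler_norm.
Qed.

(** Adding Jordan decompositions does not in general give a Jordan decomposition, but by [sint_diff]
    it computes the same integral. *)
Lemma sint_add (m m' : set T -> R) (p q p' q' : {finite_measure set T -> \bar R}) (h : T -> R) :
  is_rmeasure m -> is_rmeasure m' -> is_rmeasure (fun A => m A + m' A) ->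
  (forall A, measurable A -> (m A)%:E = (p A - q A)%E) ->
  (forall A, measurable A -> (m' A)%:E = (p' A - q' A)%E) ->
  p.-integrable setT (EFin \o h) -> q.-integrable setT (EFin \o h) ->
  p'.-integrable setT (EFin \o h) -> q'.-integrable setT (EFin \o h) ->
  sint (fun A => m A + m' A) h = sint m h + sint m' h.
Proof.
move=> hm hm' hs mE mE' ip iq ip' iq'.
rewrite (@sint_diff _ _ _ _ (fmeasure_add p p') (fmeasure_add q q'))//; last 3 first.
- move=> A mA; rewrite EFinD mE// mE'//.
  have ep : (fmeasure_add p p' A = p A + p' A)%E by exact: measure_addE.
  have eq : (fmeasure_add q q' A = q A + q' A)%E by exact: measure_addE.
  apply: etrans (esym (f_equal2 (fun x y => x - y)%E ep eq)).
  by rewrite fin_num_oppeD ?fin_num_measure// addeACA.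
- exact: integrable_fmeasure_add.
- exact: integrable_fmeasure_add.
rewrite (sint_diff hm mE)// (sint_diff hm' mE')//.
have f_ (u : {finite_measure set T -> \bar R}) : u.-integrable setT (EFin \o h) ->
    (\int[u]_x (h x)%:E)%E \is a fin_num by exact: integrable_fin_num.
rewrite /Rintegral [in LHS]/fmeasure_add !integral_measure_add//.
rewrite (fineD (f_ _ ip) (f_ _ ip')) (fineD (f_ _ iq) (f_ _ iq')); lra.
Qed.

Lemma total_var_set0 mu : is_cmeasure mu -> total_var mu set0 = 0%E.
Proof.
move=> hmu; apply: null_total_var => // B _; rewrite subset0 => ->.
have [l [dn D]] := cmeasure_density hmu; rewrite (densityE D)//.
by under eq_cI do rewrite indicE in_set0 ofR0 mulr0; exact: cI0.
Qed.

Lemma cint_addm mu nu (h : T -> C R) : is_cmeasure mu -> is_cmeasure nu -> cmfun h ->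
  (\int[total_var mu]_x (n1 (h x))%:E < +oo)%E ->
  (\int[total_var nu]_x (n1 (h x))%:E < +oo)%E ->
  cint (fun A => mu A + nu A) h = cint mu h + cint nu h.
Proof.
move=> hmu hnu mh imu inu.
have hs := cmeasureD hmu hnu.
have add (m : C R -> R) (h' : T -> R) : (forall z w, m (z + w) = m z + m w) ->
    (forall rho : set T -> C R, is_cmeasure rho -> is_rmeasure (fun A => m (rho A))) ->
    (forall z, `|m z| <= cmod z) -> measurable_fun setT h' ->
    (forall x, `|h' x| <= n1 (h x)) ->
    sint (fun A => m (mu A + nu A)) h' = sint (fun A => m (mu A)) h' + sint (fun A => m (nu A)) h'.
  move=> mD mr mc mh' hh'.
  have J (rho : set T -> C R) : is_cmeasure rho -> (\int[total_var rho]_x (n1 (h x))%:E < +oo)%E ->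
     exists p q : {finite_measure set T -> \bar R}, [/\
       forall A, measurable A -> (m (rho A))%:E = (p A - q A)%E,
       p.-integrable setT (EFin \o h') & q.-integrable setT (EFin \o h')].
    move=> hrho irho; apply: (@real_jordan_integrable _ (total_var rho)) => //.
    - exact: mr.
    - exact: total_var_set0.
    - move=> A B mA mB BA; apply: le_trans (cmod_le_total_var rho mA mB BA).
      by rewrite lee_fin.
    have [l [dn D]] := cmeasure_density hrho.
    apply: (density_tvint D) => //.
    apply: (@integrable_EFin_le _ _ _ _ _ (fun x => n1 (h x))).
    - exact: measurableT_comp.
    - apply: (density_integrable D) => //; first exact: measurable_n1.
      by move=> x; exact: n1_ge0.
    - by move=> x; rewrite normr_id.
  have [p [q [mE ip iq]]] := J _ hmu imu.
  have [p' [q' [mE' ip' iq']]] := J _ hnu inu.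
  rewrite (_ : (fun A => m (mu A + nu A)) = (fun A => m (mu A) + m (nu A))); last first.
    by apply/funext => A; rewrite mD.
  apply: (sint_add _ _ _ mE mE') => //; [exact: mr|exact: mr|].
  rewrite (_ : (fun A => _) = (fun A => m (mu A + nu A))); first exact: (mr _ hs).
  by apply/funext => A; rewrite mD.
have [mhr mhi] := mh.
have rr := add (@cRe R) _ (@cReD R) (@cmeasure_Re _ _ _) (@cRe_le_cmod R).
have ri := add (@cIm R) _ (@cImD R) (@cmeasure_Im _ _ _) (@cIm_le_cmod R).
have hr x : `|cRe (h x)| <= n1 (h x) by exact: cRe_le_n1.
have hi x : `|cIm (h x)| <= n1 (h x) by exact: cIm_le_n1.
rewrite /cint (rr _ mhr hr) (rr _ mhi hi) (ri _ mhr hr) (ri _ mhi hi).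
by apply: C_eq; rewrite !cE; lra.
Qed.

Lemma tvint_le mu (G : {measure set T -> \bar R}) (q : T -> R) :
  (forall A, measurable A -> ((n1 (mu A))%:E <= G A)%E) ->
  measurable_fun setT q -> (forall x, 0 <= q x) ->
  (\int[G]_x (q x)%:E < +oo)%E -> (\int[total_var mu]_x (q x)%:E < +oo)%E.
Proof.
move=> h mq q0; apply: le_lt_trans; apply: le_integral_raw => //= A mA.
by rewrite total_var_ge0// (total_var_le h).
Qed.

Lemma tvintD mu nu (q : T -> R) : is_cmeasure mu -> is_cmeasure nu ->
  measurable_fun setT q -> (forall x, 0 <= q x) ->
  (\int[total_var mu]_x (q x)%:E < +oo)%E -> (\int[total_var nu]_x (q x)%:E < +oo)%E ->
  (\int[total_var (fun A => mu A + nu A)%R]_x (q x)%:E < +oo)%E.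
Proof.
move=> hmu hnu mq q0 imu inu.
have [l1 [d1 D1]] := cmeasure_density hmu.
have [l2 [d2 D2]] := cmeasure_density hnu.
(* The dominating measure is p + p: passing from the modulus to [n1] costs a factor 2. *)
pose p := fmeasure_add l1 l2.
have i1 := density_integrable D1 mq q0 imu.
have i2 := density_integrable D2 mq q0 inu.
have ip : (fmeasure_add p p).-integrable setT (EFin \o q).
  by apply: integrable_fmeasure_add; exact: integrable_fmeasure_add.
apply: (@tvint_le _ (fmeasure_add p p)) => // [A mA|].
  have b (rho : set T -> C R) (l : {finite_measure set T -> \bar R}) dn :
      is_density rho l dn -> cmod (rho A) <= fine (l A).
    move=> D; rewrite -lee_fin fineK ?fin_num_measure//.
    by apply: le_trans (density_tv_le D mA); exact: cmod_le_total_var.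
  have ep : (fmeasure_add p p A = p A + p A)%E by exact: measure_addE.
  have ep' : (p A = l1 A + l2 A)%E by exact: measure_addE.
  rewrite (_ : (_ <= _)%E = ((n1 (mu A + nu A))%:E <= (l1 A + l2 A) + (l1 A + l2 A))%E); last first.
    by rewrite -ep' -ep.
  rewrite -(fineK (fin_num_measure l1 A mA)) -(fineK (fin_num_measure l2 A mA)) -!EFinD lee_fin.
  have := n1D (mu A) (nu A); have := n1_le_cmod (mu A); have := n1_le_cmod (nu A).
  have := b _ _ _ D1; have := b _ _ _ D2; lra.
have /integrableP[_] := ip; apply: le_lt_trans.
apply: ge0_le_integral => //=.
- by move=> x _; rewrite lee_fin.
- exact/measurable_EFinP.
- by apply/measurable_EFinP; exact: measurableT_comp.
- by move=> x _; rewrite lee_fin ler_norm.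
Qed.

End measure_sums.

Section push_spec.
Context d (T : measurableType d) (R : realType).
Implicit Types (mu nu : set T -> C R).

(* [rho] is the image under [S] of a multiple of [mu], or of its complex
   conjugate: [(m, m')] is [(z |-> c z, id)] or [(conj, conj)]. *)
Lemma push_spec d' (T' : measurableType d') mu (S : T -> T') (m m' : C R -> C R)
    (rho : set T' -> C R) : is_cmeasure mu ->
  (forall (l : {finite_measure set T -> \bar R}) h, cintg l h ->
     cintg l (fun x => m (h x)) /\ cI l (fun x => m (h x)) = m (cI l h)) ->
  (exists k, forall z, n1 (m z) <= k * n1 z) ->
  (forall z w, m (z * m' w) = m z * w) ->
  (forall h : T -> C R, cmfun h -> cmfun (fun x => m' (h x))) ->
  (forall z, n1 (m' z) = n1 z) -> (forall b, m' (ofR b) = ofR b) ->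
  measurable_fun setT S ->
  (forall A, measurable A -> rho A = m (mu (S @^-1` A))) ->
  [/\ is_cmeasure rho,
     forall h, cmfun h -> (\int[total_var mu]_x (n1 (h (S x)))%:E < +oo)%E ->
       cint rho h = m (cint mu (fun x => m' (h (S x)))) &
     forall q : T' -> R, measurable_fun setT q -> (forall x, 0 <= q x) ->
       (\int[total_var mu]_x (q (S x))%:E < +oo)%E ->
       (\int[total_var rho]_x (q x)%:E < +oo)%E].
Proof.
move=> hmu hm [k mk] mM m'c m'n m'R mS rhoE; have [l [dn D]] := cmeasure_density hmu.
have [iD _] := hm _ _ (cintg_density D).
have mD : cmfun (fun x => m (dn x)) by exact: cintg_mfun iD.
have E A : measurable A -> rho A = cI l (fun x => m (dn x) * ofR (\1_A (S x))).
  move=> mA; have mSA : measurable (S @^-1` A) by rewrite -[X in measurable X]setTI; exact: mS.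
  rewrite rhoE// (densityE D)//.
  have idA : cintg l (fun x => dn x * ofR (\1_(S @^-1` A) x)).
    apply: (cintgM_density D (w := fun=> 1)).
    - by apply: cmfun_ofR; exact: measurable_indic.
    - exact: finite_measure_integrable_cst.
    - by move=> x; rewrite n1_ofR indicE; case: (_ \in _); rewrite ?normr1 ?normr0.
  by rewrite -(hm _ _ idA).2; apply: eq_cI => x; rewrite -mM m'R.
have k0 x : n1 (m (dn x)) <= `|k| * 4.
  apply: le_trans (mk _) _; apply: (@le_trans _ _ (`|k| * n1 (dn x))).
    by rewrite ler_wpM2r ?n1_ge0 ?ler_norm.
  by rewrite ler_wpM2l// (density_le4 D).
have ib (w : T -> R) : measurable_fun setT w -> (forall x, 0 <= w x) ->
    (\int[total_var mu]_x (w x)%:E < +oo)%E ->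
    l.-integrable setT (EFin \o (fun x => w x * n1 (m (dn x)))).
  move=> mw w0 iw.
  apply: (@integrable_EFin_le _ _ _ _ _ (fun x => (`|k| * 4) * w x)).
  - by apply: measurable_funM => //; exact: measurable_n1.
  - by apply: integrable_EFinZ; exact: (density_integrable D).
  - by move=> x; rewrite ger0_norm ?mulr_ge0 ?n1_ge0// mulrC ler_wpM2r.
split; first exact: (push_cmeasure mS iD E).
  move=> h mh ih.
  have mhS : cmfun (fun x => h (S x)) by exact: cmfun_comp.
  have nhS : measurable_fun setT (fun x => n1 (h (S x))) by exact: measurable_n1.
  have n0 x : 0 <= n1 (h (S x)) by exact: n1_ge0.
  have ihl := density_integrable D nhS n0 ih.
  rewrite (push_cint mS iD E)//; last exact: ib.
  rewrite (cint_density D); last 2 first.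
  - exact: m'c.
  - by under eq_fun do rewrite m'n.
  rewrite -(hm _ _ _).2; first by apply: eq_cI => x; rewrite mM.
  apply: (cintgM_density D (w := fun x => n1 (h (S x)))) => //; first exact: m'c.
  by move=> x; rewrite m'n.
move=> q mq q0 iq.
have n0 x : 0 <= n1 (m (dn x)) by exact: n1_ge0.
have in1 : l.-integrable setT (EFin \o (fun x => n1 (m (dn x)))) by exact: cintg_n1 iD.
apply: (@tvint_le _ _ _ _ (dmeas mS in1 n0)) => //.
  by move=> A mA; exact: (push_n1_le mS iD E).
rewrite integral_dmeas//.
have /integrableP[_] := ib _ (measurableT_comp mq mS) (fun x => q0 (S x)) iq.
apply: le_lt_trans; rewrite le_eqVlt; apply/orP; left; apply/eqP.
by apply: eq_integral => p _; rewrite /= ger0_norm// mulr_ge0.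
Qed.

Lemma scale_cmeasure_spec (c : C R) mu : is_cmeasure mu ->
  [/\ is_cmeasure (fun A => c * mu A),
     forall h, cmfun h -> (\int[total_var mu]_x (n1 (h x))%:E < +oo)%E ->
       cint (fun A => c * mu A) h = c * cint mu h &
     forall q : T -> R, measurable_fun setT q -> (forall x, 0 <= q x) ->
       (\int[total_var mu]_x (q x)%:E < +oo)%E ->
       (\int[total_var (fun A => c * mu A)%R]_x (q x)%:E < +oo)%E].
Proof.
move=> hmu; apply: (@push_spec _ T mu id (fun z => c * z) id) => //.
- by move=> l h ih; split; [exact: cintgZ|exact: cIZ].
- by exists (n1 c) => z; exact: n1M.
- by move=> z w; rewrite mulrA.
Qed.

End push_spec.

(** * Injectivity of the Fourier transformation *)

(* Iterating this polynomial turns functions with values in [-1, 1] into bounded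
   approximations of their sign, hence of indicator functions of level sets. *)
Lemma smoothstep_cvg (R : realType) (y : R) : `|y| <= 1 ->
  (forall n, `|iter n (fun t => (3 * t - t ^+ 3) / 2) y| <= 1) /\
  iter n (fun t => (3 * t - t ^+ 3) / 2) y @[n --> \oo] --> Num.sg y.
Proof.
pose q (t : R) := (3 * t - t ^+ 3) / 2.
have qN t : q (- t) = - q t by rewrite /q exprNn; ring.
have iN n t : iter n q (- t) = - iter n q t by elim: n => //= n ->; exact: qN.
(* For t in [d, 1] the polynomial satisfies 1 - q(t) = (1 - t)(1 - (t + t^2)/2), so t stays in
   [d, 1] and its distance to 1 shrinks at least by the factor 1 - d/2. *)
have pos d : 0 < d -> d <= 1 -> forall n, d <= iter n q d <= 1 /\
    1 - iter n q d <= (1 - d / 2) ^+ n.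
  move=> d0 d1; elim=> [|n [/andP[h1 h2] h3]]; first by rewrite lexx d1 expr0 /=; split=> //; lra.
  rewrite iterS; set t := iter n q d in h1 h2 h3 *.
  have -> : q t = t + t * (1 - t) * (1 + t) / 2 by rewrite /q; field.
  have a1 : 0 <= t * (1 - t) * (1 + t) by rewrite !mulr_ge0; lra.
  have e1 : 1 - (t + t * (1 - t) * (1 + t) / 2) = (1 - t) * (1 - (t + t ^+ 2) / 2).
    by field.
  have tt : 0 <= t ^+ 2 by exact: sqr_ge0.
  split; last first.
    have t2 : t ^+ 2 <= 1 by rewrite expr_le1//; lra.
    rewrite e1 [_ ^+ n.+1]exprSr; apply: (@le_trans _ _ ((1 - t) * (1 - d / 2))).
      by apply: ler_wpM2l; lra.
    by apply: ler_wpM2r; lra.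
  apply/andP; split; first lra.
  rewrite -subr_ge0 e1 mulr_ge0//; first lra.
  have : t ^+ 2 <= 1 by rewrite expr_le1//; lra.
  lra.
have cv d : 0 < d -> d <= 1 -> iter n q d @[n --> \oo] --> (1 : R).
  move=> d0 d1; have p := pos d d0 d1.
  have g0 : (1 - d / 2) ^+ n @[n --> \oo] --> (0 : R).
    by apply: cvg_expr; rewrite ltr_norml; apply/andP; split; lra.
  apply: (@squeeze_cvgr _ _ _ _ (fun n => 1 - (1 - d / 2) ^+ n) (fun=> 1)).
  - by near=> n; have [/andP[_ ->]] := p n; rewrite andbT; lra.
  - by rewrite -[X in _ --> X](subr0 1); apply: cvgB => //; exact: cvg_cst.
  - exact: cvg_cst.
have c0 n : iter n q 0 = 0 by elim: n => //= n ->; rewrite /q expr0n/= mulr0 subr0 mul0r.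
move=> y1; case: (ltgtP y 0) => y0.
- have d0 : 0 < - y by lra.
  have d1 : - y <= 1 by move: y1; rewrite ler_norml; lra.
  have yN : y = - (- y) by rewrite opprK.
  split=> [n|].
    have [/andP[h1 h2] _] := pos _ d0 d1 n.
    by rewrite yN iN normrN ger0_norm//; lra.
  rewrite yN ltr0_sg ?oppr_lt0//.
  by under eq_fun do rewrite iN; apply: cvgN; exact: cv.
- have d1 : y <= 1 by move: y1; rewrite ler_norml; lra.
  split=> [n|]; last by rewrite gtr0_sg//; exact: cv.
  by have [/andP[h1 h2] _] := pos _ y0 d1 n; rewrite ger0_norm//; lra.
- rewrite y0 sgr0; split=> [n|]; first by rewrite c0 normr0.
  by under eq_fun do rewrite c0; exact: cvg_cst.
Unshelve. all: by end_near.
Qed.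

Section fourier_injectivity.
Context {R : realType} {E : tvsType R}.
Hypothesis hE : hausdorff_space E.
Variable l : {finite_measure set (ilB E) -> \bar R}.
Local Notation T := (ilB E).
Implicit Types (u : T -> C R) (psi : T -> R).

Let K u := cintg l u /\ forall F : dual E, cI l (fun x => u x * expi (F x)) = 0.

(** [K] consists of the integrable densities with vanishing transform. The bounded functions
    preserving [K] form an algebra closed under bounded pointwise limits; the aim is to reach enough
    indicator functions. *)
Definition multiplier psi := [/\ measurable_fun setT psi,
  exists b, forall x, `|psi x| <= b & forall u, K u -> K (fun x => ofR (psi x) * u x)].

Let cintgM u (h : T -> C R) b : cintg l u -> cmfun h -> (forall x, n1 (h x) <= b) ->
  cintg l (fun x => u x * h x).
Proof.
move=> iu mh hb; apply: (@cintg_le _ _ _ _ _ (fun x => b * n1 (u x))).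
- by apply: cmfunM => //; exact: cintg_mfun iu.
- by apply: integrable_EFinZ; exact: cintg_n1.
- move=> x; apply: le_trans (n1M _ _) _; rewrite mulrC ler_wpM2r ?n1_ge0//.
Qed.

Let cmexp (F : dual E) : cmfun (fun x : T => expi (F x)).
Proof. by apply: cmfun_expi; exact: measurable_linf (dual_linear _). Qed.

Let iexp u (F : dual E) : cintg l u -> cintg l (fun x => u x * expi (F x)).
Proof. by move=> iu; apply: (@cintgM _ _ 2) => // x; exact: n1_expi. Qed.

Let K_D u v : K u -> K v -> K (fun x => u x + v x).
Proof.
move=> [iu hu] [iv hv]; split; first exact: cintgD.
move=> F; under eq_cI do rewrite mulrDl.
by rewrite cID ?hu ?hv ?addr0//; exact: iexp.
Qed.

Let K_Z (c : C R) u : K u -> K (fun x => c * u x).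
Proof.
move=> [iu hu]; split; first exact: cintgZ.
move=> F; under eq_cI do rewrite -mulrA.
by rewrite cIZ ?hu ?mulr0//; exact: iexp.
Qed.

(** Multiplication by a character translates the transform. *)
Let K_exp (G : dual E) u : K u -> K (fun x => expi (G x) * u x).
Proof.
move=> [iu hu]; split; first by under eq_fun do rewrite mulrC; exact: iexp.
move=> F; rewrite -[RHS](hu (G + F)); apply: eq_cI => x.
by rewrite dualD expiD mulrCA mulrA.
Qed.

Let K_lim (un : nat -> T -> C R) u (g : T -> R) : l.-integrable setT (EFin \o g) ->
  (forall n, K (un n)) -> (forall n x, n1 (un n x) <= g x) ->
  (forall x, un n x @[n --> \oo] --> u x) -> K u.
Proof.
move=> ig Kn ung unu.
have mn n : cmfun (un n) by exact: cintg_mfun (Kn n).1.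
split; first by have [] := cI_cvg mn ig ung unu.
move=> F; have i2 : l.-integrable setT (EFin \o (fun x => 2 * g x)) by exact: integrable_EFinZ.
have [] := @cI_cvg _ _ _ l (fun n x => un n x * expi (F x)) (fun x => u x * expi (F x)) _ _ i2.
- by move=> n; exact: cmfunM.
- move=> n x; apply: le_trans (n1M _ _) _; rewrite mulrC.
  by apply: ler_pM; rewrite ?n1_ge0 ?n1_expi.
- by move=> x; apply: cvgMr_tmp.
move=> _ h; apply: cvg_unique h _ => //.
rewrite (_ : (fun n => _) = (fun=> 0)); first exact: cvg_cst.
by apply/funext => n; exact: (Kn n).2.
Qed.

Lemma multiplier_cst c : multiplier (fun=> c).
Proof.
split; [exact: measurable_cst|by exists (`|c|)|].
by move=> u; exact: K_Z.
Qed.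

Lemma multiplierD psi phi : multiplier psi -> multiplier phi ->
  multiplier (fun x => psi x + phi x).
Proof.
move=> [mp [b pb] hp] [mq [c qc] hq]; split; first exact: measurable_funD.
  by exists (b + c) => x; rewrite (le_trans (ler_normD _ _))// lerD.
move=> u Ku; rewrite (_ : (fun x => _) = (fun x => ofR (psi x) * u x + ofR (phi x) * u x)).
  by apply: K_D; [exact: hp|exact: hq].
by apply/funext => x; rewrite ofRD mulrDl.
Qed.

Lemma multiplierM psi phi : multiplier psi -> multiplier phi ->
  multiplier (fun x => psi x * phi x).
Proof.
move=> [mp [b pb] hp] [mq [c qc] hq]; split; first exact: measurable_funM.
  by exists (b * c) => x; rewrite normrM; apply: ler_pM.
move=> u Ku; rewrite (_ : (fun x => _) = (fun x => ofR (psi x) * (ofR (phi x) * u x))).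
  by apply: hp; exact: hq.
by apply/funext => x; rewrite ofRM mulrA.
Qed.

Lemma multiplier_lim (psin : nat -> T -> R) psi b :
  (forall n, multiplier (psin n)) -> (forall n x, `|psin n x| <= b) ->
  (forall x, psin n x @[n --> \oo] --> psi x) -> multiplier psi.
Proof.
move=> Mn nb nlim; split.
- apply: (@measurable_fun_cvg _ _ _ _ psin) => // n; by case: (Mn n).
- have nb' n x : - b <= psin n x <= b by rewrite -ler_norml.
  exists b => x; rewrite ler_norml; apply/andP; split.
    by apply: (closed_cvg _ (@closed_ge _ (- b)) _ _ (nlim x)); apply: nearW => n; case/andP: (nb' n x).
  by apply: (closed_cvg _ (@closed_le _ b) _ _ (nlim x)); apply: nearW => n; case/andP: (nb' n x).
move=> u Ku; apply: (@K_lim (fun n x => ofR (psin n x) * u x) _ (fun x => b * n1 (u x))).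
- by apply: integrable_EFinZ; exact: cintg_n1 Ku.1.
- by move=> n; have [_ _] := Mn n; exact.
- move=> n x; apply: le_trans (n1M _ _) _; rewrite n1_ofR.
  by rewrite ler_wpM2r ?n1_ge0.
- move=> x; apply: cvgMr_tmp; apply/cvgC; split; first exact: nlim.
  exact: cvg_cst.
Qed.

Lemma multiplier_sin (G : dual E) k a : multiplier (fun x => sin (k * G x - a)).
Proof.
have mG : measurable_fun setT (fun x : T => k * G x - a).
  apply: measurable_funB => //; apply: measurable_funM => //.
  exact: measurable_linf (dual_linear _).
split.
- by have [] := cmfun_expi mG.
- by exists 1 => x; rewrite ler_norml sin_geN1 sin_le1.
move=> u Ku.
(* The formula of Euler writes the sine as a combination of two characters. *)
rewrite (_ : (fun x => _) = (fun x => (ofRI 0 (-(1/2)) * expi (- a)) * (expi ((k *: G) x) * u x) +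
    (ofRI 0 (1/2) * expi a) * (expi ((- (k *: G)) x) * u x))).
  by apply: K_D; apply: K_Z; exact: K_exp.
apply/funext => x; rewrite !mulrA -mulrDl; congr (_ * _).
rewrite dualN !dualZ sinB; apply: C_eq; rewrite !cE !(cosN, sinN).
  by field.
by ring.
Qed.

(** Iterating the cubic polynomial on sin(k(G - a)) gives its sign in the limit. For k = 1/(n + 1)
    this is the sign of G - a as soon as |k(G - a)| < 2, since 2 <= pi. *)
Lemma multiplier_sg (G : dual E) a : multiplier (fun x => Num.sg (G x - a)).
Proof.
have sgsin k : multiplier (fun x => Num.sg (sin (k * G x - k * a))).
  have s1 x : `|sin (k * G x - k * a)| <= 1 by rewrite ler_norml sin_geN1 sin_le1.
  apply: (@multiplier_lim (fun n x => iter n (fun t => (3 * t - t ^+ 3) / 2) (sin (k * G x - k * a))) _ 1).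
  - elim=> [|n IH]; first exact: multiplier_sin.
    rewrite (_ : (fun x => _) = (fun x => (3 / 2) * (iter n (fun t => (3 * t - t ^+ 3) / 2) (sin (k * G x - k * a)))
      + ((- (1 / 2)) * ((iter n (fun t => (3 * t - t ^+ 3) / 2) (sin (k * G x - k * a))) *
      ((iter n (fun t => (3 * t - t ^+ 3) / 2) (sin (k * G x - k * a))) *
       (iter n (fun t => (3 * t - t ^+ 3) / 2) (sin (k * G x - k * a)))))))).
      apply: multiplierD; first by apply: multiplierM => //; exact: multiplier_cst.
      apply: multiplierM; first exact: multiplier_cst.
      by apply: multiplierM => //; exact: multiplierM.
    by apply/funext => x /=; field.
  - by move=> n x; exact: (smoothstep_cvg (s1 x)).1.
  - by move=> x; exact: (smoothstep_cvg (s1 x)).2.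
apply: (@multiplier_lim (fun n x => Num.sg (sin (n.+1%:R^-1 * G x - n.+1%:R^-1 * a))) _ 1) => //.
- by move=> n x; rewrite normr_sg; case: (_ != 0).
move=> x; apply: cvg_near_cst; near=> n; rewrite -mulrBr.
have n0 : 0 < n.+1%:R^-1 :> R by rewrite invr_gt0.
have small : n.+1%:R^-1 * `|G x - a| < 2.
  rewrite mulrC ltr_pdivrMr// -ltr_pdivrMl//.
  apply: lt_le_trans (truncnS_gt _) _; rewrite ler_nat ltnS.
  near: n; exact: nbhs_infty_ge.
have pi2 := @pi_ge2 R.
case: (ltgtP (G x - a) 0) => h.
- have h0 : n.+1%:R^-1 * (G x - a) < 0 by rewrite pmulr_rlt0.
  rewrite (ltr0_sg h) ltr0_sg// -[X in sin X]opprK sinN oppr_lt0 sin_gt0_pi// oppr_gt0 h0/=.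
  by rewrite -mulrN; apply: lt_le_trans pi2; rewrite ltr0_norm in small.
- have h0 : 0 < n.+1%:R^-1 * (G x - a) by rewrite pmulr_rgt0.
  rewrite (gtr0_sg h) gtr0_sg// sin_gt0_pi// h0/=.
  by apply: lt_le_trans pi2; rewrite gtr0_norm in small.
- by rewrite h mulr0 sin0 sgr0.
Unshelve. all: by end_near.
Qed.

Let S : set (set T) := [set A | measurable A /\ multiplier (\1_A : T -> R)].

Let S_sigma : sigma_algebra setT S.
Proof.
split.
- by split=> //; rewrite indic0; exact: multiplier_cst.
- move=> A [mA MA]; rewrite setTD; split; first exact: measurableC.
  rewrite (_ : \1_(~` A) = (fun x => 1 + (- 1) * \1_A x) :> (T -> R)).
    apply: multiplierD; first exact: multiplier_cst.
    by apply: multiplierM => //; exact: multiplier_cst.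
  by apply/funext => x; rewrite !indicE in_setC; case: (x \in A) => /=; ring.
move=> A SA; split; first by apply: bigcupT_measurable => n; case: (SA n).
(* The complement of a finite union has as indicator the product of the functions 1 - 1_(A i); these
   decrease to the indicator of the complement of the whole union. *)
have Mn n : multiplier (\1_(~` \bigcup_(i in `I_n) A i) : T -> R).
  elim: n => [|n IH].
    by rewrite II0 bigcup_set0 setC0 indicT; exact: multiplier_cst.
  rewrite (_ : \1_(_) = (fun x => \1_(~` \bigcup_(i in `I_n) A i) x * (1 + (- 1) * \1_(A n) x)) :> (T -> R)).
    apply: multiplierM => //; apply: multiplierD; first exact: multiplier_cst.
    by apply: multiplierM; [exact: multiplier_cst|case: (SA n)].
  apply/funext => x; rewrite bigcup_mkord big_ord_recr -bigcup_mkord setCU.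
  by rewrite !indicE in_setI [x \in ~` A n]in_setC; case: (x \in A n); case: (_ \in _) => /=; ring.
have -> : \1_(\bigcup_n A n) = (fun x => 1 + (- 1) * \1_(~` \bigcup_n A n) x) :> (T -> R).
  by apply/funext => x; rewrite !indicE in_setC; case: (x \in _) => /=; ring.
apply: multiplierD; first exact: multiplier_cst.
apply: multiplierM; first exact: multiplier_cst.
apply: (multiplier_lim (b := 1) Mn).
  by move=> n x; rewrite indicE; case: (_ \in _); rewrite ?normr1 ?normr0.
move=> x; apply: cvg_near_cst.
have [[i _ Ax]|nAx] := pselect ((\bigcup_n A n) x).
  exists i.+1 => // n /= ni; rewrite !indicE !memNset//.
    by move=> h; apply: h; exists i.
  by move=> h; apply: h; exists i.
exists 0%N => // n _; rewrite !indicE !mem_set// => -[i _ Ai].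
by apply: nAx; exists i.
Qed.

(** The space E with the sigma-algebra [S], so that maps whose preimages have multipliers as
    indicators are exactly handled by the general measurability lemmas, in particular
    [measurable_combination]. *)
Let TS := g_sigma_algebraType (S : set (set (il E))).

Let TS_measurable (A : set TS) : measurable A -> S A.
Proof. by rewrite /TS measurable_g_measurableTypeE//; exact: S_sigma. Qed.

(** A Borel set is not claimed to lie in [S], which is only reached through continuous functionals.
    It is replaced by a member of [S] that agrees with it on the carrier; the vanishing transform of
    the multiplied density is then evaluated at F = 0. *)
Lemma fourier_null (e : nat -> E) (dn : T -> C R) : K dn ->
  l (~` (cspan e : set T)) = 0%E -> forall A, measurable A ->
  cI l (fun x => dn x * ofR (\1_A x)) = 0.
Proof.
move=> Kdn nullW A mA.
have [G hG] := fspan_proj hE e.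
have mG n i : measurable_fun setT (G n i : TS -> R).
  apply: (measurability (@RGenOInfty.G R)); first exact: RGenOInfty.measurableE.
  move=> _ [_ [a ->] <-]; rewrite setTI; apply: sub_sigma_algebra; split.
    rewrite -[X in measurable X]setTI; apply: (measurable_linf (dual_linear (G n i))) => //.
  (* With g = sg(G - a), the indicator of G > a is (g + g^2)/2. *)
  rewrite (_ : \1_(_) = (fun x => (1 / 2) * (Num.sg (G n i x - a) +
     Num.sg (G n i x - a) * Num.sg (G n i x - a))) :> (T -> R)).
    apply: multiplierM; first exact: multiplier_cst.
    by apply: multiplierD; [|apply: multiplierM]; exact: multiplier_sg.
  apply/funext => x; rewrite indicE.
  have -> : (x \in G n i @^-1` `]a, +oo[) = (a < G n i x).
    apply/idP/idP => [/set_mem|h]; first by rewrite /= in_itv/= andbT.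
    by apply: mem_set; rewrite /= in_itv/= andbT.
  case: (ltgtP (G n i x) a) => h.
  - by rewrite ltr0_sg ?subr_lt0//=; ring.
  - by rewrite gtr0_sg ?subr_gt0//=; field.
  - by rewrite h subrr sgr0 /=; ring.
pose p n (x : TS) : T := \sum_(i < n) G n i x *: e i.
have mp n : measurable_fun setT (p n) by apply: measurable_combination => i; exact: mG.
(* The projections [p n] fix each point of the span for large n, so on the span this inferior limit
   of preimages of [A] is [A]. *)
pose B : set TS := \bigcup_N \bigcap_(n in [set n | (N <= n)%N]) p n @^-1` A.
have SB : S B.
  apply: TS_measurable; apply: bigcupT_measurable => N; apply: bigcap_measurable => [|n _].
    by exists N => /=.
  by rewrite -[X in measurable X]setTI; exact: mp.
have AB x : cspan e x -> A x <-> B x.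
  move=> [n0 _ x0]; have pE n : (n0 <= n)%N -> p n x = x by move=> n0n; apply: hG; exact: fspan_le x0.
  split=> [Ax|[N _ h]].
    by exists n0 => // n /= /pE; rewrite /preimage /= => ->.
  by have := h (maxn n0 N) (leq_maxr _ _); rewrite /preimage /= pE ?leq_maxl.
have mW : measurable (cspan e : set T) by exact: cspan_measurable.
have iE x : cspan e x -> \1_A x = \1_B x :> R.
  move=> Wx; rewrite !indicE; have -> // : (x \in A) = (x \in B).
  by apply/idP/idP => /set_mem h; apply: mem_set; exact/(AB x Wx).
have [mB [_ _ MB]] := SB; have [_ /(_ 0) h] := MB dn Kdn.
rewrite -[RHS]h /cI /Rintegral; congr (ofRI (fine _) (fine _)).
  by apply: (eq_integral_null mW nullW) => x Wx; rewrite expi0 mulr1 iE// mulrC.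
by apply: (eq_integral_null mW nullW) => x Wx; rewrite expi0 mulr1 iE// mulrC.
Qed.

End fourier_injectivity.

Section fourier_measures.
Context {R : realType} {E : tvsType R}.
Hypothesis hE : hausdorff_space E.
Implicit Types mu nu : set (ilB E) -> C R.

Lemma tvint_cst d (T : measurableType d) (rho : set T -> C R) (k : R) : is_cmeasure rho -> 0 <= k ->
  (\int[total_var rho]_x k%:E < +oo)%E.
Proof.
move=> hr k0; have [l [dn D]] := cmeasure_density hr.
by apply: (density_tvint D (w := fun=> k)) => //; exact: finite_measure_integrable_cst.
Qed.

Lemma tvint_bounded d (T : measurableType d) (rho : set T -> C R) (w : T -> R) (k : R) :
  is_cmeasure rho -> measurable_fun setT w -> (forall x, 0 <= w x <= k) ->
  (\int[total_var rho]_x (w x)%:E < +oo)%E.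
Proof.
move=> hr mw wk; have [l [dn D]] := cmeasure_density hr.
apply: (density_tvint D) => [|x]; last by case/andP: (wk x).
apply: (@integrable_EFin_le _ _ _ _ _ (fun=> k)) => //.
  exact: finite_measure_integrable_cst.
by move=> x; case/andP: (wk x) => h1 h2; rewrite ger0_norm.
Qed.

Lemma cmfun_weyl (F : dual E) : cmfun (fun x : ilB E => expi (F x)).
Proof. by apply: cmfun_expi; exact: measurable_linf (dual_linear _). Qed.

Lemma tvint_weyl mu (F : dual E) : is_cmeasure mu ->
  (\int[total_var mu]_x (n1 (expi (F x)))%:E < +oo)%E.
Proof.
move=> hmu; apply: (@tvint_bounded _ _ _ _ 2) => // [|x].
  by apply: measurable_n1; exact: cmfun_weyl.
by rewrite n1_ge0 n1_expi.
Qed.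

Lemma fourierD mu nu F : is_cmeasure mu -> is_cmeasure nu ->
  fourier (fun A => mu A + nu A) F = fourier mu F + fourier nu F.
Proof.
move=> hmu hnu; apply: cint_addm => //; first exact: cmfun_weyl.
  exact: tvint_weyl.
exact: tvint_weyl.
Qed.

Lemma fourierZ c mu F : is_cmeasure mu -> fourier (fun A => c * mu A) F = c * fourier mu F.
Proof.
move=> hmu; have [_ h _] := scale_cmeasure_spec c hmu; apply: h; first exact: cmfun_weyl.
exact: tvint_weyl.
Qed.

Lemma ME_cmeasure mu : ME mu -> is_cmeasure mu. Proof. by case. Qed.

Lemma ME_carrier mu : ME mu -> exists e, total_var mu (~` (cspan e : set (ilB E))) = 0%E.
Proof. by rewrite MEP// => -[_ [_ [e _ <-] h]]; exists e. Qed.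

Lemma ME_carrier2 mu nu : ME mu -> ME nu -> exists e,
  total_var mu (~` (cspan e : set (ilB E))) = 0%E /\ total_var nu (~` (cspan e : set (ilB E))) = 0%E.
Proof.
move=> /ME_carrier[e1 h1] /ME_carrier[e2 h2]; have [e [s1 s2]] := cspan_cover2 e1 e2.
exists e; split; [apply: total_var_carrier_sub h1|apply: total_var_carrier_sub h2] => //;
  exact: cspan_measurable.
Qed.

(** The difference of the measures has a density with vanishing transform and a common countable
    span as carrier. Equality is asserted on measurable sets, where alone measures are
    determined. *)
Lemma fourier_inj mu nu : ME mu -> ME nu -> fourier mu = fourier nu ->
  forall A, measurable A -> mu A = nu A.
Proof.
move=> Mmu Mnu e.
have hmu := ME_cmeasure Mmu; have hnu := ME_cmeasure Mnu.
have [hNnu _ _] := scale_cmeasure_spec (-1) hnu.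
pose rho A := mu A + -1 * nu A; have hrho : is_cmeasure rho by exact: cmeasureD.
have r0 F : fourier rho F = 0.
  apply: etrans (fourierD F hmu hNnu) _; rewrite (fourierZ (-1) F hnu) e.
  by rewrite mulN1r subrr.
have [u [u1 u2]] := ME_carrier2 Mmu Mnu.
have mW : measurable (cspan u : set (ilB E)) by exact: cspan_measurable.
have mWC := measurableC mW.
have u0 : total_var rho (~` (cspan u : set (ilB E))) = 0%E.
  apply: null_total_var => // B mB BW.
  by rewrite /rho (total_var_null mWC u1 mB BW) (total_var_null mWC u2 mB BW) mulr0 addr0.
have [l [dn D]] := cmeasure_density hrho.
move=> A mA; apply/eqP; rewrite -subr_eq0 -mulN1r -[_ + _]/(rho A) (densityE D)//; apply/eqP.
apply: (fourier_null hE (e := u)) => //; last exact: (density_null D).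
split; first exact: cintg_density D.
move=> F; rewrite -[RHS](r0 F); apply/esym; apply: (cint_density D); first exact: cmfun_weyl.
apply: (density_integrable D) => [|x|]; [|exact: n1_ge0|exact: tvint_weyl].
by apply: measurable_n1; exact: cmfun_weyl.
Qed.

End fourier_measures.

(** * Directional derivatives *)

Section elementary_limits.
Context {R : realType}.

Lemma lipschitz_derive (f df : R -> R) : (forall x : R, is_derive x 1 f (df x)) ->
  (forall x, `|df x| <= 1) -> forall a b, `|f a - f b| <= `|a - b|.
Proof.
move=> fd d1; have lt a b : a < b -> `|f a - f b| <= `|a - b|.
  move=> ab; have cf : {within `[a, b], continuous f}.
    apply: continuous_subspaceT => x; apply: differentiable_continuous.
    by apply/derivable1_diffP; exact: ex_derive.
  have [c _] := MVT ab (fun x _ => fd x) cf.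
  rewrite distrC => ->; rewrite normrM [in leRHS]distrC.
  by rewrite ler_piMl.
move=> a b; case: (ltgtP a b) => [/lt//|/lt|->]; last by rewrite !subrr.
by rewrite distrC [in leRHS]distrC.
Qed.

Lemma cos_lip (a b : R) : `|cos a - cos b| <= `|a - b|.
Proof.
apply: (lipschitz_derive (df := fun x => - sin x)) => x.
by rewrite normrN ler_norml sin_geN1 sin_le1.
Qed.

Lemma sin_lip (a b : R) : `|sin a - sin b| <= `|a - b|.
Proof.
apply: (lipschitz_derive (df := cos)) => x.
by rewrite ler_norml cos_geN1 cos_le1.
Qed.

Lemma cvg_lip (f : R -> R) (u : nat -> R) l : (forall a b, `|f a - f b| <= `|a - b|) ->
  u n @[n --> \oo] --> l -> f (u n) @[n --> \oo] --> f l.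
Proof.
move=> fl ul; apply/cvgrPdist_lt => d d0; near=> n.
by apply: le_lt_trans (fl _ _) _; near: n; move/cvgrPdist_lt : ul; exact.
Unshelve. all: by end_near.
Qed.

Lemma derive_seq (f : R -> R) (df a : R) (u : nat -> R) : is_derive (0 : R) 1 f df ->
  (forall n, u n != 0) -> u n @[n --> \oo] --> (0 : R) ->
  (u n)^-1 * (f (u n * a) - f 0) @[n --> \oo] --> a * df.
Proof.
move=> fd u0 uc.
(* The substitution h = u_n a must avoid h = 0, so the direction a = 0 is separate. *)
have [->|a0] := eqVneq a 0.
  by rewrite mul0r; under eq_fun do rewrite mulr0 subrr mulr0; exact: cvg_cst.
have h : (fun h : R => h^-1 * (f h - f 0)) @ (0 : R)^' --> df.
  have [d1 d2] := fd; rewrite -d2; move: d1.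
  rewrite /derivable /derive (_ : (fun h : R => h^-1 *: _) = (fun h : R => h^-1 * (f h - f 0)))//.
  by apply/funext => t /=; rewrite /GRing.scale/= mulr1 addr0.
have /cvgr_dnbhsP/(_ (fun n => u n * a)) h' := h.
have : (u n * a)^-1 * (f (u n * a) - f 0) @[n --> \oo] --> df.
  apply: h'; split=> [n|]; first by rewrite mulf_neq0.
  by rewrite -[X in _ --> X](mul0r a); apply: cvgM => //; exact: cvg_cst.
move=> /(cvgM (cvg_cst a)); apply: cvg_trans; apply: near_eq_cvg; near=> n.
by rewrite /= invfM [(u n)^-1 / a]mulrC -mulrA mulVKf.
Unshelve. all: by end_near.
Qed.

Lemma cvg_sum_ord (u : nat -> nat -> R) (l : nat -> R) N :
  (forall i, (i < N)%N -> u i n @[n --> \oo] --> l i) ->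
  \sum_(i < N) u i n @[n --> \oo] --> \sum_(i < N) l i.
Proof.
elim: N => [_|N IH h].
  by rewrite big_ord0; under eq_fun do rewrite big_ord0; exact: cvg_cst.
rewrite big_ord_recr; under eq_fun do rewrite big_ord_recr.
by apply: cvgD; [apply: IH => i iN; apply: h; exact: ltnW|exact: h].
Qed.

(** Dominated convergence concerns sequences; difference quotients are therefore tested along
    sequences of nonzero increments. *)
Lemma cvg_dnbhs_seqC (f : R -> C R) (z : C R) :
  (forall u : nat -> R, (forall n, u n != 0) -> u n @[n --> \oo] --> (0 : R) ->
     f (u n) @[n --> \oo] --> z) -> f t @[t --> (0 : R)^'] --> z.
Proof.
move=> h; apply/cvgC; split; apply/cvgr_dnbhsP => u [u0 uc];
  by have /cvgC[] := h u u0 uc.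
Qed.

End elementary_limits.

Section dual_topology.
Context {R : realType} {E : tvsType R}.

Lemma dual_near (F0 : dual E) (x : E) e : 0 < e ->
  nbhs F0 [set F : dual E | `|F0 x - F x| < e].
Proof.
move=> e0; have c := @initial_continuous _ _ (fun F : dual E => (dual_fun F : {ptws E -> R^o})).
have := c F0 _ (@pointwise_cvg_entourage _ _ x (dual_fun F0 : {ptws E -> R^o}) _ (entourage_ball R^o (PosNum e0))).
done.
Qed.

Lemma dual_near_seq (F0 : dual E) (x : nat -> E) e n : 0 < e ->
  nbhs F0 [set F : dual E | forall i, (i < n)%N -> `|F0 (x i) - F (x i)| < e].
Proof.
move=> e0; elim: n => [|n IH]; first exact: filterE.
near=> F => i; rewrite ltnS leq_eqVlt => /orP[/eqP->|].
  by near: F; exact: dual_near.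
by move: i; near: F.
Unshelve. all: by end_near.
Qed.

End dual_topology.

Section fourier_density.
Context {R : realType} {E : tvsType R}.
Hypothesis hE : hausdorff_space E.
Variables (mu : set (ilB E) -> C R).
Hypothesis Mmu : ME mu.
Implicit Types h : E -> C R.

(** The transform of the measure with density [h] against [mu]. Directional derivatives stay in this
    class, with [h] multiplied by iG. *)
Definition wfourier h : dual E -> C R := fun F => cint mu (fun f => h f * expi (F f)).

(** Convergence is assumed on the carrier only; the integrands are multiplied by its indicator so
    that they converge at every point, to a measurable limit. *)
Lemma wfourier_cvg e (g : nat -> E -> C R) (g0 : E -> C R) (w : E -> R) :
  measurable_fun setT (w : ilB E -> R) -> (forall x, 0 <= w x) ->
  (\int[total_var mu]_x (w x)%:E < +oo)%E ->
  (forall n, cmfun (g n : ilB E -> C R)) -> (forall n x, n1 (g n x) <= w x) ->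
  total_var mu (~` (cspan e : set (ilB E))) = 0%E ->
  (forall x, cspan e x -> g n x @[n --> \oo] --> g0 x) ->
  cint mu (g n) @[n --> \oo] --> cint mu g0.
Proof.
move=> mw w0 iw mg gw he gl; have hmu := ME_cmeasure Mmu.
have [l [dn D]] := cmeasure_density hmu.
have mW : measurable (cspan e : set (ilB E)) by exact: cspan_measurable.
have il := density_integrable D mw w0 iw.
pose k n (x : ilB E) := ofR (\1_(cspan e : set (ilB E)) x) * g n x.
pose k0 (x : ilB E) := ofR (\1_(cspan e : set (ilB E)) x) * g0 x.
have one x : cspan e x -> ofR (\1_(cspan e : set (ilB E)) x) = 1 :> C R.
  by move=> Wx; rewrite indicE mem_set.
have zero x : ~ cspan e x -> ofR (\1_(cspan e : set (ilB E)) x) = 0 :> C R.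
  by move=> Wx; rewrite indicE memNset.
have kw n x : n1 (k n x) <= w x.
  have [Wx|Wx] := pselect (cspan e x); rewrite /k; first by rewrite one// mul1r.
  by rewrite zero// mul0r n10.
have mk n : cmfun (k n).
  by apply: cmfunM => //; apply: cmfun_ofR; exact: measurable_indic.
have kc x : k n x @[n --> \oo] --> k0 x.
  have [Wx|Wx] := pselect (cspan e x); rewrite /k /k0.
    by rewrite one// mul1r; under eq_fun do rewrite mul1r; exact: gl.
  by rewrite zero// mul0r; under eq_fun do rewrite mul0r; exact: cvg_cst.
have ik n : l.-integrable setT (EFin \o (fun x => n1 (k n x))).
  apply: (@integrable_EFin_le _ _ _ _ _ (w : ilB E -> R)) => //; first exact: measurable_n1.
  by move=> x; rewrite ger0_norm ?n1_ge0.
have [ik0 _] := cI_cvg mk il kw kc.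
have cE n : cint mu (g n) = cI l (fun x => dn x * k n x).
  rewrite -(cint_density D (mk n) (ik n)).
  by apply: (cint_null hmu mW he) => x Wx; rewrite /k one// mul1r.
have cE0 : cint mu g0 = cI l (fun x => dn x * k0 x).
  rewrite -(cint_density D (cintg_mfun ik0) (cintg_n1 ik0)).
  by apply: (cint_null hmu mW he) => x Wx; rewrite /k0 one// mul1r.
rewrite cE0; under eq_fun do rewrite cE.
have i4 : l.-integrable setT (EFin \o (fun x => 4 * w x)) by exact: integrable_EFinZ.
have m4 n : cmfun (fun x => dn x * k n x) by apply: cmfunM => //; exact: density_mfun D.
have b4 n x : n1 (dn x * k n x) <= 4 * w x.
  apply: le_trans (n1M _ _) _.
  by apply: ler_pM; rewrite ?n1_ge0 ?(density_le4 D).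
have c4 x : dn x * k n x @[n --> \oo] --> dn x * k0 x by apply: cvgMl_tmp.
by have [_] := cI_cvg m4 i4 b4 c4.
Qed.

(** The weak topology need not be metrizable, but [mu] lives on a countable span, so only the values
    of F at the [e i] matter. If no neighbourhood given by the first n of them at scale 1/(n + 1)
    worked, a choice of counterexamples would converge pointwise on the span and contradict
    dominated convergence. *)
Lemma wfourier_continuous h : cmfun (h : ilB E -> C R) ->
  (\int[total_var mu]_x (n1 (h x))%:E < +oo)%E -> continuous (wfourier h).
Proof.
move=> mh ih F0; have [e he] := ME_carrier hE Mmu.
apply: (cvgC_n1 (nbhs_filter (F0 : dual E)) (wfourier h) (wfourier h F0)).2 => eps eps0.
have [[n hn]|nh] := pselect (exists n, forall F : dual E,
    (forall i, (i < n)%N -> `|F0 (e i) - F (e i)| < n.+1%:R^-1) ->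
    n1 (wfourier h F0 - wfourier h F) < eps).
  have n0 : 0 < n.+1%:R^-1 :> R by rewrite invr_gt0.
  by near=> F; apply: hn; near: F; exact: dual_near_seq.
exfalso.
have /choice[G hG] n : exists F : dual E,
    (forall i, (i < n)%N -> `|F0 (e i) - F (e i)| < n.+1%:R^-1) /\
    ~ n1 (wfourier h F0 - wfourier h F) < eps.
  apply/not_existsP => H; apply: nh; exists n => F hF.
  by apply/negPn/negP => /negP hh; apply: (H F); split=> //; exact/negP.
have Gc x : cspan e x -> G n x @[n --> \oo] --> (F0 x : R).
  move=> [N _ [a ->]]; rewrite (linf_sum (dual_linear F0)).
  under eq_fun do rewrite (linf_sum (dual_linear _)).
  apply: (cvg_sum_ord (u := fun i n => G n (a i *: e i)) (l := fun i => F0 (a i *: e i))) => i iN; rewrite (linfZ (dual_linear F0)).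
  under eq_fun do rewrite (linfZ (dual_linear _)).
  apply: cvgM; first exact: cvg_cst.
  apply/cvgrPdist_lt => d d0; near=> n.
  apply: (@lt_trans _ _ n.+1%:R^-1).
    apply: (hG n).1; apply: leq_trans iN _.
    by near: n; exact: nbhs_infty_ge.
  by near: n; exact: near_infty_natSinv_lt (PosNum d0).
have [_] := hG 0%N; suff /cvgC_n1/(_ _ eps0)[N _ hN] :
    wfourier h (G n) @[n --> \oo] --> wfourier h F0.
  by move=> _; have [_] := hG N; apply; exact: hN (leqnn N).
apply: (@wfourier_cvg e _ _ (fun x => 2 * n1 (h x))).
- by apply: measurable_funM => //; exact: measurable_n1.
- by move=> x; rewrite mulr_ge0 ?n1_ge0.
- have [l [dn D]] := cmeasure_density (ME_cmeasure Mmu).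
  apply: (density_tvint D) => [|x]; last by rewrite mulr_ge0 ?n1_ge0.
  apply: integrable_EFinZ; apply: (density_integrable D) => //; first exact: measurable_n1.
  by move=> x; exact: n1_ge0.
- by move=> n; apply: cmfunM => //; exact: cmfun_weyl.
- move=> n x; apply: le_trans (n1M _ _) _; rewrite mulrC.
  by apply: ler_pM; rewrite ?n1_ge0 ?n1_expi.
- exact: he.
move=> x Wx; apply: cvgMl_tmp; apply/cvgC; split => /=.
  exact: (cvg_lip (@cos_lip R) (Gc x Wx)).
exact: (cvg_lip (@sin_lip R) (Gc x Wx)).
Unshelve. all: by end_near.
Qed.

End fourier_density.

Section cint_function_linear.
Context d (T : measurableType d) (R : realType) (mu : set T -> C R).
Hypothesis hmu : is_cmeasure mu.
Implicit Types h : T -> C R.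

Definition tvintg h := cmfun h /\ (\int[total_var mu]_x (n1 (h x))%:E < +oo)%E.

Lemma tvintg_density l dn h : is_density mu l dn -> tvintg h -> cintg l h.
Proof.
move=> D [mh ih]; apply: (@cintg_le _ _ _ _ _ (fun x => n1 (h x))) => //.
by apply: (density_integrable D) => // [|x]; [exact: measurable_n1|exact: n1_ge0].
Qed.

Lemma cintg_tvintg l dn h : is_density mu l dn -> cintg l h -> tvintg h.
Proof.
move=> D ih; split; first exact: cintg_mfun ih.
by apply: (density_tvint D) => [|x]; [exact: cintg_n1|exact: n1_ge0].
Qed.

Lemma tvintg_le h (w : T -> R) : cmfun h -> measurable_fun setT w -> (forall x, n1 (h x) <= w x) ->
  (\int[total_var mu]_x (w x)%:E < +oo)%E -> tvintg h.
Proof.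
move=> mh mw hw iw; have [l [dn D]] := cmeasure_density hmu.
have w0 x : 0 <= w x by exact: le_trans (n1_ge0 _) (hw x).
apply: (cintg_tvintg D); apply: (cintg_le mh) hw.
exact: (density_integrable D).
Qed.

Lemma tvintgD h g : tvintg h -> tvintg g -> tvintg (fun x => h x + g x).
Proof.
move=> ih ig; have [l [dn D]] := cmeasure_density hmu.
by apply: (cintg_tvintg D); apply: cintgD; exact: (tvintg_density D).
Qed.

Lemma tvintgZ c h : tvintg h -> tvintg (fun x => c * h x).
Proof.
move=> ih; have [l [dn D]] := cmeasure_density hmu.
by apply: (cintg_tvintg D); apply: cintgZ; exact: (tvintg_density D).
Qed.

Lemma tvintg_bddM h g k : tvintg h -> cmfun g -> (forall x, n1 (g x) <= k) ->
  tvintg (fun x => h x * g x).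
Proof.
move=> ih mg gk; have [l [dn D]] := cmeasure_density hmu.
have ih' := tvintg_density D ih.
apply: (cintg_tvintg D); apply: (@cintg_le _ _ _ _ _ (fun x => k * n1 (h x))).
- exact: cmfunM ih.1 mg.
- by apply: integrable_EFinZ; exact: cintg_n1.
- by move=> x; apply: le_trans (n1M _ _) _; rewrite mulrC ler_wpM2r ?n1_ge0.
Qed.

Lemma cintE_density l dn h : is_density mu l dn -> tvintg h ->
  cint mu h = cI l (fun x => dn x * h x) /\ cintg l (fun x => dn x * h x).
Proof.
move=> D ih; have ih' := tvintg_density D ih; split.
  by rewrite (cint_density D ih.1)//; exact: cintg_n1.
by apply: (cintgM_density D (w := fun x => n1 (h x))) => //; [exact: ih.1|exact: cintg_n1].
Qed.

Lemma cintD h g : tvintg h -> tvintg g ->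
  cint mu (fun x => h x + g x) = cint mu h + cint mu g.
Proof.
move=> ih ig; have [l [dn D]] := cmeasure_density hmu.
have [-> i1] := cintE_density D ih; have [-> i2] := cintE_density D ig.
have [-> _] := cintE_density D (tvintgD ih ig).
by rewrite -cID//; apply: eq_cI => x; rewrite mulrDr.
Qed.

Lemma cintZ c h : tvintg h -> cint mu (fun x => c * h x) = c * cint mu h.
Proof.
move=> ih; have [l [dn D]] := cmeasure_density hmu.
have [-> i1] := cintE_density D ih; have [-> _] := cintE_density D (tvintgZ c ih).
by rewrite -cIZ//; apply: eq_cI => x; rewrite mulrCA.
Qed.

Lemma eq_cint h g : (forall x, h x = g x) -> cint mu h = cint mu g.
Proof. by move=> hg; congr cint; apply/funext. Qed.

End cint_function_linear.

Section fourier_derivative.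
Context {R : realType} {E : tvsType R}.
Hypothesis hE : hausdorff_space E.
Variables (mu : set (ilB E) -> C R).
Hypothesis Mmu : ME mu.
Implicit Types h : E -> C R.

Let hmu : is_cmeasure mu. Proof. exact: ME_cmeasure. Qed.

Lemma n1_quotient (u a : R) : u != 0 -> n1 (ofR u^-1 * (expi (u * a) - 1)) <= 2 * `|a|.
Proof.
move=> u0; have u1 : 0 < `|u| by rewrite normr_gt0.
rewrite /n1 !cE !mul0r subr0 addr0 !subr0 !normrM !normfV.
have hc := cos_lip (u * a) 0; have hs := sin_lip (u * a) 0.
rewrite cos0 subr0 normrM in hc; rewrite sin0 !subr0 normrM in hs.
have h1 : `|u|^-1 * `|cos (u * a) - 1| <= `|a| by rewrite ler_pdivrMl.
have h2 : `|u|^-1 * `|sin (u * a)| <= `|a| by rewrite ler_pdivrMl.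
by rewrite (_ : 2 * `|a| = `|a| + `|a|); [exact: lerD|ring].
Qed.

Lemma wfourier_dirder h (G F : dual E) : tvintg mu h ->
  tvintg mu (fun f => 'i * ofR (G f) * h f) ->
  is_dirder (wfourier mu h) F G (wfourier mu (fun f => 'i * ofR (G f) * h f) F).
Proof.
move=> ih iG; apply: cvg_dnbhs_seqC => u u0 uc.
have [e he] := ME_carrier hE Mmu.
have mexp (F' : dual E) : cmfun (fun f : ilB E => expi (F' f)) by exact: cmfun_weyl.
have iexp (F' : dual E) : tvintg mu (fun f => h f * expi (F' f)).
  by apply: (tvintg_bddM hmu ih (mexp F')) => x; exact: n1_expi.
have E1 n : ofR (u n)^-1 * (wfourier mu h (F + u n *: G) - wfourier mu h F) =
    cint mu (fun f => h f * expi (F f) * (ofR (u n)^-1 * (expi (u n * G f) - 1))).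
  have iN := tvintgZ hmu (-1) (iexp F); have iD := tvintgD hmu (iexp (F + u n *: G)) iN.
  transitivity (ofR (u n)^-1 * cint mu (fun f => h f * expi ((F + u n *: G) f) + -1 * (h f * expi (F f)))).
    by congr (_ * _); rewrite cintD// cintZ// mulN1r.
  rewrite -cintZ//; apply: eq_cint => f; rewrite dualD dualZ expiD; ring.
under eq_fun do rewrite E1.
have mG : measurable_fun setT (G : ilB E -> R) by exact: measurable_linf (dual_linear _).
have nG f : n1 ('i * ofR (G f) * h f) = `|G f| * n1 (h f).
  by rewrite -mulrA n1_i /n1 !cE !mul0r subr0 addr0 !normrM mulrDr.
have mh := ih.1.
(* In the majorant 4 = 2 * 2, from [n1_expi] and [n1_quotient]. *)
apply: (@wfourier_cvg _ _ hE _ Mmu e _ _ (fun f => 4 * n1 ('i * ofR (G f) * h f))) => //.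
- apply: measurable_funM => //; apply: measurable_n1; exact: iG.1.
- by move=> f; rewrite mulr_ge0 ?n1_ge0.
- have [l [dn D]] := cmeasure_density hmu.
  apply: (density_tvint D) => [|f]; last by rewrite mulr_ge0 ?n1_ge0.
  by apply: integrable_EFinZ; apply: cintg_n1; exact: (tvintg_density D iG).
- move=> n; apply: cmfunM; first exact: (iexp F).1.
  apply: cmfunM; first exact: cmfun_cst.
  apply: cmfunD; last exact: cmfun_cst.
  by apply: cmfun_expi; apply: measurable_funM.
- move=> n f; rewrite nG (_ : 4 * (`|G f| * n1 (h f)) = (n1 (h f) * 2) * (2 * `|G f|)); last by ring.
  apply: le_trans (n1M _ _) _; apply: ler_pM; rewrite ?n1_ge0//; last exact: n1_quotient.
  by apply: le_trans (n1M _ _) _; rewrite ler_wpM2l ?n1_ge0 ?n1_expi.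
move=> f Wf; rewrite (_ : 'i * _ * _ * _ = h f * expi (F f) * ('i * ofR (G f))); last by ring.
apply: cvgMl_tmp; apply/cvgC; split.
  rewrite !(cE, cRe_i, cIm_i) mul0r mulr0 subr0.
  have := @derive_seq R cos _ (G f) u (is_derive_cos 0) u0 uc; rewrite sin0 oppr0 mulr0 cos0.
  by under [in X in _ -> X]eq_fun do rewrite !cE mul0r subr0.
rewrite !(cE, cRe_i, cIm_i) mul0r mul1r add0r.
have := @derive_seq R sin _ (G f) u (is_derive_sin 0) u0 uc; rewrite cos0 mulr1 sin0.
by under [in X in _ -> X]eq_fun do rewrite !cE mul0r addr0.
Qed.

Variable s : E -> R.
Hypothesis ss : is_seminorm s.

(** The weight is general so that induction on the order works: a derivative along G multiplies the
    weight by iG, which costs one power of [s]. *)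
Lemma Cn_dir_wfourier m h : cmfun (h : ilB E -> C R) ->
  (forall j, (j <= m)%N -> (\int[total_var mu]_f (n1 (h f) * s f ^+ j)%:E < +oo)%E) ->
  Cn_dir (dual_sn s) m (wfourier mu h).
Proof.
have ms : measurable_fun setT (s : ilB E -> R) by exact: measurable_seminorm.
elim: m h => [|m IH] h mh ih.
  split=> //; apply: wfourier_continuous => //.
  by have := ih 0%N isT; under eq_fun do rewrite expr0 mulr1.
have i0 : (\int[total_var mu]_f (n1 (h f))%:E < +oo)%E.
  by have := ih 0%N isT; under eq_fun do rewrite expr0 mulr1.
split; first exact: wfourier_continuous.
move=> G [k k0 Gk].
have mG : measurable_fun setT (G : ilB E -> R) by exact: measurable_linf (dual_linear _).
have mGh : cmfun (fun f : ilB E => 'i * ofR (G f) * h f).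
  by apply: cmfunM => //; apply: cmfunM; [exact: cmfun_cst|exact: cmfun_ofR].
have nG f : n1 ('i * ofR (G f) * h f) = `|G f| * n1 (h f).
  by rewrite -mulrA n1_i /n1 !cE !mul0r subr0 addr0 !normrM mulrDr.
have s0 f : 0 <= s f by exact: seminorm_ge0.
have int j : (j <= m)%N ->
    (\int[total_var mu]_f (n1 ('i * ofR (G f) * h f) * s f ^+ j)%:E < +oo)%E.
  move=> jm; have [l [dn D]] := cmeasure_density hmu.
  have msj i : measurable_fun setT (fun f : ilB E => s f ^+ i) by exact: measurable_funX.
  have ij : l.-integrable setT (EFin \o (fun f => n1 (h f) * s f ^+ j.+1)).
    apply: (density_integrable D); last exact: ih.
      by apply: measurable_funM => //; exact: measurable_n1.
    by move=> f; rewrite mulr_ge0 ?n1_ge0 ?exprn_ge0.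
  apply: (density_tvint D) => [|f]; last by rewrite mulr_ge0 ?n1_ge0 ?exprn_ge0.
  apply: (@integrable_EFin_le _ _ _ _ _ (fun f : ilB E => k * (n1 (h f) * s f ^+ j.+1))).
  - by apply: measurable_funM => //; exact: measurable_n1.
  - exact: integrable_EFinZ.
  - move=> f; rewrite ger0_norm ?mulr_ge0 ?n1_ge0 ?exprn_ge0// nG exprS.
    rewrite (_ : k * _ = (k * s f) * n1 (h f) * s f ^+ j); last by ring.
    by rewrite ler_wpM2r ?exprn_ge0// ler_wpM2r ?n1_ge0.
exists (wfourier mu (fun f => 'i * ofR (G f) * h f)); split; last exact: IH.
move=> F; apply: wfourier_dirder; split => //.
by have := int 0%N isT; under eq_fun do rewrite expr0 mulr1.
Qed.

Lemma fourier_wfourier : fourier mu = wfourier mu (fun=> 1).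
Proof. by apply/funext => F; apply: eq_cint => f; rewrite mul1r. Qed.

Lemma Cn_dir_fourier m : (forall j, (j <= m)%N -> (\int[total_var mu]_f (s f ^+ j)%:E < +oo)%E) ->
  Cn_dir (dual_sn s) m (fourier mu).
Proof.
move=> h; rewrite fourier_wfourier; apply: Cn_dir_wfourier; first exact: cmfun_cst.
by move=> j /h; under [in X in _ -> X]eq_fun do rewrite (n1_ofR 1) normr1 mul1r.
Qed.

End fourier_derivative.

(** * Total differentials *)

Section completion_functionals.
Context {R : realType} {E : tvsType R} {s : E -> R}.
Context {X : completeNormedModType R} {cls : {linear E -> X}}.
Hypothesis Xc : is_completion s cls.

Let clsn f : `|cls f| = s f. Proof. exact: Xc.1. Qed.
Let clsd : dense (range cls). Proof. exact: Xc.2. Qed.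

Lemma ext_unique (L L' : X -> R) : continuous (L : X -> R^o) -> continuous (L' : X -> R^o) ->
  (forall f, L (cls f) = L' (cls f)) -> L = L'.
Proof.
by move=> cL cL' e; apply: (linf_dense_eq clsd cL cL') => _ [f _ <-].
Qed.

(** Bound and prescribed values are coded in one sublinear function, the infimum over f of k|x - cls
    f| + G(f). It is at most k|x| by f = 0 and at most G(f) at [cls f]; applying this to the
    opposite vectors turns both bounds for a linear functional into the claim. *)
Lemma ext_functional (G : E -> R) k : linear (G : E -> R^o) -> 0 <= k ->
  (forall f, `|G f| <= k * s f) ->
  exists2 L : X -> R, linear (L : X -> R^o) &
    (forall x, `|L x| <= k * `|x|) /\ forall f, L (cls f) = G f.
Proof.
move=> lG k0 Gk.
pose A x := [set k * `|x - cls f| + G f | f in [set: E]].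
pose q x := inf (A x).
have A0 x : A x !=set0 by exists (k * `|x - cls 0| + G 0), 0.
have Al x : lbound (A x) (- (k * `|x|)).
  move=> _ [f _ <-]; have := Gk f; rewrite -clsn ler_norml => /andP[h _].
  have : `|cls f| <= `|x - cls f| + `|x| by rewrite -(distrC (cls f) x) -{1}(subrK x (cls f)) ler_normD.
  move=> /(ler_wpM2l k0); rewrite mulrDr; lra.
have hA x : has_lbound (A x) by exists (- (k * `|x|)).
have qle x f : q x <= k * `|x - cls f| + G f by apply: ge_inf => //; exists f.
have qge x a : (forall f, a <= k * `|x - cls f| + G f) -> a <= q x.
  by move=> h; apply: lb_le_inf => // _ [f _ <-].
have qZ t x : 0 < t -> q (t *: x) <= t * q x.
  move=> t0; rewrite -ler_pdivrMl//; apply: qge => f; rewrite ler_pdivrMl//.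
  apply: le_trans (qle _ (t *: f)) _.
  by rewrite linearZ -scalerBr normrZ (gtr0_norm t0) (linfZ lG) mulrDr mulrCA.
have sq : sublinear q.
  split=> [x y|t x t0].
    rewrite -lerBlDr; apply: (qge) => f; rewrite lerBlDr -lerBlDl; apply: (qge) => g.
    rewrite lerBlDl; apply: le_trans (qle _ (f + g)) _.
    rewrite linearD (linfD lG) (_ : x + y - (cls f + cls g) = (x - cls f) + (y - cls g)); last first.
      by rewrite opprD addrACA.
    have := ler_wpM2l k0 (ler_normD (x - cls f) (y - cls g)); rewrite mulrDr; lra.
  apply/eqP; rewrite eq_le qZ//= mulrC -ler_pdivlMr// mulrC.
  by apply: le_trans (qZ _ _ _); rewrite ?invr_gt0// scalerA mulVf ?gt_eqF// scale1r.
have [L lL Lq] := Hahn_Banach sq; exists L => //; split.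
  have le x : L x <= k * `|x|.
    by apply: le_trans (Lq x) _; apply: le_trans (qle x 0) _; rewrite linear0 subr0 (linf0 lG) addr0.
  move=> x; rewrite ler_norml le andbT; have := le (- x); rewrite (linfN lL) normrN; lra.
have le f : L (cls f) <= G f.
  by apply: le_trans (Lq _) _; apply: le_trans (qle _ f) _; rewrite subrr normr0 mulr0 add0r.
move=> f; apply/eqP; rewrite eq_le le/=.
by have := le (- f); rewrite linearN (linfN lL) (linfN lG) lerN2.
Qed.

Variable sigma : {biscalar E}.
Hypothesis sigma_le : exists2 c : R, 0 < c & forall f g : E, `|sigma f g| <= c * s f * s g.

(** The form is extended one variable at a time. Density of the classes makes the first extension
    unique, hence linear in [f], so that [ext_functional] applies again for each fixed [y]. *)
Lemma sigma_ext_exists : exists S : X -> X -> R, [/\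
  exists2 c : R, 0 <= c & forall x y, `|S x y| <= c * `|x| * `|y|,
  forall y, linear (S^~ y : X -> R^o), forall x, linear (S x : X -> R^o) &
  forall f g, S (cls f) (cls g) = sigma f g].
Proof.
have [c c0 hc] := sigma_le.
have s0 f : 0 <= s f by rewrite -clsn.
have /choice[La hLa] f : exists La : X -> R, [/\ linear (La : X -> R^o),
    (forall x, `|La x| <= c * s f * `|x|) & forall g, La (cls g) = sigma f g].
  have lf : linear (sigma f : E -> R^o) by move=> a x y; rewrite linearPr.
  have k0 : 0 <= c * s f by rewrite mulr_ge0// ltW.
  by have [L lL [Lk Lc]] := ext_functional lf k0 (hc f); exists L.
have lLa y : linear ((fun f => La f y) : E -> R^o).
  move=> a f g; have [l1 b1 e1] := hLa f; have [l2 b2 e2] := hLa g.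
  have [l3 b3 e3] := hLa (a *: f + g).
  suff -> : La (a *: f + g) = (fun y => a * La f y + La g y) by [].
  apply: ext_unique.
  - exact: linf_bounded_continuous b3.
  - move=> x; apply: cvgD; last exact: (linf_bounded_continuous l2 b2).
    by apply: cvgMr_tmp || apply: cvgMl_tmp; exact: (linf_bounded_continuous l1 b1).
  - by move=> h; rewrite e1 e2 e3 linearPl.
have /choice[T hT] y : exists T : X -> R, [/\ linear (T : X -> R^o),
    (forall x, `|T x| <= (c * `|y|) * `|x|) & forall f, T (cls f) = La f y].
  have k0 : 0 <= c * `|y| by rewrite mulr_ge0// ltW.
  have b f : `|La f y| <= (c * `|y|) * s f.
    by have [_ /(_ y) h _] := hLa f; apply: le_trans h _; rewrite -!mulrA (mulrC (s f)).
  by have [L lL [Lk Lc]] := ext_functional (lLa y) k0 b; exists L.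
exists (fun x y => T y x); split.
- exists c; first exact: ltW.
  by move=> x y; have [_ h _] := hT y; rewrite -mulrA (mulrC `|x|) mulrA.
- by move=> y; have [] := hT y.
- move=> x a y y'; have [l1 b1 e1] := hT y; have [l2 b2 e2] := hT y'.
  have [l3 b3 e3] := hT (a *: y + y').
  suff -> : T (a *: y + y') = (fun x => a * T y x + T y' x) by [].
  apply: ext_unique.
  - exact: linf_bounded_continuous b3.
  - move=> z; apply: cvgD; last exact: (linf_bounded_continuous l2 b2).
    by apply: cvgMr_tmp || apply: cvgMl_tmp; exact: (linf_bounded_continuous l1 b1).
  - by move=> h; rewrite e1 e2 e3; have [l _ _] := hLa h; rewrite (linfD l) (linfZ l).
- by move=> f g; have [_ _ ->] := hT (cls g); have [_ _ ->] := hLa f.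
Qed.

Lemma bilinear_bounded_continuous (S : X -> X -> R) c : 0 <= c ->
  (forall x y, `|S x y| <= c * `|x| * `|y|) ->
  (forall y, linear (S^~ y : X -> R^o)) -> (forall x, linear (S x : X -> R^o)) ->
  continuous (fun p : X * X => S p.1 p.2 : R^o).
Proof.
move=> c0 Sc l1 l2 [x0 y0]; apply/cvgrPdist_lt => e e0 /=.
(* [M] dominates both c|x0| and c(|y0| + 1), where |y0| + 1 bounds the second component within
   distance 1; each of the two error terms is then at most M d <= e/4. *)
pose M := c * (`|x0| + `|y0| + 1) + 1.
have M0 : 0 < M by rewrite ltr_wpDl// mulr_ge0// !addr_ge0.
pose d := Num.min 1 (e / (4 * M)).
have d0 : 0 < d by rewrite lt_min ltr01 divr_gt0// mulr_gt0.
near=> p; have pd : `|(x0, y0) - p| < d by near: p; exact: cvgr_dist_lt.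
have h1 : `|x0 - p.1| < d by apply: le_lt_trans pd; rewrite prod_normE le_max lexx.
have h2 : `|y0 - p.2| < d by apply: le_lt_trans pd; rewrite prod_normE le_max lexx orbT.
have d1 : d <= 1 by rewrite ge_min lexx.
have d2 : d <= e / (4 * M) by rewrite ge_min lexx orbT.
have -> : S x0 y0 - S p.1 p.2 = S (x0 - p.1) p.2 + S x0 (y0 - p.2).
  by rewrite (linfB (l1 p.2)) (linfB (l2 x0)); ring.
have p2 : `|p.2| <= `|y0| + 1.
  have : `|p.2| <= `|p.2 - y0| + `|y0| by rewrite -{1}(subrK y0 p.2) ler_normD.
  by rewrite distrC => h; apply: le_trans h _; lra.
apply: le_lt_trans (ler_normD _ _) _.
have b1 : `|S (x0 - p.1) p.2| <= M * d.
  apply: le_trans (Sc _ _) _; rewrite -mulrA mulrCA mulrC; apply: ler_pM; rewrite ?mulr_ge0//; last exact: ltW.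
  rewrite /M; apply: le_trans (ler_wpM2l c0 p2) _; have := mulr_ge0 c0 (normr_ge0 x0); rewrite !mulrDr; lra.
have b2 : `|S x0 (y0 - p.2)| <= M * d.
  apply: le_trans (Sc _ _) _; apply: ler_pM; rewrite ?mulr_ge0//; last exact: ltW.
  rewrite /M; have := mulr_ge0 c0 (normr_ge0 y0); rewrite !mulrDr; lra.
have b3 : M * d <= e / 4.
  apply: le_trans (ler_wpM2l (ltW M0) d2) _; rewrite (_ : M * _ = e / 4)//.
  by field; rewrite gt_eqF.
by apply: le_lt_trans (lerD b1 b2) _; lra.
Unshelve. all: by end_near.
Qed.

Lemma sigma_extP (S : X -> X -> R) : continuous (fun p : X * X => S p.1 p.2 : R^o) ->
  (forall f g, S (cls f) (cls g) = sigma f g) -> sigma_ext cls sigma = S.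
Proof.
move=> cS eS; rewrite /sigma_ext; apply: xget_subset1 => // S1 S2 [c1 e1] [c2 e2].
have pc (S' : X -> X -> R) : continuous (fun p : X * X => S' p.1 p.2 : R^o) ->
    (forall x, continuous (S' x : X -> R^o)) /\ (forall y, continuous (S'^~ y : X -> R^o)).
  move=> cS'; split=> [x y|y x].
    by apply: (cvg_comp2 (cvg_cst x) cvg_id (cS' (x, y))).
  by apply: (cvg_comp2 cvg_id (cvg_cst y) (cS' (x, y))).
have [a1 b1] := pc _ c1; have [a2 b2] := pc _ c2.
apply/funext => x; apply/funext => y.
have e : S1^~ y = S2^~ y.
  apply: ext_unique => // f.
  have e : S1 (cls f) = S2 (cls f) by apply: ext_unique => // g; rewrite e1 e2.
  exact: (congr1 (fun T => T y) e).
exact: (congr1 (fun T => T x) e).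
Qed.

End completion_functionals.

Section total_differential.
Context {R : realType} {E : tvsType R} {s : E -> R}.
Context {X : completeNormedModType R} {cls : {linear E -> X}}.
Hypothesis ss : is_seminorm s.
Hypothesis sc : continuous (s : E -> R^o).
Hypothesis Xc : is_completion s cls.

Lemma dual_extP (G : dual E) (L : X -> R) : linear (L : X -> R^o) -> continuous (L : X -> R^o) ->
  (forall f, L (cls f) = G f) -> dual_ext cls G = L.
Proof.
move=> lL cL eL; rewrite /dual_ext; apply: xget_subset1 => // L1 L2 [_ c1 e1] [_ c2 e2].
by apply: (ext_unique Xc) => // f; rewrite e1 e2.
Qed.

Lemma dual_ext_spec (G : dual E) : dual_sn s G -> exists2 k, 0 <= k &
  [/\ linear (dual_ext cls G : X -> R^o), forall x, `|dual_ext cls G x| <= k * `|x| &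
   forall f, dual_ext cls G (cls f) = G f].
Proof.
move=> [k k0 Gk]; exists k => //.
have [L lL [Lk Lc]] := ext_functional Xc (dual_linear G) k0 Gk.
by rewrite (dual_extP lL _ Lc)//; exact: linf_bounded_continuous Lk.
Qed.

(** Continuity of [s] enters here: a ball of [s] is a neighbourhood of 0 in E, so a bounded
    functional on the completion restricts to a continuous one on E. *)
Lemma functional_dual (L : X -> R) k : 0 <= k -> linear (L : X -> R^o) ->
  (forall x, `|L x| <= k * `|x|) -> exists2 G : dual E, dual_sn s G & dual_ext cls G = L.
Proof.
move=> k0 lL Lk.
have lLc : linear ((fun f => L (cls f)) : E -> R^o).
  by move=> a f g; rewrite linearP (linfD lL) (linfZ lL).
have k1 : 0 < k + 1 by lra.
have cLc : continuous ((fun f => L (cls f)) : E -> R^o).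
  apply: (linear_nbhs_continuous (U := [set x | s x < (k + 1)^-1]) lLc).
    have i0 : 0 < (k + 1)^-1 by rewrite invr_gt0.
    move/cvgrPdist_lt : (@sc 0) => /(_ _ i0); rewrite (seminorm0 ss).
    by apply: filterS => x; rewrite sub0r normrN; exact: le_lt_trans (ler_norm _).
  move=> x /= xs; apply: le_trans (Lk _) _; rewrite Xc.1.
  have : (k + 1) * s x <= 1 by rewrite -ler_pdivlMl// mulr1 ltW.
  have := seminorm_ge0 ss x; lra.
have [G GE] := mk_dual lLc cLc; exists G.
  by exists k => // f; rewrite GE; apply: le_trans (Lk _) _; rewrite Xc.1.
by apply: dual_extP => //; exact: linf_bounded_continuous Lk.
Qed.

(** The complex linear extension of [L] to the complexification. *)
Definition cfun (L : X -> R) (z : X * X) : C R := ofRI (L z.1) (L z.2).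

Lemma cfunZ (L : X -> R) c z : linear (L : X -> R^o) -> cfun L (cplx_scale c z) = c * cfun L z.
Proof.
move=> lL; apply: C_eq; rewrite !cE /=.
  by rewrite (linfB lL) !(linfZ lL).
by rewrite (linfD lL) !(linfZ lL).
Qed.

Lemma cfunD (L : X -> R) z w : linear (L : X -> R^o) -> cfun L (z + w) = cfun L z + cfun L w.
Proof. by move=> lL; apply: C_eq; rewrite !cE /= (linfD lL). Qed.

Lemma cfun_real (L : X -> R) x : linear (L : X -> R^o) -> cfun L (x, 0) = ofR (L x).
Proof. by move=> lL; apply: C_eq; rewrite !cE /= ?(linf0 lL). Qed.

(** A norming functional of the difference of the real parts, or of the imaginary parts, comes from
    an allowed direction by [functional_dual]. *)
Lemma cfun_sep (z w : X * X) : (forall G : dual E, dual_sn s G ->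
  cfun (dual_ext cls G) z = cfun (dual_ext cls G) w) -> z = w.
Proof.
move=> h; have k (x y : X) : (forall L : X -> R, linear (L : X -> R^o) ->
    (forall x, `|L x| <= 1 * `|x|) -> L x = L y) -> x = y.
  move=> hL; have [L lL [Lk Lx]] := norming_functional (x - y).
  apply/eqP; rewrite -subr_eq0 -normr_eq0 -Lx (linfB lL) (hL L)// ?subrr//.
  by move=> u; rewrite mul1r.
case: z w h => z1 z2 [w1 w2] h; congr (_, _); apply: k => L lL Lk;
  have [G Gs GE] := functional_dual ler01 lL Lk; have := h G Gs; rewrite GE => e.
  exact: (congr1 (@cRe R) e).
exact: (congr1 (@cIm R) e).
Qed.

Lemma totdiffE (A : dual E -> C R) F z : is_totdiff s cls A F z -> totdiff s cls A F = z.
Proof.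
move=> h; rewrite /totdiff; apply: xget_subset1 => // z1 z2 h1 h2.
by apply: cfun_sep => G Gs; apply: cvg_unique (h1 G Gs) (h2 G Gs).
Qed.

Lemma weyl_totdiff (f : E) F :
  totdiff s cls (weyl f) F = cplx_scale ('i * expi (F f)) (cls f, 0).
Proof.
apply: totdiffE => G Gs; have [k k0 [lL Lk Lc]] := dual_ext_spec Gs.
rewrite -[ofRI _ _]/(cfun _ _) cfunZ// cfun_real// Lc.
apply: cvg_dnbhs_seqC => u u0 uc.
have E1 n : ofR (u n)^-1 * (weyl f (F + u n *: G) - weyl f F) =
    expi (F f) * (ofR (u n)^-1 * (expi (u n * G f) - 1)).
  by rewrite /weyl dualD dualZ expiD; ring.
under eq_fun do rewrite E1.
rewrite (_ : 'i * _ * _ = expi (F f) * ('i * ofR (G f))); last by ring.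
apply: cvgMl_tmp; apply/cvgC; split.
  rewrite !(cE, cRe_i, cIm_i) mul0r mulr0 subr0.
  have := @derive_seq R cos _ (G f) u (is_derive_cos 0) u0 uc; rewrite sin0 oppr0 mulr0 cos0.
  by under [in X in _ -> X]eq_fun do rewrite !cE mul0r subr0.
rewrite !(cE, cRe_i, cIm_i) mul0r mul1r add0r.
have := @derive_seq R sin _ (G f) u (is_derive_sin 0) u0 uc; rewrite cos0 mulr1 sin0.
by under [in X in _ -> X]eq_fun do rewrite !cE mul0r addr0.
Qed.

End total_differential.

Lemma tvint_ge0 d (T : measurableType d) (R : realType) (mu : set T -> C R) (f : T -> R) :
  is_cmeasure mu -> (forall x, 0 <= f x) -> (0 <= \int[total_var mu]_x (f x)%:E)%E.
Proof.
move=> hmu f0; rewrite -(integral_measure_zero setT (fun x : T => (f x)%:E)).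
apply: le_integral_raw => [|A mA|x]; [exact: total_var_set0| |by rewrite lee_fin].
by rewrite lexx/= total_var_ge0.
Qed.

Section rational_combinations.
Context {R : realType} {E : lmodType R} (e : nat -> E).

(** Finite sequences of rational coefficients are enumerated from index 1 on. Index 0 is the zero
    vector, which matches the initial value of [approx]. *)
Definition qcomb (j : nat) : E :=
  if j is k.+1 then
    if @unpickle (seq rat) k is Some r then \sum_(i < size r) ratr (nth 0 r i) *: e i else 0
  else 0.

Lemma qcomb_dense (p : E -> R) x d : is_seminorm p -> cspan e x -> 0 < d ->
  exists j, p (x - qcomb j) < d.
Proof.
move=> sp [n _ [a ->]] d0.
have p0 i : 0 <= p (e i) by exact: seminorm_ge0.
pose B := 1 + \sum_(i < n) p (e i).
have B0 : 0 < B by rewrite ltr_pwDl// sumr_ge0.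
have /choice[r hr] i : exists q : rat, `|a i - ratr q| < d / B.
  by apply: rat_near; rewrite divr_gt0.
exists (pickle (mkseq r n)).+1; rewrite /qcomb pickleK size_mkseq -sumrB.
apply: le_lt_trans (seminorm_sum sp _ _ _) _.
apply: (@le_lt_trans _ _ (\sum_(i < n) d / B * p (e i))).
  apply: ler_sum => i _; rewrite nth_mkseq// -scalerBl (seminormZ sp).
  by rewrite ler_wpM2r// ltW.
rewrite -mulr_sumr mulrAC ltr_pdivrMr// ltr_pM2l// /B; lra.
Qed.

End rational_combinations.

(** * Bochner integrals with values in the completion *)

Section bochner.
Context {R : realType} {E : tvsType R} {s : E -> R}.
Context {X : completeNormedModType R} {cls : {linear E -> X}}.
Hypothesis hE : hausdorff_space E.
Hypothesis ss : is_seminorm s.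
Hypothesis clsn : forall f, `|cls f| = s f.
Variables (mu : set (ilB E) -> C R).
Hypothesis Mmu : ME mu.
Hypothesis imu : (\int[total_var mu]_f (s f)%:E < +oo)%E.
Variables (F : E -> R) (r1 r2 : E -> R).
Hypothesis lF : linear (F : E -> R^o).
Hypotheses (r1b : forall x, `|r1 x| <= 1) (r2b : forall x, `|r2 x| <= 1).
Hypotheses (r1l : forall x y, `|r1 x - r1 y| <= `|F (x - y)|)
           (r2l : forall x y, `|r2 x - r2 y| <= `|F (x - y)|).
Local Notation h := (fun f : E => (r1 f *: cls f, r2 f *: cls f) : X * X).

Let hmu : is_cmeasure mu. Proof. exact: ME_cmeasure. Qed.
Let s0 x : 0 <= s x. Proof. exact: seminorm_ge0. Qed.

(** A semi-norm depending on the base point [x] that bounds the change of [h] at [x]; it is a single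
    semi-norm in the increment, as needed for il-continuity and for rational approximation. *)
Let p (x y : E) := s y + s x * `|F y|.

Let sp x : is_seminorm (p x).
Proof. by apply: seminorm_addn => //; apply: seminorm_scale => //; exact: seminorm_linf. Qed.

Let rlip (r : E -> R) x y : (forall x, `|r x| <= 1) ->
  (forall x y, `|r x - r y| <= `|F (x - y)|) ->
  `|r x *: cls x - r y *: cls y| <= p x (x - y).
Proof.
move=> rb rl; rewrite (_ : _ - _ = (r x - r y) *: cls x + r y *: cls (x - y)); last first.
  by rewrite linearB scalerBr scalerBl addrA subrK.
apply: le_trans (ler_normD _ _) _; rewrite !normrZ !clsn /p addrC; apply: lerD.
  by rewrite ler_piMl.
by rewrite mulrC ler_wpM2l.
Qed.

Let hlip x y : `|h x - h y| <= p x (x - y).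
Proof. by rewrite prod_normE ge_max !rlip. Qed.

Let hs x : `|h x| <= s x.
Proof. by rewrite prod_normE ge_max /= !normrZ clsn !ler_piMl. Qed.

(** Only distances to fixed vectors are shown to be measurable, not [h] as a map into [X]; they
    decide all comparisons in [approx]. *)
Let mdist (z : X * X) : measurable_fun setT ((fun x => `|h x - z|) : ilB E -> R).
Proof.
apply: (@il_cont_measurable _ _ (fun x => `|h x - z|)) => x d d0.
exists (fun y => d^-1 * p x y); first by apply: seminorm_scale => //; rewrite invr_ge0 ltW.
move=> y; rewrite ltr_pdivrMl// mulr1 => pd; apply: le_lt_trans pd.
apply: le_trans (lerB_dist _ _) _ || idtac.
rewrite -(seminormN (sp x)) opprB; apply: le_trans (hlip x y).
rewrite distrC; apply: le_trans (ler_dist_dist _ _) _.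
by rewrite opprB addrA subrK.
Qed.

Section approximation.
Variable e : nat -> E.
Hypothesis he : total_var mu (~` (cspan e : set (ilB E))) = 0%E.

(* The best approximation of [h x] among the first [n + 1] values of [h] on
   rational combinations. *)
Fixpoint approx n (x : E) : X * X :=
  if n is k.+1 then
    if `|h x - h (qcomb e n)| < `|h x - approx k x| then h (qcomb e n) else approx k x
  else 0.

Let mapprox n : measurable_fun setT ((fun x => `|h x - approx n x|) : ilB E -> R).
Proof.
elim: n => [|n IH]; first exact: mdist.
rewrite (_ : (fun x => _) = (fun x => Num.min `|h x - h (qcomb e n.+1)| `|h x - approx n x|)).
  by apply: measurable_minr => //; exact: mdist.
apply/funext => x; rewrite /= minElt.
by case: ifP.
Qed.

Let approx_simple n : is_simple (approx n : ilB E -> X * X).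
Proof.
elim: n => [|n [IH1 IH2]].
  split; first by apply: (sub_finite_set (B := [set 0])) => // _ [x _ <-].
  move=> z /=; have [->|z0] := eqVneq z 0.
    by rewrite (_ : _ @^-1` _ = setT)//; apply/seteqP; split.
  rewrite (_ : _ @^-1` _ = set0)//; apply/seteqP; split=> // x /= zE.
  by move: z0; rewrite -zE eqxx.
split.
  apply: (sub_finite_set (B := range (approx n) `|` [set h (qcomb e n.+1)])); last first.
    by rewrite finite_setU.
  by move=> _ [x _ <-] /=; case: ifP => _; [right|left; exists x].
move=> z; pose A := [set x : ilB E | `|h x - h (qcomb e n.+1)| < `|h x - approx n x|].
have mA : measurable A by apply: measurable_lt_set; [exact: mdist|exact: mapprox].
rewrite (_ : _ @^-1` _ = (A `&` (if h (qcomb e n.+1) == z then setT else set0)) `|`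
    (~` A `&` approx n @^-1` [set z])).
  apply: measurableU; apply: measurableI => //; last exact: measurableC.
  by case: ifP.
apply/seteqP; split=> x /=.
  case: ifP => Ax => [hz|]; first by left; split=> //; rewrite hz eqxx.
  by right; split=> //; rewrite /A /= Ax.
move=> [[Ax]|[nAx az]]; first by rewrite Ax; case: eqP.
by case: ifP => // Ax; case: nAx.
Qed.

Let approx_le n x : `|h x - approx n x| <= s x.
Proof.
elim: n => [|n IH] /=; first by rewrite subr0.
by case: ifP => // /ltW /le_trans; exact.
Qed.

Let approx_min n j x : (j <= n)%N -> `|h x - approx n x| <= `|h x - h (qcomb e j)|.
Proof.
elim: n => [|n IH].
  by rewrite leqn0 => /eqP-> /=; rewrite !linear0.
rewrite leq_eqVlt => /orP[/eqP->|] /=.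
  by case: ifP => // /negbT; rewrite -leNgt.
by rewrite ltnS => /IH le; case: ifP => // /ltW /le_trans; exact.
Qed.

Let approx_cvg x : cspan e x -> `|h x - approx n x| @[n --> \oo] --> (0 : R).
Proof.
move=> Wx; apply/cvgrPdist_lt => d d0.
have [j hj] := qcomb_dense (sp x) Wx d0.
exists j => // n /= jn; rewrite sub0r normrN normr_id.
by apply: le_lt_trans (approx_min _ jn) _; exact: le_lt_trans (hlip _ _) _.
Qed.

(** The errors never exceed [s] because the approximation starts at 0, so their integrals [eps n]
    tend to 0 by dominated convergence. Every functional L satisfies an estimate between the simple
    integrals and the scalar integral of L over [h]; norming functionals turn these scalar estimates
    into the Cauchy property, and the limit inherits the weak characterisation. *)
Lemma bochner_spec : exists w : X * X, is_bochner_int mu h w /\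
  forall L : X -> R, linear (L : X -> R^o) -> (exists k, forall x, `|L x| <= k * `|x|) ->
    cfun L w = cint mu (fun f => cfun L (h f)).
Proof.
have [l [dn D]] := cmeasure_density hmu.
have ms : measurable_fun setT (s : ilB E -> R) by exact: measurable_seminorm.
have is_ := density_integrable D ms s0 imu.
have mW : measurable (cspan e : set (ilB E)) by exact: cspan_measurable.
have lW0 : l (~` (cspan e : set (ilB E))) = 0%E by apply: (density_null D) => //; exact: measurableC.
have idist n : l.-integrable setT (EFin \o (fun x : ilB E => `|h x - approx n x|)).
  by apply: (integrable_EFin_le _ is_) => //= x; rewrite normr_id.
pose eps n := Rintegral l setT (fun x : ilB E => `|h x - approx n x|).
have eps0 : eps n @[n --> \oo] --> (0 : R).
  (* The errors tend to 0 on the span only; the indicator removes the remaining null set. *)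
  pose k n (x : ilB E) : C R := ofR (\1_(cspan e : set (ilB E)) x * `|h x - approx n x|).
  have mk n : cmfun (k n) by apply: cmfun_ofR; apply: measurable_funM.
  have kb n x : n1 (k n x) <= s x.
    rewrite n1_ofR normrM normr_id indicE; case: (_ \in _); rewrite ?normr1 ?mul1r ?normr0 ?mul0r//.
  have kc x : k n x @[n --> \oo] --> (0 : C R).
    have [Wx|Wx] := pselect (cspan e x).
      apply/cvgC; split; last exact: cvg_cst.
      by under eq_fun do rewrite /k cE indicE mem_set// mul1r; exact: approx_cvg.
    by under eq_fun do rewrite /k indicE memNset// mul0r; exact: cvg_cst.
  have [_ /cvgC[+ _]] := cI_cvg mk is_ kb kc.
  rewrite cI0 cE; apply: cvg_trans; apply: near_eq_cvg; near=> n.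
  rewrite /cI !cE /eps /Rintegral; congr fine; apply: (eq_integral_null mW lW0) => x Wx.
  by rewrite /= indicE mem_set// mul1r.
have cfunB L (z w : X * X) : linear (L : X -> R^o) -> cfun L (z - w) = cfun L z - cfun L w.
  by move=> lL; apply: C_eq; rewrite !cE /= (linfB lL).
have cfun_le L k (z : X * X) : (forall x, `|L x| <= k * `|x|) -> 0 <= k -> n1 (cfun L z) <= 2 * k * `|z|.
  move=> Lk k0; rewrite /n1 !cE.
  have a : `|z.1| <= `|z| by rewrite prod_normE le_max lexx.
  have b : `|z.2| <= `|z| by rewrite prod_normE le_max lexx orbT.
  have := ler_wpM2l k0 a; have := ler_wpM2l k0 b; have := Lk z.1; have := Lk z.2; lra.
have simple_cint L n : linear (L : X -> R^o) ->
    cmfun (fun x : ilB E => cfun L (approx n x)) /\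
    cfun L (simple_int mu (approx n : ilB E -> X * X)) = cint mu (fun x => cfun L (approx n x)).
  move=> lL; have [fr mr] := approx_simple n.
  pose rg := finmap.enum_fset (fset_set (range (approx n))).
  have apE (x : ilB E) : cfun L (approx n x) =
      \sum_(z <- rg) cfun L z * ofR (\1_((approx n : ilB E -> X * X) @^-1` [set z]) x).
    have mem : approx n x \in rg.
      by apply: etrans (in_fset_set fr (approx n x)) _; apply: mem_set; exists x.
    rewrite (bigD1_seq _ mem (finmap.fset_uniq _))/=.
    rewrite indicE mem_set// ofR1 mulr1 big1 ?addr0// => z zx.
    rewrite indicE memNset ?ofR0 ?mulr0//= => xz; by move: zx; rewrite -xz eqxx.
  have ind z : tvintg mu (fun x : ilB E => ofR (\1_((approx n : ilB E -> X * X) @^-1` [set z]) x) : C R).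
    apply: (@tvintg_le _ _ _ _ hmu _ (fun=> 1)) => //.
    - by apply: cmfun_ofR; exact: measurable_indic.
    - by move=> x; rewrite n1_ofR indicE; case: (_ \in _); rewrite ?normr1 ?normr0.
    - exact: tvint_cst.
  have sumP (r : seq (X * X)) :
      tvintg mu (fun x : ilB E => \sum_(z <- r) cfun L z * ofR (\1_((approx n : ilB E -> X * X) @^-1` [set z]) x)) /\
      cint mu (fun x : ilB E => \sum_(z <- r) cfun L z * ofR (\1_((approx n : ilB E -> X * X) @^-1` [set z]) x)) =
      cfun L (\sum_(z <- r) cplx_scale (mu ((approx n : ilB E -> X * X) @^-1` [set z])) z).
    elim: r => [|z r [IH1 IH2]].
      under eq_fun do rewrite big_nil; rewrite big_nil; split.
        apply: (@tvintg_le _ _ _ _ hmu _ (fun=> 1)) => //.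
        - by move=> x; rewrite n10.
        - exact: tvint_cst.
      by rewrite cint0//; apply: C_eq; rewrite !cE /= (linf0 lL).
    have E1 : (fun x : ilB E => \sum_(z <- z :: r) cfun L z * ofR (\1_((approx n : ilB E -> X * X) @^-1` [set z]) x)) =
       (fun x : ilB E => cfun L z * ofR (\1_((approx n : ilB E -> X * X) @^-1` [set z]) x) +
          \sum_(z <- r) cfun L z * ofR (\1_((approx n : ilB E -> X * X) @^-1` [set z]) x)).
      by apply/funext => x; rewrite big_cons.
    rewrite E1 big_cons; have iz := tvintgZ hmu (cfun L z) (ind z); split; first exact: tvintgD.
    rewrite cintD// cintZ// IH2 cfunD// cfunZ//; congr (_ + _).
    rewrite mulrC; congr (_ * _); have [-> _] := cintE_density D (ind z).
    by rewrite (densityE D).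
  have aE : (fun x : ilB E => cfun L (approx n x)) = (fun x : ilB E => \sum_(z <- rg) cfun L z * ofR (\1_((approx n : ilB E -> X * X) @^-1` [set z]) x)).
    exact/funext.
  split; first by rewrite aE; exact: (sumP rg).1.1.
  rewrite aE (sumP rg).2 /simple_int fsbig_finite//.
have mh L : linear (L : X -> R^o) -> (exists k, forall x, `|L x| <= k * `|x|) ->
    cmfun (fun x : ilB E => cfun L (h x)).
  move=> lL [k Lk].
  have mL : measurable_fun setT ((fun f => L (cls f)) : ilB E -> R).
    by apply: measurable_linf => a f g; rewrite linearP (linfD lL) (linfZ lL).
  have mr (r : E -> R) : (forall x y, `|r x - r y| <= `|F (x - y)|) -> measurable_fun setT (r : ilB E -> R).
    move=> rl; apply: (il_cont_measurable (f := r)); apply: (il_cont_lip (seminorm_linf lF)) => x y.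
    exact: rl.
  split; under eq_fun do rewrite /cfun cE /= (linfZ lL); apply: measurable_funM => //; exact: mr.
(* The constant 8 is 4 from the density times 2 from [cfun_le]. *)
have key L k n : linear (L : X -> R^o) -> 0 <= k -> (forall x, `|L x| <= k * `|x|) ->
    n1 (cfun L (simple_int mu (approx n : ilB E -> X * X)) - cint mu (fun f => cfun L (h f))) <= 8 * k * eps n.
  move=> lL k0 Lk; have [m1 ->] := simple_cint L n lL.
  have m2 := mh L lL (ex_intro _ k Lk).
  have i2s : l.-integrable setT (EFin \o (fun x : ilB E => (2 * k * 2) * s x)) by exact: integrable_EFinZ.
  have i1 : cintg l (fun x : ilB E => cfun L (approx n x)).
    apply: (cintg_le m1 i2s) => x; apply: le_trans (cfun_le L k _ Lk k0) _.
    rewrite (_ : 2 * k * 2 * s x = (2 * k) * (2 * s x)); last by ring.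
    rewrite ler_wpM2l ?mulr_ge0//.
    have : `|approx n x| <= `|h x - approx n x| + `|h x|.
      by rewrite distrC -{1}(subrK (h x) (approx n x)) ler_normD.
    have := approx_le n x; have := hs x; lra.
  have i2 : cintg l (fun x : ilB E => cfun L (h x)).
    apply: (cintg_le m2 i2s) => x; apply: le_trans (cfun_le L k _ Lk k0) _.
    rewrite (_ : 2 * k * 2 * s x = (2 * k) * (2 * s x)); last by ring.
    by rewrite ler_wpM2l ?mulr_ge0//; have := hs x; have := s0 x; lra.
  have t1 := cintg_tvintg D i1; have t2 := cintg_tvintg D i2.
  rewrite -mulN1r -cintZ// -cintD//; last exact: tvintgZ.
  have tD := tvintgD hmu t1 (tvintgZ hmu (-1) t2).
  have [-> iD] := cintE_density D tD.
  apply: le_trans (n1_cI iD) _.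
  rewrite /eps -RintegralZl//; apply: le_Rintegral => //.
  - exact: cintg_n1.
  - exact: integrable_EFinZ.
  - move=> x _; apply: le_trans (n1M _ _) _; rewrite (_ : 8 * k * _ = 4 * (2 * k * `|h x - approx n x|)); last by ring.
    apply: ler_pM; rewrite ?n1_ge0 ?(density_le4 D)// mulN1r -cfunB// distrC.
    exact: cfun_le.
pose sg n := simple_int mu (approx n : ilB E -> X * X).
(* The estimate [key] compares both simple integrals with the same scalar integral, for a norming
   functional of their difference in one component. *)
have cau n m : `|sg n - sg m| <= 8 * (eps n + eps m).
  suff H (pr : X * X -> X) : (forall L z, linear (L : X -> R^o) -> `|L (pr z)| <= n1 (cfun L z)) ->
      `|pr (sg n - sg m)| <= 8 * (eps n + eps m).
    rewrite prod_normE ge_max; apply/andP; split.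
      by apply: (H fst) => L z _; exact: (cRe_le_n1 (cfun L z)).
    by apply: (H snd) => L z _; exact: (cIm_le_n1 (cfun L z)).
  move=> prL; have [L lL [Lk Lx]] := norming_functional (pr (sg n - sg m)).
  have L1 x : `|L x| <= 1 * `|x| by rewrite mul1r.
  rewrite -[leLHS]normr_id -Lx; apply: le_trans (prL L _ lL) _.
  rewrite cfunB//; have := key L 1 n lL ler01 L1; have := key L 1 m lL ler01 L1.
  set I := cint _ _; rewrite !mulr1 => h1 h2.
  rewrite (_ : _ - _ = (cfun L (sg n) - I) - (cfun L (sg m) - I)); last by ring.
  by apply: le_trans (n1B _ _) _; rewrite mulrDr; exact: lerD.
have cvgX (pr : X * X -> X) : (forall z w, pr (z - w) = pr z - pr w) -> (forall z, `|pr z| <= `|z|) ->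
    exists w : X, pr (sg n) @[n --> \oo] --> w.
  move=> prB prn; suff : cvg (pr (sg n) @[n --> \oo]) by move=> ?; exists (lim (pr (sg n) @[n --> \oo])).
  apply: cauchy_cvg; apply/cauchy_exP => _/posnumP[d].
  (* With both errors below d/16, the Cauchy bound 8(eps n + eps m) is below d. *)
  have d16 : 0 < d%:num / 16 by rewrite divr_gt0.
  move/cvgrPdist_lt : eps0 => /(_ _ d16)[N _ hN].
  exists (pr (sg N)); exists N => // m /= Nm.
  rewrite -ball_normE /=; rewrite -prB; apply: le_lt_trans (prn _) _.
  apply: le_lt_trans (cau _ _) _.
  have := hN N (leqnn N); have := hN m Nm; rewrite /= !sub0r !normrN.
  move=> /(le_lt_trans (ler_norm _)) a /(le_lt_trans (ler_norm _)) b; lra.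
have [w1 hw1] : exists w : X, (sg n).1 @[n --> \oo] --> w.
  by apply: cvgX => // z; rewrite prod_normE le_max lexx.
have [w2 hw2] : exists w : X, (sg n).2 @[n --> \oo] --> w.
  by apply: cvgX => // z; rewrite prod_normE le_max lexx orbT.
exists (w1, w2); split.
  exists (fun n => approx n : ilB E -> X * X); split.
  - exact: approx_simple.
  - exists (~` (cspan e : set (ilB E))); split=> //; first exact: measurableC.
    move=> x /contrapT Wx; apply/cvgrPdist_lt => d d0.
    by have /cvgrPdist_lt/(_ _ d0) := approx_cvg Wx; apply: filterS => n; rewrite sub0r normrN normr_id.
  - apply: (squeeze_cvge (f := fun=> 0%E) (h := fun n => (eps n)%:E)).
    + near=> n; apply/andP; split; first exact: tvint_ge0.
      apply: (@le_trans _ _ (\int[l]_x (`|approx n x - h x|)%:E)%E).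
        by apply: le_integral_raw => // A mA; rewrite total_var_ge0// (density_tv_le D).
      have fn := integrable_fin_num measurableT (idist n).
      rewrite le_eqVlt; apply/orP; left; apply/eqP; rewrite /eps /Rintegral fineK//.
      by apply: eq_integral => x _; rewrite distrC.
    + exact: cvg_cst.
    + by apply: cvg_EFin => //; exact: nearW.
  - have : ((sg n).1, (sg n).2) @[n --> \oo] --> (w1, w2) by exact: cvg_pair.
    by under eq_fun do rewrite -surjective_pairing.
move=> L lL [k Lk].
have Lk' x : `|L x| <= `|k| * `|x|.
  by apply: le_trans (Lk x) _; rewrite ler_wpM2r// ler_norm.
have cL : continuous (L : X -> R^o) by exact: linf_bounded_continuous Lk'.
have c1 : cfun L (sg n) @[n --> \oo] --> cfun L (w1, w2).
  by apply/cvgC; split; [exact: (cvg_comp _ _ hw1 (@cL w1))|exact: (cvg_comp _ _ hw2 (@cL w2))].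
have c2 : cfun L (sg n) @[n --> \oo] --> cint mu (fun f => cfun L (h f)).
  apply/cvgC_n1 => d d0.
  have d8 : 0 < d / (8 * `|k| + 1) by rewrite divr_gt0// ltr_wpDl// mulr_ge0.
  move/cvgrPdist_lt : eps0 => /(_ _ d8); apply: filterS => n.
  rewrite sub0r normrN => /(le_lt_trans (ler_norm _)); rewrite ltr_pdivlMr; last by rewrite ltr_wpDl// mulr_ge0.
  have e0 : 0 <= eps n by apply: Rintegral_ge0.
  move=> h1; rewrite -n1N opprB; apply: le_lt_trans (key L `|k| n lL (normr_ge0 _) Lk') _.
  rewrite mulrC; nra.
apply: cvg_unique c1 c2.
Unshelve. all: by end_near.
Qed.

End approximation.

End bochner.

Section fourier_total_differential.
Context {R : realType} {E : tvsType R} {s : E -> R}.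
Context {X : completeNormedModType R} {cls : {linear E -> X}}.
Hypothesis hE : hausdorff_space E.
Hypothesis ss : is_seminorm s.
Hypothesis sc : continuous (s : E -> R^o).
Hypothesis Xc : is_completion s cls.
Implicit Types mu : set (ilB E) -> C R.

Lemma tvintg_bounded_linear mu (L : E -> R) (c : E -> C R) k : is_cmeasure mu ->
  (\int[total_var mu]_f (s f)%:E < +oo)%E -> linear (L : E -> R^o) -> 0 <= k ->
  (forall f, `|L f| <= k * s f) -> cmfun (c : ilB E -> C R) -> (forall f, n1 (c f) <= 2) ->
  tvintg mu (fun f : ilB E => c f * ofR (L f)).
Proof.
move=> hmu imu lL k0 Lk mc c2.
have ms : measurable_fun setT (s : ilB E -> R) by exact: measurable_seminorm.
have [l [dn D]] := cmeasure_density hmu.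
have s0 f : 0 <= s f by exact: seminorm_ge0.
have il := density_integrable D ms s0 imu.
apply: (cintg_tvintg D); apply: (@cintg_le _ _ _ _ _ (fun f : ilB E => (2 * k) * s f)).
- by apply: cmfunM => //; apply: cmfun_ofR; exact: measurable_linf lL.
- exact: integrable_EFinZ.
- move=> f; apply: le_trans (n1M _ _) _; rewrite n1_ofR -mulrA.
  by apply: ler_pM; rewrite ?n1_ge0.
Qed.

(** [bochner_spec] is applied twice, with components (cos, sin) for exp(iF) and (- sin, cos) for i
    exp(iF). The two integrals come from different approximations; they differ by the factor i
    because all functionals agree on them. *)
Lemma fourier_bochner mu (F : dual E) : ME mu -> (\int[total_var mu]_f (s f)%:E < +oo)%E ->
  exists w : X * X, [/\
    is_bochner_int mu (fun f : E => cplx_scale (expi (F f)) (cls f, 0)) w,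
    is_totdiff s cls (fourier mu) F (cplx_scale 'i w),
    is_bochner_int mu (fun f : E => totdiff s cls (weyl f) F) (cplx_scale 'i w) &
    forall L : X -> R, linear (L : X -> R^o) -> (exists k, forall x, `|L x| <= k * `|x|) ->
      cfun L (cplx_scale 'i w) = cint mu (fun f : E => 'i * expi (F f) * ofR (L (cls f)))].
Proof.
move=> Mmu imu; have hmu := ME_cmeasure Mmu; have [e he] := ME_carrier hE Mmu.
have lF := dual_linear F.
have cl (r : R -> R) : (forall a b, `|r a - r b| <= `|a - b|) ->
    forall x y : E, `|r (F x) - r (F y)| <= `|F (x - y)|.
  by move=> rl x y; rewrite (linfB lF).
have cb x : `|cos (F x : R)| <= 1 by rewrite ler_norml cos_geN1 cos_le1.
have sb x : `|sin (F x : R)| <= 1 by rewrite ler_norml sin_geN1 sin_le1.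
have sNb x : `|- sin (F x : R)| <= 1 by rewrite normrN.
have sNl (a b : R) : `|- sin a - - sin b| <= `|a - b|.
  by rewrite -opprD normrN; exact: sin_lip.
have [w [bw ww]] := bochner_spec hE ss Xc.1 Mmu imu lF cb sb (cl _ (@cos_lip R)) (cl _ (@sin_lip R)) he.
have [w' [bw' ww']] := bochner_spec hE ss Xc.1 Mmu imu lF sNb cb (cl _ sNl) (cl _ (@cos_lip R)) he.
have h1 : (fun f : E => cplx_scale (expi (F f)) (cls f, 0)) =
    (fun f : E => (cos (F f) *: cls f, sin (F f) *: cls f) : X * X).
  by apply/funext => f; rewrite /cplx_scale !cE /= !scaler0 subr0 add0r.
have h2 : (fun f : E => totdiff s cls (weyl f) F) =
    (fun f : E => (- sin (F f) *: cls f, cos (F f) *: cls f) : X * X).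
  apply/funext => f; rewrite (weyl_totdiff ss sc Xc) /cplx_scale !(cE, cRe_i, cIm_i) /= !scaler0.
  by rewrite subr0 add0r !mul0r !mul1r sub0r add0r.
have char L : linear (L : X -> R^o) -> (exists k, forall x, `|L x| <= k * `|x|) ->
    cfun L (cplx_scale 'i w) = cint mu (fun f : E => 'i * expi (F f) * ofR (L (cls f))).
  move=> lL [k Lk]; rewrite cfunZ// ww//; last by exists k.
  have lLc : linear ((fun f => L (cls f)) : E -> R^o).
    by move=> a f g; rewrite linearP (linfD lL) (linfZ lL).
  have Lk' f : `|L (cls f)| <= `|k| * s f.
    by apply: le_trans (Lk _) _; rewrite Xc.1 ler_wpM2r ?seminorm_ge0 ?ler_norm.
  have i1 : tvintg mu (fun f : ilB E => expi (F f) * ofR (L (cls f))).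
    apply: (tvintg_bounded_linear hmu imu lLc _ Lk') => //; first exact: cmfun_weyl.
    by move=> f; exact: n1_expi.
  transitivity ('i * cint mu (fun f : E => expi (F f) * ofR (L (cls f)))).
    congr (_ * _); apply: eq_cint => f; apply: C_eq; rewrite !cE /= (linfZ lL); ring.
  by rewrite -cintZ//; apply: eq_cint => f; rewrite mulrA.
exists w; split.
- by rewrite h1.
- move=> G Gs; have [k k0 [lL Lk Lc]] := dual_ext_spec Xc Gs.
  rewrite -[ofRI _ _]/(cfun _ _) char//; last by exists k.
  have -> : cint mu (fun f : E => 'i * expi (F f) * ofR (dual_ext cls G (cls f))) =
      wfourier mu (fun f => 'i * ofR (G f) * 1) F.
    by apply: eq_cint => f; rewrite Lc mulr1 mulrAC.
  have [kG kG0 Gk] := Gs.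
  rewrite (fourier_wfourier mu); apply: wfourier_dirder => //.
    split; first exact: cmfun_cst.
    by rewrite (n1_ofR 1) normr1; exact: tvint_cst.
  under eq_fun do rewrite mulr1.
  apply: (tvintg_bounded_linear hmu imu (dual_linear G) kG0 Gk (c := fun=> 'i)).
    exact: cmfun_cst.
  by move=> f; rewrite -[X in n1 X]mulr1 n1_i (n1_ofR 1) normr1; lra.
- rewrite h2 (_ : cplx_scale 'i w = w')//; apply: (cfun_sep ss sc Xc) => G Gs.
  have [k k0 [lL Lk Lc]] := dual_ext_spec Xc Gs.
  rewrite char//; last by exists k.
  rewrite ww'//; last by exists k.
  apply: eq_cint => f; apply: C_eq; rewrite !(cE, cRe_i, cIm_i) /= (linfZ lL); ring.
- exact: char.
Qed.

Lemma fourier_totdiff_weak mu (F : dual E) (L : X -> R) : ME mu ->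
  (\int[total_var mu]_f (s f)%:E < +oo)%E ->
  linear (L : X -> R^o) -> (exists k, forall x, `|L x| <= k * `|x|) ->
  cfun L (totdiff s cls (fourier mu) F) = cint mu (fun f : E => 'i * expi (F f) * ofR (L (cls f))).
Proof.
move=> Mmu imu lL Lk; have [w [_ tw _ char]] := fourier_bochner F Mmu imu.
by rewrite (totdiffE ss sc Xc tw) char.
Qed.

Lemma moment1 n mu : ME_moment n s mu -> le_ext 1 n -> (\int[total_var mu]_f (s f)%:E < +oo)%E.
Proof. by move=> [_ h] /h; under eq_fun do rewrite expr1. Qed.

Theorem fourier_differentiable (n : option nat) mu : ME_moment n s mu ->
  (forall m : nat, le_ext m n -> Cn_dir (dual_sn s) m (fourier mu)) /\
  (le_ext 1 n -> forall F : dual E, exists w : X * X,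
     [/\ is_bochner_int mu (fun f : E => cplx_scale (expi (F f)) (cls f, 0)) w,
         is_totdiff s cls (fourier mu) F (cplx_scale 'i w),
         totdiff s cls (fourier mu) F = cplx_scale 'i w
       & is_bochner_int mu (fun f : E => totdiff s cls (weyl f) F)
           (totdiff s cls (fourier mu) F)]).
Proof.
move=> h; have [Mmu mom] := h; split=> [m mn|n1' F].
  apply: Cn_dir_fourier => // j jm; apply: mom.
  by case: (n) mn => //= k; exact: leq_trans.
have [w [b t b' _]] := fourier_bochner F Mmu (moment1 h n1').
by exists w; rewrite (totdiffE ss sc Xc t).
Qed.

Variable sigma : {biscalar E}.
Hypothesis sigma_le : exists2 c : R, 0 < c & forall f g : E, `|sigma f g| <= c * s f * s g.

(* Applied twice, the weak characterisation of the differentials turns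
   [sigma_extC] into an iterated integral. *)
Lemma fbracket_iterated mu nu F : ME mu -> ME nu ->
  (\int[total_var mu]_f (s f)%:E < +oo)%E -> (\int[total_var nu]_f (s f)%:E < +oo)%E ->
  fbracket s cls sigma (fourier mu) (fourier nu) F =
  cint mu (fun f : E => expi (F f) * cint nu (fun g : E => expi (F g) * ofR (sigma f g))).
Proof.
move=> Mmu Mnu imu inu; have hmu := ME_cmeasure Mmu; have hnu := ME_cmeasure Mnu.
have [S [[c c0 Sc] Sl1 Sl2 Se]] := sigma_ext_exists Xc sigma_le.
have cS := bilinear_bounded_continuous c0 Sc Sl1 Sl2.
rewrite /fbracket /sigma_extC (sigma_extP Xc cS Se).
set z := totdiff s cls (fourier mu) F; set w := totdiff s cls (fourier nu) F.
have Sb1 y : exists k, forall x, `|S x y| <= k * `|x|.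
  by exists (c * `|y|) => x; apply: le_trans (Sc x y) _; rewrite -!mulrA (mulrC `|x|).
have Sb2 x : exists k, forall y, `|S x y| <= k * `|y|.
  by exists (c * `|x|) => y; exact: Sc.
have E1 y : cfun (S^~ y) z = cint mu (fun f : E => 'i * expi (F f) * ofR (S (cls f) y)).
  exact: fourier_totdiff_weak.
have E2 x : cfun (S x) w = cint nu (fun g : E => 'i * expi (F g) * ofR (S x (cls g))).
  exact: fourier_totdiff_weak.
have int1 y : tvintg mu (fun f : ilB E => 'i * expi (F f) * ofR (S (cls f) y)).
  have lS : linear ((fun f => S (cls f) y) : E -> R^o).
    by move=> a f g; rewrite linearP (linfD (Sl1 y)) (linfZ (Sl1 y)).
  apply: (tvintg_bounded_linear hmu imu lS (k := c * `|y|)).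
  - exact: mulr_ge0.
  - by move=> f; apply: le_trans (Sc _ _) _; rewrite Xc.1 -!mulrA (mulrC (s f)).
  - by apply: cmfunM; [exact: cmfun_cst|exact: cmfun_weyl].
  - by move=> f; rewrite n1_i n1_expi.
(* Bilinearity in w = w.1 + i w.2 leaves two functionals applied to [z], to which the weak
   characterisation applies. *)
have -> : ofRI (S z.1 w.1 - S z.2 w.2) (S z.1 w.2 + S z.2 w.1) =
    cfun (S^~ w.1) z + 'i * cfun (S^~ w.2) z.
  by apply: C_eq; rewrite !(cE, cRe_i, cIm_i) /=; ring.
rewrite !E1 -cintZ// -cintD//; last exact: tvintgZ.
rewrite -mulN1r -cintZ//; last by apply: tvintgD => //; exact: tvintgZ.
apply: eq_cint => f.
have -> : -1 * ('i * expi (F f) * ofR (S (cls f) w.1) + 'i * ('i * expi (F f) * ofR (S (cls f) w.2))) =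
    expi (F f) * (- 'i * cfun (S (cls f)) w).
  by apply: C_eq; rewrite !(cE, cRe_i, cIm_i) /=; ring.
rewrite E2; congr (_ * _).
have lS : linear (sigma f : E -> R^o) by move=> a x y; rewrite linearPr.
have i2 : tvintg nu (fun g : ilB E => expi (F g) * ofR (sigma f g)).
  have [c' c'0 hc] := sigma_le.
  apply: (tvintg_bounded_linear hnu inu lS (k := c' * s f)).
  - by rewrite mulr_ge0 ?seminorm_ge0// ltW.
  - exact: hc.
  - exact: cmfun_weyl.
  - by move=> g; exact: n1_expi.
(* The two factors i of the differentials cancel the minus sign in the definition of the bracket. *)
transitivity (- 'i * ('i * cint nu (fun g : E => expi (F g) * ofR (sigma f g)))).
  by congr (_ * _); rewrite -cintZ//; apply: eq_cint => g; rewrite Se mulrA.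
by apply: C_eq; rewrite !(cE, cRe_i, cIm_i) /=; ring.
Qed.

End fourier_total_differential.

(** * The Poisson bracket *)

Section tv_integrability.
Context d (T : measurableType d) (R : realType) (mu : set T -> C R).
Hypothesis hmu : is_cmeasure mu.
Implicit Types w : T -> R.

Definition tvint w := [/\ measurable_fun setT w, forall x, 0 <= w x &
  (\int[total_var mu]_x (w x)%:E < +oo)%E].

Lemma tvintP l dn w : is_density mu l dn ->
  tvint w <-> [/\ measurable_fun setT w, forall x, 0 <= w x & l.-integrable setT (EFin \o w)].
Proof.
move=> D; split=> [[mw w0 iw]|[mw w0 iw]]; split=> //.
  exact: (density_integrable D).
exact: (density_tvint D).
Qed.

Lemma tvint_dom w w' : tvint w -> measurable_fun setT w' -> (forall x, 0 <= w' x <= w x) -> tvint w'.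
Proof.
have [l [dn D]] := cmeasure_density hmu.
move=> /(tvintP w D)[mw w0 iw] mw' ww'; apply/(tvintP w' D); split=> // [x|].
  by case/andP: (ww' x).
by apply: (integrable_EFin_le mw' iw) => x; case/andP: (ww' x) => h1 h2; rewrite ger0_norm.
Qed.

Lemma tvint_add w w' : tvint w -> tvint w' -> tvint (fun x => w x + w' x).
Proof.
have [l [dn D]] := cmeasure_density hmu.
move=> /(tvintP w D)[mw w0 iw] /(tvintP w' D)[mw' w0' iw']; apply/(tvintP _ D); split.
- exact: measurable_funD.
- by move=> x; rewrite addr_ge0.
- exact: integrable_EFinD.
Qed.

Lemma tvint_scale k w : 0 <= k -> tvint w -> tvint (fun x => k * w x).
Proof.
have [l [dn D]] := cmeasure_density hmu.
move=> k0 /(tvintP w D)[mw w0 iw]; apply/(tvintP _ D); split.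
- exact: measurable_funM.
- by move=> x; rewrite mulr_ge0.
- exact: integrable_EFinZ.
Qed.

Lemma tvint_const k : 0 <= k -> tvint (fun=> k).
Proof. by move=> k0; split=> //; exact: tvint_cst. Qed.

(** A form of the Cauchy-Schwarz inequality, from ab <= a^2 + b^2. *)
Lemma tvint_sq w w' : measurable_fun setT w -> measurable_fun setT w' ->
  (forall x, 0 <= w x) -> (forall x, 0 <= w' x) ->
  tvint (fun x => w x ^+ 2) -> tvint (fun x => w' x ^+ 2) -> tvint (fun x => w x * w' x).
Proof.
move=> mw mw' w0 w0' i1 i2; apply: (tvint_dom (tvint_add i1 i2)); first exact: measurable_funM.
move=> x; rewrite mulr_ge0//=.
have := sqr_ge0 (w x - w' x); have := sqr_ge0 (w x); have := sqr_ge0 (w' x).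
rewrite sqrrB; lra.
Qed.

End tv_integrability.

(** * Twisted convolutions with kernels of linear growth *)

Section tame_kernels.
Context {R : realType} {E : tvsType R} {s : E -> R}.
Hypothesis hE : hausdorff_space E.
Hypothesis ss : is_seminorm s.
Variable sigma : {biscalar E}.
Hypothesis sigma_le : exists2 c : R, 0 < c & forall f g : E, `|sigma f g| <= c * s f * s g.
Implicit Types mu nu : set (ilB E) -> C R.

Definition tame (phi : R -> C R) := cmfun phi /\
  exists2 k, 0 <= k & forall r, n1 (phi r) <= k * (1 + `|r|).

Lemma tame_expi (a : R) : tame (fun r => expi (a * r)).
Proof.
split; first by apply: cmfun_expi; apply: measurable_funM.
exists 2 => // r; apply: le_trans (n1_expi _) _; have := normr_ge0 r; lra.
Qed.

Lemma tame_ofR : tame (@ofR R).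
Proof. by split; [exact: cmfun_ofR|exists 1 => // r; rewrite n1_ofR mul1r lerDr]. Qed.

Lemma weyl_convE (hbar : R) mu nu :
  weyl_conv sigma hbar mu nu = twisted_conv sigma (fun r => expi (- (hbar / 2) * r)) mu nu.
Proof. by []. Qed.

Lemma mbracketE mu nu : mbracket sigma mu nu = twisted_conv sigma (@ofR R) mu nu.
Proof.
apply/funext => A; apply: eq_cint => f; apply: eq_cint => g; exact: ofRM.
Qed.

Let s0 x : 0 <= s x. Proof. exact: seminorm_ge0. Qed.
Let ms : measurable_fun setT (s : ilB E -> R). Proof. exact: measurable_seminorm. Qed.

Lemma ME_mk mu e : is_cmeasure mu -> total_var mu (~` (cspan e : set (ilB E))) = 0%E -> ME mu.
Proof. by move=> hmu he; rewrite MEP//; split=> //; exists (cspan e) => //; exists e. Qed.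

Lemma tame_bound phi e : tame phi -> exists2 k, 0 <= k &
  forall x y, n1 (phi (sigmaW e sigma (x, y))) <= (k * (1 + s x)) * (1 + s y) /\
    n1 (phi (sigma x y)) <= (k * (1 + s x)) * (1 + s y).
Proof.
move=> [_ [k k0 hk]]; have [c c0 hc] := sigma_le.
(* The constant comes from 1 + c s(x) s(y) <= (1 + c)(1 + s(x))(1 + s(y)). The bound is needed for
   [sigmaW] on the product and for [sigma] in the inner integral at fixed f. *)
exists (k * (1 + c)); first by rewrite mulr_ge0// addr_ge0// ltW.
move=> x y; suff h r : `|r| <= c * (s x * s y) -> n1 (phi r) <= k * (1 + c) * (1 + s x) * (1 + s y).
  split; apply: h; last by rewrite mulrA; exact: hc.
  rewrite /sigmaW; case: ifP => _; first by rewrite mulrA; exact: hc.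
  by rewrite normr0 !mulr_ge0// ltW.
move=> hs; apply: le_trans (hk _) _; rewrite -!mulrA ler_wpM2l//.
have sxy : 0 <= s x * s y by rewrite mulr_ge0.
have csx : 0 <= c * s x by rewrite mulr_ge0// ltW.
have csy : 0 <= c * s y by rewrite mulr_ge0// ltW.
have : (1 + c) * ((1 + s x) * (1 + s y)) = 1 + s x + s y + s x * s y + c + c * s x + c * s y + c * (s x * s y).
  by ring.
have := s0 x; have := s0 y; lra.
Qed.

Section twisted.
Variables (phi : R -> C R) (tphi : tame phi) (mu nu : set (ilB E) -> C R).
Hypotheses (Mmu : ME mu) (Mnu : ME nu).
Hypotheses (imu : (\int[total_var mu]_f (s f)%:E < +oo)%E).
Hypotheses (inu : (\int[total_var nu]_f (s f)%:E < +oo)%E).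

Let hmu : is_cmeasure mu. Proof. exact: ME_cmeasure. Qed.
Let hnu : is_cmeasure nu. Proof. exact: ME_cmeasure. Qed.
Let m1s : measurable_fun setT ((fun x => 1 + s x) : ilB E -> R).
Proof. exact: measurable_funD. Qed.
Let s10 x : 0 <= 1 + s x. Proof. exact: addr_ge0. Qed.

Let i1s rho : ME rho -> (\int[total_var rho]_f (s f)%:E < +oo)%E ->
  tvint rho ((fun x => 1 + s x) : ilB E -> R).
Proof.
move=> Mrho irho; have hrho := ME_cmeasure Mrho.
by apply: (tvint_add hrho (tvint_const hrho ler01)); split.
Qed.

Lemma twisted_ME : ME (twisted_conv sigma phi mu nu).
Proof.
have [e [e1 e2]] := ME_carrier2 hE Mmu Mnu.
have [k k0 hk'] := tame_bound e tphi; have hk x y := (hk' x y).1.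
have [_ w10 iw1] := tvint_scale hmu k0 (i1s Mmu imu).
have [_ w20 iw2] := i1s Mnu inu.
have mk1 : measurable_fun setT ((fun x => k * (1 + s x)) : ilB E -> R) by exact: measurable_funM.
have [hK _] := twisted_conv_spec hE tphi.1 hmu hnu e1 e2 mk1 m1s w10 w20 hk iw1 iw2.
apply: (ME_mk (e := e) hK).
have mW : measurable (cspan e : set (ilB E)) by exact: cspan_measurable.
by apply: (twisted_conv_carrier sigma phi hmu hnu mW mW mW e1 e2) => x y; exact: cspanD.
Qed.

(** The character of f + g factorises and its part in f leaves the inner integral; only the kernel
    couples the variables. *)
Lemma twisted_fourier F : fourier (twisted_conv sigma phi mu nu) F =
  cint mu (fun f : E => expi (F f) * cint nu (fun g : E => expi (F g) * phi (sigma f g))).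
Proof.
have [e [e1 e2]] := ME_carrier2 hE Mmu Mnu.
have [k k0 hk'] := tame_bound e tphi; have hk x y := (hk' x y).1.
have [_ w10 iw1] := tvint_scale hmu k0 (i1s Mmu imu).
have [_ w20 iw2] := i1s Mnu inu.
have mk1 : measurable_fun setT ((fun x => k * (1 + s x)) : ilB E -> R) by exact: measurable_funM.
have [_ [spec _]] := twisted_conv_spec hE tphi.1 hmu hnu e1 e2 mk1 m1s w10 w20 hk iw1 iw2.
have [u1m u10 iu1] := tvint_scale hmu (ler0n R 2) (tvint_scale hmu k0 (i1s Mmu imu)).
rewrite /fourier (spec (fun f => expi (F f)) (fun x => 2 * (k * (1 + s x))) (fun y => 1 + s y))//.
- apply: eq_cint => f; rewrite -cintZ//; last first.
    have c0 : 0 <= 2 * (k * (1 + s f)) by rewrite mulr_ge0// mulr_ge0.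
    have [m2 _ i2] := tvint_scale hnu c0 (i1s Mnu inu).
    apply: (tvintg_le hnu _ m2 _ i2).
    + apply: cmfunM; first exact: cmfun_weyl.
      by apply: (cmfun_comp (S := sigma f : ilB E -> R)) tphi.1; apply: measurable_linf => a x y; rewrite linearPr.
    + move=> y; apply: le_trans (n1M _ _) _; rewrite -mulrA.
      by apply: ler_pM; rewrite ?n1_ge0 ?n1_expi//; exact: (hk' f y).2.
  by apply: eq_cint => g; rewrite (linfD (dual_linear F)) expiD; ring.
- exact: cmfun_weyl.
- move=> x y; rewrite -[leRHS]mulrA; apply: ler_pM; rewrite ?n1_ge0 ?n1_expi//.
  by rewrite mulr_ge0.
Qed.

(** A power of kappa(x + y) is at most 2^m times the sum of the powers, and the kernel contributes 1
    + s in each variable. The product of kappa^m and s is integrable by [tvint_sq] from the moments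
    of order 2m of kappa and 2 of s. *)
Lemma twisted_moment kappa : is_seminorm kappa ->
  (forall m, (\int[total_var mu]_f (kappa f ^+ m)%:E < +oo)%E) ->
  (forall m, (\int[total_var nu]_f (kappa f ^+ m)%:E < +oo)%E) ->
  (\int[total_var mu]_f (s f ^+ 2)%:E < +oo)%E ->
  (\int[total_var nu]_f (s f ^+ 2)%:E < +oo)%E ->
  forall m, (\int[total_var (twisted_conv sigma phi mu nu)]_f (kappa f ^+ m)%:E < +oo)%E.
Proof.
move=> sk kmu knu smu snu m.
have k0 x : 0 <= kappa x by exact: seminorm_ge0.
have mk : measurable_fun setT (kappa : ilB E -> R) by exact: measurable_seminorm.
have mkm j : measurable_fun setT ((fun x => kappa x ^+ j) : ilB E -> R) by exact: measurable_funX.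
have km0 j x : 0 <= kappa x ^+ j by exact: exprn_ge0.
have [e [e1 e2]] := ME_carrier2 hE Mmu Mnu.
have [k k0' hk'] := tame_bound e tphi; have hk x y := (hk' x y).1.
have [_ w10 iw1] := tvint_scale hmu k0' (i1s Mmu imu).
have [_ w20 iw2] := i1s Mnu inu.
have mk1 : measurable_fun setT ((fun x => k * (1 + s x)) : ilB E -> R) by exact: measurable_funM.
have [_ [_ spec]] := twisted_conv_spec hE tphi.1 hmu hnu e1 e2 mk1 m1s w10 w20 hk iw1 iw2.
have iks (rho : set (ilB E) -> C R) : is_cmeasure rho -> (forall m, (\int[total_var rho]_f (kappa f ^+ m)%:E < +oo)%E) ->
    (\int[total_var rho]_f (s f ^+ 2)%:E < +oo)%E ->
    tvint rho ((fun x => kappa x ^+ m * (1 + s x)) : ilB E -> R).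
  move=> hrho krho srho.
  have t1 : tvint rho ((fun x => kappa x ^+ m * s x) : ilB E -> R).
    apply: tvint_sq => //; split=> //; [exact: measurable_funX|by move=> x; rewrite sqr_ge0| |exact: measurable_funX|by move=> x; rewrite sqr_ge0].
    by under eq_fun do rewrite -exprM.
  have t2 : tvint rho ((fun x => kappa x ^+ m) : ilB E -> R) by split.
  have := tvint_add hrho t2 t1; congr tvint; apply/funext => x; ring.
pose K := 2 ^+ m * k.
have K0 : 0 <= K by rewrite mulr_ge0.
(* The term of index 0 carries the power of kappa(x), the term of index 1 that of kappa(y). *)
pose u1 (i : 'I_2) x := if val i == 0%N then K * (kappa x ^+ m * (1 + s x)) else K * (1 + s x).
pose u2 (i : 'I_2) y := if val i == 0%N then 1 + s y else kappa y ^+ m * (1 + s y).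
have tu1 i : tvint mu (u1 i : ilB E -> R).
  have a1 := tvint_scale hmu K0 (iks mu hmu kmu smu).
  have a2 := tvint_scale hmu K0 (i1s Mmu imu).
  by case: i => -[|j] hj; rewrite /u1 /=; [exact: a1|exact: a2].
have tu2 i : tvint nu (u2 i : ilB E -> R).
  have a1 := i1s Mnu inu; have a2 := iks nu hnu knu snu.
  by case: i => -[|j] hj; rewrite /u2 /=; [exact: a1|exact: a2].
apply: (spec (fun x => kappa x ^+ m) 2%N u1 u2) => //.
- by move=> i; case: (tu1 i).
- by move=> i; case: (tu2 i).
- by move=> i; case: (tu1 i).
- by move=> i; case: (tu2 i).
- by move=> i; case: (tu1 i).
- by move=> i; case: (tu2 i).
move=> x y; rewrite big_ord_recl big_ord1 /u1 /u2 /=.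
have kxy : kappa (addW e (x, y)) <= kappa x + kappa y.
  rewrite /addW; case: ifP => _; first exact: (seminormD sk).
  by rewrite (seminorm0 sk) addr_ge0.
have kp : kappa (addW e (x, y)) ^+ m <= 2 ^+ m * (kappa x ^+ m + kappa y ^+ m).
  apply: le_trans (lerXn2r m _ _ kxy) _; rewrite ?nnegrE ?addr_ge0// mulrDr -!exprMn.
  case: (leP (kappa x) (kappa y)) => le.
    apply: (@le_trans _ _ ((2 * kappa y) ^+ m)); last by rewrite lerDr exprn_ge0// mulr_ge0.
    by apply: lerXn2r; rewrite ?nnegrE ?addr_ge0 ?mulr_ge0//; lra.
  apply: (@le_trans _ _ ((2 * kappa x) ^+ m)); last by rewrite lerDl exprn_ge0// mulr_ge0.
  by apply: lerXn2r; rewrite ?nnegrE ?addr_ge0 ?mulr_ge0//; lra.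
have := ler_wpM2r (mulr_ge0 (w10 x) (s10 y)) kp; rewrite /K => h; apply: le_trans h _.
by rewrite le_eqVlt; apply/orP; left; apply/eqP; ring.
Qed.

End twisted.

End tame_kernels.

Section complex_limits.
Context {R : realType} {T : Type} {F : set_system T} {FF : Filter F}.
Implicit Types (f g : T -> C R) (a b : C R).

Lemma cvg_ext f g a : (forall t, f t = g t) -> f t @[t --> F] --> a -> g t @[t --> F] --> a.
Proof. by move=> /funext->. Qed.

Lemma cvgC_D f g a b : f t @[t --> F] --> a -> g t @[t --> F] --> b ->
  f t + g t @[t --> F] --> a + b.
Proof.
move=> /cvgC[fr fi] /cvgC[gr gi]; apply/cvgC; split.
  by rewrite cReD; under eq_fun do rewrite cReD; exact: cvgD.
by rewrite cImD; under eq_fun do rewrite cImD; exact: cvgD.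
Qed.

Lemma cvgC_M f g a b : f t @[t --> F] --> a -> g t @[t --> F] --> b ->
  f t * g t @[t --> F] --> a * b.
Proof.
move=> /cvgC[fr fi] /cvgC[gr gi]; apply/cvgC; split.
  by rewrite cReM; under eq_fun do rewrite cReM; apply: cvgB; exact: cvgM.
by rewrite cImM; under eq_fun do rewrite cImM; apply: cvgD; exact: cvgM.
Qed.

Lemma cvgC_conj f a : f t @[t --> F] --> a -> (f t)^* @[t --> F] --> a^*.
Proof.
move=> /cvgC[fr fi]; apply/cvgC; split.
  by rewrite cRe_conj; under eq_fun do rewrite cRe_conj.
by rewrite cIm_conj; under eq_fun do rewrite cIm_conj; exact: cvgN.
Qed.

(** The shape of the product rule: [q] and [r] are the difference quotients of two functions, [e]
    the increment, [v] and [u] their values. Writing the second function at the moved point as u + e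
    r derives its continuity from its quotient. *)
Lemma cvg_product (q r e : T -> C R) a b (v u : C R) : e t @[t --> F] --> (0 : C R) ->
  q t @[t --> F] --> a -> r t @[t --> F] --> b ->
  q t * (u + e t * r t) + v * r t @[t --> F] --> a * (u + 0 * b) + v * b.
Proof.
move=> he hq hr; apply: cvgC_D; last by apply: (cvgC_M _ hr); exact: cvg_cst.
by apply: (cvgC_M hq); apply: cvgC_D; [exact: cvg_cst|exact: (cvgC_M he hr)].
Qed.

End complex_limits.

(** * Rules for total differentials and the function bracket *)

Section bracket_calculus.
Context {R : realType} {E : tvsType R} {s : E -> R}.
Context {X : completeNormedModType R} {cls : {linear E -> X}}.
Hypothesis ss : is_seminorm s.
Hypothesis sc : continuous (s : E -> R^o).
Hypothesis Xc : is_completion s cls.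
Implicit Types (A B : dual E -> C R) (F G : dual E) (z w : X * X).
Local Notation totd := (is_totdiff s cls).

Lemma dirderD A B F G a b : is_dirder A F G a -> is_dirder B F G b ->
  is_dirder (A + B) F G (a + b).
Proof.
rewrite /is_dirder => ha hb; apply: cvg_ext (cvgC_D ha hb) => t.
by rewrite -mulrDr opprD addrACA.
Qed.

Lemma dirderZ (c : C R) A F G a : is_dirder A F G a -> is_dirder (c *: A) F G (c * a).
Proof.
rewrite /is_dirder => ha; apply: cvg_ext (cvgC_M (cvg_cst c) ha) => t.
by rewrite mulrCA mulrBr.
Qed.

Lemma dirder_conj A F G a : is_dirder A F G a -> is_dirder (fstar A) F G a^*.
Proof.
rewrite /is_dirder => ha; apply: cvg_ext (cvgC_conj ha) => t.
by apply: C_eq; rewrite /fstar !cE; ring.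
Qed.

Lemma dirderM A B F G a b : is_dirder A F G a -> is_dirder B F G b ->
  is_dirder (fun F => A F * B F) F G (A F * b + B F * a).
Proof.
rewrite /is_dirder => ha hb.
have t0 : ofR t @[t --> (0 : R)^'] --> (0 : C R).
  apply/cvgC; split; last exact: cvg_cst.
  by apply: cvg_within_filter; exact: cvg_id.
have h := cvg_product (v := A F) (u := B F) t0 ha hb.
rewrite (_ : A F * b + B F * a = a * (B F + 0 * b) + A F * b); last by ring.
have {}h := h (dnbhs_filter _); apply: cvg_trans h; apply: near_eq_cvg.
near=> t; have tn0 : t != 0 by near: t; exact: nbhs_dnbhs_neq.
rewrite [ofR t * _]mulrA -ofRM mulfV// ofR1 mul1r; ring.
Unshelve. all: by end_near.
Qed.

Lemma totdD A B F z w : totd A F z -> totd B F w -> totd (A + B) F (z + w).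
Proof.
move=> hz hw G Gs; have [k k0 [lL _ _]] := dual_ext_spec Xc Gs.
by rewrite -[ofRI _ _]/(cfun _ _) cfunD//; apply: dirderD; [exact: hz|exact: hw].
Qed.

Lemma totdZ c A F z : totd A F z -> totd (c *: A) F (cplx_scale c z).
Proof.
move=> hz G Gs; have [k k0 [lL _ _]] := dual_ext_spec Xc Gs.
by rewrite -[ofRI _ _]/(cfun _ _) cfunZ//; apply: dirderZ; exact: hz.
Qed.

Lemma totdM A B F z w : totd A F z -> totd B F w ->
  totd (fun F => A F * B F) F (cplx_scale (A F) w + cplx_scale (B F) z).
Proof.
move=> hz hw G Gs; have [k k0 [lL _ _]] := dual_ext_spec Xc Gs.
by rewrite -[ofRI _ _]/(cfun _ _) cfunD// !cfunZ//; apply: dirderM; [exact: hz|exact: hw].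
Qed.

Lemma totd_conj A F z : totd A F z -> totd (fstar A) F (z.1, - z.2).
Proof.
move=> hz G Gs; have [k k0 [lL _ _]] := dual_ext_spec Xc Gs.
have -> : ofRI (dual_ext cls G (z.1, - z.2).1) (dual_ext cls G (z.1, - z.2).2) =
    (ofRI (dual_ext cls G z.1) (dual_ext cls G z.2))^*.
  by apply: C_eq; rewrite !cE //= (linfN lL).
by apply: dirder_conj; exact: hz.
Qed.

Variable sigma : {biscalar E}.
Hypothesis sigma_antisym : forall f g : E, sigma f g = - sigma g f.
Hypothesis sigma_le : exists2 c : R, 0 < c & forall f g : E, `|sigma f g| <= c * s f * s g.
Local Notation S := (sigma_ext cls sigma).
Local Notation sC := (sigma_extC cls sigma).
Local Notation br := (fbracket s cls sigma).

(** Antisymmetry follows from uniqueness: (x, y) |-> - S(y, x) is another continuous extension of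
    [sigma]. *)
Lemma sigma_ext_bilinear : [/\ forall y, linear (S^~ y : X -> R^o),
  forall x, linear (S x : X -> R^o) & forall x y, S x y = - S y x].
Proof.
have [S0 [[c c0 Sc] Sl1 Sl2 Se]] := sigma_ext_exists Xc sigma_le.
have cS := bilinear_bounded_continuous c0 Sc Sl1 Sl2.
have e := sigma_extP Xc cS Se; rewrite e; split=> // x y.
have e' : sigma_ext cls sigma = (fun x y => - S0 y x).
  apply: (sigma_extP Xc); last by move=> f g; rewrite Se -sigma_antisym.
  apply: (bilinear_bounded_continuous c0 (S := fun x y => - S0 y x)).
  - by move=> u v; rewrite normrN mulrAC.
  - by move=> v a u u'; rewrite (linfD (Sl2 v)) (linfZ (Sl2 v)) opprD scalerN.
  - by move=> u a v v'; rewrite (linfD (Sl1 u)) (linfZ (Sl1 u)) opprD scalerN.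
by rewrite -[in LHS]e e'.
Qed.

Lemma sCC z w : sC z w = - sC w z.
Proof.
have [_ _ a] := sigma_ext_bilinear; rewrite /sigma_extC.
rewrite (a z.1 w.1) (a z.2 w.2) (a z.1 w.2) (a z.2 w.1).
by apply: C_eq; rewrite !cE; ring.
Qed.

Lemma sCDl z z' w : sC (z + z') w = sC z w + sC z' w.
Proof.
have [l1 _ _] := sigma_ext_bilinear; rewrite /sigma_extC /= !(linfD (l1 _)).
by apply: C_eq; rewrite !cE; ring.
Qed.

Lemma sCZl c z w : sC (cplx_scale c z) w = c * sC z w.
Proof.
have [l1 _ _] := sigma_ext_bilinear; rewrite /sigma_extC /= !(linfB (l1 _), linfD (l1 _), linfZ (l1 _)).
by apply: C_eq; rewrite !cE; ring.
Qed.

Lemma sC_conj z w : sC (z.1, - z.2) (w.1, - w.2) = (sC z w)^*.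
Proof.
have [l1 l2 _] := sigma_ext_bilinear; rewrite /sigma_extC /= !(linfN (l1 _), linfN (l2 _)).
by apply: C_eq; rewrite !cE; ring.
Qed.

Definition has_totd A := forall F, exists z, totd A F z.

Lemma fbracketE A B F z w : totd A F z -> totd B F w -> br A B F = - sC z w.
Proof. by move=> hz hw; rewrite /fbracket (totdiffE ss sc Xc hz) (totdiffE ss sc Xc hw). Qed.

Lemma fbracketC A B : br A B = - br B A.
Proof. by apply/funext => F; rewrite /fbracket sCC. Qed.

Lemma fbracketDl A B D : has_totd A -> has_totd B -> br (A + B) D = br A D + br B D.
Proof.
move=> tA tB; apply/funext => F; have [z hz] := tA F; have [w hw] := tB F.
rewrite -[RHS]/(br A D F + br B D F) /fbracket (totdiffE ss sc Xc (totdD hz hw)).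
by rewrite (totdiffE ss sc Xc hz) (totdiffE ss sc Xc hw) sCDl opprD.
Qed.

Lemma fbracketZl c A B : has_totd A -> br (c *: A) B = c *: br A B.
Proof.
move=> tA; apply/funext => F; have [z hz] := tA F.
rewrite -[RHS]/(c * br A B F) /fbracket (totdiffE ss sc Xc (@totdZ c _ _ _ hz)).
by rewrite (totdiffE ss sc Xc hz) sCZl mulrN.
Qed.

Lemma fbracket_star A B : has_totd A -> has_totd B -> fstar (br A B) = br (fstar A) (fstar B).
Proof.
move=> tA tB; apply/funext => F; have [z hz] := tA F; have [w hw] := tB F.
rewrite (fbracketE (totd_conj hz) (totd_conj hw)) sC_conj /fstar (fbracketE hz hw).
by apply: C_eq; rewrite !cE.
Qed.

Lemma fbracket_leibniz A B D : has_totd A -> has_totd B -> has_totd D ->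
  br A (fun F => B F * D F) = (fun F => br A B F * D F + B F * br A D F).
Proof.
move=> tA tB tD; apply/funext => F; have [z hz] := tA F; have [w hw] := tB F; have [v hv] := tD F.
rewrite (fbracketE hz (totdM hw hv)) (fbracketE hz hw) (fbracketE hz hv).
rewrite sCC sCDl !sCZl (sCC z w) (sCC z v); ring.
Qed.

End bracket_calculus.

(** * Iterated integrals and the Jacobi identity *)

Section jacobi.
Context {R : realType} {E : tvsType R} {s : E -> R}.
Hypothesis hE : hausdorff_space E.
Hypothesis ss : is_seminorm s.
Variable sigma : {biscalar E}.
Hypothesis sigma_le : exists2 c : R, 0 < c & forall f g : E, `|sigma f g| <= c * s f * s g.
Implicit Types (mu nu rho : set (ilB E) -> C R) (a b : E -> C R).

Let s0 x : 0 <= s x. Proof. exact: seminorm_ge0. Qed.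
Let ms : measurable_fun setT (s : ilB E -> R). Proof. exact: measurable_seminorm. Qed.

Definition growth2 a := cmfun (a : ilB E -> C R) /\
  exists2 k, 0 <= k & forall x, n1 (a x) <= k * (1 + s x) ^+ 2.

Definition growth1 a := cmfun (a : ilB E -> C R) /\
  exists2 k, 0 <= k & forall x, n1 (a x) <= k * (1 + s x).

Lemma growth1_sigma (f : E) : growth1 (fun g => ofR (sigma f g)).
Proof.
split; first by apply: cmfun_ofR; apply: measurable_linf => a x y; rewrite linearPr.
have [c c0 hc] := sigma_le; have k0 : 0 <= c * s f by rewrite mulr_ge0// ltW.
exists (c * s f) => // g; rewrite n1_ofR; apply: le_trans (hc f g) _.
by rewrite ler_wpM2l// lerDr.
Qed.

Lemma growth1_sigmar (g : E) : growth1 (fun f => ofR (sigma f g)).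
Proof.
split; first by apply: cmfun_ofR; apply: measurable_linf => a x y; rewrite linearPl.
have [c c0 hc] := sigma_le; have k0 : 0 <= c * s g by rewrite mulr_ge0// ltW.
exists (c * s g) => // f; rewrite n1_ofR; apply: le_trans (hc f g) _.
by rewrite mulrAC ler_wpM2l// lerDr.
Qed.

Lemma growth1_le a : cmfun (a : ilB E -> C R) -> (exists2 k, 0 <= k & forall x, n1 (a x) <= k) ->
  growth1 a.
Proof.
move=> ma [k k0 hk]; split=> //; exists k => // x.
by apply: le_trans (hk x) _; rewrite ler_peMr// lerDl.
Qed.

Lemma growth1_exp (F : dual E) a : growth1 a -> growth1 (fun x => expi (F x) * a x).
Proof.
move=> [ma [k k0 hk]]; split; first by apply: cmfunM => //; exact: cmfun_weyl.
exists (2 * k) => [|x]; first by rewrite mulr_ge0.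
by apply: le_trans (n1M _ _) _; rewrite -mulrA; apply: ler_pM; rewrite ?n1_ge0 ?n1_expi.
Qed.

Lemma growth2M a b : growth1 a -> growth1 b -> growth2 (fun x => a x * b x).
Proof.
move=> [ma [k k0 hk]] [mb [j j0 hj]]; split; first exact: cmfunM.
exists (k * j) => [|x]; first by rewrite mulr_ge0.
apply: le_trans (n1M _ _) _; rewrite expr2 mulrACA.
by apply: ler_pM; rewrite ?n1_ge0.
Qed.

Section one_measure.
Variables (mu : set (ilB E) -> C R) (Mmu : ME_moment None s mu).

Lemma moment_cmeasure : is_cmeasure mu. Proof. exact: (ME_cmeasure Mmu.1). Qed.

Lemma moment_s : (\int[total_var mu]_f (s f)%:E < +oo)%E.
Proof. exact: (moment1 Mmu). Qed.

Let hmu := moment_cmeasure.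

Lemma moment_poly n : tvint mu ((fun x => (1 + s x) ^+ n) : ilB E -> R).
Proof.
elim: n => [|n IH]; first by have := tvint_const hmu ler01; congr tvint; apply/funext => x; rewrite expr0.
have mpow k : measurable_fun setT ((fun x => (1 + s x) ^+ k) : ilB E -> R).
  by apply: measurable_funX; exact: measurable_funD.
have t1 := tvint_const hmu (ler0n R (2 ^ n.+1)).
have t2 : tvint mu ((fun x => 2 ^+ n.+1 * s x ^+ n.+1) : ilB E -> R).
  apply: tvint_scale => //; split; [exact: measurable_funX|by move=> x; exact: exprn_ge0|exact: (Mmu.2 n.+1)].
apply: (tvint_dom hmu (tvint_add hmu t1 t2)) => // x.
rewrite exprn_ge0 ?addr_ge0//= natrX; case: (leP (s x) 1) => sx.
  apply: (@le_trans _ _ (2 ^+ n.+1)); last by rewrite lerDl mulr_ge0 ?exprn_ge0.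
  by apply: lerXn2r; rewrite ?nnegrE ?addr_ge0//; lra.
apply: (@le_trans _ _ ((2 * s x) ^+ n.+1)).
  by apply: lerXn2r; rewrite ?nnegrE ?addr_ge0 ?mulr_ge0//; lra.
by rewrite exprMn lerDr exprn_ge0.
Qed.

Lemma growth2_tvintg a : growth2 a -> tvintg mu (a : ilB E -> C R).
Proof.
move=> [ma [k k0 hk]]; have [m1 _ i1] := tvint_scale hmu k0 (moment_poly 2).
exact: (tvintg_le hmu ma m1 hk i1).
Qed.

(* [apot b g] is [- sigma(d, g)] for the differential [d] of a function at a
   point [F], with [b = exp(iF)]; it is linear in [g]. *)
Definition apot a (f : E) : C R := cint mu (fun g : E => a g * ofR (sigma f g)).

(** The function is linear in [f], hence Borel on all of E without joint measurability of [sigma],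
    and it is bounded by a multiple of [s]. *)
Lemma growth1_apot a : growth1 a -> growth1 (apot a).
Proof.
move=> ga; have [c c0 hc] := sigma_le.
have it f : tvintg mu (fun g : ilB E => a g * ofR (sigma f g)).
  by apply: growth2_tvintg; apply: growth2M => //; exact: growth1_sigma.
have lin k f f' : apot a (k *: f + f') = ofR k * apot a f + apot a f'.
  rewrite /apot -cintZ// -cintD//; last exact: tvintgZ.
  by apply: eq_cint => g; rewrite linearPl/= ofRD ofRM; ring.
have [l [dn D]] := cmeasure_density hmu.
split.
  split; apply: measurable_linf => k f f'; rewrite lin !cE mul0r ?subr0 ?addr0//.
have [ma [k k0 hk]] := ga.
have [m2 _ i2] := moment_poly 2.
have [m2' w20 il2] := (tvintP _ D).1 (moment_poly 2).
(* The factors are 4 for the density, [k] for the growth of [a] and [c] for [sigma]; the square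
   collects the growth of [a] and of [sigma] in g. *)
pose J := Rintegral l setT (fun x : ilB E => (4 * (k * c)) * (1 + s x) ^+ 2).
have J0 : 0 <= J.
  by apply: Rintegral_ge0 => x _; rewrite mulr_ge0 ?exprn_ge0 ?addr_ge0// mulr_ge0// mulr_ge0// ltW.
exists J => // f.
rewrite /apot; have [-> iD] := cintE_density D (it f); apply: le_trans (n1_cI iD) _.
apply: (@le_trans _ _ (s f * J)); last by rewrite mulrC ler_wpM2l// lerDr.
rewrite /J -RintegralZl//; last exact: integrable_EFinZ.
apply: le_Rintegral => //.
- exact: cintg_n1.
- by apply: integrable_EFinZ; exact: integrable_EFinZ.
move=> g _; apply: le_trans (n1M _ _) _.
rewrite (_ : s f * _ = 4 * ((k * (1 + s g)) * (c * s f * (1 + s g)))); last by ring.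
apply: ler_pM; rewrite ?n1_ge0 ?(density_le4 D)//; apply: le_trans (n1M _ _) _.
apply: ler_pM; rewrite ?n1_ge0// n1_ofR; apply: le_trans (hc f g) _.
by rewrite ler_wpM2l ?lerDr// mulr_ge0// ltW.
Qed.

End one_measure.

(** An exchange of integrals. The weights grow quadratically and [sigma] linearly in each variable,
    whence the third powers in the majorants. *)
Lemma apot_swap mu nu a b : ME_moment None s mu -> ME_moment None s nu ->
  growth2 a -> growth2 b ->
  cint mu (fun f => a f * apot nu b f) = cint nu (fun g => b g * cint mu (fun f => a f * ofR (sigma f g))).
Proof.
move=> Mmu Mnu [ma [k k0 hk]] [mb [j j0 hj]].
have hmu := moment_cmeasure Mmu; have hnu := moment_cmeasure Mnu.
have [e [e1 e2]] := ME_carrier2 hE Mmu.1 Mnu.1.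
have mW : measurable (cspan e : set (ilB E)) by exact: cspan_measurable.
have [l1 [d1 D1]] := cmeasure_density hmu; have [l2 [d2 D2]] := cmeasure_density hnu.
have [c c0 hc] := sigma_le.
have [_ _ i1] := (tvintP _ D1).1 (moment_poly Mmu 3).
have [_ _ i2] := (tvintP _ D2).1 (moment_poly Mnu 3).
have i1' := integrable_EFinZ (k * c) i1; have i2' := integrable_EFinZ j i2.
pose kt (p : ilB E * ilB E) := a p.1 * b p.2 * ofR (sigmaW e sigma p).
have mkt : cmfun kt.
  apply: cmfunM; last by apply: cmfun_ofR; exact: measurable_sigmaW.
  by apply: cmfunM; [exact: (cmfun_comp (S := fst))|exact: (cmfun_comp (S := snd))].
have ktE x y : cspan e x -> cspan e y -> kt (x, y) = a x * b y * ofR (sigma x y).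
  by move=> Wx Wy; rewrite /kt sigmaW_in.
have kv x y : n1 (kt (x, y)) <= (k * c * (1 + s x) ^+ 3) * (j * (1 + s y) ^+ 3).
  have hs : `|sigmaW e sigma (x, y)| <= c * (1 + s x) * (1 + s y).
    rewrite /sigmaW; case: ifP => _; last by rewrite normr0 !mulr_ge0 ?addr_ge0// ltW.
    apply: le_trans (hc _ _) _; apply: ler_pM; rewrite ?mulr_ge0 ?lerDr//; first exact: ltW.
    by rewrite ler_wpM2l ?lerDr// ltW.
  apply: le_trans (n1M _ _) _; rewrite n1_ofR.
  rewrite (_ : _ * (j * _) = ((k * (1 + s x) ^+ 2) * (j * (1 + s y) ^+ 2)) * (c * (1 + s x) * (1 + s y))); last by ring.
  apply: ler_pM; rewrite ?n1_ge0//; apply: le_trans (n1M _ _) _.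
  by apply: ler_pM; rewrite ?n1_ge0.
have sw := cint_swap hmu hnu D1 D2 mW mW e1 e2 (k := fun x y => a x * b y * ofR (sigma x y)) mkt ktE i1' i2' kv.
have g3 (rho : set (ilB E) -> C R) (u : E -> C R) m (h : E -> C R) : ME_moment None s rho ->
    cmfun (u : ilB E -> C R) -> 0 <= m -> (forall x, n1 (u x) <= m * (1 + s x) ^+ 2) -> growth1 h ->
    tvintg rho (fun x : ilB E => u x * h x).
  move=> Mrho mu' m0 hu [mh [r r0 hr]].
  have mr0 : 0 <= m * r by rewrite mulr_ge0.
  have [mm _ im] := tvint_scale (moment_cmeasure Mrho) mr0 (moment_poly Mrho 3).
  apply: (tvintg_le (moment_cmeasure Mrho) _ mm _ im); first exact: cmfunM.
  move=> x; apply: le_trans (n1M _ _) _; rewrite exprSr mulrACA.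
  by apply: ler_pM; rewrite ?n1_ge0.
transitivity (cint mu (fun x => cint nu (fun y => a x * b y * ofR (sigma x y)))).
  apply: eq_cint => x; rewrite /apot -cintZ//; last exact: (g3 _ _ _ _ Mnu mb j0 hj (growth1_sigma x)).
  by apply: eq_cint => y; rewrite mulrA.
rewrite sw; apply: eq_cint => y; rewrite -cintZ//; last exact: (g3 _ _ _ _ Mmu ma k0 hk (growth1_sigmar y)).
by apply: eq_cint => x; ring.
Qed.

Hypothesis sigma_antisym : forall f g : E, sigma f g = - sigma g f.

(** The exchange puts f in the first place of [sigma]; antisymmetry restores the form [apot] at the
    price of a sign. This is the only rule by which terms of the double brackets are rearranged. *)
Lemma apot_swap_anti mu nu a b : ME_moment None s mu -> ME_moment None s nu ->
  growth1 a -> growth2 b ->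
  cint mu (fun f => a f * apot nu b f) = cint nu (fun g => - (b g * apot mu a g)).
Proof.
move=> Mmu Mnu ga gb.
have g1 : growth1 (fun=> 1 : C R).
  by apply: growth1_le; [exact: cmfun_cst|exists 1 => // x; rewrite (n1_ofR 1) normr1].
have ga2 : growth2 a.
  have := growth2M ga g1; congr growth2; apply/funext => x; exact: mulr1.
have hmu := moment_cmeasure Mmu.
rewrite apot_swap//; apply: eq_cint => g; rewrite -mulrN; congr (_ * _).
rewrite /apot -mulN1r -cintZ//; last first.
  by apply: (growth2_tvintg Mmu); apply: growth2M => //; exact: growth1_sigma.
by apply: eq_cint => f; rewrite (sigma_antisym f g) ofRN; ring.
Qed.

Lemma twisted_cint phi mu nu h : tame phi -> ME_moment None s mu -> ME_moment None s nu ->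
  growth1 h ->
  cint (twisted_conv sigma phi mu nu) h =
  cint mu (fun f => cint nu (fun g : E => phi (sigma f g) * h ((f : E) + g))).
Proof.
move=> tphi Mmu Mnu [mh [j j0 hj]].
have hmu := moment_cmeasure Mmu; have hnu := moment_cmeasure Mnu.
have [e [e1 e2]] := ME_carrier2 hE Mmu.1 Mnu.1.
have [k k0 hk'] := tame_bound ss sigma_le e tphi; have hk x y := (hk' x y).1.
have e1E (rho : set (ilB E) -> C R) (M : ME_moment None s rho) : tvint rho ((fun x => 1 + s x) : ilB E -> R).
  by have := moment_poly M 1; congr tvint; apply/funext => x; rewrite expr1.
have [mk1 w10 iw1] := tvint_scale hmu k0 (e1E mu Mmu).
have [m1s w20 iw2] := e1E nu Mnu.
have [_ [spec _]] := twisted_conv_spec hE tphi.1 hmu hnu e1 e2 mk1 m1s w10 w20 hk iw1 iw2.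
have jk0 : 0 <= j * k by rewrite mulr_ge0.
have [mu1 u10 iu1] := tvint_scale hmu jk0 (moment_poly Mmu 2).
have [mu2 u20 iu2] := moment_poly Mnu 2.
apply: (spec h (fun x => j * k * (1 + s x) ^+ 2) (fun y => (1 + s y) ^+ 2)) => // x y.
have sxy : s (addW e (x, y)) <= s x + s y.
  rewrite /addW; case: ifP => _; first exact: (seminormD ss).
  by rewrite (seminorm0 ss) addr_ge0.
rewrite (_ : j * k * _ * _ = (j * ((1 + s x) * (1 + s y))) * (k * (1 + s x) * (1 + s y))); last by ring.
rewrite ler_wpM2r//; first by rewrite !mulr_ge0 ?addr_ge0.
apply: le_trans (hj _) _; rewrite ler_wpM2l//.
have := mulr_ge0 (s0 x) (s0 y); rewrite mulrDl !mulrDr; lra.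
Qed.

Section jacobi_identity.
Variable F : dual E.
Local Notation e := (fun f : E => expi (F f)).

Lemma growth1_e : growth1 e.
Proof.
by apply: growth1_le; [exact: cmfun_weyl|exists 2 => // x; exact: n1_expi].
Qed.

(** The triple integral of exp(iF(f + g + h)) sigma(f, g) sigma(f, h), with f integrated against
    [rho]. *)
Definition iter3 rho mu nu := cint rho (fun f => e f * apot mu e f * apot nu e f).

Lemma iter3C rho mu nu : iter3 rho mu nu = iter3 rho nu mu.
Proof. by apply: eq_cint => f; rewrite mulrAC. Qed.

(** The point of this form is that the cyclic sum consists of six triple integrals that cancel in
    pairs, by the symmetry [iter3C] in the last two measures. *)
Lemma double_bracket mu nu rho :
  ME_moment None s mu -> ME_moment None s nu -> ME_moment None s rho ->
  cint mu (fun f => e f * apot (mbracket sigma nu rho) e f) =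
  - iter3 nu mu rho + iter3 rho mu nu.
Proof.
move=> Mmu Mnu Mrho.
have hmu := moment_cmeasure Mmu; have hnu := moment_cmeasure Mnu; have hrho := moment_cmeasure Mrho.
have ge := growth1_e.
have gap (m : set (ilB E) -> C R) : ME_moment None s m -> growth1 (apot m e).
  by move=> Mm; exact: growth1_apot.
have gex b : growth1 b -> growth1 (fun x => e x * b x) by exact: growth1_exp.
(* the inner integral splits along [sigma(f, g + k) = sigma(f, g) + sigma(f, k)] *)
have inner f : apot (mbracket sigma nu rho) e f =
    apot nu (fun g => e g * apot rho e g) f - apot rho (fun k => e k * apot nu e k) f.
  have gef : growth1 (fun h => e h * ofR (sigma f h)) by apply: gex; exact: growth1_sigma.
  rewrite {1}/apot mbracketE (twisted_cint tame_ofR Mnu Mrho gef).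
  transitivity (cint nu (fun g => e g * apot rho e g * ofR (sigma f g) +
      e g * apot rho (fun k => e k * ofR (sigma f k)) g)).
    apply: eq_cint => g.
    rewrite {1}/apot [e g * _ * _]mulrAC -!cintZ//; last 2 first.
    - by apply: (growth2_tvintg Mrho); apply: growth2M; [exact: gef|exact: growth1_sigma].
    - by apply: (growth2_tvintg Mrho); apply: growth2M => //; exact: growth1_sigma.
    rewrite -cintD//; last 2 first.
    - by apply: tvintgZ => //; apply: (growth2_tvintg Mrho); apply: growth2M => //; exact: growth1_sigma.
    - by apply: tvintgZ => //; apply: (growth2_tvintg Mrho); apply: growth2M; [exact: gef|exact: growth1_sigma].
    apply: eq_cint => k; rewrite (linfD (dual_linear F)) expiD linearDr ofRD; ring.
  rewrite cintD//; last 2 first.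
  - by apply: (growth2_tvintg Mnu); apply: growth2M; [exact: (gex _ (gap _ Mrho))|exact: growth1_sigma].
  - by apply: (growth2_tvintg Mnu); apply: growth2M => //; exact: growth1_apot.
  congr (_ + _).
  rewrite (apot_swap_anti Mnu Mrho ge); last first.
    have := growth2M ge (growth1_sigma f); exact.
  rewrite /apot -mulN1r -cintZ//; last first.
    by apply: (growth2_tvintg Mrho); apply: growth2M; [exact: (gex _ (gap _ Mnu))|exact: growth1_sigma].
  by apply: eq_cint => k; ring.
have g2 m : ME_moment None s m -> growth2 (fun g => e g * apot m e g).
  by move=> Mm; apply: growth2M => //; exact: gap.
have ap2 m m' : ME_moment None s m -> ME_moment None s m' ->
    growth1 (apot m' (fun g => e g * apot m e g)).
  by move=> Mm Mm'; apply: growth1_apot => //; apply: gex; exact: gap.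
transitivity (cint mu (fun f => e f * apot nu (fun g => e g * apot rho e g) f +
    -1 * (e f * apot rho (fun k => e k * apot nu e k) f))).
  by apply: eq_cint => f; rewrite inner; ring.
have t1 := growth2_tvintg Mmu (growth2M ge (ap2 _ _ Mrho Mnu)).
have t2 := growth2_tvintg Mmu (growth2M ge (ap2 _ _ Mnu Mrho)).
have t3 := tvintgZ hmu (-1) t2.
rewrite (cintD hmu t1 t3) (cintZ hmu (-1) t2) (apot_swap_anti Mmu Mnu ge (g2 _ Mrho)) (apot_swap_anti Mmu Mrho ge (g2 _ Mnu)).
have i3 (m m' m'' : set (ilB E) -> C R) : ME_moment None s m -> ME_moment None s m' -> ME_moment None s m'' ->
    tvintg m (fun g : ilB E => e g * apot m' e g * apot m'' e g).
  move=> Mm Mm' Mm''; apply: (growth2_tvintg Mm); apply: growth2M; last exact: gap.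
  exact: (gex _ (gap _ Mm')).
have N (m m' m'' : set (ilB E) -> C R) : ME_moment None s m -> ME_moment None s m' -> ME_moment None s m'' ->
    cint m (fun g : ilB E => - (e g * apot m' e g * apot m'' e g)) = - iter3 m m' m''.
  move=> Mm Mm' Mm''; have t := i3 _ _ _ Mm Mm' Mm''.
  rewrite -mulN1r -(cintZ (moment_cmeasure Mm) (-1) t).
  by apply: eq_cint => g; rewrite mulN1r.
by rewrite !N// mulN1r opprK (iter3C nu) (iter3C rho).
Qed.

End jacobi_identity.

End jacobi.

(** * Admissible spaces *)

Section stable_classes.
Context {R : realType} {E : tvsType R} {s : E -> R}.
Context {X : completeNormedModType R} {cls : {linear E -> X}}.
Hypothesis hE : hausdorff_space E.
Hypothesis ss : is_seminorm s.
Hypothesis sc : continuous (s : E -> R^o).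
Hypothesis Xc : is_completion s cls.
Variable sigma : {biscalar E}.
Hypothesis sigma_antisym : forall f g : E, sigma f g = - sigma g f.
Hypothesis sigma_le : exists2 c : R, 0 < c & forall f g : E, `|sigma f g| <= c * s f * s g.
Local Notation setfun := (set (ilB E) -> C R).
Implicit Types (mu nu rho : setfun) (P Q : set setfun).
Local Notation br := (fbracket s cls sigma).
Local Notation def := (deformed sigma).

Lemma fbracket_fourier mu nu : ME_moment (Some 1%N) s mu -> ME_moment (Some 1%N) s nu ->
  br (fourier mu) (fourier nu) = fourier (mbracket sigma mu nu).
Proof.
move=> Mmu Mnu; apply/funext => F.
have i1 := moment1 Mmu isT; have i2 := moment1 Mnu isT.
rewrite (fbracket_iterated hE ss sc Xc sigma_le F Mmu.1 Mnu.1 i1 i2).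
by rewrite mbracketE (twisted_fourier hE ss sigma_le tame_ofR Mmu.1 Mnu.1 i1 i2).
Qed.

Definition mstar mu : setfun := fun A => (mu [set x : ilB E | A (- (x : E) : ilB E)])^*.

(* Closure under the twisted convolutions is only required for measures with
   all [s]-moments, so that the property passes to intersections. *)
Record stable Q : Prop := {
  stable_eq : forall mu nu, (forall A, measurable A -> mu A = nu A) -> Q mu -> Q nu ;
  stable0 : Q (fun=> 0) ;
  stableD : forall mu nu, Q mu -> Q nu -> ME mu -> ME nu -> Q (fun A => mu A + nu A) ;
  stableZ : forall (c : C R) mu, Q mu -> ME mu -> Q (fun A => c * mu A) ;
  stable_star : forall mu, Q mu -> ME mu -> Q (mstar mu) ;
  stable_twist : forall phi mu nu, tame phi -> Q mu -> Q nu ->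
    ME_moment None s mu -> ME_moment None s nu -> Q (twisted_conv sigma phi mu nu) }.

Lemma stableI P Q : stable P -> stable Q -> stable (P `&` Q).
Proof.
move=> sP sQ; split.
- by move=> mu nu e [Pm Qm]; split; [exact: stable_eq sP _ _ e Pm|exact: stable_eq sQ _ _ e Qm].
- by split; exact: stable0.
- by move=> mu nu [? ?] [? ?] ? ?; split; exact: stableD.
- by move=> c mu [? ?] ?; split; exact: stableZ.
- by move=> mu [? ?] ?; split; exact: stable_star.
- by move=> phi mu nu ? [? ?] [? ?] ? ?; split; exact: stable_twist.
Qed.

Lemma stable_bigcap (B : Type) (P : B -> set setfun) : (forall b, stable (P b)) ->
  stable (\bigcap_b P b).
Proof.
move=> sP; split.
- by move=> mu nu e Pm b _; exact: stable_eq (sP b) _ _ e (Pm b I).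
- by move=> b _; exact: stable0.
- by move=> mu nu Pm Pn ? ? b _; apply: (stableD (sP b)) => //; [exact: Pm|exact: Pn].
- by move=> c mu Pm ? b _; apply: (stableZ (sP b)) => //; exact: Pm.
- by move=> mu Pm ? b _; apply: (stable_star (sP b)) => //; exact: Pm.
- by move=> phi mu nu ? Pm Pn ? ? b _; apply: (stable_twist (sP b)) => //; [exact: Pm|exact: Pn].
Qed.

Section poisson.
Variable P : set setfun.
Hypothesis sP : stable P.
Hypothesis PM : P `<=` ME_moment None s.
Local Notation PF := (@fourier R E @` P).

Let PME mu : P mu -> ME mu. Proof. by move=> /PM[]. Qed.
Let Pcm mu : P mu -> is_cmeasure mu. Proof. by move=> /PM[/ME_cmeasure]. Qed.
Let P1 mu : P mu -> ME_moment (Some 1%N) s mu.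
Proof. by move=> /PM[M h]; split=> // m _; exact: h. Qed.
Let Ps mu : P mu -> (\int[total_var mu]_f (s f)%:E < +oo)%E.
Proof. by move=> /PM; exact: moment_s. Qed.

(** The chosen inverse agrees with [mu] on measurable sets by injectivity; [stable_eq] then keeps it
    in [P]. *)
Lemma ifourierP mu : P mu -> P (ifourier (fourier mu)) /\ fourier (ifourier (fourier mu)) = fourier mu.
Proof.
move=> Pmu; rewrite /ifourier; case: xgetP => [nu _ [Mnu nuE]|/(_ mu)[]]; last by split=> //; exact: PME.
split=> //; apply: (stable_eq sP _ Pmu).
exact: (fourier_inj hE (PME Pmu) Mnu (esym nuE)).
Qed.

Lemma deformed_stable hbar A B : PF A -> PF B -> PF (def hbar A B).
Proof.
move=> [mu Pmu <-] [nu Pnu <-]; have [Pi _] := ifourierP Pmu; have [Pj _] := ifourierP Pnu.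
exists (weyl_conv sigma hbar (ifourier (fourier mu)) (ifourier (fourier nu))) => //.
rewrite weyl_convE; apply: (stable_twist sP) => //; [exact: tame_expi|exact: PM|exact: PM].
Qed.

(** For hbar = 0 the kernel is 1, the inner integral no longer depends on f, and the iterated
    integral is a product. *)
Lemma deformed0 A B : PF A -> PF B -> def 0 A B = (fun F => A F * B F).
Proof.
move=> [mu Pmu <-] [nu Pnu <-]; have [Pi ei] := ifourierP Pmu; have [Pj ej] := ifourierP Pnu.
apply/funext => F; rewrite /deformed weyl_convE.
rewrite (twisted_fourier hE ss sigma_le (tame_expi _) (PME Pi) (PME Pj) (Ps Pi) (Ps Pj)).
rewrite -[in RHS]ei -[in RHS]ej; set m := ifourier _ in Pi ei *; set n := ifourier _ in Pj ej *.
transitivity (cint m (fun f : E => fourier n F * expi (F f))).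
  apply: eq_cint => f; rewrite mulrC; congr (_ * _); apply: eq_cint => g.
  by rewrite mul0r oppr0 mul0r expi0 mulr1.
have t : tvintg m (fun f : ilB E => expi (F f)).
  by split; [exact: cmfun_weyl|apply: tvint_weyl; exact: (Pcm Pi)].
apply: etrans (cintZ (Pcm Pi) (fourier n F) t) _; exact: mulrC.
Qed.

Lemma fourier_has_totd mu : P mu -> has_totd (s := s) (cls := cls) (fourier mu).
Proof.
move=> Pmu F; have [w [_ tw _ _]] := fourier_bochner hE ss sc Xc F (PME Pmu) (Ps Pmu).
by exists (cplx_scale 'i w).
Qed.

Lemma fourier_bracket_stable A B : PF A -> PF B -> PF (br A B).
Proof.
move=> [mu Pmu <-] [nu Pnu <-]; exists (mbracket sigma mu nu).
  by rewrite mbracketE; apply: (stable_twist sP) => //; [exact: tame_ofR|exact: PM|exact: PM].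
by rewrite fbracket_fourier//; exact: P1.
Qed.

Lemma fourierDf mu nu : P mu -> P nu -> fourier (fun A => mu A + nu A) = fourier mu + fourier nu.
Proof. by move=> Pm Pn; apply/funext => F; apply: fourierD; exact: Pcm. Qed.

Lemma fourierZf c mu : P mu -> fourier (fun A => c * mu A) = c *: fourier mu.
Proof. by move=> Pm; apply/funext => F; apply: fourierZ; exact: Pcm. Qed.

Lemma mstar_spec mu : is_cmeasure mu ->
  [/\ is_cmeasure (mstar mu), forall F, fourier (mstar mu) F = (fourier mu F)^* &
   forall q : E -> R, measurable_fun setT (q : ilB E -> R) -> (forall x, 0 <= q x) ->
     (\int[total_var mu]_x (q (- x))%:E < +oo)%E ->
     (\int[total_var (mstar mu)]_x (q x)%:E < +oo)%E].
Proof.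
move=> hmu; have [||||||||hc hf hq] := @push_spec _ (ilB E) R _ (ilB E) mu
    (fun x : ilB E => - (x : E) : ilB E) (fun z => z^*) (fun z => z^*) (mstar mu) hmu => //.
- by move=> l h ih; split; [|exact: cI_conj]; move: ih => [hr hi]; split;
    [under eq_fun do rewrite cRe_conj|under eq_fun do rewrite cIm_conj EFinN; apply: integrableN].
- by exists 1 => z; rewrite n1_conj mul1r.
- by move=> z w; apply: C_eq; rewrite !cE; ring.
- by move=> h; exact: cmfun_conj.
- by move=> z; exact: n1_conj.
- by move=> b; apply: C_eq; rewrite !cE ?oppr0.
- exact: measurable_oppE.
split=> //.
move=> F; rewrite /fourier hf; last 2 first.
- exact: cmfun_weyl.
- have e : (fun x : ilB E => (n1 (expi (F (- x : E))))%:E) =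
      (fun x : ilB E => (n1 (expi ((- F) x)))%:E).
    by apply/funext => x; rewrite (linfN (dual_linear F)) dualN.
  rewrite e; exact: tvint_weyl.
congr (_^*); apply: eq_cint => x; rewrite (linfN (dual_linear F)) expiN.
by apply: C_eq; rewrite !cE ?opprK.
Qed.

Lemma fourier_star mu : P mu -> fourier (mstar mu) = fstar (fourier mu).
Proof. by move=> Pm; apply/funext => F; have [_ + _] := mstar_spec (Pcm Pm); apply. Qed.

Lemma fourier_jacobi mu nu rho : P mu -> P nu -> P rho -> forall F,
  br (fourier mu) (br (fourier nu) (fourier rho)) F =
  - iter3 sigma F nu mu rho + iter3 sigma F rho mu nu.
Proof.
move=> Pm Pn Pr F; have PK : P (mbracket sigma nu rho).
  by rewrite mbracketE; apply: (stable_twist sP) => //; [exact: tame_ofR|exact: PM|exact: PM].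
rewrite fbracket_fourier; [|exact: P1|exact: P1].
rewrite (fbracket_iterated hE ss sc Xc sigma_le F (PME Pm) (PME PK) (Ps Pm) (Ps PK)).
rewrite -(double_bracket hE ss sigma_le sigma_antisym F (PM Pm) (PM Pn) (PM Pr)).
by [].
Qed.

Theorem stable_poisson : is_poisson_algebra PF (def 0) br (@fstar R (dual E)).
Proof.
have tot A : PF A -> has_totd (s := s) (cls := cls) A by move=> [mu Pmu <-]; exact: fourier_has_totd.
have PD A B : PF A -> PF B -> PF (A + B).
  move=> [mu Pm <-] [nu Pn <-]; exists (fun A => mu A + nu A); last exact: fourierDf.
  by apply: (stableD sP) => //; exact: PME.
have PZ c A : PF A -> PF (c *: A).
  move=> [mu Pm <-]; exists (fun A => c * mu A); last exact: fourierZf.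
  by apply: (stableZ sP) => //; exact: PME.
have PS A : PF A -> PF (fstar A).
  move=> [mu Pm <-]; exists (mstar mu); last exact: fourier_star.
  by apply: (stable_star sP) => //; exact: PME.
have Pmul A B : PF A -> PF B -> PF (def 0 A B) by exact: deformed_stable.
have Pbr A B : PF A -> PF B -> PF (br A B) by exact: fourier_bracket_stable.
have brC A B : br A B = - br B A by exact: (fbracketC Xc sigma_antisym sigma_le).
have brDl A B D : PF A -> PF B -> PF D -> br (A + B) D = br A D + br B D.
  by move=> /tot tA /tot tB _; exact: (fbracketDl ss sc Xc sigma_antisym sigma_le).
split.
- exists (fun=> 0); first exact: stable0.
  apply/funext => F; have := fourierZ 0 F (Pcm (stable0 sP)).
  by rewrite !mul0r.
- exact: PD.
- exact: PZ.
- exact: Pmul.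
- exact: PS.
- exact: Pbr.
- move=> A B D hA hB hD; rewrite (deformed0 hB hD) (deformed0 hA hB).
  have hBD : PF (fun F => B F * D F) by rewrite -(deformed0 hB hD); exact: Pmul.
  have hAB : PF (fun F => A F * B F) by rewrite -(deformed0 hA hB); exact: Pmul.
  by rewrite (deformed0 hA hBD) (deformed0 hAB hD); apply/funext => F; rewrite mulrA.
- by move=> A B hA hB; rewrite !deformed0//; apply/funext => F; rewrite mulrC.
- move=> A B D hA hB hD; rewrite (deformed0 (PD _ _ hA hB) hD) (deformed0 hA hD) (deformed0 hB hD).
  by apply/funext => F; exact: mulrDl.
- move=> k A B hA hB; rewrite (deformed0 (PZ k _ hA) hB) (deformed0 hA hB).
  by apply/funext => F; rewrite -[RHS]/(k * (A F * B F)) mulrA.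
- by move=> A hA; apply/funext => F; apply: C_eq; rewrite /fstar !cE ?opprK.
- by move=> A B hA hB; apply/funext => F; apply: C_eq; rewrite /fstar -[(A + B) F]/(A F + B F) -[(_ + _) F]/((A F)^* + (B F)^*) !cE ?opprD.
- by move=> k A hA; apply/funext => F; apply: C_eq; rewrite /fstar -[(k *: A) F]/(k * A F) -[(_ *: _) F]/(k^* * (A F)^*) !cE; ring.
- move=> A B hA hB; rewrite (deformed0 hA hB) (deformed0 (PS _ hB) (PS _ hA)).
  by apply/funext => F; apply: C_eq; rewrite /fstar !cE; ring.
- exact: brDl.
- by move=> k A B /tot tA _; exact: (fbracketZl ss sc Xc sigma_antisym sigma_le).
- by move=> A B _ _; exact: brC.
- by move=> A B /tot tA /tot tB; exact: (fbracket_star ss sc Xc sigma_antisym sigma_le).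
- move=> _ _ _ [mu Pm <-] [nu Pn <-] [rho Pr <-]; apply/funext => F.
  rewrite -[LHS]/(br _ (br _ _) F + br _ (br _ _) F + br _ (br _ _) F).
  (* Reordering three of the six triple integrals exhibits the cancelling pairs. *)
  rewrite !fourier_jacobi// (iter3C sigma F rho mu nu) (iter3C sigma F mu nu rho) (iter3C sigma F nu rho mu).
  set x := iter3 _ _ nu mu rho; set y := iter3 _ _ rho nu mu; set z := iter3 _ _ mu rho nu.
  rewrite -[RHS]/(0 : C R); move: x y z => x y z; ring.
- move=> A B D hA hB hD; rewrite (deformed0 hB hD).
  rewrite (deformed0 (Pbr _ _ hA hB) hD) (deformed0 hB (Pbr _ _ hA hD)).
  have tA := tot _ hA; have tB := tot _ hB; have tD := tot _ hD.
  exact: (fbracket_leibniz ss sc Xc sigma_antisym sigma_le tA tB tD).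
Qed.

End poisson.

End stable_classes.

(** * Closure properties of the admissible spaces *)

Section admissible_spaces.
Context {R : realType} {E : tvsType R} {s : E -> R}.
Hypothesis hE : hausdorff_space E.
Hypothesis ss : is_seminorm s.
Variable sigma : {biscalar E}.
Hypothesis sigma_le : exists2 c : R, 0 < c & forall f g : E, `|sigma f g| <= c * s f * s g.
Local Notation setfun := (set (ilB E) -> C R).
Implicit Types (mu nu : setfun) (K : set (set E)) (kappa : E -> R).

Lemma cmeasure_eq mu nu : (forall A, measurable A -> mu A = nu A) -> is_cmeasure mu -> is_cmeasure nu.
Proof.
move=> e hmu F mF tF; rewrite -e; last exact: bigcupT_measurable.
rewrite (_ : (fun n => _) = (fun n => \sum_(0 <= i < n) mu (F i))); first exact: hmu.
by apply/funext => n; apply: eq_bigr => i _; rewrite e.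
Qed.

Lemma total_var_eq mu nu : (forall A, measurable A -> mu A = nu A) -> total_var mu = total_var nu.
Proof.
move=> e; apply/funext => A; congr ereal_sup; apply/seteqP; split=> x [n [D [mD tD DA ->]]];
  exists n, D; split=> //; congr EFin; apply: eq_bigr => i _; by rewrite e.
Qed.

Lemma twisted_cmeasure phi mu nu : tame phi -> ME_moment None s mu -> ME_moment None s nu ->
  is_cmeasure (twisted_conv sigma phi mu nu).
Proof.
move=> tphi Mmu Mnu; apply: ME_cmeasure.
by apply: (twisted_ME hE ss sigma_le tphi Mmu.1 Mnu.1); exact: moment_s.
Qed.

(** The carrier D must contain [D1] and [D2] for sums of measures and D1 + D2 for convolutions;
    reflected sets serve the involution. *)
Record additive_family K : Prop := {
  family_nonempty : exists D, K D ;
  family_measurable : forall D : set (ilB E), K D -> measurable D ;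
  family_add : forall D1 D2, K D1 -> K D2 -> exists2 D, K D &
    [/\ D1 `<=` D, D2 `<=` D & forall x y, D1 x -> D2 y -> D (x + y)] ;
  family_opp : forall D1, K D1 -> exists2 D, K D & forall x, D1 x -> D (- x) }.

Lemma carried_stable K : additive_family K -> stable (s := s) sigma (carried K).
Proof.
move=> fK; have mK := family_measurable fK.
have nul (D : set (ilB E)) mu : K D -> is_cmeasure mu -> total_var mu (~` D) = 0%E ->
    forall B, measurable B -> B `<=` ~` D -> mu B = 0.
  by move=> KD hmu D0 B mB; apply: total_var_null D0 mB; apply: measurableC; exact: mK.
split.
- move=> mu nu e [hmu [D KD D0]]; split; first exact: cmeasure_eq e hmu.
  by exists D => //; rewrite -(total_var_eq e).
- have [D KD] := family_nonempty fK; split; first exact: cmeasure_cst0.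
  by exists D => //; apply: null_total_var => //; apply: measurableC; exact: mK.
- move=> mu nu [hmu [D1 K1 h1]] [hnu [D2 K2 h2]] _ _; split; first exact: cmeasureD.
  have [D KD [D1D D2D _]] := family_add fK K1 K2; exists D => //.
  apply: null_total_var => [|B mB BD]; first by apply: measurableC; exact: mK.
  rewrite (nul D1 mu)// ?(nul D2 nu)// ?addr0//.
    by apply: subset_trans BD _; exact: subsetC.
  by apply: subset_trans BD _; exact: subsetC.
- move=> c mu [hmu [D KD D0]] _; split; first exact: cmeasureZ.
  exists D => //; apply: null_total_var => [|B mB BD]; first by apply: measurableC; exact: mK.
  by rewrite (nul D mu)// mulr0.
- move=> mu [hmu [D1 K1 h1]] _; split; first by have [] := mstar_spec hmu.
  have [D KD D1D] := family_opp fK K1; exists D => //.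
  apply: null_total_var => [|B mB BD]; first by apply: measurableC; exact: mK.
  rewrite /mstar (nul D1 mu)// ?conjC0//.
    exact: (measurable_preimage measurable_oppE mB).
  by move=> x /= Bx D1x; apply: (BD _ Bx); exact: D1D.
- move=> phi mu nu tphi [hmu [D1 K1 h1]] [hnu [D2 K2 h2]] Mmu Mnu.
  split; first exact: twisted_cmeasure.
  have [D KD [_ _ DD]] := family_add fK K1 K2; exists D => //.
  exact: (twisted_conv_carrier sigma phi hmu hnu (mK _ K1) (mK _ K2) (mK _ KD) h1 h2).
Qed.

Lemma cspan_family : additive_family [set cspan e | e in [set: nat -> E]].
Proof.
split.
- by exists (cspan (fun=> 0)), (fun=> 0).
- by move=> _ [e _ <-]; exact: cspan_measurable.
- move=> _ _ [e1 _ <-] [e2 _ <-]; have [e [s1 s2]] := cspan_cover2 e1 e2.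
  exists (cspan e); first by exists e.
  by split=> // x y /s1 ? /s2 ?; exact: cspanD.
- by move=> _ [e _ <-]; exists (cspan e) => [|x]; [exists e|exact: cspanN].
Qed.

Lemma countable_family : additive_family [set D : set E | countable D].
Proof.
split.
- by exists set0; exact: countable0.
- exact: (countableE_measurable hE).
- move=> D1 D2 /= c1 c2.
  exists ((D1 `|` D2) `|` [set p.1 + p.2 | p in D1 `*` D2]).
    have cU (A B : set E) : countable A -> countable B -> countable (A `|` B).
      by move=> cA cB; rewrite -bigcup2E; apply: bigcup_countable => // -[|[|i]] _ //=; exact: countable0.
    apply: (cU); first exact: (cU).
    by apply: (sub_countable (card_image_le _ _)); exact: countableX.
  split=> [x|x|x y Dx Dy]; [by left; left|by left; right|by right; exists (x, y)].
- move=> D /= cD; exists [set - x | x in D]; last by move=> x Dx; exists x.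
  exact: (sub_countable (card_image_le _ _)).
Qed.

Lemma finite_family : additive_family [set D : set E | finite_set D].
Proof.
split.
- by exists set0; exact: finite_set0.
- exact: (finiteE_measurable hE).
- move=> D1 D2 /= c1 c2.
  exists ((D1 `|` D2) `|` [set p.1 + p.2 | p in D1 `*` D2]).
    by rewrite !finite_setU; split=> //; apply: finite_image; exact: finite_setX.
  split=> [x|x|x y Dx Dy]; [by left; left|by left; right|by right; exists (x, y)].
- move=> D /= cD; exists [set - x | x in D]; last by move=> x Dx; exists x.
  exact: finite_image.
Qed.

Lemma findim_family (V : set E) : is_findim V -> additive_family [set V].
Proof.
move=> fV; have [e [n Ve]] := findim_fspan fV; split.
- by exists V.
- by move=> _ ->; exact: findim_measurable.
- by move=> _ _ -> ->; exists V => //; split=> // x y; rewrite Ve; exact: fspanD.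
- move=> _ ->; exists V => // x; rewrite Ve -scaleN1r; exact: fspanZ.
Qed.

Lemma ME_stable : stable (s := s) sigma (@ME R E).
Proof. by rewrite MEP//; apply: carried_stable; exact: cspan_family. Qed.

Lemma moment_stable kappa : is_seminorm kappa -> stable (s := s) sigma (ME_moment None kappa).
Proof.
move=> sk; have mk j : measurable_fun setT ((fun x => kappa x ^+ j) : ilB E -> R).
  by apply: measurable_funX; exact: measurable_seminorm.
have k0 j x : 0 <= kappa x ^+ j by rewrite exprn_ge0// (seminorm_ge0 sk).
split.
- move=> mu nu e [Mmu h]; split; first exact: (stable_eq ME_stable e Mmu).
  by rewrite -(total_var_eq e).
- split; first exact: (stable0 ME_stable).
  move=> m _; apply: (@tvint_le _ _ _ _ mzero) => //.
    by move=> A _; rewrite n10.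
  by rewrite integral_measure_zero.
- move=> mu nu [Mmu h1] [Mnu h2] _ _; split; first exact: (stableD ME_stable Mmu Mnu Mmu Mnu).
  by move=> m _; apply: tvintD => //; [exact: ME_cmeasure|exact: ME_cmeasure|exact: h1|exact: h2].
- move=> c mu [Mmu h] _; split; first exact: (stableZ ME_stable c Mmu Mmu).
  move=> m _; have [_ _ +] := scale_cmeasure_spec c (ME_cmeasure Mmu); apply => //; exact: h.
- move=> mu [Mmu h] _; split; first exact: (stable_star ME_stable Mmu Mmu).
  move=> m _; have [_ _ +] := mstar_spec (ME_cmeasure Mmu); apply => //.
  by under eq_fun do rewrite (seminormN sk); exact: h.
- move=> phi mu nu tphi [Mmu h1] [Mnu h2] Ms Ns; split.
    exact: (stable_twist ME_stable tphi Mmu Mnu Ms Ns).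
  move=> m _; apply: (twisted_moment hE ss sigma_le tphi Mmu Mnu) => //.
  - exact: moment_s.
  - exact: moment_s.
  - by move=> j; exact: h1.
  - by move=> j; exact: h2.
  - exact: (Ms.2 2%N).
  - exact: (Ns.2 2%N).
Qed.

Lemma ME_c_stable : stable (s := s) sigma (@ME_c R E).
Proof.
have -> : @ME_c R E = [set mu | ME mu /\ forall f : E, mu [set f] = 0].
  by apply/seteqP; split=> mu /(ME_cP hE).
split.
- move=> mu nu e [Mmu h]; split; first exact: (stable_eq ME_stable e Mmu).
  by move=> f; rewrite -e//; exact: measurable_pt.
- by split=> //; exact: (stable0 ME_stable).
- move=> mu nu [Mmu h1] [Mnu h2] _ _; split; first exact: (stableD ME_stable Mmu Mnu Mmu Mnu).
  by move=> f; rewrite h1 h2 addr0.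
- move=> c mu [Mmu h] _; split; first exact: (stableZ ME_stable c Mmu Mmu).
  by move=> f; rewrite h mulr0.
- move=> mu [Mmu h] _; split; first exact: (stable_star ME_stable Mmu Mmu).
  move=> f; rewrite /mstar (_ : [set x | _] = [set - f]) ?h ?conjC0//.
  by apply/seteqP; split=> x /= => [<-|->]; rewrite opprK.
- move=> phi mu nu tphi [Mmu h1] [Mnu h2] Ms Ns; split.
    exact: (stable_twist ME_stable tphi Mmu Mnu Ms Ns).
  move=> f; have hnu := ME_cmeasure Mnu.
  (* At each x the inner integrand lives on the single point f - x, which has no mass for [nu]. *)
  rewrite /twisted_conv (_ : (fun x : E => _) = fun=> 0); first exact: (cint0 (ME_cmeasure Mmu)).
  apply/funext => x; have mp : measurable ([set f - x] : set (ilB E)) by exact: measurable_pt.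
  rewrite (@cint_null _ _ _ nu (~` [set f - x]) _ (fun=> 0)) ?cint0//.
  + exact: measurableC.
  + rewrite setCK; apply: null_total_var => // B mB Bf.
    have [->|/set0P[y By]] := eqVneq B set0; first exact: cmeasure0.
    rewrite (_ : B = [set f - x]) ?h2//; apply/seteqP; split=> // z /= ->.
    by rewrite -(Bf _ By).
  + move=> y /= yf; rewrite indicE memNset ?ofR0 ?mulr0//= => xyf.
    by apply: yf; rewrite -xyf addrC addKr.
Qed.

Lemma il_continuous_opp : continuous ((fun x => - x) : il E -> il E).
Proof.
apply/continuousP => U oU.
suff : il_open ((fun x : il E => - x : il E) @^-1` U) by [].
have {}oU : il_open U := oU.
move=> x /= /oU[p sp pU]; exists p => // y /= py; apply: pU => /=.
by rewrite -opprD (seminormN sp).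
Qed.

(** Absolute continuity is required for every Haar measure, so for the involution it is enough that
    the reflected one is again a Haar measure, without comparing the two. *)
Lemma haar_reflect (V : set E) (lam : {measure set (ilB E) -> \bar R}) : is_findim V -> is_haar V lam ->
  exists2 lam' : {measure set (ilB E) -> \bar R}, is_haar V lam' &
    forall A, lam' A = lam [set x : ilB E | A (- (x : E) : ilB E)].
Proof.
move=> fV [h1 h2 h3 h4]; have [e [n Ve]] := findim_fspan fV.
have VN x : V (- x) <-> V x.
  by rewrite Ve; split=> [/(fspanZ (-1))|/(fspanZ (-1))]; rewrite scaleN1r ?opprK.
pose lam' : {measure set (ilB E) -> \bar R} :=
  measure_function_pushforward__canonical__measure_function_Measure lam (measurable_oppE (E := E) (R := R)).
have lE A : lam' A = lam [set x : ilB E | A (- (x : E) : ilB E)] by [].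
exists lam' => //.
have VE : [set x : ilB E | V (- (x : E))] = V by apply/seteqP; split=> x /VN.
split.
- by rewrite lE -[X in lam X]/(~` [set x : ilB E | V (- (x : E))]) VE.
- by rewrite lE VE.
- move=> v A Vv mA; rewrite !lE.
  have mNA : measurable ((fun x : ilB E => - (x : E) : ilB E) @^-1` A).
    exact: (measurable_preimage measurable_oppE mA).
  rewrite -[RHS](h3 (- v) _ _ mNA); last exact/VN.
  congr (lam _); apply/seteqP; split=> [x /= [y Ay yx]|_ /= [x Ax <-]].
    by exists (- y) => /=; rewrite ?opprK// -opprD yx opprK.
  by exists (- x) => //; rewrite opprD opprK.
- move=> K cK KV; rewrite lE.
  have -> : [set x : ilB E | K (- (x : E))] = [set (- x : E) | x in K].
    by apply/seteqP; split=> [x Kx|_ [x Kx <-]] /=; [exists (- x : E); rewrite ?opprK|rewrite opprK].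
  apply: h4.
    apply: (@continuous_compact (il E) (il E)) => //.
    by apply: continuous_subspaceT => x; exact: il_continuous_opp.
  by move=> _ [x Kx <-]; apply/VN; exact: KV.
Qed.

Lemma meas_on_a_stable (V : set E) : is_findim V -> stable (s := s) sigma (meas_on_a V).
Proof.
move=> fV; have sV := carried_stable (findim_family fV).
have onE mu : meas_on V mu <-> carried [set V] mu.
  by split=> [[hmu V0]|[hmu [_ -> V0]]]; split=> //; exists V.
have mV : measurable (V : set (ilB E)) by exact: findim_measurable.
have [e [n Ve]] := findim_fspan fV.
split.
- move=> mu nu eq [/onE Mmu h]; split; first by apply/onE; exact: (stable_eq sV eq Mmu).
  by move=> lam hl A mA A0; rewrite -eq//; exact: h hl _ mA A0.
- by split=> //; apply/onE; exact: (stable0 sV).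
- move=> mu nu [/onE Mmu h1] [/onE Mnu h2] M1 M2; split; first by apply/onE; exact: (stableD sV Mmu Mnu M1 M2).
  by move=> lam hl A mA A0; rewrite (h1 lam)// (h2 lam)// addr0.
- move=> c mu [/onE Mmu h] M1; split; first by apply/onE; exact: (stableZ sV c Mmu M1).
  by move=> lam hl A mA A0; rewrite (h lam)// mulr0.
- move=> mu [/onE Mmu h] M1; split; first by apply/onE; exact: (stable_star sV Mmu M1).
  move=> lam hl A mA A0; have [lam' hl' lE] := haar_reflect fV hl.
  rewrite /mstar (h lam')// ?conjC0//; first exact: (measurable_preimage measurable_oppE mA).
  rewrite lE (_ : [set x | _] = A)//.
  by apply/seteqP; split=> x /=; rewrite opprK.
- move=> phi mu nu tphi [/onE Mmu h1] [/onE Mnu h2] Ms Ns; split.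
    by apply/onE; exact: (stable_twist sV tphi Mmu Mnu Ms Ns).
  move=> lam hl A mA A0; have [hmu V0] := (onE mu).2 Mmu; have hnu := Mnu.1.
  rewrite /twisted_conv (@cint_null _ _ _ mu V _ (fun=> 0)) ?cint0// => x Vx.
  (* For x in [V] the inner integrand lives on A - x, which is a Haar null set by invariance under
     translations in [V], hence null for [nu]. *)
  pose B := [set ((y : E) + (- x) : ilB E) | y in A].
  have mB : measurable B by exact: measurable_translate.
  have VNx : V (- x) by move: Vx; rewrite Ve -scaleN1r; exact: fspanZ.
  have lB : lam B = 0%E by have [_ _ tr _] := hl; rewrite tr.
  rewrite (@cint_null _ _ _ nu (~` B) _ (fun=> 0)) ?cint0//.
  + exact: measurableC.
  + rewrite setCK; apply: null_total_var => // M mM MB; apply: (h2 lam) => //.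
    by apply/eqP; rewrite eq_le measure_ge0 andbT -lB le_measure// inE.
  + move=> y /= yB; rewrite indicE memNset ?ofR0 ?mulr0//= => Axy.
    by apply: yB; exists (x + y) => //; rewrite addrC addKr.
Qed.

Lemma pow_add_le (a b : R) m : 0 <= a -> 0 <= b -> (a + b) ^+ m <= 2 ^+ m * (a ^+ m + b ^+ m).
Proof.
move=> a0 b0; rewrite mulrDr -!exprMn; case: (leP a b) => ab.
  apply: (@le_trans _ _ ((2 * b) ^+ m)); last by rewrite lerDr exprn_ge0// mulr_ge0.
  by apply: lerXn2r; rewrite ?nnegrE ?addr_ge0 ?mulr_ge0//; lra.
apply: (@le_trans _ _ ((2 * a) ^+ m)); last by rewrite lerDl exprn_ge0// mulr_ge0.
by apply: lerXn2r; rewrite ?nnegrE ?addr_ge0 ?mulr_ge0//; lra.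
Qed.

Lemma ME_moment_le kappa kappa' k : is_seminorm kappa -> is_seminorm kappa' -> 0 <= k ->
  (forall x, kappa' x <= k * kappa x) -> ME_moment None kappa `<=` ME_moment None kappa'.
Proof.
move=> sk sk' k0 kk mu [Mmu h]; split=> // m _; have hmu := ME_cmeasure Mmu.
have mk (p : E -> R) j : is_seminorm p -> measurable_fun setT ((fun x => p x ^+ j) : ilB E -> R).
  by move=> sp; apply: measurable_funX; exact: measurable_seminorm.
have t : tvint mu ((fun x => kappa x ^+ m) : ilB E -> R).
  by split=> [|x|]; [exact: mk|rewrite exprn_ge0// (seminorm_ge0 sk)|exact: h].
have km0 : 0 <= k ^+ m by exact: exprn_ge0.
have [||_ _ //] := tvint_dom hmu (tvint_scale hmu km0 t) (w' := fun x : ilB E => kappa' x ^+ m).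
  exact: mk.
move=> x; rewrite exprn_ge0 ?(seminorm_ge0 sk')//= -exprMn.
by apply: lerXn2r; rewrite ?nnegrE ?mulr_ge0 ?(seminorm_ge0 sk') ?(seminorm_ge0 sk).
Qed.

Lemma ME_momentD (p q : E -> R) : is_seminorm p -> is_seminorm q ->
  ME_moment None p `&` ME_moment None q `<=` ME_moment None (fun x => p x + q x).
Proof.
move=> sp sq mu [[Mmu hp] [_ hq]]; split=> // m _; have hmu := ME_cmeasure Mmu.
have p0 x : 0 <= p x by exact: seminorm_ge0.
have q0 x : 0 <= q x by exact: seminorm_ge0.
have mk (r : E -> R) j : is_seminorm r -> measurable_fun setT ((fun x => r x ^+ j) : ilB E -> R).
  by move=> sr; apply: measurable_funX; exact: measurable_seminorm.
have tp : tvint mu ((fun x => p x ^+ m) : ilB E -> R).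
  by split=> [|x|]; [exact: mk|rewrite exprn_ge0|exact: hp].
have tq : tvint mu ((fun x => q x ^+ m) : ilB E -> R).
  by split=> [|x|]; [exact: mk|rewrite exprn_ge0|exact: hq].
have c0 : 0 <= 2 ^+ m :> R by exact: exprn_ge0.
have [||_ _ //] := tvint_dom hmu (tvint_scale hmu c0 (tvint_add hmu tp tq)) (w' := fun x : ilB E => (p x + q x) ^+ m).
  by apply: mk; exact: seminorm_addn.
by move=> x; rewrite exprn_ge0 ?addr_ge0//= pow_add_le.
Qed.

Lemma finite_carrier_moment mu : carried [set D : set E | finite_set D] mu -> ME_moment None s mu.
Proof.
move=> [hmu [D fD D0]]; have mD := finiteE_measurable hE fD.
have [e De] := countable_sub_range (finite_set_countable fD).
have mW : measurable (cspan e : set (ilB E)) by exact: cspan_measurable.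
split.
  apply: (ME_mk hE (e := e) hmu); apply: total_var_carrier_sub D0 => //.
  by move=> x /De[i _ <-]; exact: cspan_gen.
move=> m _; have [l [dn dl]] := cmeasure_density hmu.
have lD : l (~` (D : set (ilB E))) = 0%E by apply: (density_null dl) => //; exact: measurableC.
have msm : measurable_fun setT ((fun x => s x ^+ m) : ilB E -> R).
  by apply: measurable_funX; exact: measurable_seminorm.
have s0 x : 0 <= s x ^+ m by rewrite exprn_ge0// (seminorm_ge0 ss).
have [k hk] : exists k, forall x, D x -> s x ^+ m <= k.
  have [r Dr] := (finite_seqP (D : set E)).1 fD.
  exists (\sum_(x <- r) s x ^+ m) => x; rewrite Dr /= => xr.
  by rewrite (big_rem x xr)/= lerDl sumr_ge0.
apply: (@le_lt_trans _ _ (\int[l]_x (s x ^+ m)%:E)%E).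
  apply: le_integral_raw => //= A mA.
  by rewrite total_var_ge0// (density_tv_le dl).
rewrite (@eq_integral_null _ _ _ l D _ (fun x : ilB E => (\1_(D : set (ilB E)) x * s x ^+ m)%:E))//; last first.
  by move=> x Dx; rewrite indicE mem_set// mul1r.
have i : l.-integrable setT (EFin \o (fun x : ilB E => \1_(D : set (ilB E)) x * s x ^+ m)).
  apply: (@integrable_EFin_le _ _ _ _ _ (fun=> `|k|)).
  - by apply: measurable_funM => //; exact: measurable_indic.
  - exact: finite_measure_integrable_cst.
  - move=> x; rewrite indicE; have [/set_mem Dx|_] := boolP (x \in (D : set (ilB E))).
      by rewrite mul1r ger0_norm//; apply: le_trans (hk x Dx) _; exact: ler_norm.
    by rewrite mul0r normr0.
have /integrableP[_] := i; apply: le_lt_trans.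
rewrite le_eqVlt; apply/orP; left; apply/eqP; apply: eq_integral => x _.
by rewrite /= ger0_norm// mulr_ge0// indicE.
Qed.

Hypothesis sigma_neq0 : exists f g : E, sigma f g <> 0.

Theorem admissible_stable (P : set setfun) : admissible s P ->
  stable (s := s) sigma P /\ P `<=` ME_moment None s.
Proof.
have hI Q : admissible_I s Q -> stable (s := s) sigma Q /\ Q `<=` ME_moment None s.
  move=> [kappa [sk [k k0 sle] ->]]; split; first exact: moment_stable.
  exact: (ME_moment_le sk ss k0 sle).
have hII Q : admissible_II s Q -> stable (s := s) sigma Q /\ Q `<=` ME_moment None s.
  move=> [B [kappa [sk [G [c [c0 sle]]] ->]]]; split.
    by apply: stable_bigcap => b; exact: moment_stable.
  have sc b : is_seminorm (fun f => c b * kappa b f) by apply: seminorm_scale => //; exact: ltW.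
  have sG (G' : seq B) : is_seminorm (fun f => \sum_(b <- G') c b * kappa b f).
    elim: G' => [|b G' IH]; first by split=> *; rewrite !big_nil ?addr0 ?mulr0.
    under eq_fun do rewrite big_cons; exact: (seminorm_addn (sc b) IH).
  case: G sle => [|b0 G] sle mu Pmu.
    (* An empty index list would force s = 0 and hence sigma = 0, which is excluded. *)
    have [f [g []]] := sigma_neq0; have [k k0 hk] := sigma_le.
    have sf : s f = 0.
      by apply/eqP; rewrite eq_le (seminorm_ge0 ss) andbT; have := sle f; rewrite big_nil.
    by have := hk f g; rewrite sf mulr0 mul0r normr_le0 => /eqP.
  have Mb b : ME_moment None (fun f => c b * kappa b f) mu.
    by apply: (ME_moment_le (sk b) (sc b) (ltW (c0 b))) (Pmu b I) => x.
  (* The list keeps its head [b0], so that the induction starts from the moments of one semi-norm,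
     which include membership in [ME]. *)
  have MG (G' : seq B) : ME_moment None (fun f => \sum_(b <- b0 :: G') c b * kappa b f) mu.
    elim: G' => [|b G' IH]; first by under eq_fun do rewrite big_seq1.
    have -> : (fun f => \sum_(b <- [:: b0, b & G']) c b * kappa b f) =
        (fun f => c b * kappa b f + \sum_(b <- b0 :: G') c b * kappa b f).
      by apply/funext => f; rewrite !big_cons addrCA.
    by apply: ME_momentD => //; exact: sG.
  by apply: (ME_moment_le (sG _) ss ler01) (MG G) => x; rewrite mul1r.
move=> [/hI//|/hII//|[Q hQ hP]|->].
  have [sQ QM] : stable (s := s) sigma Q /\ Q `<=` ME_moment None s by case: hQ => [/hI|/hII].
  have sub P' : Q `&` P' `<=` ME_moment None s by move=> mu [/QM].
  case: hP => [->|->|[V fV ->]]; split=> //; apply: stableI => //.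
  - by rewrite ME_dP//; apply: carried_stable; exact: countable_family.
  - exact: ME_c_stable.
  - exact: meas_on_a_stable.
rewrite ME_dfP//; split; first by apply: carried_stable; exact: finite_family.
exact: finite_carrier_moment.
Qed.

End admissible_spaces.

Theorem theorem5 (R : realType) (E : tvsType R) (sigma : {biscalar E})
    (s : E -> R) (X : completeNormedModType R) (cls : {linear E -> X})
    (E_hausdorff : hausdorff_space E)
    (E_infinite_dim : ~ is_findim [set: E])
    (sigma_antisym : forall f g : E, sigma f g = - sigma g f)
    (sigma_neq0 : exists f g : E, sigma f g <> 0)
    (s_seminorm : is_seminorm s)
    (s_continuous : continuous (s : E -> R^o))
    (sigma_le : exists2 c : R, 0 < c &
       forall f g : E, `|sigma f g| <= c * s f * s g)
    (X_completion : is_completion s cls) :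
  [/\ (* (1) *)
      forall (n : option nat) (mu : set (ilB E) -> C R), ME_moment n s mu ->
        (forall m : nat, le_ext m n ->
           Cn_dir (dual_sn s) m (fourier mu)) /\
        (le_ext 1 n -> forall F : dual E, exists w : X * X,
           [/\ is_bochner_int mu
                 (fun f : E => cplx_scale (expi (F f)) (cls f, 0)) w,
               is_totdiff s cls (fourier mu) F (cplx_scale 'i w),
               totdiff s cls (fourier mu) F = cplx_scale 'i w
             & is_bochner_int mu
                 (fun f : E => totdiff s cls (weyl f) F)
                 (totdiff s cls (fourier mu) F)]),
      (* (2) *)
      forall mu nu : set (ilB E) -> C R,
        ME_moment (Some 1%N) s mu -> ME_moment (Some 1%N) s nu ->
        fbracket s cls sigma (fourier mu) (fourier nu) =
          fourier (mbracket sigma mu nu),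
      (* (3) *)
      forall P : set (set (ilB E) -> C R), admissible s P ->
        [/\ is_poisson_algebra (@fourier R E @` P)
              (deformed sigma 0) (fbracket s cls sigma) (@fstar R (dual E)),
            @fourier R E @` P `<=` @fourier R E @` ME_moment None s
          & forall (hbar : R) (A B : dual E -> C R),
              (@fourier R E @` P) A -> (@fourier R E @` P) B ->
              (@fourier R E @` P) (deformed sigma hbar A B)]
    & admissible s (ME_moment None s) /\
      is_poisson_algebra (@fourier R E @` ME_moment None s)
        (deformed sigma 0) (fbracket s cls sigma) (@fstar R (dual E))].
Proof.
have sP P : admissible s P -> stable (s := s) sigma P /\ P `<=` ME_moment None s.
  exact: (admissible_stable E_hausdorff s_seminorm sigma_le sigma_neq0).
have poisson P : admissible s P -> is_poisson_algebra (@fourier R E @` P)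
    (deformed sigma 0) (fbracket s cls sigma) (@fstar R (dual E)).
  move=> /sP[stP PM].
  exact: (stable_poisson E_hausdorff s_seminorm s_continuous X_completion sigma_antisym sigma_le stP PM).
have aM : admissible s (ME_moment None s).
  by constructor 1; exists s; split=> //; exists 1 => // f; rewrite mul1r.
split.
- by move=> n mu; exact: (fourier_differentiable E_hausdorff s_seminorm s_continuous X_completion).
- by move=> mu nu; exact: (fbracket_fourier E_hausdorff s_seminorm s_continuous X_completion sigma_le).
- move=> P aP; have [stP PM] := sP _ aP; split; first exact: poisson.
    exact: image_subset.
  move=> hbar A B.
  exact: (deformed_stable E_hausdorff stP PM).
- by split; [|exact: poisson].
Qed.
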